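(* Assume (A) (see context), and let $0<h_0<1$ and $0<\tau_0<1$ be constants independent of $\varepsilon$ such that for all $0<\varepsilon\le1$, $0<h\le h_0$, $0<\tau\le\tau_0$ and all integers $0\le n\le T/\tau$ the MTI-FP solution satisfies the two bounds $$\|e^n_\psi\|_{H^1}+\|e^n_\phi\|_{H^1}+\varepsilon^2\|\dot e^n_\phi\|_{H^1}\lesssim h^{m_0-1}+\frac{\tau^2}{\varepsilon^2},\qquad \|e^n_\psi\|_{H^1}+\|e^n_\phi\|_{H^1}+\varepsilon^2\|\dot e^n_\phi\|_{H^1}\lesssim h^{m_0-1}+\varepsilon^2$$ together with $\|I_N\Psi^n\|_{H^1}\le C_\psi+1$, $\|I_N\Phi^n\|_{H^1}\le C_\phi+1$, $\|I_N\dot\Phi^n\|_{H^1}\le\varepsilon^{-2}(C_\phi+1)$. Then for any $0<\varepsilon\le1$, when $0<h\le h_0$ and $0<\tau\le\tau_0$, the multiscale interpolants $\mathbf\Psi(t),\mathbf\Phi(t)$ satisfy for $0\le t\le T$ \begin{align*} &\|\psi(\cdot,t)-(I_N\mathbf\Psi)(\cdot,t)\|_{H^1}\lesssim h^{m_0-1}+\frac{\tau^2}{\varepsilon^2},\qquad \|\psi(\cdot,t)-(I_N\mathbf\Psi)(\cdot,t)\|_{H^1}\lesssim h^{m_0-1}+\tau+\varepsilon^2,\\ &\|\phi(\cdot,t)-(I_N\mathbf\Phi)(\cdot,t)\|_{H^1}\lesssim h^{m_0-1}+\frac{\tau^2}{\varepsilon^2},\qquad \|\phi(\cdot,t)-(I_N\mathbf\Phi)(\cdot,t)\|_{H^1}\lesssim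 h^{m_0-1}+\tau+\varepsilon^2 . \end{align*} Consequently, uniformly for $\varepsilon\in(0,1]$, \begin{align*} &\|\psi(\cdot,t)-(I_N\mathbf\Psi)(\cdot,t)\|_{H^1}\lesssim h^{m_0-1}+\tau+\max_{0<\varepsilon\le1}\min\Big\{\frac{\tau^2}{\varepsilon^2},\varepsilon^2\Big\}\lesssim h^{m_0-1}+\tau,\\ &\|\phi(\cdot,t)-(I_N\mathbf\Phi)(\cdot,t)\|_{H^1}\lesssim h^{m_0-1}+\tau+\max_{0<\varepsilon\le1}\min\Big\{\frac{\tau^2}{\varepsilon^2},\varepsilon^2\Big\}\lesssim h^{m_0-1}+\tau . \end{align*}
   Context: **Notation.** $A\lesssim B$ means $|A|\le CB$ with a constant $C>0$ independent of $\varepsilon$, $h$, $\tau$ (and of $n$, $t$). $\overline{z}$ is complex conjugation. $\Omega=(a,b)$ is a bounded interval, $H^k=H^k(\Omega)$, and $H^m_{\rm per}(\Omega)=\{u\in H^m(\Omega): u^{(k)}(a)=u^{(k)}(b),\ k=0,\dots,m-1\}$. **Problem.** For $\varepsilon\in(0,1]$, let $\psi$ (complex-valued) and $\phi$ (real-valued), both depending on $\varepsilon$, solve on $\Omega$ with periodic boundary conditions (for the functions and their first $x$-derivatives) $$i\partial_t\psi+\partial_{xx}\psi+\phi\psi=0,\qquad \varepsilon^2\partial_{tt}\phi-\partial_{xx}\phi+\tfrac1{\varepsilon^2}\phi-|\psi|^2=0,$$ $$\psi(x,0)=\psi_0(x),\quad \phi(x,0)=\phi_0(x),\quad \partial_t\phi(x,0)=\tfrac1{\varepsilon^2}\phi_1(x),$$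 where $\psi_0$ (complex-valued) and $\phi_0,\phi_1$ (real-valued) are independent of $\varepsilon$. Let $T>0$ be a fixed time smaller than the maximal existence time. **Assumption (A).** There is an integer $m_0\ge5$ such that $\psi\in C([0,T];H^{m_0}_{\rm per}(\Omega))$, $\phi\in C^1([0,T];H^{m_0}_{\rm per}(\Omega))$ and, uniformly in $\varepsilon\in(0,1]$, $$\|\psi\|_{L^\infty([0,T];H^{m_0})}\lesssim1,\qquad \|\phi\|_{L^\infty([0,T];H^{m_0})}+\varepsilon^2\|\partial_t\phi\|_{L^\infty([0,T];H^{m_0})}\lesssim1 .$$ Put $C_\psi=\sup_{0<\varepsilon\le1}\|\psi\|_{L^\infty([0,T];H^{m_0})}$ and $C_\phi=\sup_{0<\varepsilon\le1}\max\{\|\phi\|_{L^\infty([0,T];H^{m_0})},\ \varepsilon^2\|\partial_t\phi\|_{L^\infty([0,T];H^{m_0})}\}$. **Grid and Fourier notation.** $\tau>0$ is the time step, $t_n=n\tau$. $N$ is a positive even integer, $h=(b-a)/N$, $x_j=a+jh$ ($0\le j\le N$), $\mu_l=\frac{2\pi l}{b-a}$. $Y_N=\{\mathbf v=(v_0,\dots,v_N)^T\in\mathbb C^{N+1}:v_0=v_N\}$; products, conjugates, real parts and moduli of elements of $Y_N$ are taken componentwise. For $\mathbf v\in Y_N$, $\widetilde{\mathbf v}_l=\frac1N\sum_{j=0}^{N-1}v_je^{-i\mu_l(x_j-a)}$ and $(I_N\mathbf v)(x)=\sum_{l=-N/2}^{N/2-1}\widetilde{\mathbf v}_le^{i\mu_l(x-a)}$.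 **Coefficients.** $\omega_l=\frac1{\varepsilon^2}\sqrt{1+\varepsilon^2\mu_l^2}$, $\lambda_l^\pm=-\frac1{\varepsilon^2}\big[1\pm\sqrt{1+\varepsilon^2\mu_l^2}\big]$, $$a_l(s)=\frac{\lambda_l^+e^{is\lambda_l^-}-\lambda_l^-e^{is\lambda_l^+}}{\lambda_l^+-\lambda_l^-},\qquad a_l'(s)=i\lambda_l^+\lambda_l^-\frac{e^{is\lambda_l^-}-e^{is\lambda_l^+}}{\lambda_l^+-\lambda_l^-},$$ $$p_l(\tau)=\int_0^\tau\frac{\sin(\omega_l(\tau-\theta))}{\varepsilon^2\omega_l}d\theta,\quad q_l(\tau)=\int_0^\tau\theta\frac{\sin(\omega_l(\tau-\theta))}{\varepsilon^2\omega_l}d\theta,$$ $$p_l'(\tau)=\int_0^\tau\frac{\cos(\omega_l(\tau-\theta))}{\varepsilon^2}d\theta,\quad q_l'(\tau)=\int_0^\tau\theta\frac{\cos(\omega_l(\tau-\theta))}{\varepsilon^2}d\theta,$$ $$c_l^\pm(\tau)=ie^{-i\mu_l^2\tau}\int_0^\tau e^{i(\mu_l^2\pm\frac1{\varepsilon^2})\theta}d\theta,\qquad d_l^\pm(\tau)=ie^{-i\mu_l^2\tau}\int_0^\tau\theta e^{i(\mu_l^2\pm\frac1{\varepsilon^2})\theta}d\theta .$$ **MTI-FP scheme.** Vectors $\Psi^n,\Phi^n,\dot\Phi^n\in Y_N$ (components $\psi_j^n,\phi_j^n,\dot\phi_j^n$) are defined by $\psi^0_j=\psi_0(x_j)$,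 $\phi^0_j=\phi_0(x_j)$, $\dot\phi^0_j=\frac1{\varepsilon^2}\phi_1(x_j)$ and, for $n\ge0$, as follows. Let $\mathbf v^{n,0}=\frac12(\Phi^n-i\varepsilon^2\dot\Phi^n)\in Y_N$ and let $\dot\Psi^n\in Y_N$ have discrete Fourier coefficients $\widetilde{(\dot\Psi^n)}_l=-i\frac{\sin(\mu_l^2\tau)}{\tau}\widetilde{(\Psi^n)}_l+i\widetilde{(\Phi^n\Psi^n)}_l$. For $-\frac N2\le l\le\frac N2-1$ set \begin{align*} &\widetilde{(\mathbf v^{n,1})}_l=a_l(\tau)\widetilde{(\mathbf v^{n,0})}_l,\qquad \widetilde{(\dot{\mathbf v}^{n,1})}_l=a_l'(\tau)\widetilde{(\mathbf v^{n,0})}_l,\\ &\widetilde{(\mathbf r^{n,1})}_l=p_l(\tau)\widetilde{(|\Psi^n|^2)}_l+2q_l(\tau)\widetilde{(\mathrm{Re}\{\overline{\Psi^n}\dot\Psi^n\})}_l,\\ &\widetilde{(\dot{\mathbf r}^{n,1})}_l=p_l'(\tau)\widetilde{(|\Psi^n|^2)}_l+2q_l'(\tau)\widetilde{(\mathrm{Re}\{\overline{\Psi^n}\dot\Psi^n\})}_l,\\ &\widetilde{(\Psi^{n+1})}_l=e^{-i\mu_l^2\tau}\widetilde{(\Psi^n)}_l+c_l^+(\tau)\widetilde{(\mathbf v^{n,0}\Psi^n)}_l+d_l^+(\tau)\widetilde{(\mathbf v^{n,0}\dot\Psi^n)}_l+c_l^-(\tau)\widetilde{(\overline{\mathbf v^{n,0}}\Psi^n)}_l+d_l^-(\tau)\widetilde{(\overline{\mathbf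 v^{n,0}}\dot\Psi^n)}_l, \end{align*} which determine vectors in $Y_N$ via $v_j=\sum_{l=-N/2}^{N/2-1}\widetilde{\mathbf v}_le^{i\mu_l(x_j-a)}$, and then \begin{align*} &\phi^{n+1}_j=e^{i\tau/\varepsilon^2}v_j^{n,1}+e^{-i\tau/\varepsilon^2}\overline{v_j^{n,1}}+r_j^{n,1},\\ &\dot\phi_j^{n+1}=e^{i\tau/\varepsilon^2}\Big(\dot v_j^{n,1}+\frac i{\varepsilon^2}v_j^{n,1}\Big)+e^{-i\tau/\varepsilon^2}\Big(\overline{\dot v_j^{n,1}}-\frac i{\varepsilon^2}\overline{v_j^{n,1}}\Big)+\dot r_j^{n,1}. \end{align*} **Errors.** $e^n_\psi(x)=\psi(x,t_n)-(I_N\Psi^n)(x)$, $e^n_\phi(x)=\phi(x,t_n)-(I_N\Phi^n)(x)$, $\dot e^n_\phi(x)=\partial_t\phi(x,t_n)-(I_N\dot\Phi^n)(x)$. **Multiscale interpolation in time.** $\mathbf\Psi(t)=(\Psi_0(t),\dots,\Psi_N(t))^T$ and $\mathbf\Phi(t)=(\Phi_0(t),\dots,\Phi_N(t))^T$ are defined for $t=t_n+s$, $n\ge0$, $0\le s\le\tau$, $0\le j\le N$, by $$\Psi_j(t_n+s)=\frac{\tau-s}\tau\psi_j^n+\frac s\tau\psi_j^{n+1},$$ $$\Phi_j(t_n+s)=e^{is/\varepsilon^2}\Big(\frac{\tau-s}\tau v_j^{n,0}+\frac s\tau v_j^{n,1}\Big)+e^{-is/\varepsilon^2}\,\overline{\Big(\frac{\tau-s}\tau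 v_j^{n,0}+\frac s\tau v_j^{n,1}\Big)}+\frac s\tau r_j^{n,1}.$$ $(I_N\mathbf\Psi)(\cdot,t)$ denotes $I_N$ applied to the vector $\mathbf\Psi(t)$, and similarly for $\mathbf\Phi$. *)

(* Defs.v *)
From HB Require Import structures.
From mathcomp Require Import all_boot all_order all_algebra.
From mathcomp Require Import all_classical all_reals all_analysis.
From mathcomp Require Import ess_sup_inf complex.

Set Implicit Arguments.
Unset Strict Implicit.
Unset Printing Implicit Defensive.

Import Order.TTheory GRing.Theory Num.Theory.
Import numFieldNormedType.Exports.

Local Open Scope classical_set_scope.
Local Open Scope ring_scope.
Local Open Scope complex_scope.

Section calculus.
Context {R : realType}.
Implicit Types (f : R -> R[i]) (D : set R) (x : R).

(* Integrals and derivatives of complex-valued functions of a real variable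
   are taken on real and imaginary parts. *)
Definition cint D f : R[i] :=
  (\int[lebesgue_measure]_(x in D) complex.Re (f x)) +i*
  (\int[lebesgue_measure]_(x in D) complex.Im (f x)).

Definition cderivable f x : Prop :=
  derivable (fun y => complex.Re (f y)) x 1 /\
  derivable (fun y => complex.Im (f y)) x 1.

Definition cderive f x : R[i] :=
  (derive1 (fun y => complex.Re (f y)) x) +i* (derive1 (fun y => complex.Im (f y)) x).

Definition ccontinuous_on D f : Prop :=
  {within D, continuous (fun y => complex.Re (f y))} /\
  {within D, continuous (fun y => complex.Im (f y))}.

Definition expi x : R[i] := cos x +i* sin x.

Definition is_max (A : set R) (M : R) : Prop := A M /\ ubound A M.

End calculus.

Section sobolev.
Context {R : realType}.
Variables a b : R.
Implicit Types (u g : R -> R[i]) (k m : nat).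

Definition L2normsq u : \bar R :=
  (\int[lebesgue_measure]_(x in `]a, b[) ((ComplexField.Normc.normc (u x)) ^+ 2)%:E)%E.

Definition L2 u : Prop :=
  [/\ measurable_fun `]a, b[ (fun x => complex.Re (u x)),
      measurable_fun `]a, b[ (fun x => complex.Im (u x)) &
      (L2normsq u < +oo)%E].

Definition test_function (eta : R -> R) : Prop :=
  [/\ forall x, derivable eta x 1,
      continuous (derive1 eta) &
      exists c d, [/\ a < c, d < b & forall x, eta x != 0 -> c <= x <= d]].

(* One-dimensional convention (as in Brezis, Functional Analysis, Sobolev
   Spaces and Partial Differential Equations, chapter 8): the test functions
   are those of class C^1 with compact support in (a, b). *)
Definition weak_derivative u g : Prop :=
  forall eta : R -> R, test_function eta ->
    cint `]a, b[ (fun x => u x * (derive1 eta x)%:C) =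
    - cint `]a, b[ (fun x => g x * (eta x)%:C).

(* D 0, ..., D k are u and its weak derivatives up to order k, all in L^2;
   u is in H^k(a, b) iff such a D exists. *)
Definition weak_derivatives k u (D : nat -> R -> R[i]) : Prop :=
  [/\ D 0%N = u,
      forall j, (j <= k)%N -> L2 (D j) &
      forall j, (j < k)%N -> weak_derivative (D j) (D j.+1)].

(* The H^k(a, b) norm, with value +oo outside H^k(a, b). Weak derivatives are
   unique almost everywhere, so the set below has at most one element. *)
Definition Hnorm k u : \bar R :=
  ereal_inf [set sqrte (\sum_(j < k.+1) L2normsq (D j))%E |
             D in weak_derivatives k u].

(* Elements of H^m_per are represented by their continuous representatives,
   and so are the derivatives of order < m, whose boundary values are thus
   genuine values. *)
Definition Hper m u : Prop :=
  exists D, [/\ weak_derivatives m u D,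
    forall k, (k < m)%N -> ccontinuous_on `[a, b] (D k) &
    forall k, (k < m)%N -> D k a = D k b].

(* Below, u t is the value at time t of a curve with values in H^m_per. *)
Definition C0_Hper (T : R) m (u : R -> R -> R[i]) : Prop :=
  (forall t, 0 <= t <= T -> Hper m (u t)) /\
  (forall t0, 0 <= t0 <= T ->
    Hnorm m (fun x => u t x - u t0 x)
      @[t --> within `[0, T] (nbhs t0)] --> 0%E).

(* u is in C^1([0, T]; H^m_per), with time derivative ut; derivatives at the
   end points 0 and T are one-sided. *)
Definition C1_Hper (T : R) m (u ut : R -> R -> R[i]) : Prop :=
  [/\ C0_Hper T m u, C0_Hper T m ut &
    forall t0, 0 <= t0 <= T ->
      Hnorm m (fun x => ((t - t0)^-1)%:C * (u t x - u t0 x) - ut t0 x)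
        @[t --> within `[0, T] (dnbhs t0)] --> 0%E].

Definition LinfH (T : R) m (u : R -> R -> R[i]) : \bar R :=
  ess_sup lebesgue_measure
    (patch (fun=> 0%E) `[0, T] (fun t => Hnorm m (u t))).

End sobolev.

Section problem.
Context {R : realType}.
Variables (a b T : R) (m0 : nat).

(* psi eps t x, phi eps t x and phit eps t x stand for psi(x, t), phi(x, t)
   and d/dt phi(x, t) for the given value of eps. The periodic boundary
   conditions are part of the membership in H^m0_per required by
   assumption_A. *)
Definition solves (psi0 : R -> R[i]) (phi0 phi1 : R -> R) (eps : R)
    (psi : R -> R -> R[i]) (phi phit : R -> R -> R) : Prop :=
  [/\ forall t x, 0 < t < T -> a < x < b ->
        [/\ cderivable (psi ^~ x) t,
            cderivable (psi t) x,
            cderivable (cderive (psi t)) x &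
            'i%C * cderive (psi ^~ x) t + cderive (cderive (psi t)) x
              + (phi t x)%:C * psi t x = 0],
      forall t x, 0 < t < T -> a < x < b ->
        [/\ is_derive t 1 (phi ^~ x) (phit t x),
            derivable (phit ^~ x) t 1,
            derivable (phi t) x 1,
            derivable (derive1 (phi t)) x 1 &
            eps ^+ 2 * derive1 (phit ^~ x) t - derive1 (derive1 (phi t)) x
              + (eps ^+ 2)^-1 * phi t x
              - ComplexField.Normc.normc (psi t x) ^+ 2 = 0] &
      forall x, a <= x <= b ->
        [/\ psi 0 x = psi0 x, phi 0 x = phi0 x &
            phit 0 x = (eps ^+ 2)^-1 * phi1 x]].

Definition assumption_A (psi : R -> R -> R -> R[i])
    (phi phit : R -> R -> R -> R) : Prop :=
  [/\ (5 <= m0)%N,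
      forall eps, 0 < eps <= 1 -> C0_Hper a b T m0 (psi eps),
      forall eps, 0 < eps <= 1 ->
        C1_Hper a b T m0 (fun t x => (phi eps t x)%:C)
                         (fun t x => (phit eps t x)%:C),
      exists2 K : R, 0 < K & forall eps, 0 < eps <= 1 ->
        (LinfH a b T m0 (psi eps) <= K%:E)%E &
      exists2 K : R, 0 < K & forall eps, 0 < eps <= 1 ->
        (LinfH a b T m0 (fun t x => (phi eps t x)%:C)
         + (eps ^+ 2)%:E * LinfH a b T m0 (fun t x => (phit eps t x)%:C)
         <= K%:E)%E].

Definition Cpsi (psi : R -> R -> R -> R[i]) : \bar R :=
  ereal_sup [set LinfH a b T m0 (psi eps) | eps in [set e | 0 < e <= 1]].

Definition Cphi (phi phit : R -> R -> R -> R) : \bar R :=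
  ereal_sup [set maxe (LinfH a b T m0 (fun t x => (phi eps t x)%:C))
      ((eps ^+ 2)%:E * LinfH a b T m0 (fun t x => (phit eps t x)%:C))%E |
    eps in [set e | 0 < e <= 1]].

End problem.

Section fourier.
Context {R : realType}.
Variables (a b : R) (N : nat).
Implicit Types (l : int) (c : int -> R[i]).

Definition mesh : R := (b - a) / N%:R.
Definition node (j : nat) : R := a + j%:R * mesh.
Definition mu l : R := 2 * pi * l%:~R / (b - a).

(* Vectors of Y_N are functions on 'I_N.+1; all the vectors built below from
   (b - a)-periodic data satisfy v_0 = v_N. *)
Definition grid := 'I_N.+1 -> R[i].
Implicit Types v : grid.

Definition dft v l : R[i] :=
  (N%:R)^-1 * \sum_(j < N)
    v (widen_ord (leqnSn N) j) * expi (- (mu l * (node j - a))).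

(* sum over l = -N/2, ..., N/2 - 1, for N even *)
Definition trig_poly c (x : R) : R[i] :=
  \sum_(k < N) let l := k%:Z - (N./2)%:Z in c l * expi (mu l * (x - a)).

Definition idft c : grid := fun j => trig_poly c (node j).

Definition interp v : R -> R[i] := trig_poly (dft v).

End fourier.

Section scheme.
Context {R : realType}.
Variables (a b eps tau : R) (N : nat).
Implicit Types (l : int) (s : R).
Local Notation grid := (@grid R N).
Local Notation mu := (mu a b).
Local Notation dft := (@dft R a b N).
Local Notation idft := (@idft R a b N).

Definition omega l : R := (eps ^+ 2)^-1 * Num.sqrt (1 + eps ^+ 2 * mu l ^+ 2).
Definition lambdap l : R :=
  - ((eps ^+ 2)^-1 * (1 + Num.sqrt (1 + eps ^+ 2 * mu l ^+ 2))).
Definition lambdam l : R :=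
  - ((eps ^+ 2)^-1 * (1 - Num.sqrt (1 + eps ^+ 2 * mu l ^+ 2))).

Definition coef_a l s : R[i] :=
  ((lambdap l)%:C * expi (s * lambdam l) - (lambdam l)%:C * expi (s * lambdap l))
  / (lambdap l - lambdam l)%:C.
Definition coef_da l s : R[i] :=
  'i%C * (lambdap l * lambdam l)%:C
  * ((expi (s * lambdam l) - expi (s * lambdap l)) / (lambdap l - lambdam l)%:C).

Definition coef_p l : R := \int[lebesgue_measure]_(th in `[0, tau])
  (sin (omega l * (tau - th)) / (eps ^+ 2 * omega l)).
Definition coef_q l : R := \int[lebesgue_measure]_(th in `[0, tau])
  (th * (sin (omega l * (tau - th)) / (eps ^+ 2 * omega l))).
Definition coef_dp l : R := \int[lebesgue_measure]_(th in `[0, tau])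
  (cos (omega l * (tau - th)) / eps ^+ 2).
Definition coef_dq l : R := \int[lebesgue_measure]_(th in `[0, tau])
  (th * (cos (omega l * (tau - th)) / eps ^+ 2)).

(* c_l^+, d_l^+ for sg = 1 and c_l^-, d_l^- for sg = -1 *)
Definition coef_c (sg : R) l : R[i] :=
  'i%C * expi (- (mu l ^+ 2 * tau)) *
  cint `[0, tau] (fun th => expi ((mu l ^+ 2 + sg / eps ^+ 2) * th)).
Definition coef_d (sg : R) l : R[i] :=
  'i%C * expi (- (mu l ^+ 2 * tau)) *
  cint `[0, tau] (fun th => th%:C * expi ((mu l ^+ 2 + sg / eps ^+ 2) * th)).

Record state := State { Psi : grid ; Phi : grid ; dPhi : grid }.
Implicit Type S : state.

Definition v0 S : grid := fun j => 2^-1 * (Phi S j - 'i%C * (eps ^+ 2)%:C * dPhi S j).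

Definition dPsi S : grid := idft (fun l =>
  - 'i%C * (sin (mu l ^+ 2 * tau) / tau)%:C * dft (Psi S) l
  + 'i%C * dft (fun j => Phi S j * Psi S j) l).

Definition v1 S : grid := idft (fun l => coef_a l tau * dft (v0 S) l).
Definition dv1 S : grid := idft (fun l => coef_da l tau * dft (v0 S) l).

Definition Psi_sq S : grid :=
  fun j => (ComplexField.Normc.normc (Psi S j) ^+ 2)%:C.
Definition Re_Psi_dPsi S : grid :=
  fun j => (complex.Re (conjc (Psi S j) * dPsi S j))%:C.

Definition r1 S : grid := idft (fun l =>
  (coef_p l)%:C * dft (Psi_sq S) l + 2 * (coef_q l)%:C * dft (Re_Psi_dPsi S) l).
Definition dr1 S : grid := idft (fun l =>
  (coef_dp l)%:C * dft (Psi_sq S) l + 2 * (coef_dq l)%:C * dft (Re_Psi_dPsi S) l).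

Definition Psi_next S : grid := idft (fun l =>
  expi (- (mu l ^+ 2 * tau)) * dft (Psi S) l
  + coef_c 1 l * dft (fun j => v0 S j * Psi S j) l
  + coef_d 1 l * dft (fun j => v0 S j * dPsi S j) l
  + coef_c (-1) l * dft (fun j => conjc (v0 S j) * Psi S j) l
  + coef_d (-1) l * dft (fun j => conjc (v0 S j) * dPsi S j) l).

Definition Phi_next S : grid := fun j =>
  expi (tau / eps ^+ 2) * v1 S j + expi (- (tau / eps ^+ 2)) * conjc (v1 S j)
  + r1 S j.

Definition dPhi_next S : grid := fun j =>
  expi (tau / eps ^+ 2) * (dv1 S j + 'i%C / (eps ^+ 2)%:C * v1 S j)
  + expi (- (tau / eps ^+ 2))
    * (conjc (dv1 S j) - 'i%C / (eps ^+ 2)%:C * conjc (v1 S j))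
  + dr1 S j.

Definition step S : state := State (Psi_next S) (Phi_next S) (dPhi_next S).

Variables (psi0 : R -> R[i]) (phi0 phi1 : R -> R).

Definition initial_state : state :=
  State (fun j => psi0 (node a b N j)) (fun j => (phi0 (node a b N j))%:C)
        (fun j => ((eps ^+ 2)^-1 * phi1 (node a b N j))%:C).

Definition mtifp (n : nat) : state := iter n step initial_state.

(* Multiscale interpolants at time t_n + s, for 0 <= s <= tau. *)
Definition Psi_int (n : nat) s : grid := fun j =>
  ((tau - s) / tau)%:C * Psi (mtifp n) j + (s / tau)%:C * Psi (mtifp n.+1) j.

Definition v_int (n : nat) s : grid := fun j =>
  ((tau - s) / tau)%:C * v0 (mtifp n) j + (s / tau)%:C * v1 (mtifp n) j.

Definition Phi_int (n : nat) s : grid := fun j =>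
  expi (s / eps ^+ 2) * v_int n s j
  + expi (- (s / eps ^+ 2)) * conjc (v_int n s j)
  + (s / tau)%:C * r1 (mtifp n) j.

End scheme.

Section errors.
Context {R : realType}.
Variables (a b : R) (psi0 : R -> R[i]) (phi0 phi1 : R -> R).
Variables (psi : R -> R -> R -> R[i]) (phi phit : R -> R -> R -> R).
Variables (eps tau : R) (N : nat).
Local Notation mtifp := (@mtifp R a b eps tau N psi0 phi0 phi1).
Local Notation interp := (@interp R a b N).

Definition e_psi (n : nat) (x : R) : R[i] :=
  psi eps (n%:R * tau) x - interp (Psi (mtifp n)) x.
Definition e_phi (n : nat) (x : R) : R[i] :=
  (phi eps (n%:R * tau) x)%:C - interp (Phi (mtifp n)) x.
Definition de_phi (n : nat) (x : R) : R[i] :=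
  (phit eps (n%:R * tau) x)%:C - interp (dPhi (mtifp n)) x.

Definition eint_psi (n : nat) (s x : R) : R[i] :=
  psi eps (n%:R * tau + s) x
  - interp (Psi_int a b eps tau psi0 phi0 phi1 n s) x.
Definition eint_phi (n : nat) (s x : R) : R[i] :=
  (phi eps (n%:R * tau + s) x)%:C
  - interp (Phi_int a b eps tau psi0 phi0 phi1 n s) x.

End errors.

Definition admissible {R : realType} (a b h0 tau0 eps tau : R) (N : nat) : Prop :=
  [/\ 0 < eps <= 1, (0 < N)%N, ~~ odd N, 0 < mesh a b N <= h0 &
      0 < tau <= tau0].

(* Main.v *)
Require Import Defs.
From HB Require Import structures.
From mathcomp Require Import all_boot all_order all_algebra.
From mathcomp Require Import all_classical all_reals all_analysis.
From mathcomp Require Import complex measurable_realfun ess_sup_inf.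
From mathcomp Require Import ring lra zify.

Import Order.TTheory GRing.Theory Num.Theory.
Import numFieldNormedType.Exports.

Local Open Scope classical_set_scope.
Local Open Scope ring_scope.
Local Open Scope complex_scope.

Set Implicit Arguments.
Unset Strict Implicit.
Unset Printing Implicit Defensive.

(** The estimate is proved for Fourier coefficients in the modes
    [-N/2 <= l < N/2] carried by the grid; [nrm] is the H^1 norm of the
    trigonometric polynomial with given coefficients. Write [t = t_n + s]. The
    exact coefficients at time [t] are compared with those of the interpolant
    through the data at time [t_n], where the error is known.

    For [psi], the coefficients solve [F' = i (- mu^2 F + (phi psi)^)], and [F']
    varies at a rate of order [eps^-2] because [d/dt phi] is of that size. Hence
    [F (t_n + s) - F (t_n)] is [s F' (t_n)] up to [s^2 / eps^2]
    ([psi_hat_taylor]), and is of order [s] in any case ([psi_hat_lip]). One step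
    of the scheme adds [tau F' (t_n)] up to [tau^2 / eps^2] and the error at
    [t_n] ([dstep_taylor]), and linear interpolation scales this by [s / tau].

    For [phi], Duhamel's formula ([phi_hat_duhamel]) leaves the free propagator
    and a source weighted by [sin (omega x) / (omega eps^2)], which is at most
    [1] and at most [x / eps^2]. Multiplied by the phases
    [e^(+- i s / eps^2)], the coefficient [a_l (s)] of the scheme and its
    conjugate reproduce that propagator exactly ([coef_a_rot]);
    interpolating [a_l] linearly in time costs at most [tau mu^2] and at most
    [(tau^2 / eps^2) mu^2] ([lin_a_approx]), and the phases themselves are never
    interpolated. This gives both bounds at once ([phi_interp]).

    The nonlinear terms are products of grid functions, whose discrete Fourier
    coefficients are to be compared with the Fourier coefficients of products of
    functions. Discrete H^1 is an algebra, uniformly in [N] ([nrm_dftM]), and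
    aliasing is absent for trigonometric polynomials of degree less than [N / 4]
    ([near_mul]). Such polynomials within a constant times [h^(m0 - 1)] of the
    exact solution at any time are provided by the error hypothesis itself: on a
    grid about half as fine, and with a time step so small that
    [tau^2 / eps^2] is negligible, the numerical solution is one
    ([approximable_exists]).

    The regularity used is that of five derivatives in space: weak derivatives
    that are continuous are classical ([rweak_C1]), an essential bound in time
    holds at all times by continuity ([Reg_of_C0]), and the equations pass to the
    Fourier coefficients by differentiation under the integral sign ([fc_time]).

    The last statement follows since [min (tau^2 / eps^2) eps^2 <= tau], with
    equality for [eps^2 = tau]. *)

(** * Complex numbers and the exponential *)

Notation nc := ComplexField.Normc.normc.

Section complex_scalars.
Context {R : realType}.
Implicit Types (z w : R[i]) (x y r : R).

Lemma nc_ge0 z : 0 <= nc z.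
Proof. by case: z => x y /=; exact: sqrtr_ge0. Qed.

Lemma nc_sqr z : nc z ^+ 2 = complex.Re z ^+ 2 + complex.Im z ^+ 2.
Proof. by case: z => x y /=; rewrite sqr_sqrtr// addr_ge0// sqr_ge0. Qed.

Lemma ncD z w : nc (z + w) <= nc z + nc w.
Proof. exact: le_normcD. Qed.

Lemma ncN z : nc (- z) = nc z.
Proof. exact: normcN. Qed.

Lemma ncB z w : nc (z - w) <= nc z + nc w.
Proof. by rewrite -(ncN w); exact: ncD. Qed.

Lemma ncM z w : nc (z * w) = nc z * nc w.
Proof. exact: ComplexField.Normc.normcM. Qed.

Lemma nc0 : nc (0 : R[i]) = 0.
Proof. exact: ComplexField.Normc.normc0. Qed.

Lemma nc1 : nc (1 : R[i]) = 1.
Proof. exact: ComplexField.Normc.normc1. Qed.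

Lemma ncV z : nc z^-1 = (nc z)^-1.
Proof. exact: ComplexField.Normc.normcV. Qed.

Lemma ncR x : nc x%:C = `|x|.
Proof. by rewrite /= expr0n addr0 sqrtr_sqr. Qed.

Lemma nci : nc ('i%C : R[i]) = 1.
Proof. by rewrite /= expr0n add0r expr1n sqrtr1. Qed.

Lemma ncJ z : nc (conjc z) = nc z.
Proof. by case: z => x y /=; rewrite sqrrN. Qed.

Lemma Re_le_nc z : `|complex.Re z| <= nc z.
Proof.
rewrite -ler_sqr ?nnegrE ?nc_ge0 ?normr_ge0// nc_sqr real_normK ?num_real//.
by rewrite lerDl sqr_ge0.
Qed.

Lemma Im_le_nc z : `|complex.Im z| <= nc z.
Proof.
rewrite -ler_sqr ?nnegrE ?nc_ge0 ?normr_ge0// nc_sqr real_normK ?num_real//.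
by rewrite lerDr sqr_ge0.
Qed.

Lemma nc_le_ReIm z : nc z <= `|complex.Re z| + `|complex.Im z|.
Proof.
rewrite -ler_sqr ?nnegrE ?nc_ge0 ?addr_ge0 ?normr_ge0// nc_sqr sqrrD.
rewrite !real_normK ?num_real// -addrA [_ *+ 2 + _]addrC addrA lerDl.
by rewrite mulrn_wge0// mulr_ge0.
Qed.

Lemma cReD z w : complex.Re (z + w) = complex.Re z + complex.Re w.
Proof. by case: z; case: w. Qed.
Lemma cImD z w : complex.Im (z + w) = complex.Im z + complex.Im w.
Proof. by case: z; case: w. Qed.
Lemma cReN z : complex.Re (- z) = - complex.Re z.
Proof. by case: z. Qed.
Lemma cImN z : complex.Im (- z) = - complex.Im z.
Proof. by case: z. Qed.
Lemma cReM z w : complex.Re (z * w) =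
  complex.Re z * complex.Re w - complex.Im z * complex.Im w.
Proof. by case: z; case: w. Qed.
Lemma cImM z w : complex.Im (z * w) =
  complex.Re z * complex.Im w + complex.Im z * complex.Re w.
Proof. by case: z; case: w => ? ? ? ? /=; rewrite addrC. Qed.
Lemma cReJ z : complex.Re (conjc z) = complex.Re z.
Proof. by case: z. Qed.
Lemma cImJ z : complex.Im (conjc z) = - complex.Im z.
Proof. by case: z. Qed.
Lemma cReMr x z : complex.Re (x%:C * z) = x * complex.Re z.
Proof. by rewrite cReM /= mul0r subr0. Qed.
Lemma cImMr x z : complex.Im (x%:C * z) = x * complex.Im z.
Proof. by rewrite cImM /= mul0r addr0. Qed.

Lemma complex_eq z w :
  complex.Re z = complex.Re w -> complex.Im z = complex.Im w -> z = w.
Proof. by case: z; case: w => /= ? ? ? ? -> ->. Qed.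

Lemma mulcJ z : z * conjc z = (nc z ^+ 2)%:C.
Proof.
apply: complex_eq; rewrite ?cReM ?cImM cReJ cImJ ?nc_sqr/= ?expr2; ring.
Qed.

Lemma conjcM z w : conjc (z * w) = conjc z * conjc w.
Proof. exact: rmorphM. Qed.
Lemma conjcD z w : conjc (z + w) = conjc z + conjc w.
Proof. exact: rmorphD. Qed.
Lemma conjcN z : conjc (- z) = - conjc z.
Proof. exact: rmorphN. Qed.
Lemma conjcR x : conjc (x%:C) = x%:C.
Proof. exact: conjc_real. Qed.

Lemma expi0 : expi (0 : R) = 1.
Proof. by rewrite /expi cos0 sin0. Qed.

Lemma expiD x y : expi (x + y) = expi x * expi y.
Proof.
by apply: complex_eq; rewrite ?cReM ?cImM /= ?cosD ?sinD// addrC.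
Qed.

Lemma expiN x : expi (- x) = conjc (expi x).
Proof. by rewrite /expi cosN sinN. Qed.

Lemma nc_expi x : nc (expi x) = 1.
Proof. by rewrite /= cos2Dsin2 sqrtr1. Qed.

Lemma expi_2pi (k : int) : expi (2 * pi * k%:~R : R) = 1.
Proof.
have H n : expi (2 * pi * n%:R : R) = 1.
  elim: n => [|n IH]; first by rewrite mulr0 expi0.
  rewrite -[n.+1]addn1 natrD mulrDr mulr1 expiD IH mul1r mulr_natl.
  by rewrite /expi cos2pi sin2pi.
case: k => n; first exact: H.
by rewrite NegzE mulrNz mulrN expiN -pmulrn H conjc1.
Qed.

Lemma mvt_norm (f df : R -> R) (M x : R) :
  (forall y, is_derive y 1 f (df y)) ->
  (forall y, `|y| <= `|x| -> `|df y| <= M) -> `|f x - f 0| <= M * `|x|.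
Proof.
move=> fd fM.
have cf (A : set R) : {within A, continuous f}.
  apply: continuous_subspaceT => y; apply: differentiable_continuous.
  exact/derivable1_diffP/(@ex_derive _ _ _ _ _ _ _ (fd y)).
have [x0|/ltW x0] := leP 0 x.
  have [c /[!in_itv]/= /andP[c0 cx] ->] := MVT_segment x0 (fun y _ => fd y) (cf _).
  rewrite subr0 normrM ler_wpM2r// fM// !ger0_norm//.
have [c /[!in_itv]/= /andP[c0 cx] fE] := MVT_segment x0 (fun y _ => fd y) (cf _).
rewrite distrC fE sub0r normrM normrN ler_wpM2r// fM// !ler0_norm//.
by rewrite lerN2.
Qed.

Lemma norm_sin_le x : `|sin x| <= `|x|.
Proof.
have := @mvt_norm sin cos 1 x (fun y => is_derive_sin y) (fun y _ => cos_max y).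
by rewrite sin0 subr0 mul1r.
Qed.

Lemma norm_cosB1_le x : `|cos x - 1| <= `|x|.
Proof.
have := @mvt_norm cos (fun y => - sin y) 1 x (fun y => is_derive_cos y).
by rewrite cos0 mul1r; apply => y _; rewrite normrN sin_max.
Qed.

Lemma norm_cosB1_le2 x : `|cos x - 1| <= x ^+ 2.
Proof.
have := @mvt_norm cos (fun y => - sin y) `|x| x (fun y => is_derive_cos y).
rewrite cos0 -expr2 real_normK ?num_real//; apply => y yx.
by rewrite normrN (le_trans (norm_sin_le y)).
Qed.

Lemma norm_sinB_le2 x : `|sin x - x| <= x ^+ 2.
Proof.
have := @mvt_norm (fun y => sin y - y) (fun y => cos y - 1) `|x| x.
rewrite sin0 !subr0 -expr2 real_normK ?num_real//; apply => y yx.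
by rewrite (le_trans (norm_cosB1_le y)).
Qed.

Lemma nc_expiB1 x : nc (expi x - 1) <= 2 * `|x|.
Proof.
rewrite (le_trans (nc_le_ReIm _))//= oppr0 addr0 mulr_natl mulr2n.
by rewrite lerD ?norm_cosB1_le ?norm_sin_le.
Qed.

Lemma nc_expiB1_le2 x : nc (expi x - 1) <= 2.
Proof.
by rewrite (le_trans (ncB _ _))// nc_expi nc1.
Qed.

Lemma nc_expiB2 x : nc (expi x - 1 - 'i%C * x%:C) <= 2 * x ^+ 2.
Proof.
rewrite (le_trans (nc_le_ReIm _))//= mulr_natl mulr2n lerD//.
  by rewrite !(mul0r, mul1r, mulr0, subr0) norm_cosB1_le2.
by rewrite !(mul0r, mul1r, mulr0, subr0, oppr0, add0r, addr0) norm_sinB_le2.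
Qed.

(** A weak form of Jordan's inequality; only the order of magnitude matters, to
    compare difference quotients on the grid with derivatives. *)
Lemma norm_sin_ge x : `|x| <= pi / 2 -> `|x| / 16 <= `|sin x|.
Proof.
wlog x0 : x / 0 <= x => [H|].
  have [/H//|/ltW x0] := leP 0 x.
  by rewrite -normrN -(normrN (sin x)) -sinN; apply: H; rewrite oppr_ge0.
rewrite ger0_norm// => xpi.
have pi2 : pi / 2 < 2 :> R := pihalf_lt2 R.
have singe0 (y : R) : 0 <= y -> y <= 1 -> y / 8 <= sin y.
  move=> y0 y1.
  have cf (A : set R) : {within A, continuous (fun y : R => sin y)}.
    by apply: continuous_subspaceT => z; exact: continuous_sin.
  have [c /[!in_itv]/= /andP[c0 cx]] :=
    MVT_segment y0 (fun y _ => is_derive_sin y) (cf _).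
  rewrite sin0 !subr0 => ->; rewrite mulrC ler_wpM2r//.
  have c2 : c ^+ 2 <= 1 by nra.
  have := norm_cosB1_le2 (c / 2); rewrite ler_norml => /andP[+ _].
  (* by the bound on [cos (c / 2)], the slope [cos c] is at least [1/8] *)
  have -> : cos c = 2 * cos (c/2) ^+ 2 - 1.
    have E : c = (c / 2) *+ 2 by rewrite mulr2n; lra.
    by rewrite {1}E cos_mulr2n mulr2n; ring.
  have := cos_le1 (c/2).
  have -> : (c/2) ^+ 2 = c ^+ 2 / 4 by field.
  nra.
have [x1|x1] := leP x 1.
  have := singe0 _ x0 x1; have := ler_norm (sin x); lra.
have h1 : 1/8 <= sin (1 : R) by apply: singe0.
have hpi : 1 <= pi / 2 :> R := pihalf_ge1 R.
have : sin 1 <= sin x.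
  apply/ltW; rewrite ltr_sin ?in_itv/=; lra.
have := ler_norm (sin x); lra.
Qed.

End complex_scalars.

Arguments ComplexField.Normc.normc : simpl never.

(** * Weighted sums *)

Section weighted_l2.
Context {R : realType} {I : finType}.
Variable w : I -> R.
Hypothesis w_ge0 : forall i, 0 <= w i.
Implicit Types x y : I -> R.

Lemma cauchy_schwarz_sum x y :
  \sum_i w i * (x i * y i) <=
  Num.sqrt (\sum_i w i * x i ^+ 2) * Num.sqrt (\sum_i w i * y i ^+ 2).
Proof.
set X := \sum_i w i * x i ^+ 2; set Y := \sum_i w i * y i ^+ 2.
have p0 (z : I -> R) : 0 <= \sum_i w i * z i ^+ 2.
  by apply: sumr_ge0 => i _; rewrite mulr_ge0// sqr_ge0.
have key (z t : I -> R) : \sum_i w i * z i ^+ 2 = 0 -> \sum_i w i * (z i * t i) = 0.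
  move=> z0; apply: big1 => i _.
  have : w i * z i ^+ 2 = 0.
    by apply: (psumr_eq0P _ z0) => // j _; rewrite mulr_ge0// sqr_ge0.
  move/eqP; rewrite mulf_eq0 expf_eq0/= => /orP[/eqP->|/eqP->]; first by rewrite mul0r.
  by rewrite mul0r mulr0.
have [X0|X0] := eqVneq X 0; first by rewrite key// X0 sqrtr0 mul0r.
have [Y0|Y0] := eqVneq Y 0.
  under eq_bigr do rewrite [x _ * _]mulrC.
  by rewrite key// Y0 sqrtr0 mulr0.
set p := Num.sqrt X; set q := Num.sqrt Y.
have pp : 0 < p by rewrite sqrtr_gt0 lt0r X0 p0.
have qp : 0 < q by rewrite sqrtr_gt0 lt0r Y0 p0.
have p2 : p ^+ 2 = X by rewrite sqr_sqrtr// p0.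
have q2 : q ^+ 2 = Y by rewrite sqr_sqrtr// p0.
apply: (@le_trans _ _ (\sum_i (w i * x i ^+ 2 * (q / p / 2) + w i * y i ^+ 2 * (p / q / 2)))).
  apply: ler_sum => i _.
  rewrite -!mulrA -mulrDr ler_wpM2l// -subr_ge0.
  have -> : x i * (x i * (q * (p^-1 * 2^-1))) + y i * (y i * (p * (q^-1 * 2^-1))) - x i * y i
     = (x i * q - y i * p) ^+ 2 / (2 * p * q).
    by field; rewrite !gt_eqF.
  by rewrite divr_ge0 ?sqr_ge0// !mulr_ge0// ltW.
rewrite big_split/= -!mulr_suml -/X -/Y -p2 -q2 le_eqVlt; apply/orP; left.
by apply/eqP; field; rewrite !gt_eqF.
Qed.

Lemma minkowski_sum x y : (forall i, 0 <= x i) -> (forall i, 0 <= y i) ->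
  Num.sqrt (\sum_i w i * (x i + y i) ^+ 2) <=
  Num.sqrt (\sum_i w i * x i ^+ 2) + Num.sqrt (\sum_i w i * y i ^+ 2).
Proof.
move=> x0 y0.
have p0 (z : I -> R) : 0 <= \sum_i w i * z i ^+ 2.
  by apply: sumr_ge0 => i _; rewrite mulr_ge0// sqr_ge0.
rewrite -ler_sqr ?nnegrE ?addr_ge0 ?sqrtr_ge0// sqr_sqrtr// sqrrD !sqr_sqrtr//.
apply: (@le_trans _ _ (\sum_i w i * x i ^+ 2 + 2 * (\sum_i w i * (x i * y i))
   + \sum_i w i * y i ^+ 2)).
  rewrite mulr_sumr -!big_split/= le_eqVlt; apply/orP; left; apply/eqP.
  by apply: eq_bigr => i _; ring.
by rewrite lerD2r lerD2l mulr_natl lerMn2r/= cauchy_schwarz_sum.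
Qed.

End weighted_l2.

Section derivation_rules.
Context {R : realType}.
Implicit Types (f g : R -> R) (x p q : R).

Lemma rder_cst x p : is_derive x 1 (fun=> p) 0.
Proof. exact: is_derive_cst. Qed.

Lemma rderD f g x p q : is_derive x 1 f p -> is_derive x 1 g q ->
  is_derive x 1 (fun y => f y + g y) (p + q).
Proof. by move=> hf hg; exact: is_deriveD. Qed.

Lemma rderB f g x p q : is_derive x 1 f p -> is_derive x 1 g q ->
  is_derive x 1 (fun y => f y - g y) (p - q).
Proof. by move=> hf hg; exact: is_deriveB. Qed.

Lemma rderN f x p : is_derive x 1 f p -> is_derive x 1 (fun y => - f y) (- p).
Proof. by move=> hf; exact: is_deriveN. Qed.

Lemma rderM f g x p q : is_derive x 1 f p -> is_derive x 1 g q ->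
  is_derive x 1 (fun y => f y * g y) (p * g x + f x * q).
Proof.
move=> hf hg; have := @is_deriveM _ _ f g x 1 _ _ hf hg.
by rewrite addrC [p * _]mulrC.
Qed.

Lemma rderZ f x p q : is_derive x 1 f p -> is_derive x 1 (fun y => q * f y) (q * p).
Proof. by move=> hf; exact: is_deriveZ. Qed.

Lemma rder_id x : is_derive x 1 (fun y : R => y) 1.
Proof. exact: is_derive_id. Qed.

Lemma rder_comp f g x p q : is_derive x 1 g p -> is_derive (g x) 1 f q ->
  is_derive x 1 (fun y => f (g y)) (q * p).
Proof. by move=> hg hf; have := @is_derive1_comp _ f g x q p hf hg. Qed.

End derivation_rules.

Definition cdif {R : realType} (f : R -> R[i]) (t : R) (d : R[i]) : Prop :=
  is_derive t 1 (fun s => complex.Re (f s)) (complex.Re d) /\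
  is_derive t 1 (fun s => complex.Im (f s)) (complex.Im d).

Definition freq (N k : nat) : int := k%:Z - (N./2)%:Z.

Lemma freqB_lt N (k k' : 'I_N) : `|freq N k - freq N k'| < N%:Z.
Proof.
have := ltn_ord k; have := ltn_ord k'; rewrite /freq.
rewrite ltr_norml; lia.
Qed.

Lemma freq_inj N (k k' : 'I_N) : (freq N k - freq N k' == 0) = (k == k').
Proof.
apply/eqP/eqP => [h|->]; last by rewrite subrr.
by apply: val_inj => /=; move: h; rewrite /freq; lia.
Qed.

(** * The H^1 norm of a sequence of Fourier coefficients *)

Section modes.
Context {R : realType}.
Variables (a b : R) (N : nat).
Hypothesis hab : a < b.
Implicit Types (c d : int -> R[i]) (l m : int).
Local Notation mu := (mu a b).
Local Notation freq := (freq N).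

Definition wgt (k : 'I_N) : R := (b - a) * (1 + mu (freq k) ^+ 2).

Lemma ba_gt0 : 0 < b - a. Proof. by rewrite subr_gt0. Qed.

Lemma wgt_ge0 k : 0 <= wgt k.
Proof. by rewrite mulr_ge0 ?(ltW ba_gt0)// addr_ge0// sqr_ge0. Qed.

(** By Parseval, the H^1 norm of the trigonometric polynomial with coefficients
    [c]. *)
Definition nrm c : R := Num.sqrt (\sum_(k < N) wgt k * nc (c (freq k)) ^+ 2).

Lemma nrm_ge0 c : 0 <= nrm c. Proof. exact: sqrtr_ge0. Qed.

Lemma nsq_ge0 c : 0 <= \sum_(k < N) wgt k * nc (c (freq k)) ^+ 2.
Proof. by apply: sumr_ge0 => k _; rewrite mulr_ge0 ?wgt_ge0// sqr_ge0. Qed.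

Lemma nrm_sqr c : nrm c ^+ 2 = \sum_(k < N) wgt k * nc (c (freq k)) ^+ 2.
Proof. by rewrite sqr_sqrtr// nsq_ge0. Qed.

Lemma nrm_le c d (M : R) : 0 <= M ->
  (forall k : 'I_N, nc (c (freq k)) <= M * nc (d (freq k))) -> nrm c <= M * nrm d.
Proof.
move=> M0 h; rewrite -ler_sqr ?nnegrE ?mulr_ge0 ?nrm_ge0//.
rewrite exprMn !nrm_sqr mulr_sumr; apply: ler_sum => k _.
rewrite [leRHS]mulrCA ler_wpM2l ?wgt_ge0// -exprMn ler_sqr ?nnegrE ?nc_ge0//.
by rewrite mulr_ge0 ?nc_ge0.
Qed.

Lemma nrm_le1 c d :
  (forall k : 'I_N, nc (c (freq k)) <= nc (d (freq k))) -> nrm c <= nrm d.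
Proof. by move=> h; rewrite -[leRHS]mul1r nrm_le// => k; rewrite mul1r. Qed.

Lemma eq_nrm c d : (forall k : 'I_N, c (freq k) = d (freq k)) -> nrm c = nrm d.
Proof. by move=> h; congr Num.sqrt; apply: eq_bigr => k _; rewrite h. Qed.

Lemma nrmD c d : nrm (fun l => c l + d l) <= nrm c + nrm d.
Proof.
apply: le_trans (minkowski_sum wgt_ge0 (fun k => nc_ge0 _) (fun k => nc_ge0 _)).
rewrite ler_wsqrtr// ler_sum// => k _; rewrite ler_wpM2l ?wgt_ge0//.
by rewrite ler_sqr ?nnegrE ?addr_ge0 ?nc_ge0// ncD.
Qed.

Lemma nrmN c : nrm (fun l => - c l) = nrm c.
Proof. by congr Num.sqrt; apply: eq_bigr => k _; rewrite ncN. Qed.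

Lemma nrmB c d : nrm (fun l => c l - d l) <= nrm c + nrm d.
Proof. by rewrite -(nrmN d); exact: nrmD. Qed.

Lemma nrm_sub c d e :
  nrm (fun l => c l - e l) <= nrm (fun l => c l - d l) + nrm (fun l => d l - e l).
Proof.
apply: le_trans (nrmD _ _); rewrite le_eqVlt; apply/orP; left; apply/eqP.
by apply: eq_nrm => k /=; rewrite addrA subrK.
Qed.

Lemma nrm_bound c d : nrm c <= nrm (fun l => c l - d l) + nrm d.
Proof.
apply: le_trans (nrmD _ _); rewrite le_eqVlt; apply/orP; left; apply/eqP.
by apply: eq_nrm => k /=; rewrite subrK.
Qed.

Lemma nrm_distC c d : nrm (fun l => c l - d l) = nrm (fun l => d l - c l).
Proof. by rewrite -nrmN; apply: eq_nrm => k; rewrite opprB. Qed.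

(** Mean value inequality for curves of coefficient sequences: pair the
    increment with itself and apply the scalar mean value theorem. *)
Lemma nrm_mvt (F dF : R -> int -> R[i]) (s0 s1 M : R) : s0 <= s1 ->
  (forall k : 'I_N, ccontinuous_on `[s0, s1] (fun t => F t (freq k))) ->
  (forall (k : 'I_N) t, s0 < t < s1 ->
     cdif (fun t => F t (freq k)) t (dF t (freq k))) ->
  (forall t, s0 < t < s1 -> nrm (dF t) <= M) ->
  nrm (fun l => F s1 l - F s0 l) <= M * (s1 - s0).
Proof.
rewrite le_eqVlt => /predU1P[->|s01] cF dFF FM.
  rewrite subrr mulr0 [leLHS](_ : _ = 0)//.
  rewrite /nrm big1 ?sqrtr0// => k _.
  by rewrite subrr nc0 expr0n/= mulr0.
pose D l := F s1 l - F s0 l.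
pose f t := \sum_(k < N) wgt k *
  (complex.Re (F t (freq k)) * complex.Re (D (freq k)) +
   complex.Im (F t (freq k)) * complex.Im (D (freq k))).
pose df t := \sum_(k < N) wgt k *
  (complex.Re (dF t (freq k)) * complex.Re (D (freq k)) +
   complex.Im (dF t (freq k)) * complex.Im (D (freq k))).
have fd t : t \in `]s0, s1[%R -> is_derive t 1 f (df t).
  rewrite in_itv/= => ts.
  have -> : f = \sum_(k < N) (fun t => wgt k *
    (complex.Re (F t (freq k)) * complex.Re (D (freq k)) +
     complex.Im (F t (freq k)) * complex.Im (D (freq k)))).
    by apply/funext => z; rewrite /f fct_sumE.
  apply: is_derive_sum => k; have [dR dI] := dFF k t ts.
  by apply: rderZ; apply: rderD; rewrite mulrC; (under eq_fun do rewrite mulrC); apply: rderZ.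
have cf : {within `[s0, s1], continuous f}.
  have -> : f = \sum_(k < N) (fun t => wgt k *
    (complex.Re (F t (freq k)) * complex.Re (D (freq k)) +
     complex.Im (F t (freq k)) * complex.Im (D (freq k)))).
    by apply/funext => z; rewrite /f fct_sumE.
  elim/big_ind : _ => [x|g1 g2 c1 c2 x|k _ x]; first exact: cvg_cst.
    by apply: cvgD; [exact: c1|exact: c2].
  have [cR cI] := cF k.
  apply: cvgM; first exact: cvg_cst.
  apply: cvgD; (apply: cvgM; last exact: cvg_cst); [exact: cR|exact: cI].
have [t ts E] := MVT s01 fd cf.
have E2 : f s1 - f s0 = nrm D ^+ 2.
  rewrite nrm_sqr /f -sumrB; apply: eq_bigr => k _.
  rewrite nc_sqr -mulrBr; congr (_ * _); rewrite /D cReD cImD cReN cImN; ring.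
have le1 : df t <= nrm (dF t) * nrm D.
  apply: le_trans (cauchy_schwarz_sum wgt_ge0 _ _).
  apply: ler_sum => k _; rewrite ler_wpM2l ?wgt_ge0//.
  set p := dF t _; set q := D _.
  have -> : complex.Re p * complex.Re q + complex.Im p * complex.Im q
     = complex.Re (p * conjc q) by rewrite cReM cReJ cImJ; ring.
  by rewrite (le_trans (ler_norm _))// (le_trans (Re_le_nc _))// ncM ncJ.
change (nrm D <= M * (s1 - s0)).
have [D0|D0] := leP (nrm D) 0.
  apply: (le_trans D0); rewrite mulr_ge0 ?subr_ge0 ?(ltW s01)//.
  by apply: le_trans (FM t _); [exact: nrm_ge0|by move: ts; rewrite in_itv].
rewrite -(ler_pM2r D0) -expr2 -E2 E.
rewrite mulrAC ler_wpM2r ?subr_ge0 ?(ltW s01)//.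
rewrite (le_trans le1)// ler_wpM2r ?nrm_ge0// FM//.
Qed.

End modes.

(** * Discrete Fourier transform and the discrete H^1 algebra *)

Section discrete_fourier.
Context {R : realType}.
Variables (a b : R) (N : nat).
Hypothesis hab : a < b.
Hypothesis N0 : (0 < N)%N.
Implicit Types (l m : int) (v u : @grid R N) (c : int -> R[i]).
Local Notation mu := (mu a b).
Local Notation h := (mesh a b N).
Local Notation node := (node a b N).
Local Notation dft := (@dft R a b N).
Local Notation idft := (@idft R a b N).

Definition em m (x : R) : R[i] := expi (mu m * (x - a)).

Lemma muD l m : mu (l + m) = mu l + mu m.
Proof. by rewrite /Defs.mu intrD mulrDr mulrDl. Qed.
Lemma muN l : mu (- l) = - mu l.
Proof. by rewrite /Defs.mu mulrNz mulrN mulNr. Qed.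
Lemma mu0 : mu 0 = 0.
Proof. by rewrite /Defs.mu mulr0z mulr0 mul0r. Qed.

Lemma emD l m x : em (l + m) x = em l x * em m x.
Proof. by rewrite /em muD mulrDl expiD. Qed.
Lemma emN m x : em (- m) x = conjc (em m x).
Proof. by rewrite /em muN mulNr expiN. Qed.
Lemma em0 x : em 0 x = 1.
Proof. by rewrite /em mu0 mul0r expi0. Qed.
Lemma nc_em m x : nc (em m x) = 1.
Proof. exact: nc_expi. Qed.
Lemma em_a m : em m a = 1.
Proof. by rewrite /em subrr mulr0 expi0. Qed.

Let NR0 : N%:R != 0 :> R. Proof. by rewrite pnatr_eq0 -lt0n. Qed.
Let ba0 : b - a != 0. Proof. by rewrite subr_eq0 gt_eqF. Qed.

Lemma em_b m : em m b = 1.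
Proof.
rewrite /em /Defs.mu (_ : _ * _ = 2 * pi * m%:~R) ?expi_2pi//.
by rewrite mulfVK.
Qed.

Definition ang m : R := 2 * pi * m%:~R / N%:R.

Lemma em_node m (j : nat) : em m (node j) = expi (ang m * j%:R).
Proof.
rewrite /em /node addrAC subrr add0r /mesh /Defs.mu /ang; congr expi.
by field; rewrite NR0.
Qed.

Lemma expi_nat (x : R) (j : nat) : expi (x * j%:R) = expi x ^+ j.
Proof.
elim: j => [|j IH]; first by rewrite mulr0 expi0.
by rewrite -[j.+1]addn1 natrD mulrDr mulr1 expiD IH addn1 exprSr.
Qed.

Lemma expi_ang_neq1 m : m != 0 -> `|m| < N%:Z -> expi (ang m) != 1.
Proof.
move=> m0 mN; apply/eqP => /(congr1 (@complex.Re R))/=.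
set t := ang m / 2; have -> : ang m = t *+ 2 by rewrite mulr2n /t; lra.
rewrite cos_mulr2n => ct.
have : sin t ^+ 2 = 0 by rewrite sin2cos2; lra.
move/eqP; rewrite expf_eq0/= => /eqP st.
have pi0 : 0 < pi :> R := pi_gt0 R.
have N0R : 0 < N%:R :> R by rewrite ltr0n.
have tE : t = pi * (m%:~R / N%:R) by rewrite /t /ang; field.
have tm : `|t| = pi * (`|m|%:~R / N%:R).
  by rewrite tE normrM (gtr0_norm pi0) normrM -intr_norm normfV (gtr0_norm N0R).
have : 0 < sin `|t|.
  apply: sin_gt0_pi; rewrite tm; apply/andP; split.
    by rewrite mulr_gt0// divr_gt0// ltr0z normr_gt0.
  by rewrite gtr_pMr// ltr_pdivrMr// mul1r (_ : N%:R = N%:Z%:~R)// ltr_int.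
have [t0|t0] := ger0P t; first by rewrite st ltxx.
by rewrite sinN st oppr0 ltxx.
Qed.

(** A geometric sum whose ratio is an [N]-th root of unity other than 1. *)
Lemma sum_em m : `|m| < N%:Z ->
  \sum_(j < N) em m (node j) = (if m == 0 then N%:R else 0).
Proof.
move=> mN; have [->|m0] := eqVneq m 0.
  by under eq_bigr do rewrite em0; rewrite sumr_const card_ord.
under eq_bigr do rewrite em_node expi_nat.
apply/eqP; rewrite -(mulrI_eq0 _ (mulfI (x := expi (ang m) - 1) _)); last first.
  by rewrite subr_eq0 expi_ang_neq1.
rewrite -subrX1 -expi_nat /ang mulfVK// expi_2pi subrr eqxx//.
Qed.

(** Natural-number indices allow shifts and telescoping sums; [inord] is
    harmless since only indices up to [N] occur. *)
Definition gv v (j : nat) : R[i] := v (inord j).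

Lemma dftE v l : dft v l = (N%:R)^-1 * \sum_(j < N) gv v j * em (- l) (node j).
Proof.
rewrite /Defs.dft; congr (_ * _); apply: eq_bigr => j _; congr (_ * _).
  by congr v; apply: val_inj; rewrite /= inordK// (leq_trans (ltn_ord j)).
by rewrite /em muN mulNr.
Qed.

Lemma dftD v u l : dft (fun j => v j + u j) l = dft v l + dft u l.
Proof.
by rewrite !dftE -mulrDr -big_split/=; congr (_ * _); apply: eq_bigr => j _; rewrite mulrDl.
Qed.

Lemma dftZ (z : R[i]) v l : dft (fun j => z * v j) l = z * dft v l.
Proof.
by rewrite !dftE [RHS]mulrCA; congr (_ * _); rewrite mulr_sumr; apply: eq_bigr => j _; rewrite mulrA.
Qed.

Lemma dftN v l : dft (fun j => - v j) l = - dft v l.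
Proof.
by rewrite !dftE -mulrN -sumrN; congr (_ * _); apply: eq_bigr => j _; rewrite mulNr.
Qed.

Lemma dftB v u l : dft (fun j => v j - u j) l = dft v l - dft u l.
Proof. by rewrite dftD dftN. Qed.

Lemma ncNR : (N%:R : R[i]) = (N%:R : R)%:C.
Proof. by rewrite rmorph_nat. Qed.

Let NC0 : (N%:R : R[i]) != 0.
Proof. by rewrite pnatr_eq0 -lt0n. Qed.

Lemma dft_em m l : `|m - l| < N%:Z ->
  dft (fun j => em m (node j)) l = (m == l)%:R.
Proof.
move=> ml; rewrite dftE.
under eq_bigr => j _.
  rewrite /gv inordK ?(leq_trans (ltn_ord j))//.
  rewrite -emD.
  over.
rewrite sum_em// subr_eq0; case: eqP => _; first by rewrite mulVf.
by rewrite mulr0.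
Qed.

Lemma dft_sum (I : Type) (r : seq I) (P : pred I) (F : I -> grid N) l :
  dft (fun j => \sum_(i <- r | P i) F i j) l = \sum_(i <- r | P i) dft (F i) l.
Proof.
elim: r => [|i r IH].
  rewrite big_nil dftE big1 ?mulr0// => j _.
  by rewrite /gv big_nil mul0r.
rewrite big_cons -IH; case: ifP => Pi.
  by rewrite -dftD; congr Defs.dft; apply/funext => j; rewrite big_cons Pi.
by congr Defs.dft; apply/funext => j; rewrite big_cons Pi.
Qed.

Lemma dft_idft c (k : 'I_N) : dft (idft c) (freq N k) = c (freq N k).
Proof.
rewrite /Defs.idft /trig_poly dft_sum (bigD1 k)//= big1 ?addr0.
  rewrite dftZ dft_em ?eqxx ?mulr1//.
  by rewrite subrr normr0 ltz_nat.
move=> i ik; rewrite dftZ dft_em; last exact: freqB_lt.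
by rewrite -subr_eq0 freq_inj (negbTE ik) mulr0.
Qed.

Lemma dft_conj v l : dft (fun j => conjc (v j)) l = conjc (dft v (- l)).
Proof.
rewrite !dftE opprK conjcM conjc_inv ncNR conjcR rmorph_sum/=; congr (_ * _).
by apply: eq_bigr => j _; rewrite conjcM emN -emN.
Qed.

Lemma dft_period v l : dft v (l + N%:Z) = dft v l.
Proof.
rewrite !dftE; congr (_ * _); apply: eq_bigr => j _; congr (_ * _).
rewrite opprD emD [X in _ * X](_ : _ = 1) ?mulr1//.
rewrite em_node /ang mulrNz mulrN mulNr mulfK//.
by rewrite mulNr (_ : j%:R = (j%:Z)%:~R)// expiN expi_2pi conjc1.
Qed.

Lemma parseval_grid v :
  \sum_(j < N) nc (gv v j) ^+ 2 = N%:R * \sum_(k < N) nc (dft v (freq N k)) ^+ 2.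
Proof.
apply: complexI; rewrite -[LHS]/(real_complex_def _ _) -[RHS]/(real_complex_def _ _).
rewrite rmorph_sum rmorphM rmorph_sum/= -ncNR.
under [LHS]eq_bigr do rewrite -mulcJ.
under [X in _ * X]eq_bigr => k _.
  rewrite -mulcJ dftE conjcM conjc_inv ncNR conjcR -ncNR rmorph_sum/=.
  rewrite mulrACA big_distrlr/= .
  over.
rewrite -mulr_sumr mulrA mulrA mulfV// mul1r.
rewrite exchange_big/=.
under [in RHS]eq_bigr => j _ do rewrite exchange_big/=.
have key (j j' : 'I_N) : \sum_(k < N) (gv v j * em (- freq N k) (node j)) *
    (conjc (gv v j' * em (- freq N k) (node j')))
    = (if j == j' then N%:R * (gv v j * conjc (gv v j')) else 0).
  have E (k : 'I_N) : (gv v j * em (- freq N k) (node j)) *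
    (conjc (gv v j' * em (- freq N k) (node j'))) =
     (gv v j * conjc (gv v j')) * (expi (- (ang (- (N./2)%:Z) * (j%:R - j'%:R))) *
       em (j'%:Z - j%:Z) (node k)).
    rewrite conjcM -emN opprK !mulrA; rewrite -!mulrA; congr (_ * _).
    rewrite mulrCA; congr (_ * _); rewrite !em_node -!expiD /freq; congr expi.
    by rewrite /ang !(intrD, intrN, mulrNz); field.
  under eq_bigr do rewrite E.
  rewrite -!mulr_sumr sum_em; last first.
    by have := ltn_ord j; have := ltn_ord j'; rewrite ltr_norml; lia.
  rewrite subr_eq0 eqz_nat eq_sym -(inj_eq val_inj).
  have [->|_] := eqVneq (val j) (val j'); last by rewrite !mulr0.
  by rewrite subrr mulr0 oppr0 expi0 mul1r mulrC.
under [in RHS]eq_bigr => j _.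
  under eq_bigr => j' _ do rewrite key.
  rewrite (bigD1 j)//= eqxx big1 ?addr0; last first.
    by move=> i ij; rewrite eq_sym (negbTE ij).
  over.
rewrite -mulr_sumr mulrA mulVf// mul1r//.
Qed.

Lemma sum_shift (f : nat -> R[i]) : f N = f 0%N ->
  \sum_(j < N) f j.+1 = \sum_(j < N) f j.
Proof.
move=> fN; case: N fN => [|n] fn; first by rewrite !big_ord0.
rewrite [RHS]big_ord_recl [LHS]big_ord_recr/= fn addrC; congr (_ + _).
Qed.

(** Defined modulo [N], so that it acts diagonally on discrete Fourier
    coefficients even for vectors that do not satisfy [v_0 = v_N]. *)
Definition cyclic_shift v : grid N := fun j => gv v (j.+1 %% N).

Lemma gv_shift v (j : 'I_N) : gv (cyclic_shift v) j = gv v (j.+1 %% N).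
Proof. by rewrite /gv /cyclic_shift inordK// (leq_trans (ltn_ord j)). Qed.

Lemma dft_shift v l : dft (cyclic_shift v) l = expi (ang l) * dft v l.
Proof.
rewrite !dftE [RHS]mulrCA; congr (_ * _); rewrite mulr_sumr.
pose f (j : nat) := gv v (j %% N) * (expi (ang l) * em (- l) (node j)).
transitivity (\sum_(j < N) f j.+1).
  apply: eq_bigr => j _; rewrite gv_shift /f; congr (_ * _).
  rewrite !em_node -expiD; congr expi.
  by rewrite /ang mulrNz -addn1 natrD; ring.
rewrite sum_shift.
  by apply: eq_bigr => j _; rewrite /f modn_small// mulrCA.
rewrite /f modnn mod0n; congr (_ * (_ * _)).
rewrite !em_node mulr0 expi0 /ang mulfVK//; exact: expi_2pi.
Qed.

Definition delta v : grid N := fun j => cyclic_shift v j - v j.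

Lemma dft_delta v l : dft (delta v) l = (expi (ang l) - 1) * dft v l.
Proof. by rewrite /delta dftB dft_shift mulrBl mul1r. Qed.

Let h0 : 0 < h. Proof. by rewrite divr_gt0 ?subr_gt0// ltr0n. Qed.

Lemma ang_mu l : ang l = mu l * h.
Proof. by rewrite /ang /Defs.mu /mesh; field; rewrite NR0. Qed.

Lemma nc_expi_ang l : nc (expi (ang l) - 1) = 2 * `|sin (ang l / 2)|.
Proof.
set t := ang l / 2; have -> : ang l = t *+ 2 by rewrite mulr2n /t; lra.
apply/eqP; rewrite -(eqrXn2 (n := 2))// ?nc_ge0 ?mulr_ge0 ?normr_ge0//.
rewrite nc_sqr cReD cImD cReN cImN/= oppr0 addr0 cos_mulr2n sin_mulr2n.
rewrite exprMn real_normK ?num_real// !mulr2n.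
have := cos2Dsin2 t; set x := cos t; set y := sin t => E.
have -> : x ^+ 2 = 1 - y ^+ 2 by lra.
have -> : (x * y + x * y) ^+ 2 = 4 * (x ^+ 2 * y ^+ 2) by ring.
have -> : x ^+ 2 = 1 - y ^+ 2 by lra.
by apply/eqP; ring.
Qed.

Hypothesis Neven : ~~ odd N.

Lemma ang_freq (k : 'I_N) : `|ang (freq N k) / 2| <= pi / 2.
Proof.
have pi0 : 0 < pi :> R := pi_gt0 R.
have N0R : 0 < N%:R :> R by rewrite ltr0n.
have fk : `|freq N k|%:~R * 2 <= N%:R :> R.
  rewrite (_ : N%:R = N%:Z%:~R)// -[2]/(2%:~R) -intrM ler_int /freq.
  have := ltn_ord k; have := odd_double_half N; rewrite (negbTE Neven).
  lia.
rewrite (_ : ang _ / 2 = pi * (freq N k)%:~R / N%:R); last by rewrite /ang; field.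
rewrite !normrM (gtr0_norm pi0) normfV (gtr0_norm N0R) -intr_norm.
rewrite ler_pdivrMr// -mulrA ler_pM2l//; lra.
Qed.

(** The difference quotient of a grid vector is comparable, frequency by
    frequency, with the derivative of its trigonometric interpolant. *)
Lemma nc_expi_ang_ge (k : 'I_N) :
  `|mu (freq N k)| * h / 16 <= nc (expi (ang (freq N k)) - 1).
Proof.
rewrite nc_expi_ang; have := norm_sin_ge (ang_freq k).
rewrite ang_mu 2!normrM normfV (gtr0_norm h0) (ger0_norm (ler0n _ 2)); lra.
Qed.

Lemma nc_expi_ang_le l : nc (expi (ang l) - 1) <= 2 * (`|mu l| * h).
Proof. by apply: le_trans (nc_expiB1 _) _; rewrite ang_mu normrM (gtr0_norm h0). Qed.

(** The squared discrete H^1 norm, with forward differences. *)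
Definition dsq v : R :=
  h * \sum_(j < N) nc (gv v j) ^+ 2 + h^-1 * \sum_(j < N) nc (gv (delta v) j) ^+ 2.

Lemma dsqE v : dsq v = \sum_(k < N) (b - a) *
  (1 + (nc (expi (ang (freq N k)) - 1) / h) ^+ 2) * nc (dft v (freq N k)) ^+ 2.
Proof.
rewrite /dsq !parseval_grid !mulrA (_ : h * N%:R = b - a); last first.
  by rewrite /mesh mulfVK.
have -> : h^-1 * N%:R = (b - a) * h^-1 ^+ 2.
  have <- : h * N%:R = b - a by rewrite /mesh mulfVK.
  by field; rewrite gt_eqF.
rewrite !mulr_sumr -big_split/=; apply: eq_bigr => k _.
rewrite dft_delta ncM; ring.
Qed.

Local Notation nrm := (@nrm R a b N).

Lemma dsq_le v : dsq v <= 4 * nrm (dft v) ^+ 2.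
Proof.
rewrite dsqE nrm_sqr// mulr_sumr; apply: ler_sum => k _.
rewrite [leRHS]mulrA ler_wpM2r ?sqr_ge0// /wgt mulrCA ler_wpM2l//.
  by rewrite subr_ge0 ltW.
set x := nc _ / h.
have : x <= 2 * `|mu (freq N k)|.
  by rewrite ler_pdivrMr// -mulrA nc_expi_ang_le.
have x0 : 0 <= x by rewrite divr_ge0 ?nc_ge0// ltW.
rewrite -[mu _ ^+ 2]real_normK ?num_real//.
set y := `| _ | => xy; nra.
Qed.

Lemma nrm_le_dsq v : nrm (dft v) ^+ 2 <= 256 * dsq v.
Proof.
rewrite dsqE nrm_sqr// mulr_sumr; apply: ler_sum => k _.
rewrite [leRHS]mulrA ler_wpM2r ?sqr_ge0// /wgt mulrCA ler_wpM2l//.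
  by rewrite subr_ge0 ltW.
set x := nc _ / h.
have : `|mu (freq N k)| <= 16 * x.
  rewrite /x mulrA ler_pdivlMr//; have := nc_expi_ang_ge k; lra.
rewrite -[mu _ ^+ 2]real_normK ?num_real//.
have : 0 <= `|mu (freq N k)| by [].
set y := `| _ | => y0 xy; nra.
Qed.

Lemma dsq_ge0 v : 0 <= dsq v.
Proof.
by rewrite addr_ge0// mulr_ge0// ?invr_ge0 ?(ltW h0)// sumr_ge0// => j _; rewrite sqr_ge0.
Qed.

Definition Kalg : R := 2 / (b - a) + 2 * (b - a).

Lemma Kalg_ge0 : 0 <= Kalg.
Proof. by rewrite addr_ge0 ?divr_ge0 ?mulr_ge0// subr_ge0 ltW. Qed.

Lemma sqr_sum_le (x : 'I_N -> R) :
  (\sum_j x j) ^+ 2 <= N%:R * \sum_j x j ^+ 2.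
Proof.
have := @cauchy_schwarz_sum R 'I_N (fun=> 1) (fun=> ler01) (fun=> 1) x.
under eq_bigr do rewrite !mul1r.
under [X in Num.sqrt X * _]eq_bigr do rewrite mul1r expr1n.
under [X in _ * Num.sqrt X]eq_bigr do rewrite mul1r.
rewrite sumr_const card_ord -sqrtrM// => H.
have s0 : 0 <= \sum_j x j ^+ 2 by apply: sumr_ge0 => j _; exact: sqr_ge0.
have H' : (\sum_j x j) <= Num.sqrt (N%:R * \sum_j x j ^+ 2) by [].
have H2 : - (\sum_j x j) <= Num.sqrt (N%:R * \sum_j x j ^+ 2).
  have := @cauchy_schwarz_sum R 'I_N (fun=> 1) (fun=> ler01) (fun=> 1) (fun j => - x j).
  under eq_bigr do rewrite !mul1r.
  under [X in Num.sqrt X * _]eq_bigr do rewrite mul1r expr1n.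
  under [X in _ * Num.sqrt X]eq_bigr do rewrite mul1r sqrrN.
  by rewrite sumr_const card_ord -sqrtrM// sumrN.
rewrite -real_normK ?num_real// -[leRHS]sqr_sqrtr ?mulr_ge0//.
by rewrite ler_sqr ?nnegrE ?sqrtr_ge0 ?normr_ge0// ler_norml H' andbT lerNl.
Qed.

(** Telescoping along the arc from [i] to [j]. *)
Lemma gv_dist v (i j : 'I_N) :
  nc (gv v i - gv v j) <= \sum_(k < N) nc (gv (delta v) k).
Proof.
wlog ij : i j / (i <= j)%N => [H|].
  by have [/H//|/ltnW/H] := leqP i j; rewrite -ncN opprB.
have dE (k : nat) : (k < j)%N -> gv v k.+1 - gv v k = gv (delta v) k.
  move=> kj; have kN : (k < N)%N by rewrite (ltn_trans kj).
  rewrite /delta {3}/gv -[cyclic_shift v _]/(gv (cyclic_shift v) (Ordinal kN)) gv_shift/=.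
  by rewrite modn_small// (leq_trans _ (ltn_ord j)).
rewrite -ncN opprB -(telescope_sumr (fun k => gv v k) ij).
apply: (@le_trans _ _ (\sum_(i <= k < j) nc (gv (delta v) k))).
  rewrite (eq_big_nat _ _ (F2 := fun k => gv (delta v) k)); last first.
    by move=> k /andP[_ kj]; rewrite dE.
  elim/big_rec2 : _ => [|k y x _ H]; first by rewrite nc0.
  by rewrite (le_trans (ncD _ _))// lerD2l.
rewrite -(big_mkord xpredT (fun k => nc (gv (delta v) k))).
rewrite (big_cat_nat (m := 0) (n := i) (p := N)) ?leq0n ?(ltnW (ltn_ord i))//=.
rewrite (big_cat_nat (m := i) (n := j) (p := N)) ?(ltnW (ltn_ord j))//=.
rewrite addrCA lerDl addr_ge0// sumr_ge0// => k _; exact: nc_ge0.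
Qed.

(** Discrete Sobolev embedding of H^1 into the bounded functions: average
    [gv_dist] over [j]. *)
Lemma gv_sup v (i : 'I_N) : nc (gv v i) ^+ 2 <= Kalg * dsq v.
Proof.
set S := \sum_(k < N) nc (gv (delta v) k).
have S0 : 0 <= S by apply: sumr_ge0 => k _; exact: nc_ge0.
have H (j : 'I_N) : nc (gv v i) ^+ 2 <= 2 * nc (gv v j) ^+ 2 + 2 * S ^+ 2.
  have : nc (gv v i) <= nc (gv v j) + S.
    rewrite -[gv v i](subrK (gv v j)) addrC (le_trans (ncD _ _))//.
    by rewrite lerD2l gv_dist.
  have := nc_ge0 (gv v i); have := nc_ge0 (gv v j).
  set x := nc _; set y := nc _ => x0 y0 xyS.
  apply: (@le_trans _ _ ((x + S) ^+ 2)).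
    by rewrite ler_sqr ?nnegrE ?addr_ge0.
  rewrite -subr_ge0 (_ : _ - _ = (x - S) ^+ 2) ?sqr_ge0//; ring.
have : \sum_(j < N) nc (gv v i) ^+ 2 <= \sum_(j < N) (2 * nc (gv v j) ^+ 2 + 2 * S ^+ 2).
  by apply: ler_sum => j _.
rewrite big_split/= !sumr_const card_ord -mulr_sumr -[X in X <= _]mulr_natl -[X in _ + X]mulr_natl.
have S2 := sqr_sum_le (fun k => nc (gv (delta v) k)); rewrite -/S in S2.
have N0R : 0 < N%:R :> R by rewrite ltr0n.
have hN : h * N%:R = b - a by rewrite /mesh mulfVK.
have ba : 0 < b - a by rewrite subr_gt0.
rewrite /dsq; set A := \sum_j _; set B := \sum_j _ in S2 * => H2.
have A0 : 0 <= A by apply: sumr_ge0 => k _; exact: sqr_ge0.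
have B0 : 0 <= B by apply: sumr_ge0 => k _; exact: sqr_ge0.
have hB : N%:R * B = (b - a) * (h^-1 * B).
  by rewrite -hN; field; rewrite gt_eqF.
rewrite /Kalg mulrDl.
have H3 : (b - a) * nc (gv v i) ^+ 2 <= 2 * (h * A) + 2 * (b - a) * S ^+ 2.
  rewrite -hN.
  have := ler_wpM2l (ltW h0) H2; rewrite !mulrDr; lra.
have H4 : nc (gv v i) ^+ 2 <= 2 / (b - a) * (h * A) + 2 * S ^+ 2.
  rewrite -(ler_pM2l ba) (le_trans H3)// le_eqVlt; apply/orP; left; apply/eqP.
  by field.
apply: (le_trans H4); rewrite [leRHS]addrC.
have hA0 : 0 <= h * A by rewrite mulr_ge0// ltW.
have hB0 : 0 <= h^-1 * B by rewrite mulr_ge0// invr_ge0 ltW.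
have : 2 / (b - a) * (h * A) <= 2 / (b - a) * (h * A + h^-1 * B).
  by rewrite ler_wpM2l ?divr_ge0 ?(ltW ba)// lerDl.
have : 2 * (b - a) * (h^-1 * B) <= 2 * (b - a) * (h * A + h^-1 * B).
  by rewrite ler_wpM2l ?mulr_ge0 ?(ltW ba)// lerDr.
lra.
Qed.

Lemma gvM v u j : gv (fun j => v j * u j) j = gv v j * gv u j.
Proof. by []. Qed.

(** Discrete product rule, each undifferentiated factor being bounded by
    [gv_sup]. *)
Lemma dsqM v u : dsq (fun j => v j * u j) <= 4 * Kalg * dsq v * dsq u.
Proof.
have D (j : 'I_N) : nc (gv (delta (fun j => v j * u j)) j) ^+ 2 <=
   2 * (Kalg * dsq v) * nc (gv (delta u) j) ^+ 2 +
   2 * (Kalg * dsq u) * nc (gv (delta v) j) ^+ 2.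
  have -> : gv (delta (fun j => v j * u j)) j =
     gv (cyclic_shift v) j * gv (delta u) j + gv (delta v) j * gv u j.
    by rewrite /delta /cyclic_shift /gv; ring.
  have a1 := gv_sup u j.
  have jN : ((j.+1 %% N) < N)%N by rewrite ltn_mod.
  have a2 := gv_sup v (Ordinal jN); rewrite /= in a2.
  have := ncD (gv (cyclic_shift v) j * gv (delta u) j) (gv (delta v) j * gv u j).
  rewrite !ncM gv_shift; set w := nc (_ + _).
  have w0 : 0 <= w := nc_ge0 _.
  have := nc_ge0 (gv v (j.+1 %% N)); have := nc_ge0 (gv (delta v) j).
  have := nc_ge0 (gv u j); have := nc_ge0 (gv (delta u) j).
  move: a1 a2; move: (nc (gv v (j.+1 %% N))) (nc (gv (delta v) j)) (nc (gv u j))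
    (nc (gv (delta u) j)) => p q r s ar ap s0 r0 q0 p0 wl.
  apply: (@le_trans _ _ ((p * s + q * r) ^+ 2)).
    by rewrite ler_sqr ?nnegrE// addr_ge0// mulr_ge0.
  apply: (@le_trans _ _ (2 * p ^+ 2 * s ^+ 2 + 2 * r ^+ 2 * q ^+ 2)).
    rewrite -subr_ge0 (_ : _ - _ = (p * s - q * r) ^+ 2) ?sqr_ge0//; ring.
  by apply: lerD; rewrite ler_wpM2r ?sqr_ge0// ler_wpM2l.
have := gv_sup v; have := dsq_ge0 v; have := dsq_ge0 u; have := Kalg_ge0.
rewrite {1}/dsq => K0 du dv sv.
have s1 : \sum_(j < N) nc (gv (fun j => v j * u j) j) ^+ 2 <=
   Kalg * dsq v * \sum_(j < N) nc (gv u j) ^+ 2.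
  rewrite mulr_sumr; apply: ler_sum => j _.
  by rewrite gvM ncM exprMn ler_wpM2r ?sqr_ge0.
have s2 : \sum_(j < N) nc (gv (delta (fun j => v j * u j)) j) ^+ 2 <=
   2 * (Kalg * dsq v) * \sum_(j < N) nc (gv (delta u) j) ^+ 2 +
   2 * (Kalg * dsq u) * \sum_(j < N) nc (gv (delta v) j) ^+ 2.
  by rewrite !mulr_sumr -big_split/=; apply: ler_sum => j _; exact: D.
have ih0 : 0 <= h^-1 by rewrite invr_ge0 ltW.
have t1 := ler_wpM2l (ltW h0) s1.
have t2 := ler_wpM2l ih0 s2.
apply: (le_trans (lerD t1 t2)).
have q1 : h * \sum_(j < N) nc (gv u j) ^+ 2 +
   h^-1 * \sum_(j < N) nc (gv (delta u) j) ^+ 2 = dsq u by [].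
have q2 : h^-1 * \sum_(j < N) nc (gv (delta v) j) ^+ 2 <= dsq v.
  by rewrite /dsq lerDr mulr_ge0 ?(ltW h0)// sumr_ge0// => j _; exact: sqr_ge0.
have q3 : 0 <= h * \sum_(j < N) nc (gv u j) ^+ 2.
  by rewrite mulr_ge0 ?(ltW h0)// sumr_ge0// => j _; exact: sqr_ge0.
have Kv : 0 <= Kalg * dsq v by rewrite mulr_ge0.
have Ku : 0 <= Kalg * dsq u by rewrite mulr_ge0.
have r1 := ler_wpM2l Ku q2; have r2 := mulr_ge0 Kv q3.
move: q1 r1 r2.
set A := h * _; set B := h^-1 * _; set C := h^-1 * _ => q1 r1 r2.
apply: (@le_trans _ _ (Kalg * dsq v * A +
    (2 * (Kalg * dsq v) * B + 2 * (Kalg * dsq u) * C))).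
  by rewrite le_eqVlt; apply/orP; left; apply/eqP; rewrite /A /B /C; ring.
have e : Kalg * dsq v * A + Kalg * dsq v * B = Kalg * dsq v * dsq u.
  by rewrite -mulrDr q1.
lra.
Qed.

(** The factor by which a product on the grid may increase [nrm]; the constants
    come from the comparison of [nrm] with [dsq] in both directions. *)
Definition Calg : R := 64 * Num.sqrt (4 * Kalg).

Lemma Calg_ge0 : 0 <= Calg.
Proof. by rewrite mulr_ge0// sqrtr_ge0. Qed.

Lemma nrm_dftM v u :
  nrm (dft (fun j => v j * u j)) <= Calg * nrm (dft v) * nrm (dft u).
Proof.
have K0 := Kalg_ge0.
rewrite -ler_sqr ?nnegrE ?mulr_ge0 ?nrm_ge0 ?Calg_ge0// !exprMn.
apply: (le_trans (nrm_le_dsq _)).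
rewrite sqr_sqrtr ?mulr_ge0//.
apply: (@le_trans _ _ (256 * (4 * Kalg * dsq v * dsq u))).
  by rewrite ler_wpM2l// dsqM.
have := dsq_le v; have := dsq_le u; have := dsq_ge0 v; have := dsq_ge0 u.
move: (dsq v) (dsq u) (nrm _ ^+ 2) (nrm _ ^+ 2) => p q r s q0 p0 qr ps.
have : p * q <= (4 * r) * (4 * s) by apply: ler_pM.
move=> /(ler_wpM2l (_ : 0 <= 1024 * Kalg)) => /(_ (mulr_ge0 (ler0n _ _) K0)).
lra.
Qed.

Lemma dsq_conj v : dsq (fun j => conjc (v j)) = dsq v.
Proof.
rewrite /dsq; congr (_ * _ + _ * _); apply: eq_bigr => j _.
  by rewrite /gv ncJ.
by rewrite /gv /delta /cyclic_shift /gv -conjcN -conjcD ncJ.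
Qed.

(** Conjugation does not preserve [nrm], because the frequency [-N/2] has no
    opposite among those of the grid, but it preserves [dsq]. *)
Lemma nrm_dft_conj v : nrm (dft (fun j => conjc (v j))) <= 32 * nrm (dft v).
Proof.
rewrite -ler_sqr ?nnegrE ?mulr_ge0 ?nrm_ge0// exprMn.
apply: (le_trans (nrm_le_dsq _)); rewrite dsq_conj.
have := dsq_le v; lra.
Qed.

End discrete_fourier.

(** * Integrals of real and complex functions *)

Notation leb := lebesgue_measure.

Lemma rder_eq {R : realType} (f : R -> R) (x p q : R) :
  is_derive x 1 f p -> p = q -> is_derive x 1 f q.
Proof. by move=> h <-. Qed.

Section real_layer.
Context {R : realType}.
Implicit Types (a b x y : R) (f g : R -> R).

Definition rint a b f := (@leb R).-integrable `]a, b[ (EFin \o f).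
Definition rcont a b f := {within `[a, b], continuous f}.
Definition RI a b f : R := \int[leb]_(x in `]a, b[) f x.

Lemma mDoo a b : measurable (`]a, b[%classic : set (measurableTypeR R)).
Proof. exact: measurable_itv. Qed.

Lemma eq_rcont a b f g : f =1 g -> rcont a b f -> rcont a b g.
Proof. by move=> /funext ->. Qed.
Lemma rcontD a b f g : rcont a b f -> rcont a b g -> rcont a b (fun x => f x + g x).
Proof. by move=> cf cg x; apply: cvgD; [exact: cf|exact: cg]. Qed.
Lemma rcontM a b f g : rcont a b f -> rcont a b g -> rcont a b (fun x => f x * g x).
Proof. by move=> cf cg x; apply: cvgM; [exact: cf|exact: cg]. Qed.
Lemma rcontN a b f : rcont a b f -> rcont a b (fun x => - f x).
Proof. by move=> cf x; apply: cvgN; exact: cf. Qed.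
Lemma rcontB a b f g : rcont a b f -> rcont a b g -> rcont a b (fun x => f x - g x).
Proof. by move=> cf cg; apply: rcontD => //; exact: rcontN. Qed.
Lemma rcont_cst a b (r : R) : rcont a b (fun=> r).
Proof. by move=> x; exact: cvg_cst. Qed.
Lemma rcontT a b f : continuous f -> rcont a b f.
Proof. exact: continuous_subspaceT. Qed.
Lemma rcont_norm a b f : rcont a b f -> rcont a b (fun x => `|f x|).
Proof. by move=> cf x; apply: cvg_norm; exact: cf. Qed.
Lemma rcontS a b x y f : a <= x -> y <= b -> rcont a b f -> rcont x y f.
Proof.
move=> ax yb; apply: continuous_subspaceW => z /=; rewrite !in_itv/= => /andP[xz zy].
by rewrite (le_trans ax xz) (le_trans zy yb).
Qed.

Lemma is_derive_cont f x d : is_derive x 1 f d -> {for x, continuous f}.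
Proof. by move=> [fd _]; apply/differentiable_continuous/derivable1_diffP. Qed.

Lemma rcont_bnd a b f : rcont a b f -> exists M, 0 <= M /\ forall x, a <= x <= b -> `|f x| <= M.
Proof.
move=> cf; have [ab|ba] := leP a b; last first.
  by exists 0; split => // x /andP[ax xb]; have := le_trans ax xb; rewrite leNgt ba.
have [c _ H] := EVT_max ab (rcont_norm cf).
by exists `|f c|; split => // x xab; apply: H; rewrite in_itv.
Qed.

Lemma rcont_rint_cc a b f : rcont a b f -> (@leb R).-integrable `[a, b] (EFin \o f).
Proof. by move=> cf; apply: continuous_compact_integrable => //; exact: segment_compact. Qed.

Lemma rcont_rint a b f : rcont a b f -> rint a b f.
Proof.
move=> /rcont_rint_cc; apply: integrableS => //.
by move=> x /=; rewrite !in_itv/= => /andP[/ltW -> /ltW ->].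
Qed.

Lemma rcont_meas a b f : rcont a b f -> measurable_fun `]a, b[ f.
Proof. by move=> /rcont_rint/(measurable_int leb)/measurable_EFinP. Qed.

Lemma rintD a b f g : rint a b f -> rint a b g -> rint a b (fun x => f x + g x).
Proof. by move=> hf hg; exact: (integrableD (mDoo a b) hf hg). Qed.

Lemma rintZ a b (r : R) f : rint a b f -> rint a b (fun x => r * f x).
Proof. by move=> hf; exact: (integrableZl (mDoo a b) r hf). Qed.

Lemma rintN a b f : rint a b f -> rint a b (fun x => - f x).
Proof.
move=> /(@rintZ _ _ (-1)); congr (_.-integrable _ _).
by apply/funext => x /=; rewrite mulN1r.
Qed.

Lemma rintB a b f g : rint a b f -> rint a b g -> rint a b (fun x => f x - g x).
Proof. by move=> hf hg; apply: rintD => //; exact: rintN. Qed.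

Lemma rintM a b f g : rint a b f -> rcont a b g -> rint a b (fun x => f x * g x).
Proof.
move=> hf cg; have [M [M0 gM]] := rcont_bnd cg.
apply: (le_integrable (mDoo a b) _ _ (rintZ M hf)).
  apply/measurable_EFinP; apply: measurable_funM; last exact: rcont_meas.
  by apply/measurable_EFinP; exact: (measurable_int _ hf).
move=> x /=; rewrite in_itv/= => /andP[/ltW ax /ltW xb].
by rewrite lee_fin !normrM mulrC ler_wpM2r// (le_trans (gM _ _))// ?ax// ler_norm.
Qed.

Lemma rint_le a b f g : measurable_fun `]a, b[ f ->
  (forall x, a < x < b -> `|f x| <= g x) -> rint a b g -> rint a b f.
Proof.
move=> mf fg hg; apply: (le_integrable (mDoo a b) _ _ hg); first exact/measurable_EFinP.
move=> x /=; rewrite in_itv/= => xab; rewrite lee_fin.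
by rewrite (le_trans (fg _ xab))// ler_norm.
Qed.

Lemma rint_cst a b (r : R) : rint a b (fun=> r).
Proof. exact/rcont_rint/rcont_cst. Qed.

Lemma rint_norm a b f : rint a b f -> rint a b (fun x => `|f x|).
Proof. exact: integrable_norm. Qed.

Lemma rintS a b x y f : a <= x -> y <= b -> rint a b f -> rint x y f.
Proof.
move=> ax yb; apply: integrableS => // z /=; rewrite !in_itv/= => /andP[xz zy].
by rewrite (le_lt_trans ax xz) (lt_le_trans zy yb).
Qed.

Lemma rint_meas a b f : rint a b f -> measurable_fun `]a, b[ f.
Proof. by move=> /(measurable_int leb)/measurable_EFinP. Qed.

Lemma RID a b f g : rint a b f -> rint a b g ->
  RI a b (fun x => f x + g x) = RI a b f + RI a b g.
Proof. by move=> hf hg; exact: RintegralD. Qed.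
Lemma RIB a b f g : rint a b f -> rint a b g ->
  RI a b (fun x => f x - g x) = RI a b f - RI a b g.
Proof. by move=> hf hg; exact: RintegralB. Qed.
Lemma RIZ a b (r : R) f : rint a b f -> RI a b (fun x => r * f x) = r * RI a b f.
Proof. by move=> hf; exact: RintegralZl. Qed.

Lemma eq_RI a b f g : (forall x, a < x < b -> f x = g x) -> RI a b f = RI a b g.
Proof. by move=> h; apply: eq_Rintegral => x; rewrite inE/= in_itv/= => /h. Qed.

Lemma eq_rint a b f g : (forall x, a < x < b -> f x = g x) -> rint a b f -> rint a b g.
Proof.
move=> h; apply: (eq_integrable (mDoo a b)) => x; rewrite inE/= in_itv/= => /h.
by move=> ->.
Qed.

Lemma le_RI a b f g : rint a b f -> rint a b g ->
  (forall x, a < x < b -> f x <= g x) -> RI a b f <= RI a b g.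
Proof.
move=> hf hg h; exact: (le_Rintegral (mDoo a b)).
Qed.

Lemma RI_ge0 a b f : (forall x, a < x < b -> 0 <= f x) -> 0 <= RI a b f.
Proof. by move=> h; apply: Rintegral_ge0 => x; rewrite /= in_itv/= => /h. Qed.

Lemma RI_cst a b (r : R) : a <= b -> RI a b (fun=> r) = r * (b - a).
Proof.
rewrite le_eqVlt => /predU1P[->|ab].
  by rewrite /RI set_itv_ge ?bnd_simp ?ltxx// Rintegral_set0 subrr mulr0.
rewrite /RI Rintegral_cst//; congr (_ * _).
transitivity (fine (b%:E - a%:E)%E) => //; congr fine.
by etransitivity; [exact: (lebesgue_measure_itv `]a, b[%R)|rewrite /= lte_fin ab].
Qed.

Lemma RI_norm a b f : rint a b f -> `|RI a b f| <= RI a b (fun x => `|f x|).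
Proof. by move=> hf; exact: le_normr_Rintegral. Qed.

Lemma RI_bnd a b f (M : R) : a <= b -> rint a b f ->
  (forall x, a < x < b -> `|f x| <= M) -> `|RI a b f| <= M * (b - a).
Proof.
move=> ab hf h; rewrite -RI_cst//; apply: (le_trans (RI_norm hf)).
by apply: le_RI => //; [exact: rint_norm|exact: rint_cst].
Qed.

Lemma RI_subset a b x y f : a <= x -> y <= b -> rint a b f ->
  (forall z, a < z < b -> 0 <= f z) -> RI x y f <= RI a b f.
Proof.
move=> ax yb hf f0.
rewrite /RI /Rintegral fine_le//.
- exact: (integrable_fin_num (mDoo x y) (rintS ax yb hf)).
- exact: (integrable_fin_num (mDoo a b) hf).
apply: ge0_subset_integral => //.
- exact: (measurable_int _ hf).
by move=> z /=; rewrite !in_itv/= => /andP[xz zy];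
  rewrite (le_lt_trans ax xz) (lt_le_trans zy yb).
Qed.

Lemma rftc a b f g : a <= b -> rcont a b f -> rcont a b g ->
  (forall x, a < x < b -> is_derive x 1 f (g x)) -> RI a b g = f b - f a.
Proof.
rewrite le_eqVlt => /predU1P[->|ab] cf cg fg.
  by rewrite /RI set_itv_ge ?bnd_simp ?ltxx// Rintegral_set0 subrr.
have [_ fa fb] := (continuous_within_itvP f ab).1 cf.
have := @continuous_FTC2 R g f a b ab cg.
have dr : derivable_oo_LRcontinuous f a b.
  split => // x; rewrite in_itv/= => /fg h; exact: ex_derive.
move=> /(_ dr) H.
have {}H : (\int[leb]_(x in `[a, b]) (g x)%:E)%E = (f b - f a)%:E.
  rewrite H// => x; rewrite in_itv/= => /fg h; rewrite derive1E; exact: derive_val.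
have rg := rcont_rint cg.
rewrite /RI Rintegral_itv_bndo_bndc// Rintegral_itv_obnd_cbnd.
  by rewrite /Rintegral H.
apply: (integrableS _ _ _ (rcont_rint_cc cg)) => //.
by move=> x /=; rewrite !in_itv/= => /andP[/ltW -> ->].
Qed.

End real_layer.

Section complex_layer.
Context {R : realType}.
Variables (a b : R).
Hypothesis hab : a < b.
Implicit Types (f g u w : R -> R[i]).

Let ab : a <= b := ltW hab.

Definition Int f := rint a b (fun x => complex.Re (f x)) /\ rint a b (fun x => complex.Im (f x)).
Definition ccont f := ccontinuous_on `[a, b] f.
Definition J f : R[i] := cint `]a, b[ f.

Lemma JE f : J f = RI a b (fun x => complex.Re (f x)) +i* RI a b (fun x => complex.Im (f x)).
Proof. by []. Qed.

Lemma ccontD f g : ccont f -> ccont g -> ccont (fun x => f x + g x).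
Proof.
move=> [f1 f2] [g1 g2]; split.
  by apply: eq_rcont => [y|]; [rewrite cReD; reflexivity|exact: rcontD].
by apply: eq_rcont => [y|]; [rewrite cImD; reflexivity|exact: rcontD].
Qed.
Lemma ccontN f : ccont f -> ccont (fun x => - f x).
Proof.
move=> [f1 f2]; split.
  by apply: eq_rcont => [y|]; [rewrite cReN; reflexivity|exact: rcontN].
by apply: eq_rcont => [y|]; [rewrite cImN; reflexivity|exact: rcontN].
Qed.
Lemma ccontM f g : ccont f -> ccont g -> ccont (fun x => f x * g x).
Proof.
move=> [f1 f2] [g1 g2]; split.
  by apply: eq_rcont => [y|]; [rewrite cReM; reflexivity|apply: rcontB; exact: rcontM].
by apply: eq_rcont => [y|]; [rewrite cImM; reflexivity|apply: rcontD; exact: rcontM].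
Qed.
Lemma ccontJ f : ccont f -> ccont (fun x => conjc (f x)).
Proof.
move=> [f1 f2]; split.
  by apply: eq_rcont => [y|]; [rewrite cReJ; reflexivity|].
by apply: eq_rcont => [y|]; [rewrite cImJ; reflexivity|exact: rcontN].
Qed.
Lemma ccont_cst z : ccont (fun=> z).
Proof. by split; exact: rcont_cst. Qed.

Lemma ccont_nc2 f : ccont f -> rcont a b (fun x => nc (f x) ^+ 2).
Proof.
move=> [f1 f2]; apply: eq_rcont => [y|]; first by rewrite nc_sqr !expr2; reflexivity.
by apply: rcontD; apply: rcontM.
Qed.

Lemma ccont_Int f : ccont f -> Int f.
Proof. by move=> [f1 f2]; split; exact: rcont_rint. Qed.

Lemma IntD f g : Int f -> Int g -> Int (fun x => f x + g x).
Proof.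
move=> [f1 f2] [g1 g2]; split.
  by apply: eq_rint => [y _|]; [rewrite cReD; reflexivity|exact: rintD].
by apply: eq_rint => [y _|]; [rewrite cImD; reflexivity|exact: rintD].
Qed.
Lemma IntN f : Int f -> Int (fun x => - f x).
Proof.
move=> [f1 f2]; split.
  by apply: eq_rint => [y _|]; [rewrite cReN; reflexivity|exact: rintN].
by apply: eq_rint => [y _|]; [rewrite cImN; reflexivity|exact: rintN].
Qed.
Lemma IntM f g : Int f -> ccont g -> Int (fun x => f x * g x).
Proof.
move=> [f1 f2] [g1 g2]; split.
  by apply: eq_rint => [y _|]; [rewrite cReM; reflexivity|apply: rintB; exact: rintM].
by apply: eq_rint => [y _|]; [rewrite cImM; reflexivity|apply: rintD; exact: rintM].
Qed.
Lemma IntZ z f : Int f -> Int (fun x => z * f x).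
Proof. by move=> hf; under eq_fun do rewrite mulrC; exact/IntM/ccont_cst. Qed.

Lemma JD f g : Int f -> Int g -> J (fun x => f x + g x) = J f + J g.
Proof.
move=> [f1 f2] [g1 g2]; apply: complex_eq; rewrite ?cReD ?cImD /=; rewrite -RID//;
  by apply: eq_RI => x _; rewrite ?cReD ?cImD.
Qed.
Lemma JZ z f : Int f -> J (fun x => z * f x) = z * J f.
Proof.
move=> [f1 f2]; apply: complex_eq; rewrite ?cReM ?cImM /= -!RIZ//.
  by rewrite -RIB; [apply: eq_RI => x _; rewrite cReM|exact: rintZ..].
by rewrite -RID; [apply: eq_RI => x _; rewrite cImM|exact: rintZ..].
Qed.
Lemma JN f : Int f -> J (fun x => - f x) = - J f.
Proof. by move=> hf; rewrite -mulN1r -JZ//; congr J; apply/funext => x; rewrite mulN1r. Qed.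
Lemma JB f g : Int f -> Int g -> J (fun x => f x - g x) = J f - J g.
Proof. by move=> hf hg; rewrite JD ?JN//; exact: IntN. Qed.
Lemma eq_J f g : (forall x, a < x < b -> f x = g x) -> J f = J g.
Proof. by move=> h; apply: complex_eq; apply: eq_RI => x /h ->. Qed.
Lemma J_cst z : J (fun=> z) = (b - a)%:C * z.
Proof.
by apply: complex_eq; rewrite ?cReMr ?cImMr -[LHS]/(RI a b (fun=> _)) RI_cst// mulrC.
Qed.

Lemma Int_sum (I : Type) (r : seq I) (P : pred I) (F : I -> R -> R[i]) :
  (forall i, Int (F i)) -> Int (fun x => \sum_(i <- r | P i) F i x).
Proof.
move=> h; elim: r => [|i r IH].
  by under eq_fun do rewrite big_nil; exact/ccont_Int/ccont_cst.
under eq_fun do rewrite big_cons; case: (P i) => //; exact: IntD.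
Qed.

Lemma J_sum (I : Type) (r : seq I) (P : pred I) (F : I -> R -> R[i]) :
  (forall i, Int (F i)) ->
  J (fun x => \sum_(i <- r | P i) F i x) = \sum_(i <- r | P i) J (F i).
Proof.
move=> h; elim: r => [|i r IH].
  by under eq_fun do rewrite big_nil; rewrite J_cst mulr0 big_nil.
under eq_fun do rewrite big_cons; rewrite big_cons; case: (P i) => //.
by rewrite JD ?IH//; exact: Int_sum.
Qed.

Lemma nc_J f (M : R) : Int f -> (forall x, a < x < b -> nc (f x) <= M) ->
  nc (J f) <= 2 * M * (b - a).
Proof.
move=> [f1 f2] h; rewrite (le_trans (nc_le_ReIm _))//= -mulrA mulr_natl mulr2n.
by rewrite lerD// RI_bnd// => x /h; apply: le_trans; rewrite ?Re_le_nc ?Im_le_nc.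
Qed.

(** * Periodic C^1 functions, Fourier coefficients and H^1 *)

(** Functions of class C^1 on [[a, b]], with derivative [g], that take the same
    value at both ends: one integration by parts then has no boundary term. *)
Record C1p u g : Prop := MkC1p {
  C1p_c0 : ccont u;
  C1p_c1 : ccont g;
  C1p_d : forall x, a < x < b -> cdif u x (g x);
  C1p_per : u a = u b }.

Lemma cdifD u w x p q : cdif u x p -> cdif w x q -> cdif (fun y => u y + w y) x (p + q).
Proof.
move=> [u1 u2] [w1 w2]; split.
  by rewrite cReD; under eq_fun do rewrite cReD; exact: rderD.
by rewrite cImD; under eq_fun do rewrite cImD; exact: rderD.
Qed.
Lemma cdifN u x p : cdif u x p -> cdif (fun y => - u y) x (- p).
Proof.
move=> [u1 u2]; split.
  by rewrite cReN; under eq_fun do rewrite cReN; exact: rderN.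
by rewrite cImN; under eq_fun do rewrite cImN; exact: rderN.
Qed.
Lemma cdifB u w x p q : cdif u x p -> cdif w x q -> cdif (fun y => u y - w y) x (p - q).
Proof. by move=> hu hw; apply: cdifD => //; exact: cdifN. Qed.
Lemma cdifJ u x p : cdif u x p -> cdif (fun y => conjc (u y)) x (conjc p).
Proof.
move=> [u1 u2]; split.
  by rewrite cReJ; under eq_fun do rewrite cReJ.
by rewrite cImJ; under eq_fun do rewrite cImJ; exact: rderN.
Qed.
Lemma cdifM u w x p q : cdif u x p -> cdif w x q ->
  cdif (fun y => u y * w y) x (p * w x + u x * q).
Proof.
move=> [u1 u2] [w1 w2]; split.
  under eq_fun do rewrite cReM.
  by apply: (rder_eq (rderB (rderM u1 w1) (rderM u2 w2))); rewrite cReD !cReM; ring.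
under eq_fun do rewrite cImM.
by apply: (rder_eq (rderD (rderM u1 w2) (rderM u2 w1))); rewrite cImD !cImM; ring.
Qed.
Lemma cdif_cst (z : R[i]) (x : R) : cdif (fun=> z) x 0.
Proof. by split; exact: rder_cst. Qed.
Lemma cdifZ z u x p : cdif u x p -> cdif (fun y => z * u y) x (z * p).
Proof.
by move=> hu; have := cdifM (cdif_cst z x) hu; rewrite mul0r add0r.
Qed.
Lemma cdif_cont u x p : cdif u x p ->
  {for x, continuous (fun y => complex.Re (u y))} /\ {for x, continuous (fun y => complex.Im (u y))}.
Proof. by move=> [h1 h2]; split; apply: is_derive_cont; eassumption. Qed.

Lemma cdif_ccont u g : (forall x, cdif u x (g x)) -> ccont u.
Proof.
by move=> h; split; apply: rcontT => x; have [] := cdif_cont (h x).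
Qed.

Lemma cdif_expi (r s x : R) :
  cdif (fun y => expi (r * (y - s))) x ('i%C * r%:C * expi (r * (x - s))).
Proof.
have d1 : is_derive x 1 (fun y => r * (y - s)) r.
  have := rderZ r (rderB (rder_id x) (rder_cst x s)).
  by rewrite subr0 mulr1.
split.
  have := rder_comp d1 (is_derive_cos (r * (x - s))).
  by move=> h; apply: (rder_eq h); rewrite !cReM !cImM/=; ring.
have := rder_comp d1 (is_derive_sin (r * (x - s))).
by move=> h; apply: (rder_eq h); rewrite !cImM !cReM/=; ring.
Qed.

Local Notation mu := (mu a b).
Local Notation em := (em a b).
Implicit Types (l m : int).

Lemma cdif_em m x : cdif (em m) x ('i%C * (mu m)%:C * em m x).
Proof. exact: cdif_expi. Qed.

Lemma C1p_em m : C1p (em m) (fun x => 'i%C * (mu m)%:C * em m x).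
Proof.
split.
- exact: (cdif_ccont (cdif_em m)).
- by apply: ccontM; [exact: ccont_cst|exact: (cdif_ccont (cdif_em m))].
- by move=> x _; exact: cdif_em.
- by rewrite em_a em_b.
Qed.

Lemma C1pD u g w k : C1p u g -> C1p w k -> C1p (fun x => u x + w x) (fun x => g x + k x).
Proof.
move=> [u0 u1 u2 u3] [w0 w1 w2 w3]; split.
- exact: ccontD.
- exact: ccontD.
- by move=> x xab; apply: cdifD; [exact: u2|exact: w2].
- by rewrite u3 w3.
Qed.
Lemma C1pN u g : C1p u g -> C1p (fun x => - u x) (fun x => - g x).
Proof.
move=> [u0 u1 u2 u3]; split; [exact: ccontN..| |by rewrite u3].
by move=> x xab; apply: cdifN; exact: u2.
Qed.
Lemma C1pB u g w k : C1p u g -> C1p w k -> C1p (fun x => u x - w x) (fun x => g x - k x).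
Proof. by move=> hu hw; apply: C1pD => //; exact: C1pN. Qed.
Lemma C1pM u g w k : C1p u g -> C1p w k ->
  C1p (fun x => u x * w x) (fun x => g x * w x + u x * k x).
Proof.
move=> [u0 u1 u2 u3] [w0 w1 w2 w3]; split.
- exact: ccontM.
- by apply: ccontD; apply: ccontM.
- by move=> x xab; apply: cdifM; [exact: u2|exact: w2].
- by rewrite u3 w3.
Qed.
Lemma C1pJ u g : C1p u g -> C1p (fun x => conjc (u x)) (fun x => conjc (g x)).
Proof.
move=> [u0 u1 u2 u3]; split; [exact: ccontJ..| |by rewrite u3].
by move=> x xab; apply: cdifJ; exact: u2.
Qed.
Lemma C1p_cst z : C1p (fun=> z) (fun=> 0).
Proof. by split => //; [exact: ccont_cst..|move=> x _; exact: cdif_cst]. Qed.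
Lemma C1pZ z u g : C1p u g -> C1p (fun x => z * u x) (fun x => z * g x).
Proof.
move=> hu; have := C1pM (C1p_cst z) hu; congr C1p.
by apply/funext => x; rewrite mul0r add0r.
Qed.

Lemma C1p_J u g : C1p u g -> J g = 0.
Proof.
move=> [[u1 u2] [g1 g2] ud per]; apply: complex_eq => /=.
  have := rftc ab u1 g1 (fun x xab => (ud x xab).1).
  by rewrite per subrr.
have := rftc ab u2 g2 (fun x xab => (ud x xab).2).
by rewrite per subrr.
Qed.

Definition fc u l : R[i] := ((b - a)^-1)%:C * J (fun x => u x * em (- l) x).

Lemma fcE u l : fc u l = ((b - a)^-1)%:C * J (fun x => u x * em (- l) x).
Proof. by []. Qed.

Let ba0 : 0 < b - a. Proof. by rewrite subr_gt0. Qed.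

Lemma ccont_em m : ccont (em m).
Proof. exact: C1p_c0 (C1p_em m). Qed.

Lemma fcD u w l : Int u -> Int w -> fc (fun x => u x + w x) l = fc u l + fc w l.
Proof.
move=> hu hw; rewrite /fc -mulrDr -JD; [|exact/IntM/ccont_em..].
by congr (_ * J _); apply/funext => x; rewrite mulrDl.
Qed.
Lemma fcZ (z : R[i]) u l : Int u -> fc (fun x => z * u x) l = z * fc u l.
Proof.
move=> hu; rewrite /fc [RHS]mulrCA; congr (_ * _).
rewrite -JZ; last exact/IntM/ccont_em.
by congr (J _); apply/funext => x; rewrite mulrA.
Qed.
Lemma fcN u l : Int u -> fc (fun x => - u x) l = - fc u l.
Proof.
move=> hu; rewrite /fc -mulrN -JN; last exact/IntM/ccont_em.
by congr (_ * J _); apply/funext => x; rewrite mulNr.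
Qed.
Lemma fcB u w l : Int u -> Int w -> fc (fun x => u x - w x) l = fc u l - fc w l.
Proof. by move=> hu hw; rewrite fcD ?fcN//; exact: IntN. Qed.
Lemma eq_fc u w l : (forall x, a < x < b -> u x = w x) -> fc u l = fc w l.
Proof. by move=> h; congr (_ * _); apply: eq_J => x /h ->. Qed.

Lemma fc_em m l : fc (em m) l = (m == l)%:R.
Proof.
rewrite /fc; under [X in J X]eq_fun do rewrite -emD.
have [->|ml] := eqVneq m l.
  under [X in J X]eq_fun do rewrite subrr em0.
  by rewrite J_cst mulr1 -rmorphM/= mulVf// gt_eqF.
have mu_neq0 : mu (m - l) != 0.
  rewrite /Defs.mu mulf_neq0 ?invr_eq0 ?(gt_eqF ba0)//.
  rewrite mulf_neq0 ?intr_eq0 ?subr_eq0// mulf_neq0 ?(gt_eqF (pi_gt0 R))//.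
have /C1p_J := C1p_em (m - l).
rewrite JZ; last exact/ccont_Int/ccont_em.
move/eqP; rewrite !mulf_eq0 => /orP[/orP[|]|/eqP->]; last by rewrite mulr0.
  by rewrite eq_complex/= oner_eq0 andbF.
by rewrite eq_complex/= (negbTE mu_neq0).
Qed.

(** Periodicity of [u] and of the exponential removes the boundary term of the
    integration by parts. *)
Lemma fc_deriv u g l : C1p u g -> fc g l = 'i%C * (mu l)%:C * fc u l.
Proof.
move=> hu; have := C1p_J (C1pM hu (C1p_em (- l))).
have i1 : Int (fun x => g x * em (- l) x).
  exact: IntM (ccont_Int (C1p_c1 hu)) (ccont_em _).
have i2 : Int (fun x => u x * em (- l) x).
  exact: IntM (ccont_Int (C1p_c0 hu)) (ccont_em _).
under [X in J X]eq_fun do rewrite mulrCA.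
rewrite JD//; last exact: IntZ.
rewrite JZ// muN => /eqP; rewrite addr_eq0 => /eqP h.
rewrite /fc h rmorphN/=; ring.
Qed.

Section trigonometric_polynomials.
Variable N : nat.
Implicit Types c : int -> R[i].
Local Notation trig := (@trig_poly R a b N).
Local Notation nrm := (@nrm R a b N).
Local Notation freq := (freq N).

Lemma trigE c x : trig c x = \sum_(k < N) c (freq k) * em (freq k) x.
Proof. by []. Qed.

Lemma C1p_sum (I : Type) (r : seq I) (F G : I -> R -> R[i]) :
  (forall i, C1p (F i) (G i)) ->
  C1p (fun x => \sum_(i <- r) F i x) (fun x => \sum_(i <- r) G i x).
Proof.
move=> h; elim: r => [|i r IH].
  have := C1p_cst 0; congr C1p; by apply/funext => x; rewrite big_nil.
have := C1pD (h i) IH; congr C1p; by apply/funext => x; rewrite big_cons.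
Qed.

Definition dcoef c l : R[i] := 'i%C * (mu l)%:C * c l.

Lemma C1p_trig c : C1p (trig c) (trig (dcoef c)).
Proof.
have := C1p_sum (index_enum 'I_N) (fun k => C1pZ (c (freq k)) (C1p_em (freq k))).
congr C1p; apply/funext => x; rewrite trigE; apply: eq_bigr => k _.
by rewrite /dcoef; ring.
Qed.

Lemma ccont_trig c : ccont (trig c).
Proof. exact: C1p_c0 (C1p_trig c). Qed.

Lemma Int_em_mul u (z : R[i]) m : Int u -> Int (fun x => z * (u x * em m x)).
Proof. by move=> hu; apply/IntZ/IntM/ccont_em. Qed.

Lemma J_pair u c : Int u ->
  J (fun x => u x * conjc (trig c x)) =
  (b - a)%:C * \sum_(k < N) conjc (c (freq k)) * fc u (freq k).
Proof.
move=> hu.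
have -> : (fun x => u x * conjc (trig c x)) =
    (fun x => \sum_(k < N) conjc (c (freq k)) * (u x * em (- freq k) x)).
  apply/funext => x; rewrite trigE rmorph_sum mulr_sumr; apply: eq_bigr => k _.
  by rewrite /= conjcM -emN mulrCA.
rewrite J_sum; last by move=> k; exact: Int_em_mul.
rewrite mulr_sumr; apply: eq_bigr => k _.
rewrite JZ; last exact/IntM/ccont_em.
rewrite /fc [RHS]mulrCA; congr (_ * _); rewrite mulrA -rmorphM/= mulfV ?mul1r//.
by rewrite gt_eqF.
Qed.

Lemma fc_trig c (k : 'I_N) : fc (trig c) (freq k) = c (freq k).
Proof.
rewrite /fc; under [X in J X]eq_fun do rewrite trigE mulr_suml.
rewrite J_sum; last by move=> i; apply/ccont_Int/ccontM/ccont_em/ccontM/ccont_em/ccont_cst.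
rewrite mulr_sumr (bigD1 k)//= big1 ?addr0.
  under [X in J X]eq_fun do rewrite -mulrA.
  rewrite JZ; last by apply/ccont_Int/ccontM/ccont_em/ccont_em.
  rewrite mulrCA -/(fc (em (freq k)) (freq k)) fc_em eqxx mulr1//.
move=> i ik; under [X in J X]eq_fun do rewrite -mulrA.
rewrite JZ; last by apply/ccont_Int/ccontM/ccont_em/ccont_em.
rewrite mulrCA -/(fc (em (freq i)) (freq k)) fc_em.
by rewrite -subr_eq0 freq_inj (negbTE ik) mulr0.
Qed.

Lemma J_nc2 u : J (fun x => u x * conjc (u x)) = (RI a b (fun x => nc (u x) ^+ 2))%:C.
Proof.
apply: complex_eq; rewrite /=.
  by apply: eq_RI => x _; rewrite mulcJ.
rewrite -[LHS]/(RI a b (fun x => complex.Im (u x * conjc (u x)))).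
rewrite (eq_RI (g := fun=> 0)) ?RI_cst ?mul0r// => x _.
by rewrite mulcJ.
Qed.

Lemma parseval_trig c :
  RI a b (fun x => nc (trig c x) ^+ 2) = (b - a) * \sum_(k < N) nc (c (freq k)) ^+ 2.
Proof.
apply: complexI; rewrite -[LHS]J_nc2 J_pair; last exact/ccont_Int/ccont_trig.
rewrite -[RHS]/(real_complex_def _ _) rmorphM rmorph_sum/=; congr (_ * _).
by apply: eq_bigr => k _; rewrite fc_trig mulrC mulcJ.
Qed.

(** Avoids the expansion of a square norm: Re (u conj P) <= (|u|^2 + |P|^2) / 2
    is integrated for the partial Fourier sum [P] of [u]. *)
Lemma bessel u : Int u -> rint a b (fun x => nc (u x) ^+ 2) ->
  (b - a) * \sum_(k < N) nc (fc u (freq k)) ^+ 2 <= RI a b (fun x => nc (u x) ^+ 2).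
Proof.
move=> hu hu2; set S := _ * _.
have E : J (fun x => u x * conjc (trig (fc u) x)) = S%:C.
  rewrite J_pair// /S rmorphM rmorph_sum/=; congr (_ * _).
  by apply: eq_bigr => k _; rewrite mulrC mulcJ.
have hP2 := rcont_rint (ccont_nc2 (ccont_trig (fc u))).
have [h1 _] := IntM hu (ccontJ (ccont_trig (fc u))).
have : S <= RI a b (fun x => 2^-1 * (nc (u x) ^+ 2 + nc (trig (fc u) x) ^+ 2)).
  have -> : S = complex.Re (J (fun x => u x * conjc (trig (fc u) x))) by rewrite E.
  apply: le_RI => //; first by apply/rintZ/rintD.
  move=> x _; apply: (le_trans (ler_norm _)).
  apply: (le_trans (Re_le_nc _)); rewrite ncM ncJ.
  set p := nc _; set q := nc _; rewrite -subr_ge0.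
  rewrite (_ : _ - _ = 2^-1 * (p - q) ^+ 2); last by field.
  by rewrite mulr_ge0// sqr_ge0.
rewrite RIZ; last exact: rintD.
rewrite RID// parseval_trig -/S; lra.
Qed.

End trigonometric_polynomials.

(** The squared H^1 norm when [g] is the derivative of [u]. *)
Definition H1sq u g : R := RI a b (fun x => nc (u x) ^+ 2 + nc (g x) ^+ 2).

Section H1_norm.
Implicit Types (k : R -> R[i]).

Lemma H1sq_int u g : ccont u -> ccont g ->
  rint a b (fun x => nc (u x) ^+ 2 + nc (g x) ^+ 2).
Proof. by move=> hu hg; apply/rcont_rint/rcontD; exact: ccont_nc2. Qed.

Lemma H1sq_ge0 u g : 0 <= H1sq u g.
Proof. by apply: RI_ge0 => x _; rewrite addr_ge0// sqr_ge0. Qed.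

Lemma H1sqE u g : C1p u g -> H1sq u g =
  RI a b (fun x => nc (u x) ^+ 2) + RI a b (fun x => nc (g x) ^+ 2).
Proof.
by move=> [u0 g0 _ _]; rewrite /H1sq RID//; apply/rcont_rint/ccont_nc2.
Qed.

Lemma bessel_H1 N u g : C1p u g -> nrm a b N (fc u) ^+ 2 <= H1sq u g.
Proof.
move=> hu; have [u0 g0 _ _] := hu.
have B1 := bessel N (ccont_Int u0) (rcont_rint (ccont_nc2 u0)).
have B2 := bessel N (ccont_Int g0) (rcont_rint (ccont_nc2 g0)).
rewrite H1sqE// (le_trans _ (lerD B1 B2))// nrm_sqr// !mulr_sumr -big_split/=.
apply: ler_sum => i _; rewrite /wgt -mulrA -mulrDr ler_wpM2l ?(ltW ba0)//.
have -> : nc (fc g (freq N i)) = `|mu (freq N i)| * nc (fc u (freq N i)).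
  by rewrite (fc_deriv _ hu) (ncM _ (fc u _)) (ncM 'i%C) nci ncR mul1r.
move: (mu _) (nc _) => m z.
by rewrite exprMn real_normK ?num_real// mulrDl mul1r.
Qed.

Lemma H1sq_trig N (c : int -> R[i]) :
  H1sq (trig_poly a b N c) (trig_poly a b N (dcoef c)) = nrm a b N c ^+ 2.
Proof.
rewrite H1sqE; last exact: C1p_trig.
rewrite !parseval_trig nrm_sqr// !mulr_sumr -big_split/=; apply: eq_bigr => k _.
rewrite /dcoef !ncM nci ncR mul1r exprMn real_normK ?num_real// /wgt; ring.
Qed.

Lemma nc2D (z w : R[i]) : nc (z + w) ^+ 2 <= 2 * nc z ^+ 2 + 2 * nc w ^+ 2.
Proof.
apply: (@le_trans _ _ ((nc z + nc w) ^+ 2)).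
  by rewrite ler_sqr ?nnegrE ?addr_ge0 ?nc_ge0// ncD.
rewrite -subr_ge0 (_ : _ - _ = (nc z - nc w) ^+ 2) ?sqr_ge0//; ring.
Qed.

Lemma H1sqD u g w k : C1p u g -> C1p w k ->
  H1sq (fun x => u x + w x) (fun x => g x + k x) <= 2 * H1sq u g + 2 * H1sq w k.
Proof.
move=> [u0 g0 _ _] [w0 k0 _ _].
rewrite -!RIZ -?RID; do ?[exact: H1sq_int|exact/rintZ/H1sq_int].
apply: le_RI.
- by apply: H1sq_int; exact: ccontD.
- by apply: rintD; exact/rintZ/H1sq_int.
move=> x _; have := nc2D (u x) (w x); have := nc2D (g x) (k x); lra.
Qed.

Lemma H1sqN u g : H1sq (fun x => - u x) (fun x => - g x) = H1sq u g.
Proof. by apply: eq_RI => x _; rewrite !ncN. Qed.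

Lemma H1sqB u g w k : C1p u g -> C1p w k ->
  H1sq (fun x => u x - w x) (fun x => g x - k x) <= 2 * H1sq u g + 2 * H1sq w k.
Proof. by move=> hu hw; rewrite -(H1sqN w); apply: H1sqD => //; exact: C1pN. Qed.

Lemma H1sqZ z u g : C1p u g ->
  H1sq (fun x => z * u x) (fun x => z * g x) = nc z ^+ 2 * H1sq u g.
Proof.
move=> [u0 g0 _ _]; rewrite -RIZ; last exact: H1sq_int.
by apply: eq_RI => x _; rewrite !ncM !exprMn mulrDr.
Qed.

Lemma H1sqJ u g : H1sq (fun x => conjc (u x)) (fun x => conjc (g x)) = H1sq u g.
Proof. by apply: eq_RI => x _; rewrite !ncJ. Qed.

Definition Ksob : R := (b - a)^-1 + 1.

Lemma Ksob_ge0 : 0 <= Ksob.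
Proof. by rewrite addr_ge0// invr_ge0 ltW. Qed.

(** Sobolev embedding: the derivative of |u|^2 is bounded by |u|^2 + |u'|^2. *)
Lemma sobolev u g x : C1p u g -> a <= x <= b -> nc (u x) ^+ 2 <= Ksob * H1sq u g.
Proof.
move=> hu /andP[ax xb]; have [u0 g0 ud _] := hu.
have [[ur ui] [gr gi]] := (u0, g0).
pose f y := nc (u y) ^+ 2.
pose df y := 2 * complex.Re (conjc (u y) * g y).
have cf : rcont a b f := ccont_nc2 u0.
have cdf : rcont a b df.
  by apply: rcontM; [exact: rcont_cst|exact: (ccontM (ccontJ u0) g0).1].
have fd y : a < y < b -> is_derive y 1 f (df y).
  move=> yab; have [h1 h2] := ud y yab.
  have := rderD (rderM h1 h1) (rderM h2 h2).
  rewrite (_ : (fun y => _ + _) = f); last first.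
    by apply/funext => z; rewrite /f nc_sqr !expr2.
  by move=> h; apply: (rder_eq h); rewrite /df cReM cReJ cImJ; ring.
have dfb y : `|df y| <= nc (u y) ^+ 2 + nc (g y) ^+ 2.
  rewrite /df normrM ger0_norm//.
  apply: (@le_trans _ _ (2 * (nc (u y) * nc (g y)))).
    by rewrite ler_wpM2l// (le_trans (Re_le_nc _))// ncM ncJ.
  rewrite -subr_ge0 (_ : _ - _ = (nc (u y) - nc (g y)) ^+ 2) ?sqr_ge0//; ring.
have hH : rint a b (fun x => nc (u x) ^+ 2 + nc (g x) ^+ 2) by exact: H1sq_int.
have key y z : a <= y -> y <= z -> z <= b -> `|f z - f y| <= H1sq u g.
  move=> ay yz zb.
  have <- : RI y z df = f z - f y.
    apply: rftc => //; [exact: rcontS cf|exact: rcontS cdf|].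
    move=> t /andP[yt tz]; apply: fd; rewrite (le_lt_trans ay yt)/=.
    exact: lt_le_trans tz zb.
  apply: (le_trans (RI_norm (rcont_rint (rcontS ay zb cdf)))).
  apply: (@le_trans _ _ (RI y z (fun x => nc (u x) ^+ 2 + nc (g x) ^+ 2))).
    apply: le_RI => //; last by apply: rintS hH.
    exact/rint_norm/rcont_rint/(rcontS ay zb).
  by apply: RI_subset => // t _; rewrite addr_ge0// sqr_ge0.
have key2 y : a < y < b -> f x <= f y + H1sq u g.
  move=> /andP[/ltW ay /ltW yb]; rewrite -lerBlDl; apply: (le_trans (ler_norm _)).
  have [xy|/ltW yx] := leP x y; last exact: key.
  by rewrite distrC key.
have : RI a b (fun=> f x) <= RI a b (fun y => f y + H1sq u g).
  apply: le_RI => //; first exact: rint_cst.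
  by apply: rintD; [exact: rcont_rint|exact: rint_cst].
rewrite RID; [|exact: rcont_rint|exact: rint_cst]; rewrite !RI_cst// => H.
have H2 : RI a b f <= H1sq u g.
  apply: le_RI => //; first exact: rcont_rint.
  by move=> y _; rewrite lerDl sqr_ge0.
rewrite -[X in X <= _](mulfK (_ : b - a != 0)) ?gt_eqF// ler_pdivrMr//.
rewrite (le_trans H)// (_ : Ksob * _ * _ = H1sq u g + H1sq u g * (b - a)).
  by rewrite lerD2r.
by rewrite /Ksob; field; rewrite gt_eqF.
Qed.

(** H^1 is an algebra: in the product rule, the factor that is not
    differentiated is bounded by the Sobolev embedding. *)
Lemma H1sqM u g w k : C1p u g -> C1p w k ->
  H1sq (fun x => u x * w x) (fun x => g x * w x + u x * k x) <=
  4 * Ksob * H1sq u g * H1sq w k.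
Proof.
move=> hu hw; have [u0 g0 _ _] := hu; have [w0 k0 _ _] := hw.
have U0 := H1sq_ge0 u g; have W0 := H1sq_ge0 w k; have K0 := Ksob_ge0.
set U := H1sq u g in U0 *; set W := H1sq w k in W0 *.
have hU := H1sq_int u0 g0; have hW := H1sq_int w0 k0.
have E : RI a b (fun x => (2 * (Ksob * W)) * (nc (u x) ^+ 2 + nc (g x) ^+ 2) +
   (2 * (Ksob * U)) * (nc (w x) ^+ 2 + nc (k x) ^+ 2)) =
   2 * (Ksob * W) * U + 2 * (Ksob * U) * W.
  by rewrite RID; [rewrite !RIZ|exact: rintZ..].
apply: (@le_trans _ _ (2 * (Ksob * W) * U + 2 * (Ksob * U) * W)); last by lra.
rewrite -E; apply: le_RI.
- by apply: H1sq_int; [exact: ccontM|apply: ccontD; exact: ccontM].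
- by apply: rintD; exact: rintZ.
- move=> x /andP[/ltW ax /ltW xb].
  have xab : a <= x <= b by rewrite ax.
  have su := sobolev hu xab; have sw := sobolev hw xab; rewrite -/U -/W in su sw.
  have := nc2D (g x * w x) (u x * k x); rewrite !ncM !exprMn.
  have := sqr_ge0 (nc (u x)); have := sqr_ge0 (nc (w x)).
  have := sqr_ge0 (nc (g x)); have := sqr_ge0 (nc (k x)).
  move: su sw; move: (nc (u x) ^+ 2) (nc (w x) ^+ 2) (nc (g x) ^+ 2) (nc (k x) ^+ 2).
  move=> p q r s pU qW s0 r0 q0 p0 h.
  have e1 := ler_wpM2l p0 qW; have e2 := ler_wpM2l r0 qW; have e3 := ler_wpM2l s0 pU.
  have e4 : 0 <= Ksob * W * p by rewrite !mulr_ge0.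
  have e5 : 0 <= Ksob * U * q by rewrite !mulr_ge0.
  lra.
Qed.

End H1_norm.

End complex_layer.

(** * Cutoff functions and the fundamental theorem for weak derivatives *)

Section cutoffs.
Context {R : realType}.
Implicit Types (s t : R).

(** A quadratic remainder identifies the derivative; this handles the points
    where a function defined by pieces is glued. *)
Lemma is_derive_quadratic (f : R -> R) t d C :
  (forall s, `|f s - f t - d * (s - t)| <= C * (s - t) ^+ 2) -> is_derive t 1 f d.
Proof.
move=> H.
have C0 : 0 <= C.
  have := H (t + 1); have -> : t + 1 - t = 1 by lra.
  by rewrite expr1n !mulr1; exact: le_trans.
have cv : (fun h : R => h^-1 *: ((f \o shift t) (h *: (1 : R)) - f t)) @ 0^' --> d.
  apply/cvgrPdist_le => e e0; near=> h.
  have h0 : h != 0 by near: h; exact: nbhs_dnbhs_neq.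
  have hn : 0 < `|h| by rewrite normr_gt0.
  rewrite /= /GRing.scale/= mulr1.
  have -> : d - h^-1 * (f (h + t) - f t) = - (h^-1 * (f (h + t) - f t - d * (h + t - t))).
    by field.
  rewrite normrN normrM normfV ler_pdivrMl//.
  apply: (le_trans (H _)); rewrite addrK -real_normK ?num_real// expr2 mulrA mulrC.
  rewrite ler_wpM2l//.
  rewrite -(@ler_pM2r _ (C + 1)^-1) ?invr_gt0 ?ltr_wpDl// .
  apply: (@le_trans _ _ `|h|).
    by rewrite mulrAC ler_piMl// ler_pdivrMr ?ltr_wpDl// mul1r lerDl.
  near: h; apply: dnbhs0_le; rewrite divr_gt0// ltr_wpDl//.
split; first by apply/cvg_ex; exists d.
exact/cvg_lim.
Unshelve. all: by end_near. Qed.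

Definition ppos t : R := Num.max 0 t.

Lemma ppos_pos t : 0 <= t -> ppos t = t.
Proof. by rewrite /ppos; case: ltgtP => //. Qed.
Lemma ppos_neg t : t <= 0 -> ppos t = 0.
Proof. by rewrite /ppos; case: ltgtP => //. Qed.

Lemma is_derive_ppos2 t : is_derive t 1 (fun s => ppos s ^+ 2) (2 * ppos t).
Proof.
apply: (@is_derive_quadratic _ _ _ 1) => s; rewrite mul1r.
have sq := sqr_ge0 (s - t); have s2 := sqr_ge0 s; have t2 := sqr_ge0 t.
have [t0|/ltW t0] := leP 0 t; have [s0|/ltW s0] := leP 0 s;
  rewrite ?(ppos_pos t0) ?(ppos_neg t0) ?(ppos_pos s0) ?(ppos_neg s0) ?expr0n/=.
- by rewrite (_ : _ - _ = (s - t) ^+ 2) ?ger0_norm//; ring.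
- have ts : 0 <= t * - s by rewrite mulr_ge0// oppr_ge0.
  by rewrite ler_norml; apply/andP; split; lra.
- have ts : 0 <= - t * s by rewrite mulr_ge0// oppr_ge0.
  by rewrite ler_norml; apply/andP; split; lra.
- by rewrite !(subr0, mulr0, mul0r) normr0.
Qed.

Lemma continuous_ppos : continuous ppos.
Proof.
move=> t; rewrite /ppos.
have -> : Num.max 0 = (fun t : R => (t + `|t|) / 2).
  apply/funext => s; have [s0|s0] := leP 0 s; first by rewrite ger0_norm//; lra.
  by rewrite ltr0_norm//; lra.
by apply: cvgM; [apply: cvgD; [exact: cvg_id|apply: cvg_norm; exact: cvg_id]|exact: cvg_cst].
Qed.

(** A smooth step from 0 on the negative side to 1 after 1. Piecewise quadratics
    are of class C^1, which is all that is asked of a test function. *)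
Definition sstep t : R := 2 * ppos t ^+ 2 - 4 * ppos (t - 2^-1) ^+ 2 + 2 * ppos (t - 1) ^+ 2.
Definition dsstep t : R := 4 * ppos t - 8 * ppos (t - 2^-1) + 4 * ppos (t - 1).

Lemma is_derive_shift (f : R -> R) t c d :
  is_derive (t - c) 1 f d -> is_derive t 1 (fun s => f (s - c)) d.
Proof.
move=> h; have := rder_comp (rderB (rder_id t) (rder_cst t c)) h.
by rewrite subr0 mulr1.
Qed.

Lemma is_derive_sstep t : is_derive t 1 sstep (dsstep t).
Proof.
have h1 := rderZ 2 (is_derive_ppos2 t).
have h2 := rderZ 4 (is_derive_shift (is_derive_ppos2 (t - 2^-1))).
have h3 := rderZ 2 (is_derive_shift (is_derive_ppos2 (t - 1))).
apply: (rder_eq (rderD (rderB h1 h2) h3)); rewrite /dsstep; ring.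
Qed.

Lemma sstep0 t : t <= 0 -> sstep t = 0.
Proof. by move=> t0; rewrite /sstep !ppos_neg; lra. Qed.
Lemma sstep1 t : 1 <= t -> sstep t = 1.
Proof. by move=> t1; rewrite /sstep !ppos_pos; [field|lra..]. Qed.
Lemma dsstep0 t : t <= 0 -> dsstep t = 0.
Proof. by move=> t0; rewrite /dsstep !ppos_neg; lra. Qed.
Lemma dsstep1 t : 1 <= t -> dsstep t = 0.
Proof. by move=> t0; rewrite /dsstep !ppos_pos; [field|lra..]. Qed.

Lemma dsstep_ge0 t : 0 <= dsstep t.
Proof.
have [t0|t0] := leP t 0; first by rewrite dsstep0.
have [t1|t1] := leP 1 t; first by rewrite dsstep1.
rewrite /dsstep (ppos_neg (t := t - 1)) ?(ppos_pos (ltW t0)); last by lra.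
have [h|h] := leP (t - 2^-1) 0; first by rewrite ppos_neg//; lra.
by rewrite ppos_pos; lra.
Qed.

Lemma sstep_bnd t : 0 <= sstep t <= 1.
Proof.
have [t0|t0] := leP t 0; first by rewrite sstep0// lexx ler01.
have [t1|t1] := leP 1 t; first by rewrite sstep1// lexx ler01.
rewrite /sstep (ppos_neg (t := t - 1)) ?(ppos_pos (ltW t0)); last by lra.
have [h|h] := leP (t - 2^-1) 0; first by rewrite ppos_neg//; nra.
by rewrite ppos_pos; nra.
Qed.

Lemma continuous_dsstep : continuous dsstep.
Proof.
have sh c : continuous (fun t => ppos (t - c)).
  by move=> t; apply: (@continuous_comp _ _ _ (fun t => t - c) ppos);
    [apply: cvgB; [exact: cvg_id|exact: cvg_cst]|exact: continuous_ppos].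
move=> t; apply: cvgD; first apply: cvgB.
- by apply: cvgM; [exact: cvg_cst|exact: continuous_ppos].
- by apply: cvgM; [exact: cvg_cst|exact: sh].
- by apply: cvgM; [exact: cvg_cst|exact: sh].
Qed.

(** The difference of two ramps is a plateau with compact support. *)
Definition ramp p d t : R := sstep ((t - p) / d).
Definition dramp p d t : R := dsstep ((t - p) / d) / d.

Lemma is_derive_ramp p d t : is_derive t 1 (ramp p d) (dramp p d t).
Proof.
have h : is_derive t 1 (fun s => (s - p) / d) d^-1.
  have := rderZ d^-1 (rderB (rder_id t) (rder_cst t p)).
  rewrite subr0 mulr1; congr is_derive; apply/funext => s; exact: mulrC.
exact: (rder_comp h (is_derive_sstep _)).
Qed.

Lemma continuous_dramp p d : continuous (dramp p d).
Proof.
move=> t; apply: cvgM; last exact: cvg_cst.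
apply: (@continuous_comp _ _ _ (fun t => (t - p) / d) dsstep).
  by apply: cvgM; [apply: cvgB; [exact: cvg_id|exact: cvg_cst]|exact: cvg_cst].
exact: continuous_dsstep.
Qed.

Section ramp_values.
Variables (p d : R).
Hypothesis d0 : 0 < d.

Lemma ramp0 t : t <= p -> ramp p d t = 0.
Proof. by move=> tp; rewrite /ramp sstep0// pmulr_lle0 ?invr_gt0// subr_le0. Qed.
Lemma ramp1 t : p + d <= t -> ramp p d t = 1.
Proof. by move=> tp; rewrite /ramp sstep1// ler_pdivlMr// mul1r lerBrDl. Qed.
Lemma dramp0 t : t <= p -> dramp p d t = 0.
Proof. by move=> tp; rewrite /dramp dsstep0 ?mul0r// pmulr_lle0 ?invr_gt0// subr_le0. Qed.
Lemma dramp1 t : p + d <= t -> dramp p d t = 0.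
Proof. by move=> tp; rewrite /dramp dsstep1 ?mul0r// ler_pdivlMr// mul1r lerBrDl. Qed.
Lemma dramp_ge0 t : 0 <= dramp p d t.
Proof. by rewrite mulr_ge0 ?dsstep_ge0// invr_ge0 ltW. Qed.
Lemma ramp_bnd t : 0 <= ramp p d t <= 1.
Proof. exact: sstep_bnd. Qed.
End ramp_values.

(** The derivative of a ramp is nonnegative and has integral 1, so that it
    averages [w] over [[p, p + d]]. *)
Lemma dramp_avg (a b : R) (w : R -> R) (x p d e : R) : 0 < d -> a <= p -> p + d <= b -> rcont a b w ->
  (forall t, p <= t <= p + d -> `|w t - w x| <= e) ->
  `|RI a b (fun t => w t * dramp p d t) - w x| <= e.
Proof.
move=> d0 ap pb cw we.
have ab : a <= b by rewrite (le_trans ap)// (le_trans _ pb)// lerDl ltW.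
have cd : rcont a b (dramp p d) by apply/rcontT/continuous_dramp.
have id : RI a b (dramp p d) = 1.
  have -> : RI a b (dramp p d) = ramp p d b - ramp p d a.
    apply: rftc => //; last by move=> t _; exact: is_derive_ramp.
    by apply: rcontT => t; exact: is_derive_cont (is_derive_ramp p d t).
  by rewrite ramp1// ramp0// subr0.
have -> : w x = RI a b (fun t => w x * dramp p d t).
  by rewrite RIZ ?id ?mulr1//; exact: rcont_rint.
have c1 := rcontM cw cd; have c2 := rcontM (@rcont_cst R a b (w x)) cd.
rewrite -RIB; [|exact: rcont_rint..].
apply: (le_trans (RI_norm (rcont_rint (rcontB c1 c2)))).
rewrite -[e]mulr1 -id -RIZ; last exact: rcont_rint.
apply: le_RI.
- exact/rint_norm/rcont_rint/rcontB.
- exact/rintZ/rcont_rint.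
move=> t _; rewrite -mulrBl normrM (ger0_norm (dramp_ge0 _ d0 _)).
have [tp|pt] := leP t p; first by rewrite dramp0// !mulr0.
have [tp|tp] := leP (p + d) t; first by rewrite dramp1// !mulr0.
by rewrite ler_wpM2r ?dramp_ge0// we// (ltW pt) (ltW tp).
Qed.

(** A function whose weak derivative against cutoffs is [k] is a primitive of
    [k]: the derivative of a plateau on [[x, y]] is close to the difference of
    the Dirac masses at [x] and [y]. *)
Lemma weak_ftc a b (w k : R -> R) : rcont a b w -> rint a b k ->
  (forall eta, test_function a b eta ->
    RI a b (fun t => w t * derive1 eta t) = - RI a b (fun t => k t * eta t)) ->
  forall x y, a <= x -> x < y -> y <= b -> RI x y k = w y - w x.
Proof.
move=> cw ik H x y ax xy yb.
pose d (n : nat) : R := (y - x) / (n.+4)%:R.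
have d0 n : 0 < d n by rewrite divr_gt0 ?subr_gt0.
have d4 n : 4 * d n <= y - x.
  rewrite /d mulrC -mulrA ger_pMr ?subr_gt0// ler_pdivrMl// mulr1 ler_nat//.
have dcv : d n @[n --> \oo] --> 0.
  rewrite -[X in _ --> X](mulr0 (y - x)); apply: cvgM; first exact: cvg_cst.
  by have := @cvg_harmonic R; rewrite -(cvg_shiftn 3); under eq_fun do rewrite addnC.
pose chi n t := ramp (x + d n) (d n) t - ramp (y - 2 * d n) (d n) t.
pose dchi n t := dramp (x + d n) (d n) t - dramp (y - 2 * d n) (d n) t.
have chid n t : is_derive t 1 (chi n) (dchi n t).
  by apply: rderB; exact: is_derive_ramp.
have chi_out n t : chi n t != 0 -> x + d n <= t <= y - d n.
  have := d0 n; have := d4 n => h1 h2; rewrite /chi; apply: contraNT; rewrite negb_and -!ltNge.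
  move=> /orP[tx|yt].
    by rewrite !ramp0 ?subrr//; lra.
  by rewrite !ramp1 ?subrr//; lra.
have chi_in n t : x + 2 * d n <= t <= y - 2 * d n -> chi n t = 1.
  by move=> /andP[h1 h2]; rewrite /chi ramp1// ?ramp0 ?subr0//; lra.
have chi_le1 n t : `|chi n t| <= 1.
  rewrite /chi; have /andP[h1 h2] := ramp_bnd (x + d n) (d n) t.
  have /andP[h3 h4] := ramp_bnd (y - 2 * d n) (d n) t.
  by rewrite ler_norml; lra.
have test n : test_function a b (chi n).
  split.
  - by move=> t; exact: (@ex_derive _ _ _ _ _ _ _ (chid n t)).
  - have -> : derive1 (chi n) = dchi n.
      by apply/funext => t; rewrite derive1E (@derive_val _ _ _ _ _ _ _ (chid n t)).
    by move=> t; apply: cvgB; exact: continuous_dramp.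
  exists (x + d n), (y - d n); have h := d0 n; split; [lra..|exact: chi_out].
have dsm (r : R) : 0 < r -> \forall n \near \oo, d n < r.
  move=> r0; move/cvgrPdist_lt : dcv => /(_ _ r0); apply: filterS => n.
  by rewrite sub0r normrN gtr0_norm.
have lhs : RI a b (fun t => w t * derive1 (chi n) t) @[n --> \oo] --> w x - w y.
  apply/cvgrPdist_le => e e0.
  have e2 : 0 < e / 2 by rewrite divr_gt0.
  have cont (z : R) : a <= z <= b -> exists2 r, 0 < r & forall t, a <= t <= b -> `|t - z| < r ->
      `|w t - w z| <= e / 2.
    move=> zab; have /subspace_continuousP/(_ z) := cw; rewrite /= in_itv/= => /(_ zab).
    move/cvgrPdist_le => /(_ _ e2).
    rewrite /prop_near1 /within/= => -[r /= r0 rP]; exists r => // t tab tz.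
    rewrite distrC; apply: rP => /=; first by rewrite distrC.
    by rewrite in_itv.
  have [r1 r10 H1] := cont x (introT andP (conj ax (le_trans (ltW xy) yb))).
  have [r2 r20 H2] := cont y (introT andP (conj (le_trans ax (ltW xy)) yb)).
  near=> n.
  have dr1 : 3 * d n < r1.
    by rewrite mulrC -ltr_pdivlMr//; near: n; apply: dsm; rewrite divr_gt0.
  have dr2 : 3 * d n < r2.
    by rewrite mulrC -ltr_pdivlMr//; near: n; apply: dsm; rewrite divr_gt0.
  have h := d0 n; have h4 := d4 n.
  have -> : RI a b (fun t => w t * derive1 (chi n) t) =
     RI a b (fun t => w t * dramp (x + d n) (d n) t) -
     RI a b (fun t => w t * dramp (y - 2 * d n) (d n) t).
    rewrite -RIB; last 2 first.
      by apply/rcont_rint/rcontM => //; exact/rcontT/continuous_dramp.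
      by apply/rcont_rint/rcontM => //; exact/rcontT/continuous_dramp.
    apply: eq_RI => t _; rewrite derive1E (@derive_val _ _ _ _ _ _ _ (chid n t)).
    by rewrite /dchi mulrBr.
  have A1 := @dramp_avg a b w x (x + d n) (d n) (e / 2) h.
  have A2 := @dramp_avg a b w y (y - 2 * d n) (d n) (e / 2) h.
  have {}A1 : `|RI a b (fun t => w t * dramp (x + d n) (d n) t) - w x| <= e / 2.
    clear - cw h h4 A1 H1 ax xy yb dr1.
    apply: A1 => //; [lra..|] => t /andP[t1 t2].
    by apply: H1; [apply/andP; split; lra|rewrite ltr_norml; apply/andP; split; lra].
  have {}A2 : `|RI a b (fun t => w t * dramp (y - 2 * d n) (d n) t) - w y| <= e / 2.
    clear - cw h h4 A2 H2 ax xy yb dr2.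
    apply: A2 => //; [lra..|] => t /andP[t1 t2].
    by apply: H2; [apply/andP; split; lra|rewrite ltr_norml; apply/andP; split; lra].
  clear - A1 A2; move: A1 A2; rewrite !ler_norml; lra.
have rhs : RI a b (fun t => k t * chi n t) @[n --> \oo] --> RI x y k.
  have -> : RI x y k = \int[leb]_(t in `]a, b[) (k \_ `]x, y[) t.
    rewrite -Rintegral_mkcondr; congr (Rintegral _ _ _).
    apply/seteqP; split => t /=; rewrite !in_itv/=; last by case.
    by move=> /andP[h1 h2]; split; apply/andP; split; lra.
  have mk := rint_meas ik.
  apply: fine_cvg; rewrite fineK; last first.
    apply: integrable_fin_num => //.
    apply: (le_integrable _ _ _ ik) => //.
      apply/measurable_EFinP/measurable_restrict => //.
      by apply: measurable_funS mk => // t /= [].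
    by move=> t _; rewrite /patch; case: ifP => //= _; rewrite lee_fin normr0.
  apply: (@dominated_cvg _ _ _ leb _ _ _ _ (fun t => `|k t|%:E)) => //.
  - move=> n; apply/measurable_EFinP; apply: measurable_funM => //.
    apply: (@rcont_meas _ a b); apply: rcontT => t; exact: is_derive_cont (chid n t).
  - move=> t _; apply: cvg_EFin; first by near=> n.
    have [txy|txy] := boolP (t \in `]x, y[%classic); last first.
      rewrite /patch (negbTE txy).
      have E n : k t * chi n t = 0.
        apply/eqP; rewrite mulf_eq0; apply/orP; right; apply/negPn/negP => /chi_out.
        move=> /andP[h1 h2]; move/negP : txy; apply; rewrite inE/= in_itv/=.
        by have h := d0 n; apply/andP; split; lra.
      by under eq_fun do rewrite /= E; exact: cvg_cst.
    rewrite /patch txy; move: txy; rewrite inE/= in_itv/= => /andP[xt ty].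
    apply: cvg_near_cst; near=> n; rewrite /= chi_in ?mulr1//.
    apply/andP; split.
      rewrite -lerBrDl mulrC -ler_pdivlMr//; apply/ltW; near: n.
      by apply: dsm; rewrite divr_gt0// subr_gt0.
    rewrite lerBrDr -lerBrDl mulrC -ler_pdivlMr//; apply/ltW; near: n.
    by apply: dsm; rewrite divr_gt0// subr_gt0.
  - by apply: integrable_norm.
  - by move=> n t _; rewrite lee_fin normrM ler_piMr.
have E n : RI a b (fun t => w t * derive1 (chi n) t) = - RI a b (fun t => k t * chi n t).
  exact: H.
move: lhs; under eq_fun do rewrite E; move=> lhs.
have e : - RI x y k = w x - w y by exact: (cvg_unique _ (cvgN rhs) lhs).
by rewrite -[LHS]opprK e opprB.
Unshelve. all: by end_near. Qed.

End cutoffs.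

(** * Weak derivatives and classical derivatives *)

Section weak_derivative_real.
Context {R : realType}.
Variables (a b : R).
Hypothesis hab : a < b.
Implicit Types (u g eta : R -> R) (x y : R).

Definition rweak u g := forall eta, test_function a b eta ->
  RI a b (fun t => u t * derive1 eta t) = - RI a b (fun t => g t * eta t).

Lemma test_rcont eta : test_function a b eta -> rcont a b eta /\ rcont a b (derive1 eta).
Proof.
move=> [h1 h2 _]; split; apply: rcontT => // x.
exact/differentiable_continuous/derivable1_diffP.
Qed.

Lemma test_derive eta x : test_function a b eta -> is_derive x 1 eta (derive1 eta x).
Proof.
by move=> [h1 _ _]; rewrite derive1E; split => //; exact: h1.
Qed.

Lemma test_ends eta : test_function a b eta -> eta a = 0 /\ eta b = 0.
Proof.
move=> [_ _ [c [d [ac db h]]]]; split; apply/eqP/negPn/negP => /h /andP[h1 h2].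
  by move: (lt_le_trans ac h1); rewrite ltxx.
by move: (le_lt_trans h2 db); rewrite ltxx.
Qed.

(** Integration by parts: [eta] times a test function is again a test function,
    so that [u eta] has the weak derivative [u eta' + g eta], to which [weak_ftc]
    applies. *)
Lemma rweak_ftc u g eta (deta : R -> R) : rcont a b u -> rint a b g -> rweak u g ->
  (forall x, is_derive x 1 eta (deta x)) -> continuous deta ->
  forall x y, a <= x -> x < y -> y <= b ->
  RI x y (fun t => u t * deta t + g t * eta t) = u y * eta y - u x * eta x.
Proof.
move=> cu ig ug ed cd.
have ce : continuous eta by move=> x; exact: is_derive_cont (ed x).
have re : rcont a b eta := rcontT ce; have rd : rcont a b deta := rcontT cd.
apply: (@weak_ftc _ a b (fun t => u t * eta t)).
- exact: rcontM.
- by apply: rintD; [exact/rcont_rint/rcontM|exact: rintM].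
move=> chi tchi.
have [cchi cdchi] := test_rcont tchi.
have der x : is_derive x 1 (fun t => chi t * eta t) (derive1 chi x * eta x + chi x * deta x).
  by apply: rderM => //; exact: test_derive.
have derE : derive1 (fun t => chi t * eta t) = (fun x => derive1 chi x * eta x + chi x * deta x).
  by apply/funext => x; rewrite derive1E (@derive_val _ _ _ _ _ _ _ (der x)).
have test2 : test_function a b (fun t => chi t * eta t).
  have [h1 h2 [c [d [ac db h]]]] := tchi; split.
  - by move=> x; exact: (@ex_derive _ _ _ _ _ _ _ (der x)).
  - rewrite derE => x; apply: cvgD; apply: cvgM; [exact: h2|exact: ce| |exact: cd].
    exact: is_derive_cont (test_derive x tchi).
  exists c, d; split => // x; rewrite mulf_eq0 negb_or => /andP[/h //].
have := ug _ test2; rewrite derE.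
have i1 : rint a b (fun t => u t * eta t * derive1 chi t).
  by apply/rcont_rint/rcontM => //; exact: rcontM.
have i2 : rint a b (fun t => u t * deta t * chi t).
  by apply/rcont_rint/rcontM => //; exact: rcontM.
have i3 : rint a b (fun t => g t * eta t * chi t) by apply: rintM => //; exact: rintM.
have -> : RI a b (fun t => u t * (derive1 chi t * eta t + chi t * deta t)) =
   RI a b (fun t => u t * eta t * derive1 chi t) + RI a b (fun t => u t * deta t * chi t).
  by rewrite -RID//; apply: eq_RI => t _; ring.
have -> : RI a b (fun t => g t * (chi t * eta t)) = RI a b (fun t => g t * eta t * chi t).
  by apply: eq_RI => t _; ring.
have -> : RI a b (fun t => (u t * deta t + g t * eta t) * chi t) =
   RI a b (fun t => u t * deta t * chi t) + RI a b (fun t => g t * eta t * chi t).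
  by rewrite -RID//; apply: eq_RI => t _; ring.
lra.
Qed.

Lemma rweak_prim u g : rcont a b u -> rint a b g -> rweak u g ->
  forall x y, a <= x -> x < y -> y <= b -> RI x y g = u y - u x.
Proof.
move=> cu ig ug x y ax xy yb.
have := @rweak_ftc u g (fun=> 1) (fun=> 0) cu ig ug (fun t => rder_cst t 1)
  (fun t => cvg_cst _) x y ax xy yb.
rewrite !mulr1 => <-; apply: eq_RI => t _; ring.
Qed.

Lemma rweak_of_C1 u g : rcont a b u -> rcont a b g ->
  (forall x, a < x < b -> is_derive x 1 u (g x)) -> rweak u g.
Proof.
move=> cu cg ug eta te; have [ce cde] := test_rcont te; have [ea eb] := test_ends te.
have i1 := rcont_rint (rcontM cg ce); have i2 := rcont_rint (rcontM cu cde).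
have : RI a b (fun t => g t * eta t + u t * derive1 eta t) = u b * eta b - u a * eta a.
  apply: (@rftc _ a b (fun t => u t * eta t)); first exact: ltW.
  - exact: rcontM.
  - by apply: rcontD; exact: rcontM.
  by move=> x xab; apply: rderM; [exact: ug|exact: test_derive].
rewrite RID// ea eb !mulr0 subrr => H.
by apply/eqP; rewrite -addr_eq0 addrC H.
Qed.

(** [u] is a primitive of its weak derivative, which is continuous. *)
Lemma rweak_C1 u g : rcont a b u -> rcont a b g -> rweak u g ->
  forall x, a < x < b -> is_derive x 1 u (g x).
Proof.
move=> cu cg ug x /andP[ax xb].
have P := rweak_prim cu (rcont_rint cg) ug.
pose F y := \int[leb]_(t in [set` `[a, y]]) (g t).
have cgx : {for x, continuous g}.
  by apply: (within_continuous_continuous hab cg); rewrite in_itv/= ax.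
have [dF F'] := @continuous_FTC1_closed R g a x b xb (rcont_rint_cc cg) ax cgx.
have Fx : is_derive x 1 F (g x).
  by split; [exact: dF|rewrite -derive1E].
have FE y : a < y < b -> u y = u a + F y.
  move=> /andP[ay yb]; rewrite (_ : F y = RI a y g).
    by rewrite P ?(ltW yb)// addrC subrK.
  have cy := rcontS (lexx a) (ltW yb) cg.
  rewrite /RI Rintegral_itv_bndo_bndc; last exact: rcont_rint.
  rewrite Rintegral_itv_obnd_cbnd//.
  apply: (integrableS _ _ _ (rcont_rint_cc cy)) => //.
  by move=> z /=; rewrite !in_itv/= => /andP[/ltW -> ->].
have h : is_derive x 1 (fun y => u a + F y) (g x).
  by apply: (rder_eq (rderD (rder_cst x (u a)) Fx)); rewrite add0r.
apply: (near_eq_is_derive _ h).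
have : x \in `]a, b[ by rewrite in_itv/= ax.
move/near_in_itvoo; by apply: filterS => y; rewrite in_itv/= => /FE ->.
Qed.

(** Lebesgue's differentiation theorem, applied to a vanishing primitive. *)
Lemma prim0_ae g : rint a b g ->
  (forall x y, a <= x -> x < y -> y <= b -> RI x y g = 0) ->
  {ae (@leb R), forall x, a < x < b -> g x = 0}.
Proof.
move=> ig P.
pose f := g \_ `]a, b[.
have intf : (@leb R).-integrable setT (EFin \o f).
  rewrite /f -restrict_EFin; apply/integrable_restrict => //.
  by rewrite setTI.
have intf2 (A : set R) : measurable A -> (@leb R).-integrable A (EFin \o f).
  by move=> mA; apply: integrableS intf.
have F0 x : \int[leb]_(t in [set` `]-oo, x]]) (f t) = 0.
  rewrite /f -Rintegral_mkcondr.
  have [xa|ax] := leP x a.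
    rewrite (_ : _ `&` _ = set0) ?Rintegral_set0//.
    apply/seteqP; split => t //=; rewrite !in_itv/= => -[h1 /andP[h2 h3]].
    by move: (lt_le_trans h2 h1); rewrite ltNge xa.
  have [bx|xb] := leP b x.
    rewrite (_ : _ `&` _ = `]a, b[%classic); first exact: P.
    apply/seteqP; split => t //=; rewrite !in_itv/=; first by case.
    by move=> /andP[h1 h2]; split; rewrite ?h1 ?h2// (le_trans (ltW h2)).
  rewrite (_ : _ `&` _ = `]a, x]%classic).
    rewrite -Rintegral_itv_bndo_bndc; first exact: (P a x (lexx a) ax (ltW xb)).
    exact: (rintS (lexx a) (ltW xb)).
  apply/seteqP; split => t //=; rewrite !in_itv/=.
    by move=> [h1 /andP[h2 h3]]; rewrite h1 h2.
  by move=> /andP[h1 h2]; rewrite h1 h2 (le_lt_trans h2 xb).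
have := @FTC1Ny R f (fun y => intf2 _ (measurable_itv _)).
have locf : locally_integrable [set: R] f by exact: integrable_locally.
move=> /(_ locf); apply: filterS; first exact: (ae_filter_ringOfSetsType leb).
move=> x /= [_].
rewrite (_ : (fun x => _) = cst 0); last by apply/funext => t; exact: F0.
rewrite derive1_cst /f patchE => + xab.
by rewrite mem_set ?in_itv//=.
Qed.

End weak_derivative_real.

Section weak_derivative_complex.
Context {R : realType}.
Variables (a b : R).
Hypothesis hab : a < b.
Implicit Types (u g : R -> R[i]) (x y : R).
Local Notation Int := (Int a b).
Local Notation ccont := (ccont a b).
Local Notation C1p := (C1p a b).
Local Notation mu := (mu a b).
Local Notation em := (em a b).
Local Notation fc := (fc a b).
Local Notation rweak := (rweak a b).

Lemma RI_ext (f g : R -> R) : (forall x, f x = g x) -> RI a b f = RI a b g.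
Proof. by move=> /funext ->. Qed.

Lemma weak_derivativeE u g : weak_derivative a b u g <->
  rweak (fun x => complex.Re (u x)) (fun x => complex.Re (g x)) /\
  rweak (fun x => complex.Im (u x)) (fun x => complex.Im (g x)).
Proof.
have re (f : R -> R[i]) (e : R -> R) :
    RI a b (fun x => complex.Re (f x * (e x)%:C)) = RI a b (fun x => complex.Re (f x) * e x).
  by apply: RI_ext => x; rewrite cReM/= mulr0 subr0.
have im (f : R -> R[i]) (e : R -> R) :
    RI a b (fun x => complex.Im (f x * (e x)%:C)) = RI a b (fun x => complex.Im (f x) * e x).
  by apply: RI_ext => x; rewrite cImM/= mulr0 add0r.
split => [h|[h1 h2] eta te].
  split => eta te; have := h eta te.
    by move=> /(congr1 (@complex.Re R)); rewrite cReN -!/(J _ _ _) !JE/= !re.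
  by move=> /(congr1 (@complex.Im R)); rewrite cImN -!/(J _ _ _) !JE/= !im.
by apply: complex_eq; rewrite ?cReN ?cImN -!/(J _ _ _) !JE/= ?re ?im; [exact: h1|exact: h2].
Qed.

Lemma weak_of_C1p u g : C1p u g -> weak_derivative a b u g.
Proof.
move=> [[u1 u2] [g1 g2] ud _]; apply/weak_derivativeE; split.
  by apply: rweak_of_C1 => // x xab; have [] := ud x xab.
by apply: rweak_of_C1 => // x xab; have [] := ud x xab.
Qed.

Lemma C1p_of_weak u g : ccont u -> ccont g -> u a = u b ->
  weak_derivative a b u g -> C1p u g.
Proof.
move=> [u1 u2] [g1 g2] per /weak_derivativeE[w1 w2]; split => // x xab; split.
  exact: (rweak_C1 hab u1 g1 w1 xab).
exact: (rweak_C1 hab u2 g2 w2 xab).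
Qed.

(** The counterpart of [fc_deriv] for the highest derivative at hand, which is
    only a weak one and need not be continuous. *)
Lemma fc_weak u g l : ccont u -> Int g -> u a = u b -> weak_derivative a b u g ->
  fc g l = 'i%C * (mu l)%:C * fc u l.
Proof.
move=> cu ig per /weak_derivativeE[w1 w2]; have [u1 u2] := cu; have [g1 g2] := ig.
pose e := em (- l); pose de x := 'i%C * (mu (- l))%:C * em (- l) x.
have ed x : cdif e x (de x) := cdif_em a b (- l) x.
have cde : ccont de.
  by apply: ccontM; [exact: ccont_cst|exact: ccont_em].
have cont : continuous (fun x => complex.Re (de x)) /\ continuous (fun x => complex.Im (de x)).
  have d2 x : cdif de x ('i%C * (mu (- l))%:C * de x) by apply: cdifZ; exact: ed.
  by split => x; have [] := cdif_cont (d2 x).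
have [c1 c2] := cont.
have ab0 := lexx a; have bb0 := lexx b.
have P (p q : R -> R) (r dr : R -> R) (cp : rcont a b p) (iq : rint a b q) (w : rweak p q)
    (rd : forall x, is_derive x 1 r (dr x)) (cdr : continuous dr) :
    p a = p b -> r b = r a -> RI a b (fun t => p t * dr t + q t * r t) = 0.
  by move=> E1 E2; rewrite (rweak_ftc cp iq w rd cdr (lexx a) hab (lexx b)) E1 E2 subrr.
have eab : e b = e a by rewrite /e em_a em_b.
have per1 := congr1 (@complex.Re R) per; have per2 := congr1 (@complex.Im R) per.
have eab1 := congr1 (@complex.Re R) eab; have eab2 := congr1 (@complex.Im R) eab.
have rr := P _ _ _ _ u1 g1 w1 (fun x => (ed x).1) c1 per1 eab1.
have ri := P _ _ _ _ u1 g1 w1 (fun x => (ed x).2) c2 per1 eab2.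
have ir := P _ _ _ _ u2 g2 w2 (fun x => (ed x).1) c1 per2 eab1.
have ii := P _ _ _ _ u2 g2 w2 (fun x => (ed x).2) c2 per2 eab2.
have ce : ccont e by exact: ccont_em.
have int4 (p q r s : R -> R) : rcont a b p -> rint a b q -> rcont a b r -> rcont a b s ->
    rint a b (fun t => p t * s t + q t * r t).
  by move=> *; apply: rintD; [exact/rcont_rint/rcontM|exact: rintM].
have Z : J a b (fun x => u x * de x + g x * e x) = 0.
  have [[e1 e2] [d1 d2]] := (ce, cde).
  apply: complex_eq; rewrite JE/=.
    rewrite (RI_ext (g := fun t =>
      (complex.Re (u t) * complex.Re (de t) + complex.Re (g t) * complex.Re (e t)) -
      (complex.Im (u t) * complex.Im (de t) + complex.Im (g t) * complex.Im (e t)))).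
      by rewrite RIB ?rr ?ii ?subrr//; exact: int4.
    by move=> t; rewrite cReD !cReM; ring.
  rewrite (RI_ext (g := fun t =>
      (complex.Re (u t) * complex.Im (de t) + complex.Re (g t) * complex.Im (e t)) +
      (complex.Im (u t) * complex.Re (de t) + complex.Im (g t) * complex.Re (e t)))).
    by rewrite RID ?ri ?ir ?addr0//; exact: int4.
  by move=> t; rewrite cImD !cImM; ring.
move: Z; rewrite JD; [|exact/ccont_Int/ccontM|exact: IntM].
move/eqP; rewrite addrC addr_eq0 => /eqP h.
rewrite !fcE h /de.
rewrite (_ : (fun x => _) = (fun x => 'i%C * (mu (- l))%:C * (u x * em (- l) x))).
  rewrite JZ; last exact: (IntM (ccont_Int cu) ce).
  by rewrite muN rmorphN/=; ring.
by apply/funext => x; ring.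
Qed.

(** The difference of two weak derivatives has integral 0 on every subinterval. *)
Lemma weak_unique u g g' : ccont u -> Int g -> Int g' ->
  weak_derivative a b u g -> weak_derivative a b u g' ->
  {ae (@leb R), forall x, a < x < b -> g x = g' x}.
Proof.
move=> [u1 u2] [g1 g2] [k1 k2] /weak_derivativeE[w1 w2] /weak_derivativeE[v1 v2].
have key (p q r : R -> R) : rcont a b p -> rint a b q -> rint a b r -> rweak p q -> rweak p r ->
    {ae (@leb R), forall x, a < x < b -> q x - r x = 0}.
  move=> cp iq ir wq wr; apply: (prim0_ae hab); first exact: rintB.
  move=> x y ax xy yb; rewrite RIB; [|exact: rintS iq|exact: rintS ir].
  by rewrite (rweak_prim cp iq wq)// (rweak_prim cp ir wr)// subrr.
have h1 := key _ _ _ u1 g1 k1 w1 v1; have h2 := key _ _ _ u2 g2 k2 w2 v2.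
have F := ae_filter_ringOfSetsType (@leb R).
apply: filterS2 h1 h2 => x h1 h2 xab.
by apply: complex_eq; apply/eqP; rewrite -subr_eq0; apply/eqP; [exact: h1|exact: h2].
Qed.

Lemma L2_Int u : L2 a b u -> Int u /\ rint a b (fun x => nc (u x) ^+ 2).
Proof.
move=> [m1 m2 h].
have mn : measurable_fun `]a, b[ (fun x => nc (u x) ^+ 2).
  have -> : (fun x => nc (u x) ^+ 2) = (fun x => complex.Re (u x) ^+ 2 + complex.Im (u x) ^+ 2).
    by apply/funext => x; rewrite nc_sqr.
  by apply: measurable_funD; exact: measurable_funX.
have i2 : rint a b (fun x => nc (u x) ^+ 2).
  apply/integrableP; split; first exact/measurable_EFinP.
  apply: le_lt_trans h; apply: ge0_le_integral => //=.
  - by do 2 apply: measurableT_comp => //.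
  - exact/measurable_EFinP.
  by move=> x _; rewrite lee_fin ger0_norm// sqr_ge0.
split => //.
have i3 : rint a b (fun x => 1 + nc (u x) ^+ 2) by apply: rintD => //; exact: rint_cst.
have le1 x : nc (u x) <= 1 + nc (u x) ^+ 2.
  by have := sqr_ge0 (nc (u x) - 1); have := sqr_ge0 (nc (u x)); rewrite sqrrB; lra.
split; apply: rint_le i3 => // x _.
  exact: le_trans (Re_le_nc _) _.
exact: le_trans (Im_le_nc _) _.
Qed.

Lemma L2normsqE u : rint a b (fun x => nc (u x) ^+ 2) ->
  L2normsq a b u = (RI a b (fun x => nc (u x) ^+ 2))%:E.
Proof. by move=> h; rewrite /RI /Rintegral fineK//; exact: integrable_fin_num. Qed.

Lemma ccont_L2 u : ccont u -> L2 a b u.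
Proof.
move=> hu; have [u1 u2] := hu; split; [exact: rcont_meas..|].
by rewrite L2normsqE ?ltry//; exact/rcont_rint/ccont_nc2.
Qed.

Lemma ae_L2normsq u g : L2 a b u -> L2 a b g ->
  {ae (@leb R), forall x, a < x < b -> u x = g x} -> L2normsq a b u = L2normsq a b g.
Proof.
move=> hu hg h.
have [_ [iu /rint_meas mu']] := conj (L2_Int hu).1 (conj (L2_Int hu).1 (L2_Int hu).2).
have [_ [ig /rint_meas mg]] := conj (L2_Int hg).1 (conj (L2_Int hg).1 (L2_Int hg).2).
apply: ae_eq_integral => //; [exact/measurable_EFinP..|].
have F := ae_filter_ringOfSetsType (@leb R).
apply: filterS h => x hx; rewrite /= in_itv/= => xab.
by rewrite hx.
Qed.

Lemma H1sq_L2 u g : C1p u g -> (L2normsq a b u + L2normsq a b g)%E = (H1sq a b u g)%:E.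
Proof.
move=> hu; have [u0 g0 _ _] := hu.
by rewrite !L2normsqE ?H1sqE//; exact/rcont_rint/ccont_nc2.
Qed.

Lemma Hnorm1_le u g (r : R) : C1p u g -> 0 <= r -> H1sq a b u g <= r ^+ 2 ->
  (Hnorm a b 1 u <= r%:E)%E.
Proof.
move=> hu r0 h; have [u0 g0 _ _] := hu.
apply: (@le_trans _ _ (sqrte (H1sq a b u g)%:E)); last first.
  by rewrite /= lee_fin -(ger0_norm r0) -sqrtr_sqr ler_wsqrtr.
apply: ereal_inf_lbound; exists (fun j => if j is 0%N then u else g).
  split => //.
  - by case => [|j] _; exact: ccont_L2.
  - by case => // _; exact: weak_of_C1p.
by rewrite !big_ord_recr big_ord0/= add0e H1sq_L2.
Qed.

(** Every weak derivative of [u] is almost everywhere equal to [g], so that the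
    infimum defining [Hnorm] is attained by [g]. *)
Lemma H1sq_le u g (r : R) : C1p u g -> (Hnorm a b 1 u <= r%:E)%E ->
  0 <= r /\ H1sq a b u g <= r ^+ 2.
Proof.
move=> hu h; have [u0 g0 _ _] := hu.
have : (sqrte (H1sq a b u g)%:E <= r%:E)%E.
  apply: le_trans h; apply: le_ereal_inf_tmp => _ [D [D0 DL Dw] <-].
  rewrite !big_ord_recr big_ord0/= add0e D0.
  rewrite (@ae_L2normsq (D 1%N) g) ?H1sq_L2//; [exact: DL|exact: ccont_L2|].
  have := Dw 0%N isT; rewrite D0 => w1.
  apply: (@weak_unique u) => //.
  - exact: (L2_Int (DL 1%N (leqnn _))).1.
  - exact: ccont_Int.
  exact: weak_of_C1p.
rewrite /= lee_fin => H.
have r0 : 0 <= r by apply: le_trans H; exact: sqrtr_ge0.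
by split => //; rewrite -(sqr_sqrtr (H1sq_ge0 a b u g)) ler_sqr ?nnegrE ?sqrtr_ge0.
Qed.

End weak_derivative_complex.

(** * Regularity at every time *)

Section regularity.
Context {R : realType}.
Variables (a b : R).
Hypothesis hab : a < b.
Implicit Types (u g : R -> R[i]) (x y t s : R) (D : nat -> R -> R[i]).
Local Notation Int := (Int a b).
Local Notation ccont := (ccont a b).
Local Notation C1p := (C1p a b).
Local Notation mu := (mu a b).
Local Notation fc := (fc a b).
Local Notation H1sq := (H1sq a b).
Local Notation nrm := (nrm a b).

(** What a bound in H^5_per provides: four classical derivatives bounded in H^1,
    and for the fifth, which is only a weak derivative, a bound on its Fourier
    coefficients. *)
Record Reg (K : R) u D : Prop := MkReg {
  Reg0 : D 0%N = u;
  RegC1p : forall k, (k < 4)%N -> C1p (D k) (D k.+1);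
  RegH1 : forall k, (k < 4)%N -> H1sq (D k) (D k.+1) <= K;
  Reg5 : forall N, nrm N (fun l => ((mu l) ^+ 4)%:C * fc u l) ^+ 2 <= K }.

Lemma ae_point (P : R -> Prop) x y : {ae (@leb R), forall t, P t} -> x < y ->
  exists2 t, x < t < y & P t.
Proof.
move=> [Z [mZ Z0 PZ]] xy; apply: contrapT => H.
have sub : `]x, y[%classic `<=` Z.
  move=> t /=; rewrite in_itv/= => xty; apply: PZ => /= Pt; apply: H; by exists t.
have : (@leb R `]x, y[%classic <= 0)%E.
  rewrite -Z0; apply: le_measure => //; rewrite inE//.
have -> : @leb R `]x, y[%classic = (y%:E - x%:E)%E.
  by etransitivity; [exact: (lebesgue_measure_itv `]x, y[%R)|rewrite /= lte_fin xy].
by rewrite -EFinB lee_fin leNgt subr_gt0 xy.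
Qed.

Lemma weak_derivative_ae u u' g : Int u -> Int u' ->
  {ae (@leb R), forall x, a < x < b -> u x = u' x} ->
  weak_derivative a b u g -> weak_derivative a b u' g.
Proof.
move=> [u1 u2] [v1 v2] h /weak_derivativeE[w1 w2]; apply/weak_derivativeE.
have F := ae_filter_ringOfSetsType (@leb R).
have key (p q r : R -> R) : rint a b p -> rint a b q ->
   {ae (@leb R), forall x, a < x < b -> p x = q x} -> rweak a b p r -> rweak a b q r.
  move=> ip iq hpq wp eta te; rewrite -(wp eta te); congr fine.
  have [ce cde] := test_rcont te.
  apply: ae_eq_integral => //.
  - by apply/measurable_EFinP; exact: (rint_meas (rintM iq cde)).
  - by apply/measurable_EFinP; exact: (rint_meas (rintM ip cde)).
  apply: filterS hpq => x hx; rewrite /= in_itv/= => xab.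
  by rewrite hx.
split; [apply: key w1 => //|apply: key w2 => //]; apply: filterS h => x hx xab; by rewrite hx.
Qed.

Lemma L2D u g : L2 a b u -> L2 a b g -> L2 a b (fun x => u x - g x) /\
  (L2normsq a b (fun x => (u x - g x)%R) <= 2%:E * L2normsq a b u + 2%:E * L2normsq a b g)%E.
Proof.
move=> hu hg; have [iu iu2] := L2_Int hu; have [ig ig2] := L2_Int hg.
have [u1 u2 _] := hu; have [g1 g2 _] := hg.
have ib : rint a b (fun x => 2 * nc (u x) ^+ 2 + 2 * nc (g x) ^+ 2).
  by apply: rintD; exact: rintZ.
have le x : nc (u x - g x) ^+ 2 <= 2 * nc (u x) ^+ 2 + 2 * nc (g x) ^+ 2.
  by have := nc2D (u x) (- g x); rewrite ncN.
have i2 : rint a b (fun x => nc (u x - g x) ^+ 2).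
  apply: rint_le ib; last by move=> x _; rewrite ger0_norm ?sqr_ge0.
  have -> : (fun x => nc (u x - g x) ^+ 2) = (fun x =>
      (complex.Re (u x) - complex.Re (g x)) ^+ 2 + (complex.Im (u x) - complex.Im (g x)) ^+ 2).
    by apply/funext => x; rewrite nc_sqr cReD cImD cReN cImN.
  by apply: measurable_funD; apply: measurable_funX; exact: measurable_funB.
have N : (L2normsq a b (fun x => (u x - g x)%R) <=
   2%:E * L2normsq a b u + 2%:E * L2normsq a b g)%E.
  rewrite !L2normsqE// -!EFinM -EFinD lee_fin -!RIZ// -RID; [|exact: rintZ..].
  exact: le_RI.
split => //; split.
- rewrite (_ : (fun x => _) = (fun x => complex.Re (u x) - complex.Re (g x))).
    exact: measurable_funB.
  by apply/funext => x; rewrite cReD cReN.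
- rewrite (_ : (fun x => _) = (fun x => complex.Im (u x) - complex.Im (g x))).
    exact: measurable_funB.
  by apply/funext => x; rewrite cImD cImN.
by rewrite L2normsqE// ltry.
Qed.

Lemma weak_derivativeB u g u' g' : Int u -> Int g -> Int u' -> Int g' ->
  weak_derivative a b u g -> weak_derivative a b u' g' ->
  weak_derivative a b (fun x => u x - u' x) (fun x => g x - g' x).
Proof.
move=> iu ig iu' ig' w w' eta te; have [ce cde] := test_rcont te.
have cc (f : R -> R) : rcont a b f -> ccont (fun x => (f x)%:C).
  by move=> cf; split => //; exact: rcont_cst.
have h := w eta te; have h' := w' eta te.
rewrite -!/(J _ _ _) in h h' *.
have -> : J a b (fun x => (u x - u' x) * (derive1 eta x)%:C) =
  J a b (fun x => u x * (derive1 eta x)%:C) - J a b (fun x => u' x * (derive1 eta x)%:C).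
  rewrite -JB; [|by apply: IntM => //; exact: cc..].
  by congr J; apply/funext => x; rewrite mulrBl.
have -> : J a b (fun x => (g x - g' x) * (eta x)%:C) =
  J a b (fun x => g x * (eta x)%:C) - J a b (fun x => g' x * (eta x)%:C).
  rewrite -JB; [|by apply: IntM => //; exact: cc..].
  by congr J; apply/funext => x; rewrite mulrBl.
by rewrite h h'; ring.
Qed.

(** The infimum defining [Hnorm] is approached by some chain of weak
    derivatives. *)
Lemma Hnorm_lt m u (r : R) : (Hnorm a b m u < r%:E)%E ->
  exists D, weak_derivatives a b m u D /\
   forall k, (k <= m)%N -> (L2normsq a b (D k) <= (r ^+ 2)%:E)%E.
Proof.
move=> /ereal_inf_lt[_ [D Du <-] h]; exists D; split => // k km.
have L0 j : (0 <= L2normsq a b (D j))%E.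
  by apply: integral_ge0 => x _; rewrite lee_fin sqr_ge0.
have [_ DL _] := Du.
pose c j : R := RI a b (fun x => nc (D j x) ^+ 2).
have cE j : (j <= m)%N -> L2normsq a b (D j) = (c j)%:E.
  by move=> jm; rewrite L2normsqE//; exact: (L2_Int (DL j jm)).2.
have sE : (\sum_(j < m.+1) L2normsq a b (D j))%E = (\sum_(j < m.+1) c j)%:E.
  by rewrite -sumEFin; apply: eq_bigr => j _; rewrite cE// -ltnS.
move: h; rewrite sE /= lte_fin cE// lee_fin => h.
have c0 j : 0 <= c j by apply: RI_ge0 => x _; exact: sqr_ge0.
have S0 : 0 <= \sum_(j < m.+1) c j by apply: sumr_ge0 => j _; exact: c0.
have r0 : 0 <= r by apply: le_trans (ltW h); exact: sqrtr_ge0.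
apply: (@le_trans _ _ (\sum_(j < m.+1) c j)).
  have km' : (k < m.+1)%N by [].
  by rewrite (bigD1 (Ordinal km'))//= lerDl sumr_ge0.
rewrite -(sqr_sqrtr S0) ler_sqr ?nnegrE ?sqrtr_ge0//; exact: ltW.
Qed.

Lemma Hnorm_ge0 m u : (0 <= Hnorm a b m u)%E.
Proof. by apply: le_ereal_inf_tmp => _ [D _ <-]; exact: sqrte_ge0. Qed.

Lemma Hnorm1_le_m m u : (0 < m)%N -> (Hnorm a b 1 u <= Hnorm a b m u)%E.
Proof.
move=> m0; apply: le_ereal_inf_tmp => _ [D Du <-].
have [D0 DL Dw] := Du.
have L0 j : (0 <= L2normsq a b (D j))%E.
  by apply: integral_ge0 => x _; rewrite lee_fin sqr_ge0.
apply: (@le_trans _ _ (sqrte (\sum_(j < 2) L2normsq a b (D j))%E)).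
  apply: ereal_inf_lbound; exists D => //; split => // j j1.
    by apply: DL; rewrite (leq_trans j1).
  by apply: Dw; rewrite (leq_trans j1).
rewrite lee_sqrt ?sume_ge0//; rewrite [leLHS]big_ord_recr [in leLHS]big_ord_recr/= big_ord0 add0e.
case: m m0 {Du DL Dw} => // m _.
rewrite [leRHS]big_ord_recl; rewrite [X in (_ <= _ + X)%E]big_ord_recl.
have key (A B S : \bar R) : (0 <= S -> A + B <= A + (B + S))%E.
  by move=> S0; rewrite addeA leeDl.
by apply: key; exact: sume_ge0.
Qed.

(** By induction on the order, chains of weak derivatives agree almost
    everywhere, so that the continuous chain inherits the L^2 bounds of any
    other. *)
Lemma weak_chain_ae m u D D' : weak_derivatives a b m u D ->
  (forall k, (k < m)%N -> ccont (D k)) -> weak_derivatives a b m u D' ->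
  forall k, (k <= m)%N -> L2normsq a b (D k) = L2normsq a b (D' k).
Proof.
move=> [D0 DL Dw] cD [D'0 D'L D'w] k km.
apply: ae_L2normsq; [exact: DL|exact: D'L|].
elim: k km => [_|k IH km]; first by apply: aeW => x _; rewrite D0 D'0.
have ae := IH (ltnW km).
apply: (weak_unique hab (cD k km)).
- exact: (L2_Int (DL _ km)).1.
- exact: (L2_Int (D'L _ km)).1.
- exact: Dw.
apply: (weak_derivative_ae _ _ _ (D'w k km)).
- exact: (L2_Int (D'L _ (ltnW km))).1.
- exact: (L2_Int (DL _ (ltnW km))).1.
have F := ae_filter_ringOfSetsType (@leb R).
by apply: filterS ae => x h xab; rewrite h.
Qed.

Lemma Reg_of_Hper m u (K : R) : (5 <= m)%N -> Hper a b m u ->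
  (exists D', weak_derivatives a b m u D' /\
    forall k, (k <= m)%N -> (L2normsq a b (D' k) <= K%:E)%E) ->
  exists D, Reg (2 * K) u D.
Proof.
move=> m5 [D [wD cD pD]] [D' [wD' LD']]; exists D.
have [D0 DL Dw] := wD.
have LE k : (k <= m)%N -> (L2normsq a b (D k) <= K%:E)%E.
  by move=> km; rewrite (weak_chain_ae wD cD wD')// LD'.
have C k : (k < 4)%N -> C1p (D k) (D k.+1).
  move=> k4; have k1 : (k.+1 < m)%N by rewrite (leq_trans _ m5).
  have k2 : (k < m)%N by rewrite ltnW.
  by apply: C1p_of_weak => //; [exact: cD|exact: cD|exact: pD|exact: Dw].
split => //.
  move=> k k4; have k1 : (k.+1 <= m)%N by rewrite (leq_trans _ m5)// ltnW.
  have := leeD (LE k (ltnW k1)) (LE _ k1).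
  by rewrite (H1sq_L2 (C k k4)) -EFinD lee_fin; lra.
move=> N.
have fcE l k : (k <= 4)%N -> fc (D k) l = ('i%C * (mu l)%:C) ^+ k * fc u l.
  elim: k => [_|k IH k4]; first by rewrite D0 expr0 mul1r.
  by rewrite (fc_deriv hab _ (C k k4)) IH ?(ltnW k4)// exprS mulrA.
have i5 := L2_Int (DL 5 m5).
have h5 l : fc (D 5) l = 'i%C * (mu l)%:C * fc (D 4) l.
  apply: fc_weak => //; first exact: cD.
  - exact: i5.1.
  - exact: pD.
  - exact: Dw.
have i4 := L2_Int (DL 4 (ltnW m5)).
have B4 := bessel hab N i4.1 i4.2; have B5 := bessel hab N i5.1 i5.2.
have := LE 4 (ltnW m5); have := LE 5 m5.
rewrite !L2normsqE ?i4.2 ?i5.2// !lee_fin => l5 l4.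
apply: (@le_trans _ _ (K + K)); last by lra.
apply: le_trans (lerD (le_trans B4 l4) (le_trans B5 l5)).
rewrite nrm_sqr// !mulr_sumr -big_split/=; apply: ler_sum => i _.
have E4 : nc (fc (D 4) (freq N i)) = nc (((mu (freq N i)) ^+ 4)%:C * fc u (freq N i)).
  rewrite fcE// (ncM _ (fc u _)) (ncM _ (fc u _)); congr (_ * _).
  rewrite exprMn -rmorphXn/= (ncM _ (_%:C)) (_ : 'i%C ^+ 4 = 1) ?nc1 ?mul1r//.
  by rewrite (exprM _ 2 2) sqr_i sqrrN expr1n.
have E5 : nc (fc (D 5) (freq N i)) = `|mu (freq N i)| * nc (fc (D 4) (freq N i)).
  by rewrite h5 (ncM _ (fc _ _)) (ncM 'i%C) nci ncR mul1r.
rewrite E5 E4 /wgt; move: (mu _) (nc _) => p q.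
by rewrite exprMn real_normK ?num_real// le_eqVlt; apply/orP; left; apply/eqP; ring.
Qed.

Lemma near_Hnorm T m (u : R -> R -> R[i]) t0 (r : R) : 0 < r ->
  C0_Hper a b T m u -> 0 <= t0 <= T ->
  exists2 d, 0 < d & forall t, 0 <= t <= T -> `|t - t0| < d ->
   (Hnorm a b m (fun x => (u t x - u t0 x)%R) < r%:E)%E.
Proof.
move=> r0 [_ uc] t0T; have := uc t0 t0T => /(_ [set y | (y < r%:E)%E]).
have H : nbhs 0%E [set y : \bar R | (y < r%:E)%E].
  by apply: open_nbhs_nbhs; split; [exact: open_ereal_lt_ereal|rewrite /= lte_fin].
move=> /(_ H); rewrite /nbhs/= /within/= => -[d /= d0 dP]; exists d => // t tT td.
by apply: dP; rewrite /= ?in_itv// distrC.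
Qed.

(** The essential bound holds at times arbitrarily close to [t]; continuity in
    time with values in H^m carries it over to [t], up to the additive
    constants. *)
Lemma Reg_of_C0 T m (u : R -> R -> R[i]) (K : R) : 0 < T -> (5 <= m)%N ->
  C0_Hper a b T m u -> (LinfH a b T m u <= K%:E)%E ->
  forall t, 0 <= t <= T -> exists D, Reg (4 * (K + 1) ^+ 2 + 4) (u t) D.
Proof.
move=> T0 m5 uC /ess_supP h t0 t0T.
have [d d0 dP] := near_Hnorm ltr01 uC t0T.
have /andP[t00 t0T'] := t0T.
pose x := Num.max 0 (t0 - d); pose y := Num.min T (t0 + d).
have xy : x < y by rewrite lt_min !gt_max; apply/andP; split; apply/andP; split; lra.
have [t /andP[xt ty] tP] := ae_point h xy.
move: xt ty; rewrite gt_max lt_min => /andP[t1 t2] /andP[t3 t4].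
have tT : 0 <= t <= T by rewrite !ltW.
have {}tP : (Hnorm a b m (u t) < (K + 1)%:E)%E.
  by move: tP; rewrite patchE mem_set ?in_itv//= => /le_lt_trans; apply; rewrite lte_fin ltrDl.
have td : `|t - t0| < d by rewrite ltr_norml; apply/andP; split; lra.
have [D1 [W1 B1]] := Hnorm_lt tP.
have [D2 [W2 B2]] := Hnorm_lt (dP t tT td).
have -> : 4 * (K + 1) ^+ 2 + 4 = 2 * (2 * (K + 1) ^+ 2 + 2 * 1 ^+ 2) by ring.
apply: (Reg_of_Hper m5); first exact: uC.1.
exists (fun k x => D1 k x - D2 k x); have [E1 L1 w1] := W1; have [E2 L2 w2] := W2; split.
  split.
  - by apply/funext => z; rewrite E1 E2 opprB addrC subrK.
  - by move=> k km; have [] := L2D (L1 k km) (L2 k km).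
  move=> k km; apply: weak_derivativeB; do ?[exact: w1|exact: w2].
  - exact: (L2_Int (L1 _ (ltnW km))).1.
  - exact: (L2_Int (L1 _ km)).1.
  - exact: (L2_Int (L2 _ (ltnW km))).1.
  - exact: (L2_Int (L2 _ km)).1.
move=> k km; have [_] := L2D (L1 k km) (L2 k km); move/le_trans; apply.
have -> : (2 * (K + 1) ^+ 2 + 2 * 1 ^+ 2)%:E = (2%:E * ((K + 1) ^+ 2)%:E + 2%:E * (1 ^+ 2)%:E)%E.
  by rewrite -!EFinM -EFinD.
by apply: (@leeD R); apply: lee_wpmul2l; rewrite ?lee_fin// ?B1// B2.
Qed.

(** By the Sobolev embedding, continuity in time for the H^1 norm implies
    continuity at each point of [[a, b]]. *)
Lemma sup_continuous T m (u : R -> R -> R[i]) x : (0 < m)%N ->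
  C0_Hper a b T m u -> (forall t, 0 <= t <= T -> exists g, C1p (u t) g) ->
  a <= x <= b -> ccontinuous_on `[0, T] (fun t => u t x).
Proof.
move=> m0 uC uD xab.
have key t0 e : 0 <= t0 <= T -> 0 < e -> exists2 d, 0 < d & forall t, 0 <= t <= T ->
    `|t - t0| < d -> nc (u t x - u t0 x) <= e.
  move=> t0T e0.
  pose r := e / Num.sqrt (Ksob a b + 1).
  have S0 : 0 < Num.sqrt (Ksob a b + 1).
    by rewrite sqrtr_gt0 ltr_wpDl// Ksob_ge0.
  have r0 : 0 < r by rewrite divr_gt0.
  have [d d0 dP] := near_Hnorm r0 uC t0T.
  exists d => // t tT td; have h := dP t tT td.
  have [g gD] := uD t tT; have [g' gD'] := uD t0 t0T.
  have [_ H] := H1sq_le hab (C1pB gD gD') (le_trans (Hnorm1_le_m _ m0) (ltW h)).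
  rewrite -ler_sqr ?nnegrE ?nc_ge0 ?(ltW e0)//.
  apply: (le_trans (sobolev hab (C1pB gD gD') xab)).
  apply: (@le_trans _ _ ((Ksob a b + 1) * r ^+ 2)).
    by rewrite ler_pM ?Ksob_ge0 ?H1sq_ge0// lerDl.
  have S2 : Num.sqrt (Ksob a b + 1) ^+ 2 = Ksob a b + 1.
    by rewrite sqr_sqrtr// addr_ge0// Ksob_ge0.
  rewrite /r expr_div_n S2 le_eqVlt; apply/orP; left; apply/eqP.
  by field; rewrite gt_eqF// -S2 exprn_gt0.
have cc (f : R[i] -> R) : (forall z w, `|f z - f w| <= nc (z - w)) ->
    rcont 0 T (fun t => f (u t x)).
  move=> hf; apply/subspace_continuousP => t0; rewrite /= in_itv/= => t0T.
  apply/cvgrPdist_le => e e0; have [d d0 dP] := key t0 e t0T e0.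
  rewrite /prop_near1 /within/=; exists d => //= t td; rewrite in_itv/= => tT.
  by apply: (le_trans (hf _ _)); rewrite -ncN opprB; apply: dP => //; rewrite distrC.
split; apply: cc => z w.
  by rewrite -cReN -cReD; exact: Re_le_nc.
by rewrite -cImN -cImD; exact: Im_le_nc.
Qed.

End regularity.

(** * Differentiation in time of Fourier coefficients *)

Section time_derivative.
Context {R : realType}.
Variables (a b : R).
Hypothesis hab : a < b.
Local Notation Int := (Int a b).
Local Notation fc := (fc a b).

Lemma lipschitz_rcont (T L : R) (f : R -> R) :
  (forall s t, 0 <= s <= T -> 0 <= t <= T -> `|f t - f s| <= L * `|t - s|) -> rcont 0 T f.
Proof.
move=> H; apply/subspace_continuousP => t0; rewrite /= in_itv/= => t0T.
have L0 : 0 <= `|L| + 1 by rewrite addr_ge0.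
apply/cvgrPdist_le => e e0; rewrite /prop_near1 /within/=.
exists (e / (`|L| + 1)) => /=; first by rewrite divr_gt0// ltr_wpDl.
move=> t td; rewrite in_itv/= => tT; rewrite distrC (le_trans (H t0 t t0T tT))//.
rewrite distrC; apply: (@le_trans _ _ ((`|L| + 1) * `|t0 - t|)).
  by rewrite ler_wpM2r// (le_trans (ler_norm L))// lerDl.
by rewrite mulrC -ler_pdivlMr ?ltr_wpDl// ltW.
Qed.

(** Differentiation under the integral sign, the domination being constant. *)
Lemma is_derive_RI (T : R) (f ft : R -> R -> R) (M : R) :
  (forall t, 0 < t < T -> rint a b (f t)) ->
  (forall t x, 0 < t < T -> a < x < b -> is_derive t 1 (f ^~ x) (ft t x)) ->
  (forall t x, 0 < t < T -> a < x < b -> `|ft t x| <= M) ->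
  forall t, 0 < t < T -> is_derive t 1 (fun t => RI a b (f t)) (RI a b (ft t)).
Proof.
move=> fi fd fM t tT.
have M0 : 0 <= M.
  have xab : a < (a + b) / 2 < b by have [-> ->] := midf_lt hab.
  exact: le_trans (normr_ge0 _) (fM t _ tT xab).
have I t' : `]0, T[%classic t' -> 0 < t' < T by rewrite /= in_itv.
have B x : `]a, b[%classic x -> a < x < b by rewrite /= in_itv.
have p t' x : 0 < t' < T -> a < x < b -> partial1of2 f t' x = ft t' x.
  move=> h1 h2; rewrite /partial1of2 derive1E.
  by rewrite (@derive_val _ _ _ _ _ _ _ (fd t' x h1 h2)).
have It : `]0, T[%classic t by rewrite /= in_itv.
have iM : (@leb R).-integrable `]a, b[ (EFin \o (fun=> M)) := rint_cst a b M.
have h1 x : `]0, T[%classic x -> (@leb R).-integrable `]a, b[ (EFin \o f x).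
  by move=> /I; exact: fi.
have h2 x y : `]0, T[%classic x -> `]a, b[%classic y -> derivable (f ^~ y) x 1.
  by move=> /I hx /B hy; exact: (@ex_derive _ _ _ _ _ _ _ (fd x y hx hy)).
have h3 x y : `]0, T[%classic x -> `]a, b[%classic y -> `|partial1of2 f x y| <= M.
  by move=> /I hx /B hy; rewrite p// fM.
have mD : measurable (`]a, b[%classic : set (measurableTypeR R)) := mDoo a b.
have d1 := @derivable_under_integral R _ _ leb f _ mD t 0 T It h1 h2 _ (fun=> M0) iM h3.
have d2 := @differentiation_under_integral R _ _ leb f _ mD t 0 T It h1 h2 _ (fun=> M0) iM h3.
split; first exact: d1.
rewrite -derive1E; etransitivity; first exact: d2.
by apply: eq_RI => x xab; exact: p.
Qed.

(** Inside [(0, T)] the derivative passes under the integral sign. At the end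
    points only continuity is known: the bound on the time derivative makes
    [t |-> g t x] Lipschitz up to them, uniformly in [x]. *)
Lemma fc_time (T : R) (g gt : R -> R -> R[i]) (M : R) (l : int) : 0 < T ->
  (forall t, 0 <= t <= T -> Int (g t)) ->
  (forall x, a < x < b -> ccontinuous_on `[0, T] (fun t => g t x)) ->
  (forall t x, 0 < t < T -> a < x < b -> cdif (fun t => g t x) t (gt t x)) ->
  (forall t x, 0 < t < T -> a < x < b -> nc (gt t x) <= M) ->
  ccontinuous_on `[0, T] (fun t => fc (g t) l) /\
  (forall t, 0 < t < T -> cdif (fun t => fc (g t) l) t (fc (gt t) l)).
Proof.
move=> T0 gI gc gd gM.
have Igl t : 0 <= t <= T -> Int (fun x => g t x * em a b (- l) x).
  by move=> tT; apply: IntM; [exact: gI|exact: ccont_em].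
have der t x : 0 < t < T -> a < x < b ->
    cdif (fun t => g t x * em a b (- l) x) t (gt t x * em a b (- l) x).
  move=> tT xab; have := cdifM (gd t x tT xab) (cdif_cst (em a b (- l) x) t).
  by rewrite mulr0 addr0.
have bnd t x : 0 < t < T -> a < x < b -> nc (gt t x * em a b (- l) x) <= M.
  by move=> tT xab; rewrite ncM nc_em mulr1 gM.
have cT t : 0 < t < T -> 0 <= t <= T by move=> /andP[/ltW -> /ltW ->].
split.
  have M0 : 0 <= M.
    have xab : a < (a + b) / 2 < b by have [-> ->] := midf_lt hab.
    have tT : 0 < T / 2 < T by have := midf_lt T0; rewrite add0r => -[-> ->].
    exact: le_trans (nc_ge0 _) (gM _ _ tT xab).
  have lip x s t : a < x < b -> 0 <= s -> s <= t -> t <= T ->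
      nc (g t x - g s x) <= 2 * M * `|t - s|.
    move=> xab s0 st tT; have [c1 c2] := gc x xab.
    have in1 z : s < z < t -> 0 < z < T.
      by move=> /andP[sz zt]; rewrite (le_lt_trans s0 sz) (lt_le_trans zt tT).
    have st0 : 0 <= t - s by rewrite subr_ge0.
    rewrite (le_trans (nc_le_ReIm _))// -mulrA mulr_natl mulr2n (ger0_norm st0).
    have P (f df : R -> R) : rcont 0 T f ->
      (forall z, s < z < t -> is_derive z 1 f (df z)) -> (forall z, s < z < t -> `|df z| <= M) ->
      `|f t - f s| <= M * (t - s).
      move=> cf fd fM; have [->|st'] := eqVneq s t; first by rewrite !subrr normr0 mulr0.
      have st2 : s < t by rewrite lt_neqAle st'.
      have fd' z : z \in `]s, t[%R -> is_derive z 1 f (df z) by rewrite in_itv/=; exact: fd.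
      have [z zst ->] := MVT st2 fd' (rcontS s0 tT cf).
      rewrite normrM (ger0_norm st0) ler_wpM2r// fM//; by rewrite in_itv/= in zst.
    apply: lerD.
      rewrite cReD cReN; apply: (P _ (fun z => complex.Re (gt z x)) c1) => z zst.
        by have [] := gd z x (in1 z zst) xab.
      exact: le_trans (Re_le_nc _) (gM _ _ (in1 z zst) xab).
    rewrite cImD cImN; apply: (P _ (fun z => complex.Im (gt z x)) c2) => z zst.
      by have [] := gd z x (in1 z zst) xab.
    exact: le_trans (Im_le_nc _) (gM _ _ (in1 z zst) xab).
  have lip2 s t : 0 <= s <= T -> 0 <= t <= T ->
      nc (fc (g t) l - fc (g s) l) <= (4 * M) * `|t - s|.
    wlog st : s t / s <= t => [H sT tT|/andP[s0 sT] /andP[t0 tT]].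
      have [st|/ltW ts] := leP s t; first exact: H.
      by rewrite -ncN opprB distrC; exact: H.
    have is' : Int (g s) by apply: gI; rewrite s0.
    have it' : Int (g t) by apply: gI; rewrite t0.
    rewrite -fcB// /fc.
    have iB : Int (fun x => (g t x - g s x) * em a b (- l) x).
      by apply: IntM; [apply: IntD => //; exact: IntN|exact: ccont_em].
    rewrite ncM ncR; apply: (@le_trans _ _ (`|(b - a)^-1| * (2 * (2 * M * `|t - s|) * (b - a)))).
      rewrite ler_wpM2l// (nc_J hab iB)// => x xab.
      by rewrite ncM nc_em mulr1 lip.
    rewrite ger0_norm ?invr_ge0 ?subr_ge0 ?(ltW hab)// le_eqVlt; apply/orP; left; apply/eqP.
    by field; rewrite subr_eq0 gt_eqF.
  split; apply: (@lipschitz_rcont _ (4 * M)) => s t sT tT.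
    apply: le_trans (lip2 s t sT tT); apply: le_trans (Re_le_nc _).
    by rewrite cReD cReN.
  apply: le_trans (lip2 s t sT tT); apply: le_trans (Im_le_nc _).
  by rewrite cImD cImN.
move=> t tT.
have dJ : cdif (fun t => J a b (fun x => g t x * em a b (- l) x)) t
    (J a b (fun x => gt t x * em a b (- l) x)).
  split; rewrite JE/=.
    apply: (@is_derive_RI T (fun t x => complex.Re (g t x * em a b (- l) x))
      (fun t x => complex.Re (gt t x * em a b (- l) x)) M) => //.
    - by move=> s /cT sT; have [] := Igl s sT.
    - by move=> s x sT xab; have [] := der s x sT xab.
    by move=> s x sT xab; exact: le_trans (Re_le_nc _) (bnd _ _ sT xab).
  apply: (@is_derive_RI T (fun t x => complex.Im (g t x * em a b (- l) x))
    (fun t x => complex.Im (gt t x * em a b (- l) x)) M) => //.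
  - by move=> s /cT sT; have [] := Igl s sT.
  - by move=> s x sT xab; have [] := der s x sT xab.
  by move=> s x sT xab; exact: le_trans (Im_le_nc _) (bnd _ _ sT xab).
exact: cdifZ dJ.
Qed.

End time_derivative.

(** * Products of smooth functions *)

Section products.
Context {R : realType}.
Variables (a b : R).
Hypothesis hab : a < b.
Implicit Types (u w g : R -> R[i]) (D E : nat -> R -> R[i]) (K L : R).
Local Notation C1p := (C1p a b).
Local Notation mu := (mu a b).
Local Notation fc := (fc a b).
Local Notation H1sq := (H1sq a b).
Local Notation nrm := (nrm a b).

Definition Ka : R := 4 * Ksob a b.

Lemma Ka_ge0 : 0 <= Ka. Proof. by rewrite mulr_ge0// Ksob_ge0. Qed.

Lemma H1sqM_le u g w k K L : C1p u g -> C1p w k -> H1sq u g <= K -> H1sq w k <= L ->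
  H1sq (fun x => u x * w x) (fun x => g x * w x + u x * k x) <= Ka * K * L.
Proof.
move=> hu hw hK hL; apply: (le_trans (H1sqM hab hu hw)).
have := H1sq_ge0 a b u g; have := H1sq_ge0 a b w k => w0 u0.
by apply: ler_pM => //; [rewrite mulr_ge0 ?Ka_ge0|rewrite ler_wpM2l ?Ka_ge0].
Qed.

Lemma nrm_sqrt c (M : R) N : nrm N c ^+ 2 <= M -> nrm N c <= Num.sqrt M.
Proof.
move=> h; have n0 : 0 <= nrm N c by exact: nrm_ge0.
by rewrite -[nrm N c]ger0_norm// -sqrtr_sqr ler_wsqrtr.
Qed.

Lemma nrm_fc_le u g K N : C1p u g -> H1sq u g <= K -> nrm N (fc u) ^+ 2 <= K.
Proof. by move=> hu; apply: le_trans; exact: bessel_H1. Qed.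

(** Three derivatives in H^1, enough to bound the coefficients weighted by
    [mu^2] in [nrm], and stable under products. *)
Record C3 K u D : Prop := MkC3 {
  C30 : D 0%N = u;
  C3C1p : forall k, (k < 3)%N -> C1p (D k) (D k.+1);
  C3H1 : forall k, (k < 3)%N -> H1sq (D k) (D k.+1) <= K }.

Lemma Reg_C3 K u D : Reg a b K u D -> C3 K u D.
Proof.
by move=> [h0 h1 h2 _]; split => // k k3; [apply: h1|apply: h2]; rewrite ltnW.
Qed.

Lemma Reg_K0 K u D : Reg a b K u D -> 0 <= K.
Proof. by move=> [_ _ h2 _]; apply: le_trans (h2 0%N isT); exact: H1sq_ge0. Qed.

Lemma fc_deriv2 u u1 u2 l : C1p u u1 -> C1p u1 u2 -> fc u2 l = - ((mu l ^+ 2)%:C * fc u l).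
Proof.
move=> h1 h2; rewrite (fc_deriv hab l h2) (fc_deriv hab l h1) rmorphXn/=.
move: (fc u l) ((mu l)%:C) => z m.
have -> : 'i%C * m * ('i%C * m * z) = 'i%C ^+ 2 * (m ^+ 2 * z) by ring.
by rewrite sqr_i mulN1r.
Qed.

Lemma nrm_mu2 u u1 u2 u3 N K : C1p u u1 -> C1p u1 u2 -> C1p u2 u3 -> H1sq u2 u3 <= K ->
  nrm N (fun l => (mu l ^+ 2)%:C * fc u l) ^+ 2 <= K.
Proof.
move=> h1 h2 h3; apply: le_trans; apply: le_trans (bessel_H1 hab N h3).
rewrite -(nrmN a b N (fun l => _)) le_eqVlt; apply/orP; left; apply/eqP; congr (_ ^+ 2).
by apply: eq_nrm => k; rewrite (fc_deriv2 _ h1 h2).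
Qed.

Lemma C3_nrm K u D N : C3 K u D -> nrm N (fc u) ^+ 2 <= K /\
  nrm N (fun l => (mu l ^+ 2)%:C * fc u l) ^+ 2 <= K.
Proof.
move=> [<- h1 h2]; split.
  exact: nrm_fc_le (h1 0%N isT) (h2 0%N isT).
exact: nrm_mu2 (h1 0%N isT) (h1 1%N isT) (h1 2%N isT) (h2 2%N isT).
Qed.

(** The second derivative of the product is in H^1 by the product rule, applied
    twice. *)
Lemma C3_prod K L u w D E N : C3 K u D -> C3 L w E ->
  nrm N (fc (fun x => u x * w x)) ^+ 2 <= Ka * K * L /\
  nrm N (fun l => (mu l ^+ 2)%:C * fc (fun x => u x * w x) l) ^+ 2 <= 22 * (Ka * K * L).
Proof.
move=> [<- p1 p2] [<- q1 q2].
have M i j (hi : (i < 3)%N) (hj : (j < 3)%N) := C1pM (p1 i hi) (q1 j hj).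
have B i j (hi : (i < 3)%N) (hj : (j < 3)%N) :=
  H1sqM_le (p1 i hi) (q1 j hj) (p2 i hi) (q2 j hj).
split; first exact: nrm_fc_le (M 0%N 0%N isT isT) (B 0%N 0%N isT isT).
have m0 := M 0%N 0%N isT isT; have m10 := M 1%N 0%N isT isT; have m01 := M 0%N 1%N isT isT.
have m20 := M 2%N 0%N isT isT; have m11 := M 1%N 1%N isT isT; have m02 := M 0%N 2%N isT isT.
have b20 := B 2%N 0%N isT isT; have b11 := B 1%N 1%N isT isT; have b02 := B 0%N 2%N isT isT.
have m1 := C1pD m10 m01.
have m2 := C1pD (C1pD m20 (C1pZ 2 m11)) m02.
have m1' : C1p (fun x => D 1%N x * E 0%N x + D 0%N x * E 1%N x)
   (fun x => D 2%N x * E 0%N x + 2 * (D 1%N x * E 1%N x) + D 0%N x * E 2%N x).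
  by move: m1; congr C1p; apply/funext => x; ring.
apply: (nrm_mu2 N m0 m1' m2).
apply: (le_trans (H1sqD (C1pD m20 (C1pZ 2 m11)) m02)).
have s1 := H1sqD m20 (C1pZ 2 m11); have s2 := H1sqZ 2 m11.
have n2 : nc (2 : R[i]) = 2.
  by rewrite (_ : 2 = (2 : R)%:C) ?ncR ?ger0_norm// rmorph_nat.
rewrite n2 in s2; move: s1; rewrite s2 => s1; lra.
Qed.

Lemma C3Z z K u D : C3 K u D -> C3 (nc z ^+ 2 * K) (fun x => z * u x) (fun k x => z * D k x).
Proof.
move=> [h0 h1 h2]; split.
- by rewrite h0.
- by move=> k k3; apply: C1pZ; exact: h1.
by move=> k k3; rewrite (H1sqZ _ (h1 k k3)) ler_wpM2l ?sqr_ge0// h2.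
Qed.

Lemma C3D K L u w D E : C3 K u D -> C3 L w E ->
  C3 (2 * K + 2 * L) (fun x => u x + w x) (fun k x => D k x + E k x).
Proof.
move=> [<- p1 p2] [<- q1 q2]; split => // k k3.
  by apply: C1pD; [exact: p1|exact: q1].
apply: (le_trans (H1sqD (p1 k k3) (q1 k k3))).
by rewrite lerD// ler_wpM2l ?p2 ?q2.
Qed.

Lemma C3J K u D : C3 K u D -> C3 K (fun x => conjc (u x)) (fun k x => conjc (D k x)).
Proof.
move=> [<- p1 p2]; split => // k k3; first by apply: C1pJ; exact: p1.
by rewrite H1sqJ p2.
Qed.

End products.

Section derivatives.
Context {R : realType}.

Lemma cdif_cderive (f : R -> R[i]) x d : cdif f x d -> cderive f x = d.
Proof.
move=> [h1 h2]; apply: complex_eq => /=; rewrite derive1E;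
  by rewrite (@derive_val _ _ _ _ _ _ _ h1) || rewrite (@derive_val _ _ _ _ _ _ _ h2).
Qed.

Lemma cderivable_cdif (f : R -> R[i]) x : cderivable f x -> cdif f x (cderive f x).
Proof. by move=> [h1 h2]; split; rewrite /= derive1E; split. Qed.

Lemma near_eq_cdif (f g : R -> R[i]) x d : (\near x, f x = g x) -> cdif f x d -> cdif g x d.
Proof.
move=> fg [h1 h2]; split.
  by apply: (near_eq_is_derive _ h1); apply: filterS fg => y ->.
by apply: (near_eq_is_derive _ h2); apply: filterS fg => y ->.
Qed.

Lemma near_itv_oo (a b x : R) (P : R -> Prop) : a < x < b -> (forall y, a < y < b -> P y) ->
  \near x, P x.
Proof.
move=> xab h; have : x \in `]a, b[ by rewrite in_itv.
by move/near_in_itvoo; apply: filterS => y; rewrite in_itv/= => /h.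
Qed.

End derivatives.

(** * The equations satisfied by the Fourier coefficients *)

Section pde.
Context {R : realType}.
Variables (a b T eps K : R).
Hypothesis hab : a < b.
Hypothesis hT : 0 < T.
Hypothesis heps : 0 < eps <= 1.
Variables (psi : R -> R -> R[i]) (phi phit : R -> R -> R).
Variables (Dpsi Dphi Dphit : R -> nat -> R -> R[i]).
Hypothesis Rpsi : forall t, 0 <= t <= T -> Reg a b K (psi t) (Dpsi t).
Hypothesis Rphi : forall t, 0 <= t <= T -> Reg a b K (fun x => (phi t x)%:C) (Dphi t).
Hypothesis Rphit : forall t, 0 <= t <= T ->
  Reg a b (K / eps ^+ 4) (fun x => (phit t x)%:C) (Dphit t).
Hypothesis cpsi : forall x, a <= x <= b -> ccontinuous_on `[0, T] (psi ^~ x).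
Hypothesis cphi : forall x, a <= x <= b -> ccontinuous_on `[0, T] (fun t => (phi t x)%:C).
Hypothesis cphit : forall x, a <= x <= b -> ccontinuous_on `[0, T] (fun t => (phit t x)%:C).
Variables (psi0 : R -> R[i]) (phi0 phi1 : R -> R).
Hypothesis sol : solves a b T psi0 phi0 phi1 eps psi phi phit.

Local Notation mu := (mu a b).
Local Notation fc := (fc a b).
Local Notation H1sq := (H1sq a b).
Local Notation nrm := (nrm a b).
Local Notation C1p := (C1p a b).
Local Notation Ka := (Ka a b).
Implicit Types (t s x : R) (l : int) (N : nat).

Definition psi_hat t l := fc (psi t) l.
Definition phi_hat t l := fc (fun x => (phi t x)%:C) l.
Definition phit_hat t l := fc (fun x => (phit t x)%:C) l.
Definition coupling_hat t l := fc (fun x => (phi t x)%:C * psi t x) l.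
Definition density_hat t l := fc (fun x => psi t x * conjc (psi t x)) l.

Let e0 : 0 < eps. Proof. by case/andP: heps. Qed.
Let e1 : eps <= 1. Proof. by case/andP: heps. Qed.
Let oc t : 0 < t < T -> 0 <= t <= T.
Proof. by move=> /andP[/ltW -> /ltW ->]. Qed.
Let xoc x : a < x < b -> a <= x <= b.
Proof. by move=> /andP[/ltW -> /ltW ->]. Qed.

(** The time derivative of [psi], read off from its equation. *)
Definition psit t x : R[i] := 'i%C * (Dpsi t 2%N x + (phi t x)%:C * psi t x).
(** The second time derivative of [phi], read off from its equation. *)
Definition phitt t x : R[i] := ((eps ^+ 2)^-1)%:C *
  (Dphi t 2%N x - ((eps ^+ 2)^-1)%:C * (phi t x)%:C + psi t x * conjc (psi t x)).

Lemma d2_of_Reg L (u : R -> R[i]) D x : Reg a b L u D -> a < x < b ->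
  cderive (cderive u) x = D 2%N x.
Proof.
move=> [h0 h1 _ _] xab; apply: cdif_cderive.
apply: near_eq_cdif (C1p_d (h1 1%N isT) xab).
apply: (near_itv_oo xab) => y yab; apply/esym/cdif_cderive.
by have := C1p_d (h1 0%N isT) yab; rewrite h0.
Qed.

Lemma psi_t t x : 0 < t < T -> a < x < b -> cdif (psi ^~ x) t (psit t x).
Proof.
move=> tT xab; have [h1 _ _] := sol; have [d1 _ _ eq] := h1 t x tT xab.
have := cderivable_cdif d1; congr cdif.
rewrite (d2_of_Reg (Rpsi (oc tT)) xab) in eq.
move: eq; set z := cderive _ _; rewrite /psit => eq.
have : 'i%C * z = - (Dpsi t 2%N x + (phi t x)%:C * psi t x).
  by apply/eqP; rewrite -addr_eq0 addrA eq.
move/(congr1 (fun w => - 'i%C * w)); rewrite mulrA mulNr -expr2 sqr_i opprK mul1r => ->.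
by rewrite mulrN mulNr opprK.
Qed.

Lemma phi_t t x : 0 < t < T -> a < x < b ->
  cdif (fun t => (phi t x)%:C) t (phit t x)%:C.
Proof.
move=> tT xab; have [_ h2 _] := sol; have [d1 _ _ _ _] := h2 t x tT xab.
by split => //=; exact: rder_cst.
Qed.

Lemma phi_tt t x : 0 < t < T -> a < x < b ->
  cdif (fun t => (phit t x)%:C) t (phitt t x).
Proof.
move=> tT xab; have [_ h2 _] := sol; have [_ d2 _ _ eq] := h2 t x tT xab.
have E : phitt t x = (derive1 (phit ^~ x) t)%:C.
  rewrite /phitt -(d2_of_Reg (Rphi (oc tT)) xab) mulcJ.
  have -> : cderive (cderive (fun x => (phi t x)%:C)) x = (derive1 (derive1 (phi t)) x)%:C.
    rewrite /cderive/=; apply: complex_eq => //=.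
    by rewrite (_ : (fun y => derive1 (fun=> 0) y) = cst 0) ?derive1_cst//;
      apply/funext => y; rewrite derive1_cst.
  rewrite -rmorphM -rmorphB -rmorphD -rmorphM; congr real_complex_def.
  have en : eps ^+ 2 != 0 by rewrite expf_neq0// gt_eqF.
  move: eq; set A := derive1 _ t; set B := derive1 _ x; set C := nc _ ^+ 2 => eq.
  apply: (mulfI en); rewrite mulrA mulfV// mul1r; lra.
rewrite E; split => /=; last exact: rder_cst.
by rewrite derive1E; split.
Qed.

(** One constant for all the coefficient sequences of this part; the numbers
    leave room for the sums of products that arise. *)
Definition mode_bound_sq : R := 2 * K + 100 * (Ka * K ^+ 2) + 2 * (Ka * K * (2 * K + 2 * (Ka * K ^+ 2))).
Definition mode_bound : R := Num.sqrt mode_bound_sq.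

Let K0 : 0 <= K.
Proof. by apply: Reg_K0 (Rpsi (t := 0) _); rewrite lexx ltW. Qed.
Let KK : 0 <= Ka * K ^+ 2. Proof. by rewrite mulr_ge0 ?sqr_ge0//; exact: Ka_ge0. Qed.
Let KKK : 0 <= Ka * K * (2 * K + 2 * (Ka * K ^+ 2)).
Proof.
apply: mulr_ge0; first by apply: mulr_ge0; [exact: Ka_ge0|exact: K0].
by have := KK; have := K0; lra.
Qed.

Lemma mode_bound_sq_ge0 : 0 <= mode_bound_sq.
Proof. by rewrite /mode_bound_sq; have := KK; have := KKK; have := K0; lra. Qed.
Lemma mode_bound_ge0 : 0 <= mode_bound. Proof. exact: sqrtr_ge0. Qed.

Lemma le_mode_bound N (c : int -> R[i]) : nrm N c ^+ 2 <= mode_bound_sq -> nrm N c <= mode_bound.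
Proof. exact: nrm_sqrt. Qed.

Lemma Reg_ex L (u : R -> R[i]) D : Reg a b L u D -> C1p u (D 1%N) /\ H1sq u (D 1%N) <= L.
Proof. by move=> [<- h1 h2 _]; split; [exact: (h1 0%N)|exact: (h2 0%N)]. Qed.

Lemma nrm_psi_hat t N : 0 <= t <= T -> [/\ nrm N (psi_hat t) <= mode_bound,
  nrm N (fun l => (mu l ^+ 2)%:C * psi_hat t l) <= mode_bound &
  nrm N (fun l => (mu l ^+ 4)%:C * psi_hat t l) <= mode_bound].
Proof.
move=> tT; have RR := Rpsi tT; have [h1 h2] := C3_nrm hab N (Reg_C3 RR).
have KB : K <= mode_bound_sq by rewrite /mode_bound_sq; have := KK; have := KKK; have := K0; lra.
split; apply: le_mode_bound; apply: le_trans KB => //; exact: (Reg5 RR).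
Qed.

Lemma nrm_coupling_hat t N : 0 <= t <= T -> nrm N (coupling_hat t) <= mode_bound /\
  nrm N (fun l => (mu l ^+ 2)%:C * coupling_hat t l) <= mode_bound.
Proof.
move=> tT; have [h1 h2] := C3_prod hab N (Reg_C3 (Rphi tT)) (Reg_C3 (Rpsi tT)).
have := KK; have := KKK; have := K0 => q1 q2 q3.
by split; apply: le_mode_bound; [apply: le_trans h1 _|apply: le_trans h2 _];
  rewrite -mulrA -expr2 /mode_bound_sq; lra.
Qed.

Lemma nrm_density_hat t N : 0 <= t <= T -> nrm N (density_hat t) <= mode_bound.
Proof.
move=> tT; have [h1 h2] := C3_prod hab N (Reg_C3 (Rpsi tT)) (C3J (Reg_C3 (Rpsi tT))).
have := KK; have := KKK; have := K0 => q1 q2 q3.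
by apply: le_mode_bound; apply: le_trans h1 _; rewrite -mulrA -expr2 /mode_bound_sq; lra.
Qed.

Lemma C1p_psit t : 0 <= t <= T -> exists k, C1p (psit t) k /\
  H1sq (psit t) k <= 2 * K + 2 * (Ka * K ^+ 2).
Proof.
move=> tT; have RR := Rpsi tT.
have [c1 b1] := Reg_ex RR; have [c2 b2] := Reg_ex (Rphi tT).
have c3 := RegC1p RR (k := 2) isT; have b3 := RegH1 RR (k := 2) isT.
have m := C1pM c2 c1; have bm := H1sqM_le hab c2 c1 b2 b1.
have s := C1pD c3 m; have bs := H1sqD c3 m.
eexists; split; first exact: (C1pZ 'i%C s).
rewrite (H1sqZ _ s) nci expr1n mul1r; apply: (le_trans bs).
by rewrite lerD// ler_wpM2l// expr2 mulrA.
Qed.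

(** The time derivative of [phi psi], of order [eps^-2] because of [phit]. *)
Definition coupling_t t x : R[i] := (phit t x)%:C * psi t x + (phi t x)%:C * psit t x.

Lemma C1p_coupling_t t : 0 <= t <= T -> exists k, C1p (coupling_t t) k /\
  H1sq (coupling_t t) k <= mode_bound_sq / eps ^+ 4.
Proof.
move=> tT.
have [c1 b1] := Reg_ex (Rpsi tT); have [c2 b2] := Reg_ex (Rphi tT).
have [c3 b3] := Reg_ex (Rphit tT); have [k [c4 b4]] := C1p_psit tT.
have m1 := C1pM c3 c1; have bm1 := H1sqM_le hab c3 c1 b3 b1.
have m2 := C1pM c2 c4; have bm2 := H1sqM_le hab c2 c4 b2 b4.
eexists; split; first exact: (C1pD m1 m2).
apply: (le_trans (H1sqD m1 m2)).
have i4 : 1 <= (eps ^+ 4)^-1 by rewrite invf_ge1 ?exprn_gt0// exprn_ile1// ltW.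
have E : Ka * (K / eps ^+ 4) * K = Ka * K ^+ 2 * (eps ^+ 4)^-1 by ring.
rewrite E in bm1.
apply: (@le_trans _ _ ((2 * (Ka * K ^+ 2) + 2 * (Ka * K * (2 * K + 2 * (Ka * K ^+ 2)))) / eps ^+ 4)).
  have h := ler_peMr KKK i4.
  rewrite [leRHS]mulrDl; apply: lerD; first by rewrite -mulrA ler_wpM2l.
  by rewrite -mulrA ler_wpM2l// (le_trans bm2).
rewrite ler_wpM2r// ?invr_ge0 ?exprn_ge0 ?(ltW e0)// /mode_bound_sq.
have := KK; have := K0; lra.
Qed.

Definition coupling_hat_t t l := fc (coupling_t t) l.

Lemma nrm_coupling_hat_t t N : 0 <= t <= T -> nrm N (coupling_hat_t t) <= mode_bound / eps ^+ 2.
Proof.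
move=> tT; have [k [c h]] := C1p_coupling_t tT.
have := nrm_sqrt (nrm_fc_le hab N c h); rewrite sqrtrM ?mode_bound_sq_ge0// => H.
apply: (le_trans H); rewrite ler_wpM2l ?mode_bound_ge0//.
by rewrite (exprM _ 2 2) -exprVn sqrtr_sqr ger0_norm// invr_ge0 exprn_ge0// ltW.
Qed.

Lemma C1p_sup u k M x : C1p u k -> H1sq u k <= M -> a < x < b ->
  nc (u x) <= Num.sqrt (Ksob a b * M).
Proof.
move=> hu hM xab.
have h := le_trans (sobolev hab hu (xoc xab)) (ler_wpM2l (Ksob_ge0 hab) hM).
have M0 : 0 <= Ksob a b * M by apply: le_trans h; exact: sqr_ge0.
by rewrite -ler_sqr ?nnegrE ?nc_ge0 ?sqrtr_ge0// sqr_sqrtr.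
Qed.

Lemma psi_hat_time l : ccontinuous_on `[0, T] (psi_hat ^~ l) /\
  forall t, 0 < t < T ->
    cdif (psi_hat ^~ l) t ('i%C * (- ((mu l ^+ 2)%:C * psi_hat t l) + coupling_hat t l)).
Proof.
have H := @fc_time _ a b hab T psi psit (Num.sqrt (Ksob a b * (2 * K + 2 * (Ka * K ^+ 2)))) l hT.
have [||||h1 h2] := H.
- by move=> t tT; have [[/ccont_Int]] := Reg_ex (Rpsi tT).
- by move=> x /xoc; exact: cpsi.
- by move=> t x; exact: psi_t.
- by move=> t x /oc tT xab; have [k [c h]] := C1p_psit tT; exact: C1p_sup c h xab.
split => // t tT; have := h2 t tT; congr cdif.
have RR := Rpsi (oc tT); have [c1 b1] := Reg_ex RR; have [c2 b2] := Reg_ex (Rphi (oc tT)).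
have i1 : Int a b (Dpsi t 2%N) := ccont_Int (C1p_c0 (RegC1p RR (k := 2) isT)).
have i2 : Int a b (fun x => (phi t x)%:C * psi t x) := ccont_Int (C1p_c0 (C1pM c2 c1)).
rewrite /psit fcZ//; last exact: IntD.
rewrite fcD// /psi_hat /coupling_hat; congr ('i%C * (_ + _)).
rewrite -[psi t](Reg0 RR).
exact: (fc_deriv2 hab l (RegC1p RR (k := 0) isT) (RegC1p RR (k := 1) isT)).
Qed.

Lemma coupling_hat_time l : ccontinuous_on `[0, T] (coupling_hat ^~ l) /\
  forall t, 0 < t < T -> cdif (coupling_hat ^~ l) t (coupling_hat_t t l).
Proof.
have H := @fc_time _ a b hab T (fun t x => (phi t x)%:C * psi t x) coupling_t
  (Num.sqrt (Ksob a b * (mode_bound_sq / eps ^+ 4))) l hT.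
apply: H.
- move=> t tT; have [c1 b1] := Reg_ex (Rpsi tT); have [c2 b2] := Reg_ex (Rphi tT).
  exact: ccont_Int (C1p_c0 (C1pM c2 c1)).
- by move=> x /xoc xab; apply: (@ccontM _ 0 T); [exact: cphi|exact: cpsi].
- by move=> t x tT xab; apply: cdifM; [exact: phi_t|exact: psi_t].
- by move=> t x /oc tT xab; have [k [c h]] := C1p_coupling_t tT; exact: C1p_sup c h xab.
Qed.

Lemma phi_hat_time l : ccontinuous_on `[0, T] (phi_hat ^~ l) /\
  forall t, 0 < t < T -> cdif (phi_hat ^~ l) t (phit_hat t l).
Proof.
have H := @fc_time _ a b hab T (fun t x => (phi t x)%:C) (fun t x => (phit t x)%:C)
  (Num.sqrt (Ksob a b * (K / eps ^+ 4))) l hT.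
apply: H.
- by move=> t tT; have [[/ccont_Int]] := Reg_ex (Rphi tT).
- by move=> x /xoc xab; exact: cphi.
- by move=> t x tT xab; exact: phi_t.
- by move=> t x /oc tT xab; have [c h] := Reg_ex (Rphit tT); exact: C1p_sup c h xab.
Qed.

Lemma omega_sqr l : omega a b eps l ^+ 2 = (eps ^+ 2)^-1 * (mu l ^+ 2 + (eps ^+ 2)^-1).
Proof.
rewrite /omega exprMn sqr_sqrtr; last by rewrite addr_ge0// mulr_ge0 ?sqr_ge0.
by field; rewrite gt_eqF.
Qed.

Lemma phit_hat_time l : ccontinuous_on `[0, T] (phit_hat ^~ l) /\
  forall t, 0 < t < T -> cdif (phit_hat ^~ l) t
   (- ((omega a b eps l ^+ 2)%:C * phi_hat t l) + ((eps ^+ 2)^-1)%:C * density_hat t l).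
Proof.
set z2 := ((eps ^+ 2)^-1)%:C.
have ci t : 0 <= t <= T -> C1p (phitt t) (fun x => z2 * (Dphi t 3%N x - z2 * Dphi t 1%N x
    + (Dpsi t 1%N x * conjc (psi t x) + psi t x * conjc (Dpsi t 1%N x)))) /\
    H1sq (phitt t) (fun x => z2 * (Dphi t 3%N x - z2 * Dphi t 1%N x
    + (Dpsi t 1%N x * conjc (psi t x) + psi t x * conjc (Dpsi t 1%N x)))) <=
    nc z2 ^+ 2 * (2 * (2 * K + 2 * (nc z2 ^+ 2 * K)) + 2 * (Ka * K * K)).
  move=> tT; have RR := Rpsi tT; have RP := Rphi tT.
  have [c1 b1] := Reg_ex RR; have [c2 b2] := Reg_ex RP.
  have c3 := RegC1p RP (k := 2) isT; have b3 := RegH1 RP (k := 2) isT.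
  have m := C1pM c1 (C1pJ c1); have bJ := H1sqJ a b (psi t) (Dpsi t 1%N).
  have b1' : H1sq (fun x => conjc (psi t x)) (fun x => conjc (Dpsi t 1%N x)) <= K by rewrite bJ.
  have bm := H1sqM_le hab c1 (C1pJ c1) b1 b1'.
  have zc := C1pZ z2 c2; have bz := H1sqZ z2 c2.
  have s1 := C1pB c3 zc; have bs1 := H1sqB c3 zc.
  have s := C1pD s1 m; have bs := H1sqD s1 m.
  split; first exact: C1pZ.
  rewrite (H1sqZ _ s) ler_wpM2l ?sqr_ge0//; apply: (le_trans bs).
  rewrite lerD ?ler_wpM2l//; apply: (le_trans bs1).
  by rewrite lerD ?ler_wpM2l// bz ler_wpM2l ?sqr_ge0.
have H := @fc_time _ a b hab T (fun t x => (phit t x)%:C) phitt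
  (Num.sqrt (Ksob a b * (nc z2 ^+ 2 * (2 * (2 * K + 2 * (nc z2 ^+ 2 * K)) + 2 * (Ka * K * K))))) l hT.
have [||||h1 h2] := H.
- by move=> t tT; have [[/ccont_Int]] := Reg_ex (Rphit tT).
- by move=> x /xoc; exact: cphit.
- by move=> t x; exact: phi_tt.
- by move=> t x /oc tT xab; have [c h] := ci t tT; exact: C1p_sup c h xab.
split => // t tT; have := h2 t tT; congr cdif.
have RP := Rphi (oc tT); have [c1 b1] := Reg_ex (Rpsi (oc tT)); have [c2 b2] := Reg_ex RP.
have i1 : Int a b (Dphi t 2%N) := ccont_Int (C1p_c0 (RegC1p RP (k := 2) isT)).
have i2 : Int a b (fun x => (phi t x)%:C) := ccont_Int (C1p_c0 c2).
have i3 : Int a b (fun x => psi t x * conjc (psi t x)) := ccont_Int (C1p_c0 (C1pM c1 (C1pJ c1))).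
have i4 : Int a b (fun x => Dphi t 2%N x - z2 * (phi t x)%:C) by apply: IntD => //; apply/IntN/IntZ.
rewrite /phitt -/z2 fcZ//; last exact: IntD.
rewrite fcD// fcB//; last exact: IntZ.
rewrite fcZ// -/(phi_hat t l) -/(density_hat t l).
have -> : fc (Dphi t 2%N) l = - ((mu l ^+ 2)%:C * phi_hat t l).
  rewrite /phi_hat -[fun x => (phi t x)%:C](Reg0 RP).
  exact: (fc_deriv2 hab l (RegC1p RP (k := 0) isT) (RegC1p RP (k := 1) isT)).
rewrite omega_sqr (_ : ((eps ^+ 2)^-1 * _)%:C = z2 * ((mu l ^+ 2)%:C + z2)); first by ring.
by rewrite rmorphM -rmorphD.
Qed.

Lemma ccont_sub (u : R -> R[i]) t0 t1 : 0 <= t0 -> t1 <= T -> ccontinuous_on `[0, T] u ->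
  ccontinuous_on `[t0, t1] u.
Proof. by move=> h0 h1 [c1 c2]; split; [exact: rcontS c1|exact: rcontS c2]. Qed.

Lemma in_sub t0 t1 t : 0 <= t0 -> t1 <= T -> t0 < t < t1 -> 0 < t < T.
Proof. by move=> h0 h1 /andP[t0t tt1]; rewrite (le_lt_trans h0) ?(lt_le_trans tt1). Qed.

(** The time derivative of [psi_hat]: its equation, in Fourier variables. *)
Definition psi_hat_t t l := 'i%C * (- ((mu l ^+ 2)%:C * psi_hat t l) + coupling_hat t l).

Lemma nrm_iZ N (c : int -> R[i]) : nrm N (fun l => 'i%C * c l) = nrm N c.
Proof.
by apply/le_anti/andP; split; apply: nrm_le1 => // k; rewrite ncM nci mul1r.
Qed.

Lemma nrm_psi_hat_t t N : 0 <= t <= T -> nrm N (psi_hat_t t) <= 2 * mode_bound.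
Proof.
move=> tT; have [_ h1 _] := nrm_psi_hat N tT; have [h2 _] := nrm_coupling_hat N tT.
rewrite nrm_iZ (le_trans (nrmD _ hab _ _))// mulr_natl mulr2n lerD//.
by rewrite (nrmN a b N (fun l => _)).
Qed.

Definition psi_hat_tt t l := 'i%C * (- ((mu l ^+ 2)%:C * psi_hat_t t l) + coupling_hat_t t l).

Lemma inv_eps2_ge1 : 1 <= (eps ^+ 2)^-1.
Proof. by rewrite invf_ge1 ?exprn_gt0// exprn_ile1// ltW. Qed.

Lemma nrm_psi_hat_tt t N : 0 <= t <= T -> nrm N (psi_hat_tt t) <= 3 * mode_bound / eps ^+ 2.
Proof.
move=> tT; have [_ _ h1] := nrm_psi_hat N tT; have [_ h2] := nrm_coupling_hat N tT.
have h3 := nrm_coupling_hat_t N tT; have B0 := mode_bound_ge0; have i1 := inv_eps2_ge1.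
rewrite nrm_iZ (le_trans (nrmD _ hab _ _))// (nrmN a b N (fun l => _)).
have h : nrm N (fun l => (mu l ^+ 2)%:C * psi_hat_t t l) <= 2 * mode_bound.
  rewrite (@eq_nrm _ a b N _ (fun l => 'i%C * (- ((mu l ^+ 4)%:C * psi_hat t l) + (mu l ^+ 2)%:C * coupling_hat t l))).
    rewrite nrm_iZ (le_trans (nrmD _ hab _ _))// mulr_natl mulr2n lerD//.
    by rewrite (nrmN a b N (fun l => _)).
  move=> k; rewrite /psi_hat_t; move: (mu _) (psi_hat _ _) (coupling_hat _ _) => m x y.
  by rewrite (_ : m ^+ 4 = m ^+ 2 * m ^+ 2) ?rmorphM/=; ring.
have := ler_peMr B0 i1; move: h h3; rewrite -!mulrA; move: (mode_bound / _) => z; lra.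
Qed.

Lemma psi_hat_lip t0 s N : 0 <= t0 -> 0 <= s -> t0 + s <= T ->
  nrm N (fun l => psi_hat (t0 + s) l - psi_hat t0 l) <= 2 * mode_bound * s.
Proof.
move=> h0 s0 h1; have -> : 2 * mode_bound * s = 2 * mode_bound * (t0 + s - t0) by ring.
apply: (nrm_mvt hab (F := psi_hat) (dF := psi_hat_t)); first by rewrite lerDl.
- by move=> k; exact: ccont_sub (psi_hat_time _).1.
- by move=> k t /(in_sub h0 h1) tT; exact: (psi_hat_time _).2.
- by move=> t /(in_sub h0 h1) /oc tT; exact: nrm_psi_hat_t.
Qed.

Lemma psi_hat_t_time l : ccontinuous_on `[0, T] (psi_hat_t ^~ l) /\
  forall t, 0 < t < T -> cdif (psi_hat_t ^~ l) t (psi_hat_tt t l).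
Proof.
have [c1 d1] := psi_hat_time l; have [c2 d2] := coupling_hat_time l; split.
  apply: (@ccontM _ 0 T); first exact: (@ccont_cst _ 0 T).
  apply: (@ccontD _ 0 T) => //; apply: (@ccontN _ 0 T); apply: (@ccontM _ 0 T) => //.
  exact: (@ccont_cst _ 0 T).
move=> t tT; rewrite /psi_hat_t; apply: cdifZ; apply: cdifD; last exact: d2.
by apply: cdifN; apply: cdifZ; exact: d1.
Qed.

Lemma psi_hat_t_lip t0 s N : 0 <= t0 -> 0 <= s -> t0 + s <= T ->
  nrm N (fun l => psi_hat_t (t0 + s) l - psi_hat_t t0 l) <= 3 * mode_bound / eps ^+ 2 * s.
Proof.
move=> h0 s0 h1; have -> : 3 * mode_bound / eps ^+ 2 * s = 3 * mode_bound / eps ^+ 2 * (t0 + s - t0) by ring.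
apply: (nrm_mvt hab (F := psi_hat_t) (dF := psi_hat_tt)); first by rewrite lerDl.
- by move=> k; exact: ccont_sub (psi_hat_t_time _).1.
- by move=> k t /(in_sub h0 h1) tT; exact: (psi_hat_t_time _).2.
- by move=> t /(in_sub h0 h1) /oc tT; exact: nrm_psi_hat_tt.
Qed.

(** The derivative of [psi_hat] is Lipschitz in time with a constant of order
    [eps^-2], by [nrm_psi_hat_tt]; integrate once more. *)
Lemma psi_hat_taylor t0 s N : 0 <= t0 -> 0 <= s -> t0 + s <= T ->
  nrm N (fun l => psi_hat (t0 + s) l - psi_hat t0 l - s%:C * psi_hat_t t0 l) <= 3 * mode_bound * (s ^+ 2 / eps ^+ 2).
Proof.
move=> h0 s0 h1.
have -> : 3 * mode_bound * (s ^+ 2 / eps ^+ 2) = 3 * mode_bound / eps ^+ 2 * s * (t0 + s - t0) by ring.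
pose G t l := psi_hat t l - (t - t0)%:C * psi_hat_t t0 l.
rewrite (@eq_nrm _ a b N _ (fun l => G (t0 + s) l - G t0 l)); last first.
  by move=> k; rewrite /G subrr mul0r subr0 (addrC t0) addrK addrAC.
apply: (nrm_mvt hab (F := G) (dF := fun t l => psi_hat_t t l - psi_hat_t t0 l)); first by rewrite lerDl.
- move=> k; apply: (@ccontD _ t0 (t0 + s)); first exact: ccont_sub (psi_hat_time _).1.
  apply: (@ccontN _ t0 (t0 + s)); apply: (@ccontM _ t0 (t0 + s)); last exact: ccont_cst.
  split => /=; last exact: rcont_cst.
  by apply: rcontT => x; apply: cvgB; [exact: cvg_id|exact: cvg_cst].
- move=> k t /(in_sub h0 h1) tT; apply: cdifB; first exact: (psi_hat_time _).2.
  rewrite -[X in cdif _ _ X](_ : 1 * psi_hat_t t0 (freq N k) + (t - t0)%:C * 0 = _); last by rewrite mulr0 addr0 mul1r.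
  apply: cdifM; last exact: cdif_cst.
  split => /=; last exact: rder_cst.
  by apply: rder_eq (rderB (rder_id t) (rder_cst t t0)) _; rewrite subr0.
- move=> t tt; have /andP[tt0 tt1] := tt.
  have -> : t = t0 + (t - t0) by ring.
  apply: (le_trans (psi_hat_t_lip N h0 _ _)).
  + by rewrite subr_ge0 ltW.
  + by rewrite addrC subrK (le_trans (ltW tt1)).
  + by rewrite ler_wpM2l ?mulr_ge0 ?mode_bound_ge0 ?invr_ge0 ?exprn_ge0 ?(ltW e0)// lerBlDl ltW.
Qed.

Lemma omega_ge l : (eps ^+ 2)^-1 <= omega a b eps l.
Proof.
rewrite /omega ler_peMr ?invr_ge0 ?exprn_ge0 ?(ltW e0)//.
by rewrite -[leLHS]sqrtr1 ler_wsqrtr// lerDl mulr_ge0 ?sqr_ge0.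
Qed.

Lemma omega_gt0 l : 0 < omega a b eps l.
Proof. by apply: lt_le_trans (omega_ge l); rewrite invr_gt0 exprn_gt0. Qed.

Lemma cdif_cos (w t0 t : R) : cdif (fun t => (cos (w * (t - t0)))%:C) t (- (w * sin (w * (t - t0))))%:C.
Proof.
have [h _] := cdif_expi w t0 t; split => /=; last exact: rder_cst.
by apply: (rder_eq h) => /=; ring.
Qed.

Lemma cdif_sin (w t0 t : R) : cdif (fun t => (sin (w * (t - t0)))%:C) t (w * cos (w * (t - t0)))%:C.
Proof.
have [_ h] := cdif_expi w t0 t; split => /=; last exact: rder_cst.
by apply: (rder_eq h) => /=; ring.
Qed.

Lemma cdif_eq (u : R -> R[i]) t p q : cdif u t p -> p = q -> cdif u t q.
Proof. by move=> h <-. Qed.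

(** Rotating by the free flow removes the stiff part of the equation of the
    modes of [phi]; what is left is the slow source [density_hat / eps^2]. *)
Definition rotA t0 t l :=
  (cos (omega a b eps l * (t - t0)))%:C * phi_hat t l
  - ((omega a b eps l)^-1)%:C * ((sin (omega a b eps l * (t - t0)))%:C * phit_hat t l).
Definition rotB t0 t l :=
  (omega a b eps l)%:C * ((sin (omega a b eps l * (t - t0)))%:C * phi_hat t l)
  + (cos (omega a b eps l * (t - t0)))%:C * phit_hat t l.

Lemma rotA_time t0 t l : 0 < t < T -> cdif (fun t => rotA t0 t l) t
  (- ((sin (omega a b eps l * (t - t0)) / (omega a b eps l * eps ^+ 2))%:C * density_hat t l)).
Proof.
move=> tT; have := (phi_hat_time l).2 t tT; have := (phit_hat_time l).2 t tT; have := omega_gt0 l.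
rewrite /rotA; move: (omega a b eps l) => w w0 dg df.
apply: cdif_eq.
  apply: cdifB; first exact: (cdifM (cdif_cos w t0 t) df).
  exact: (cdifZ _ (cdifM (cdif_sin w t0 t) dg)).
rewrite /=; move: (phi_hat t l) (phit_hat t l) (density_hat t l) (cos _) (sin _) => x y z c s.
rewrite !(rmorphM, rmorphN, rmorphXn, fmorphV)/=.
have : w%:C != 0 by rewrite fmorph_eq0 gt_eqF.
have : eps%:C != 0 by rewrite fmorph_eq0 gt_eqF.
by move: (w%:C) (eps%:C) (c%:C) (s%:C) => W E C S En Wn; field; rewrite En Wn.
Qed.

Lemma rotB_time t0 t l : 0 < t < T -> cdif (fun t => rotB t0 t l) t
  ((cos (omega a b eps l * (t - t0)) / eps ^+ 2)%:C * density_hat t l).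
Proof.
move=> tT; have := (phi_hat_time l).2 t tT; have := (phit_hat_time l).2 t tT; have := omega_gt0 l.
rewrite /rotB; move: (omega a b eps l) => w w0 dg df.
apply: cdif_eq.
  apply: cdifD; first exact: (cdifZ _ (cdifM (cdif_sin w t0 t) df)).
  exact: (cdifM (cdif_cos w t0 t) dg).
rewrite /=; move: (phi_hat t l) (phit_hat t l) (density_hat t l) (cos _) (sin _) => x y z c s.
rewrite !(rmorphM, rmorphN, rmorphXn, fmorphV)/=.
have : eps%:C != 0 by rewrite fmorph_eq0 gt_eqF.
by move: (w%:C) (eps%:C) (c%:C) (s%:C) => W E C S En; field; rewrite En.
Qed.

Lemma rot_cont t0 t1 l : 0 <= t0 -> t1 <= T ->
  ccontinuous_on `[t0, t1] (fun t => rotA t0 t l) /\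
  ccontinuous_on `[t0, t1] (fun t => rotB t0 t l).
Proof.
move=> h0 h1; have cf := ccont_sub h0 h1 (phi_hat_time l).1; have cg := ccont_sub h0 h1 (phit_hat_time l).1.
have cc : ccont t0 t1 (fun t => (cos (omega a b eps l * (t - t0)))%:C).
  exact: cdif_ccont (cdif_cos _ _).
have cs : ccont t0 t1 (fun t => (sin (omega a b eps l * (t - t0)))%:C).
  exact: cdif_ccont (cdif_sin _ _).
have ck z : ccont t0 t1 (fun=> z) := ccont_cst t0 t1 z.
split.
  apply: (@ccontD _ t0 t1); first exact: (ccontM cc cf).
  exact: (ccontN (ccontM (ck _) (ccontM cs cg))).
apply: (@ccontD _ t0 t1); last exact: (ccontM cc cg).
exact: (ccontM (ck _) (ccontM cs cf)).
Qed.

(** Duhamel's formula, written without an integral: the mean value inequality is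
    applied to the two rotated unknowns. The factor [M] multiplies the source in
    both of them, either from the sine in the derivative of [rotA] or from the
    sine in front of [rotB]. *)
Lemma phi_hat_duhamel t0 s N M : 0 <= t0 -> 0 <= s -> t0 + s <= T -> 0 <= M ->
  (forall l x, 0 <= x <= s -> `|sin (omega a b eps l * x) / (omega a b eps l * eps ^+ 2)| <= M) ->
  nrm N (fun l => phi_hat (t0 + s) l - ((cos (omega a b eps l * s))%:C * phi_hat t0 l +
      (sin (omega a b eps l * s) / omega a b eps l)%:C * phit_hat t0 l)) <= 2 * M * mode_bound * s.
Proof.
move=> h0 s0 h1 M0 hM.
pose c l := (cos (omega a b eps l * s))%:C.
pose d l := (sin (omega a b eps l * s) / omega a b eps l)%:C.
rewrite (@eq_nrm _ a b N _ (fun l => c l * (rotA t0 (t0 + s) l - rotA t0 t0 l) +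
   (d l * rotB t0 (t0 + s) l - d l * rotB t0 t0 l))); last first.
  move=> k; rewrite /c /d /rotA /rotB subrr mulr0 cos0 sin0 (addrC t0 s) addrK.
  have := omega_gt0 (freq N k); move: (omega a b eps _) => w w0.
  have h : (cos (w * s))%:C ^+ 2 + (sin (w * s))%:C ^+ 2 = 1 :> R[i].
    by rewrite -!rmorphXn -rmorphD/= cos2Dsin2.
  move: (phi_hat _ _) (phit_hat _ _) h => x y; move: (phi_hat _ _) (phit_hat _ _) => x' y'.
  rewrite !(rmorphM, fmorphV, rmorph1, rmorph0)/=.
  have : w%:C != 0 by rewrite fmorph_eq0 gt_eqF.
  move: (w%:C) ((cos _)%:C) ((sin _)%:C) => W C S Wn h.
  transitivity ((C ^+ 2 + S ^+ 2) * x - (C * x' + S / W * y)); last by field.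
  by rewrite h mul1r.
have -> : 2 * M * mode_bound * s = M * mode_bound * (t0 + s - t0) + M * mode_bound * (t0 + s - t0) by ring.
rewrite (le_trans (nrmD _ hab _ _))// lerD//.
  rewrite -[leRHS]mul1r; apply: (@le_trans _ _ (1 * nrm N (fun l => rotA t0 (t0 + s) l - rotA t0 t0 l))).
    apply: (nrm_le hab) => // k; rewrite ncM ler_wpM2r ?nc_ge0// /c ncR.
    by rewrite cos_max.
  rewrite !mul1r.
  apply: (nrm_mvt hab (F := rotA t0) (dF := fun t l =>
    - ((sin (omega a b eps l * (t - t0)) / (omega a b eps l * eps ^+ 2))%:C * density_hat t l))).
  + by rewrite lerDl.
  + by move=> k; exact: (rot_cont _ h0 h1).1.
  + by move=> k t /(in_sub h0 h1) tT; exact: rotA_time.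
  + move=> t tt; have tT := oc (in_sub h0 h1 tt); rewrite (nrmN a b N (fun l => _)).
    apply: (@le_trans _ _ (M * nrm N (density_hat t))).
      apply: (nrm_le hab) => // k; rewrite ncM ncR ler_wpM2r ?nc_ge0//; apply: hM.
      by case/andP: tt => q1 q2; rewrite subr_ge0 lerBlDl !ltW.
    by rewrite ler_wpM2l// nrm_density_hat.
apply: (nrm_mvt hab (F := fun t l => d l * rotB t0 t l) (dF := fun t l =>
  d l * ((cos (omega a b eps l * (t - t0)) / eps ^+ 2)%:C * density_hat t l))).
- by rewrite lerDl.
- move=> k; apply: (@ccontM _ t0 (t0 + s)); first exact: ccont_cst.
  exact: (rot_cont _ h0 h1).2.
- by move=> k t /(in_sub h0 h1) tT; apply: cdifZ; exact: rotB_time.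
- move=> t tt; have tT := oc (in_sub h0 h1 tt).
  apply: (@le_trans _ _ (M * nrm N (density_hat t))); last by rewrite ler_wpM2l// nrm_density_hat.
  apply: (nrm_le hab) => // k; rewrite mulrA ncM ler_wpM2r ?nc_ge0// ncM /d !ncR.
  have := hM (freq N k) s; rewrite lexx s0 => /(_ isT); apply: le_trans.
  rewrite -normrM (_ : _ / _ * (cos _ / _) = sin (omega a b eps (freq N k) * s) / (omega a b eps (freq N k) * eps ^+ 2)
     * cos (omega a b eps (freq N k) * (t - t0))).
    by rewrite normrM ler_piMr ?normr_ge0 ?cos_max.
  have alg (x y w : R) : 0 < w -> x / w * (y / eps ^+ 2) = x / (w * eps ^+ 2) * y.
    by move=> w0; have ep := e0; field; rewrite !gt_eqF.
  exact: alg (omega_gt0 _).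
Qed.

(** The component of [phi] that oscillates like [e^(i t / eps^2)]; the scheme
    approximates it by [v0]. *)
Definition vx t x : R[i] := 2^-1 * ((phi t x)%:C - 'i%C * (eps ^+ 2)%:C * (phit t x)%:C).

Lemma nc2V : nc (2^-1 : R[i]) = 2^-1.
Proof.
by rewrite (_ : 2^-1 = (2^-1 : R)%:C) ?ncR ?ger0_norm ?invr_ge0// fmorphV rmorph_nat.
Qed.

(** The weight [eps^2] compensates for the size of [phit]. *)
Lemma vx_C3 t : 0 <= t <= T -> exists D, C3 a b K (vx t) D.
Proof.
move=> tT; have hp := Reg_C3 (Rphi tT); have ht := Reg_C3 (Rphit tT).
have h1 := C3Z (- ('i%C * (eps ^+ 2)%:C)) ht.
have h2 := C3Z 2^-1 (C3D hp h1).
rewrite nc2V ncN ncM nci mul1r ncR ger0_norm ?exprn_ge0 ?(ltW e0)// in h2.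
have E : 2^-1 ^+ 2 * (2 * K + 2 * ((eps ^+ 2) ^+ 2 * (K / eps ^+ 4))) = K.
  have ep := e0; field; by rewrite gt_eqF.
rewrite E in h2; eexists; move: h2; congr C3; apply/funext => x.
by rewrite /vx mulNr.
Qed.

Lemma vx_sum t x : vx t x + conjc (vx t x) = (phi t x)%:C.
Proof.
have -> : conjc (vx t x) = 2^-1 * ((phi t x)%:C + 'i%C * (eps ^+ 2)%:C * (phit t x)%:C).
  rewrite /vx !(conjcM, conjcD, conjcN, conjcR).
  have -> : conjc (2^-1 : R[i]) = 2^-1.
    by rewrite (_ : 2^-1 = (2^-1 : R)%:C) ?conjcR// fmorphV rmorph_nat.
  have -> : conjc ('i%C : R[i]) = - 'i%C by apply: complex_eq => //=; rewrite oppr0.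
  by rewrite !mulNr opprK.
rewrite /vx; move: ('i%C * _ * _) => z.
by field.
Qed.

End pde.

(** * Band-limited functions and aliasing *)

Section band_limited.
Context {R : realType}.
Variables (a b : R).
Hypothesis hab : a < b.
Local Notation C1p := (C1p a b).
Local Notation mu := (mu a b).
Local Notation em := (em a b).
Local Notation fc := (fc a b).
Local Notation H1sq := (H1sq a b).
Implicit Types (u w V W g k : R -> R[i]) (l m : int) (M N : nat).

(** Trigonometric polynomials of degree at most [M]. An inductive definition
    makes the stability under products immediate. *)
Inductive bl M : (R -> R[i]) -> Prop :=
| bl_em z m : `|m| <= M%:Z -> bl M (fun x => z * em m x)
| bl_add V W : bl M V -> bl M W -> bl M (fun x => V x + W x).

Lemma bl_ext M V W : V =1 W -> bl M V -> bl M W.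
Proof. by move=> /funext ->. Qed.

Lemma bl_zero M : bl M (fun=> 0).
Proof. by apply: bl_ext (@bl_em M 0 0 _) => [x|//]; rewrite mul0r. Qed.

Lemma bl_sum M n (c : nat -> R[i]) (m : nat -> int) :
  (forall k : nat, (k < n)%N -> `|m k| <= M%:Z) ->
  bl M (fun x => \sum_(k < n) c k * em (m k) x).
Proof.
elim: n => [|n IH] h.
  by apply: bl_ext (bl_zero M) => x; rewrite big_ord0.
apply: bl_ext (bl_add (IH _) (bl_em (c n) (h n (ltnSn n)))) => [x|k kn].
  by rewrite big_ord_recr.
by apply: h; rewrite ltnW.
Qed.

Lemma bl_mul M M' V W : bl M V -> bl M' W -> bl (M + M') (fun x => V x * W x).
Proof.
move=> hV; elim: hV W => [z m hm|V1 V2 _ IH1 _ IH2] W hW; last first.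
  apply: bl_ext (bl_add (IH1 _ hW) (IH2 _ hW)) => x; by rewrite mulrDl.
elim: hW => [z' m' hm'|W1 W2 _ IH1 _ IH2]; last first.
  apply: bl_ext (bl_add IH1 IH2) => x; by rewrite mulrDr.
apply: bl_ext (@bl_em _ (z * z') (m + m') _) => [x|]; last first.
  by rewrite (le_trans (ler_normD _ _))// PoszD lerD.
by rewrite emD mulrACA.
Qed.

Lemma bl_conj M V : bl M V -> bl M (fun x => conjc (V x)).
Proof.
elim=> [z m hm|V1 V2 _ IH1 _ IH2].
  apply: bl_ext (@bl_em _ (conjc z) (- m) _) => [x|]; last by rewrite normrN.
  by rewrite conjcM emN.
by apply: bl_ext (bl_add IH1 IH2) => x; rewrite conjcD.
Qed.

Lemma bl_scale M (z : R[i]) V : bl M V -> bl M (fun x => z * V x).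
Proof.
elim=> [w m hm|V1 V2 _ IH1 _ IH2].
  by apply: bl_ext (bl_em (z * w) hm) => x; rewrite mulrA.
by apply: bl_ext (bl_add IH1 IH2) => x; rewrite mulrDr.
Qed.

Lemma bl_ccont M V : bl M V -> ccont a b V.
Proof.
elim=> [z m _|V1 V2 _ c1 _ c2]; first by apply: (ccontM (ccont_cst a b z)); exact: ccont_em.
exact: ccontD c1 c2.
Qed.

Definition onnode N V : @grid R N := fun j => V (node a b N j).

(** Band-limited functions are not aliased: no two of the frequencies involved
    differ by a nonzero multiple of [N]. *)
Lemma dft_bl N M V l : (0 < N)%N -> bl M V -> `|l| + M%:Z < N%:Z ->
  dft a b (@onnode N V) l = fc V l.
Proof.
move=> N0 hV hl; elim: hV => [z m hm|V1 V2 h1 e1 h2 e2]; last first.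
  rewrite (dftD a b (@onnode N V1) (@onnode N V2)) e1 e2.
  by rewrite (fcD hab)//; apply: ccont_Int; [exact: bl_ccont h1|exact: bl_ccont h2].
rewrite (dftZ a b z (@onnode N (em m))) (fcZ hab); last exact/ccont_Int/ccont_em.
rewrite (fc_em hab) (dft_em hab N0)//.
by move: hl hm; rewrite ler_norml ltr_norml; lia.
Qed.

Lemma freq_le N (k : nat) : (k < N)%N -> ~~ odd N -> `|freq N k| <= (N./2)%:Z.
Proof. by move=> kN N2; clear hab; rewrite /freq; lia. Qed.

End band_limited.

Section near.
Context {R : realType}.
Variables (a b : R) (N M : nat).
Hypothesis hab : a < b.
Hypothesis N0 : (0 < N)%N.
Hypothesis Neven : ~~ odd N.
Hypothesis MN : (2 * M < N./2)%N.
Local Notation C1p := (C1p a b).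
Local Notation em := (em a b).
Local Notation fc := (fc a b).
Local Notation H1sq := (H1sq a b).
Local Notation nrm := (nrm a b N).
Local Notation dft := (@dft R a b N).
Local Notation onnode := (@onnode R a b N).
Implicit Types (u w V W g k du dw : R -> R[i]) (l m : int) (v z : @grid R N) (e : R).

Lemma dft_freq V (k : 'I_N) M' : (M' <= 2 * M)%N -> bl a b M' V ->
  dft (onnode V) (freq N k) = fc V (freq N k).
Proof.
move=> hM hV; apply: (dft_bl hab N0 hV).
have kN := ltn_ord k; have := freq_le kN Neven; lia.
Qed.

(** A grid function [v] is close to a function [u] when both are close, in
    H^1, to the same trigonometric polynomial of degree less than a quarter of
    [N]: products of two such polynomials are still resolved by the grid, so
    that closeness is stable under products and conjugation. *)
Definition near_grid u du v e : Prop := exists V g,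
  [/\ bl a b M V, C1p V g, C1p u du,
      H1sq (fun x => V x - u x) (fun x => g x - du x) <= e ^+ 2 &
      nrm (fun l => dft v l - fc V l) <= e].

Lemma near_ge0 u du v e : near_grid u du v e -> 0 <= e.
Proof. by move=> [V [g [_ _ _ _ h]]]; apply: le_trans h; exact: nrm_ge0. Qed.

Lemma nrm_fc_sub V g u du e : C1p V g -> C1p u du -> 0 <= e ->
  H1sq (fun x => V x - u x) (fun x => g x - du x) <= e ^+ 2 ->
  nrm (fun l => fc V l - fc u l) <= e.
Proof.
move=> hV hu h0 h; rewrite (@eq_nrm _ a b N _ (fc (fun x => V x - u x))); last first.
  by move=> k; rewrite fcB//; apply: ccont_Int; [exact: (C1p_c0 hV)|exact: (C1p_c0 hu)].
have := nrm_sqrt (nrm_fc_le hab N (C1pB hV hu) h).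
by rewrite sqrtr_sqr ger0_norm.
Qed.

Lemma near_nrm u du v e : near_grid u du v e -> nrm (fun l => dft v l - fc u l) <= 2 * e.
Proof.
move=> hh; have h0 := near_ge0 hh; have [V [g [_ cV cu h1 h2]]] := hh.
rewrite (le_trans (nrm_sub N hab _ (fc V) _))// mulr_natl mulr2n lerD//.
exact: nrm_fc_sub cV cu h0 h1.
Qed.

Lemma nrm_dft_sub v V M' : (M' <= 2 * M)%N -> bl a b M' V ->
  nrm (dft (fun j => v j - onnode V j)) = nrm (fun l => dft v l - fc V l).
Proof. by move=> hM hV; apply: eq_nrm => k; rewrite dftB (dft_freq _ hM hV). Qed.

Lemma near_conj u du v e : near_grid u du v e ->
  near_grid (fun x => conjc (u x)) (fun x => conjc (du x)) (fun j => conjc (v j)) (32 * e).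
Proof.
move=> hh; have h0 := near_ge0 hh; have [V [g [bV cV cu h1 h2]]] := hh.
exists (fun x => conjc (V x)), (fun x => conjc (g x)).
have e32 : e <= 32 * e by rewrite ler_peMl// ler1n.
split; [exact: bl_conj|exact: C1pJ|exact: C1pJ| |].
  apply: (@le_trans _ _ (e ^+ 2)); last by rewrite ler_sqr ?nnegrE// (le_trans h0).
  move: h1; rewrite -(H1sqJ a b (fun x => V x - u x)).
  by congr (H1sq _ _ <= _); apply/funext => x; rewrite conjcD conjcN.
rewrite -(nrm_dft_sub _ _ (bl_conj bV)); last by rewrite mulSn leq_addr.
have -> : (fun j => conjc (v j) - onnode (fun x => conjc (V x)) j) =
  (fun j => conjc (v j - onnode V j)).
  by apply/funext => j; rewrite conjcD conjcN.
apply: (le_trans (nrm_dft_conj hab N0 Neven _)); rewrite ler_wpM2l//.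
by rewrite (nrm_dft_sub _ _ bV)// mulSn leq_addr.
Qed.

(** The combination from which [v0] is obtained. *)
Lemma near_half u du v w dw z e : near_grid u du v e -> near_grid w dw z e ->
  near_grid (fun x => 2^-1 * (u x - 'i%C * w x)) (fun x => 2^-1 * (du x - 'i%C * dw x))
    (fun j => 2^-1 * (v j - 'i%C * z j)) e.
Proof.
move=> [V [g [bV cV cu h1 h2]]] [W [k [bW cW cw q1 q2]]].
exists (fun x => 2^-1 * (V x - 'i%C * W x)), (fun x => 2^-1 * (g x - 'i%C * k x)).
have iV := ccont_Int (C1p_c0 cV); have iW := ccont_Int (C1p_c0 cW).
split.
- apply: bl_scale; apply: bl_ext (bl_add bV (bl_scale (- 'i%C) bW)) => x.
  by rewrite mulNr.
- by apply/C1pZ/C1pB => //; exact: C1pZ.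
- by apply/C1pZ/C1pB => //; exact: C1pZ.
- have d1 := C1pB cV cu; have d2 := C1pZ 'i%C (C1pB cW cw).
  have E1 (x y x' y' : R[i]) : 2^-1 * (x - 'i%C * y) - 2^-1 * (x' - 'i%C * y') =
    2^-1 * ((x - x') - 'i%C * (y - y')) by ring.
  rewrite (_ : H1sq _ _ = H1sq (fun x => 2^-1 * ((V x - u x) - 'i%C * (W x - w x)))
     (fun x => 2^-1 * ((g x - du x) - 'i%C * (k x - dw x)))); last first.
    by congr H1sq; apply/funext => x; exact: E1.
  rewrite (H1sqZ _ (C1pB d1 d2)) nc2V.
  have := H1sqB d1 d2; rewrite (H1sqZ _ (C1pB cW cw)) nci expr1n mul1r.
  move: h1 q1; move: (H1sq _ _) (H1sq _ _) (H1sq _ _) => x y t; lra.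
- rewrite (@eq_nrm _ a b N _ (fun l => 2^-1 * ((dft v l - fc V l) - 'i%C * (dft z l - fc W l)))).
    apply: (@le_trans _ _ (2^-1 * nrm (fun l => (dft v l - fc V l) - 'i%C * (dft z l - fc W l)))).
      by apply: (nrm_le hab) => // i; rewrite ncM nc2V.
    have := nrmB N hab (fun l => dft v l - fc V l) (fun l => 'i%C * (dft z l - fc W l)).
    rewrite nrm_iZ//; move: h2 q2; move: (nrm _) (nrm _) (nrm _) => x y t; lra.
  move=> i; rewrite (dftZ a b _ (fun j => v j - 'i%C * z j)) (dftB a b v (fun j => 'i%C * z j)) dftZ.
  rewrite (fcZ hab); last by apply: IntD => //; apply/IntN/IntZ.
  rewrite (fcB hab)//; last exact: IntZ.
  rewrite (fcZ hab)//; move: (fc _ _) (fc _ _) => x y; ring.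
Qed.

Definition Cmul : R := 5 * Calg a b + Num.sqrt (40 * Ksob a b).

(** Both differences, [v z] with [V W] on the grid and [V W] with [u w] on the
    interval, are controlled because H^1 is an algebra, discrete or not; the
    coefficients of [V W] on the grid and on the interval are the same. *)
Lemma near_mul u du v w dw z e B : near_grid u du v e -> near_grid w dw z e ->
  H1sq u du <= B ^+ 2 -> H1sq w dw <= B ^+ 2 -> 0 <= B -> e <= B ->
  nrm (fun l => dft (fun j => v j * z j) l - fc (fun x => u x * w x) l) <= Cmul * B * e.
Proof.
move=> hh; have h0 := near_ge0 hh; case: hh => [V [g [bV cV cu h1 h2]]].
move=> [W [k [bW cW cw q1 q2]]] hu hw B0 eB.
have e2B : e ^+ 2 <= B ^+ 2 by rewrite ler_sqr ?nnegrE.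
have N4 (V0 g0 u0 du0 : R -> R[i]) : C1p V0 g0 -> C1p u0 du0 ->
  H1sq (fun x => V0 x - u0 x) (fun x => g0 x - du0 x) <= e ^+ 2 ->
  H1sq u0 du0 <= B ^+ 2 -> H1sq V0 g0 <= 4 * B ^+ 2.
  move=> c1 c2 e1 e2; have := H1sqD (C1pB c1 c2) c2.
  rewrite (_ : H1sq (fun x => _ + _) _ = H1sq V0 g0); last first.
    by congr H1sq; apply/funext => x; rewrite subrK.
  by move: e1 e2 e2B; move: (H1sq _ _) (H1sq _ _) (H1sq _ _) => x y t; lra.
have bV4 := N4 _ _ _ _ cV cu h1 hu; have bW4 := N4 _ _ _ _ cW cw q1 hw.
have nB (V0 g0 : R -> R[i]) : C1p V0 g0 -> H1sq V0 g0 <= 4 * B ^+ 2 -> nrm (fc V0) <= 2 * B.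
  move=> c1 e1; have := nrm_sqrt (nrm_fc_le hab N c1 e1).
  have -> : 4 * B ^+ 2 = (2 * B) ^+ 2 by ring.
  by rewrite sqrtr_sqr ger0_norm ?mulr_ge0.
have nV := nB _ _ cV bV4; have nW := nB _ _ cW bW4.
have nv : nrm (dft v) <= 3 * B.
  have := nrm_bound N hab (dft v) (fc V); move: h2 nV eB.
  by move: (nrm _) (nrm _) (nrm _) => x y t; lra.
have C0 := Calg_ge0 a b.
rewrite /Cmul (mulrDl _ _ B) (mulrDl _ _ e); apply: (le_trans (nrm_sub N hab _ (fc (fun x => V x * W x)) _)).
have M1 : (M <= 2 * M)%N by rewrite mulSn leq_addr.
apply: lerD.
  have bVW : bl a b (2 * M) (fun x => V x * W x).
    by have := bl_mul bV bW; rewrite mulSn mul1n.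
  rewrite -(nrm_dft_sub _ _ bVW)//.
  have -> : (fun j => v j * z j - onnode (fun x => V x * W x) j) =
    (fun j => v j * (z j - onnode W j) + (v j - onnode V j) * onnode W j).
    by apply/funext => j; rewrite (_ : onnode (fun x => V x * W x) j = onnode V j * onnode W j)//; ring.
  apply: (@le_trans _ _ (nrm (dft (fun j => v j * (z j - onnode W j)))
     + nrm (dft (fun j => (v j - onnode V j) * onnode W j)))).
    rewrite (@eq_nrm _ a b N _ (fun l => dft (fun j => v j * (z j - onnode W j)) l +
       dft (fun j => (v j - onnode V j) * onnode W j) l)); first exact: nrmD.
    by move=> i; rewrite dftD.
  apply: (@le_trans _ _ (Calg a b * (3 * B) * e + Calg a b * e * (2 * B))); last first.
    by rewrite le_eqVlt; apply/orP; left; apply/eqP; ring.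
  apply: lerD; apply: (le_trans (nrm_dftM hab N0 Neven _ _)).
    rewrite (nrm_dft_sub _ M1 bW); apply: ler_pM => //; rewrite ?mulr_ge0 ?nrm_ge0//.
    by rewrite ler_wpM2l.
  rewrite (nrm_dft_sub _ M1 bV).
  have -> : nrm (dft (onnode W)) = nrm (fc W) by apply: eq_nrm => i; rewrite (dft_freq _ M1 bW).
  by apply: ler_pM => //; rewrite ?mulr_ge0 ?nrm_ge0// ler_wpM2l.
have S0 := Ksob_ge0 hab.
apply: (nrm_fc_sub (C1pM cV cW) (C1pM cu cw)).
  by rewrite !mulr_ge0 ?sqrtr_ge0.
have d1 := C1pM cV (C1pB cW cw); have d2 := C1pM (C1pB cV cu) cw.
have := H1sqD d1 d2; rewrite (_ : H1sq (fun x => _ * (_ - _) + _ * _) _ =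
  H1sq (fun x => V x * W x - u x * w x) (fun x => g x * W x + V x * k x - (du x * w x + u x * dw x))); last first.
  by congr H1sq; apply/funext => x; ring.
move=> hd; apply: (le_trans hd).
have e1 := H1sqM_le hab cV (C1pB cW cw) bV4 q1.
have e2 := H1sqM_le hab (C1pB cV cu) cw h1 hw.
rewrite !exprMn sqr_sqrtr ?mulr_ge0//.
move: e1 e2; rewrite /Ka; move: (Ksob _ _) (H1sq _ _) (H1sq _ _) => x y t; nra.
Qed.

End near.

(** * Coefficients of the scheme *)

Section coefficients.
Context {R : realType}.
Variables (a b eps tau : R).
Hypothesis hab : a < b.
Hypothesis heps : 0 < eps <= 1.
Hypothesis htau : 0 < tau.
Implicit Types (l : int) (s x : R) (sg : R).
Local Notation mu := (mu a b).
Local Notation omega := (omega a b eps).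
Local Notation coef_a := (coef_a a b eps).

Let e0 : 0 < eps. Proof. by case/andP: heps. Qed.
Let e1 : eps <= 1. Proof. by case/andP: heps. Qed.
Let e2 : 0 < eps ^+ 2. Proof. by rewrite exprn_gt0. Qed.

Lemma cRD x y : (x + y)%:C = x%:C + y%:C :> R[i].
Proof. by apply: complex_eq => /=; rewrite ?addr0. Qed.
Lemma cRN x : (- x)%:C = - x%:C :> R[i].
Proof. by apply: complex_eq => /=; rewrite ?oppr0. Qed.
Lemma cRM x y : (x * y)%:C = x%:C * y%:C :> R[i].
Proof. by rewrite rmorphM. Qed.
Lemma cRV x : (x^-1)%:C = (x%:C)^-1 :> R[i].
Proof. by rewrite fmorphV. Qed.
Lemma cR_nat n : (n%:R)%:C = n%:R :> R[i].
Proof. by rewrite rmorph_nat. Qed.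

Lemma RI_cc x y (u : R -> R) : rcont x y u ->
  \int[leb]_(z in `[x, y]) u z = RI x y u.
Proof.
move=> cu; have mu := rcont_meas cu; rewrite /RI /Rintegral; congr fine.
rewrite -[RHS](@integral_itv_bndoo _ x y (EFin \o u) true false)//.
exact/measurable_EFinP.
Qed.

Lemma cint_cc x y (u : R -> R[i]) : ccont x y u -> cint `[x, y] u = J x y u.
Proof. by move=> [c1 c2]; apply: complex_eq => /=; rewrite RI_cc. Qed.

Lemma ccont_expiM (k : R) x y : ccont x y (fun th => expi (k * th)).
Proof.
apply: cdif_ccont => z; have := cdif_expi k 0 z.
by rewrite subr0; under eq_fun do rewrite subr0; apply.
Qed.

Lemma coef_c_le sg l : nc (coef_c a b eps tau sg l) <= 2 * tau.
Proof.
rewrite /coef_c cint_cc; last exact: ccont_expiM.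
rewrite !ncM nci nc_expi !mul1r.
have -> : 2 * tau = 2 * 1 * (tau - 0) by ring.
apply: nc_J; [exact: htau|exact/ccont_Int/ccont_expiM|].
by move=> x _; rewrite nc_expi.
Qed.

Lemma coef_d_le sg l : nc (coef_d a b eps tau sg l) <= 2 * tau ^+ 2.
Proof.
have cx : ccont 0 tau (fun th : R => th%:C).
  by split => /=; [apply: rcontT => x; exact: cvg_id|exact: rcont_cst].
have cc k : ccont 0 tau (fun th => th%:C * expi (k * th)) := ccontM cx (ccont_expiM k 0 tau).
rewrite /coef_d cint_cc; last exact: cc.
rewrite !ncM nci nc_expi !mul1r.
have -> : 2 * tau ^+ 2 = 2 * tau * (tau - 0) by ring.
apply: nc_J; [exact: htau|exact/ccont_Int/cc|].
move=> x /andP[x0 xt]; rewrite ncM nc_expi mulr1 ncR ger0_norm ?ltW//.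
Qed.

(** Replace both exponentials by 1: the error is first order in the phases
    [mu^2 tau] and [(mu^2 + sg / eps^2) tau]. *)
Lemma coef_c_approx sg l : `|sg| = 1 ->
  nc ('i%C * tau%:C - coef_c a b eps tau sg l) <= 8 * tau ^+ 2 * (mu l ^+ 2 + (eps ^+ 2)^-1).
Proof.
move=> hsg; rewrite /coef_c cint_cc; last exact: ccont_expiM.
set k := mu l ^+ 2 + sg / eps ^+ 2; set I := J _ _ _; set E := expi _.
have hk : `|k| <= mu l ^+ 2 + (eps ^+ 2)^-1.
  rewrite (le_trans (ler_normD _ _))// ger0_norm ?sqr_ge0// lerD2l.
  by rewrite normrM hsg mul1r ger0_norm// invr_ge0 ltW.
have m0 : 0 <= mu l ^+ 2 by exact: sqr_ge0.
have hI : nc I <= 2 * tau.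
  have -> : 2 * tau = 2 * 1 * (tau - 0) by ring.
  apply: nc_J; [exact: htau|exact/ccont_Int/ccont_expiM|].
  by move=> x _; rewrite nc_expi.
have hI1 : nc (tau%:C - I) <= 4 * `|k| * tau ^+ 2.
  have i1 : Int 0 tau (fun=> 1 : R[i]) := ccont_Int (ccont_cst 0 tau 1).
  have i2 : Int 0 tau (fun th => expi (k * th)) := ccont_Int (ccont_expiM k 0 tau).
  have -> : tau%:C - I = - J 0 tau (fun th => expi (k * th) - 1).
    by rewrite JB// J_cst// subr0 mulr1 opprB.
  rewrite ncN (_ : 4 * _ * _ = 2 * (2 * (`|k| * tau)) * (tau - 0)); last by ring.
  apply: nc_J => //; first by apply: IntD => //; exact: IntN.
  move=> x /andP[x0 xt]; apply: (le_trans (nc_expiB1 _)).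
  by rewrite ler_wpM2l// normrM ler_wpM2l// ger0_norm ltW.
have hE : nc (E - 1) <= 2 * (mu l ^+ 2 * tau).
  by apply: (le_trans (nc_expiB1 _)); rewrite normrN ger0_norm// mulr_ge0// ltW.
have -> : 'i%C * tau%:C - 'i%C * E * I =
  'i%C * ((tau%:C - I) - (E - 1) * I) by ring.
rewrite ncM nci mul1r (le_trans (ncB _ _))// ncM.
have h3 : nc (E - 1) * nc I <= 2 * (mu l ^+ 2 * tau) * (2 * tau).
  by apply: ler_pM => //; exact: nc_ge0.
have h4 : 4 * `|k| * tau ^+ 2 <= 4 * (mu l ^+ 2 + (eps ^+ 2)^-1) * tau ^+ 2.
  by rewrite ler_wpM2r ?sqr_ge0// ler_wpM2l.
have h5 : 0 <= (eps ^+ 2)^-1 * tau ^+ 2 by rewrite mulr_ge0 ?sqr_ge0// invr_ge0 ltW.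
move: hI1 h3 h4 h5; move: (nc (tau%:C - I)) (nc (E - 1) * nc I) ((eps ^+ 2)^-1) (mu l ^+ 2) `|k| => x y z m k'.
nra.
Qed.

Lemma norm_quot (x y z : R) : 0 < y -> 0 < z -> `|x / (y * z)| = `|x| / (y * z).
Proof. by move=> y0 z0; rewrite normrM [X in _ * X]ger0_norm// invr_ge0 mulr_ge0 ?ltW. Qed.

Lemma sinc_le1 l x : `|sin (omega l * x) / (omega l * eps ^+ 2)| <= 1.
Proof.
have w0 := omega_gt0 a b heps l; have w1 := omega_ge a b heps l.
rewrite norm_quot//; have := sin_max (omega l * x); move: (sin _) => y.
move: (omega l) w0 w1 => w w0 w1 hy.
rewrite ler_pdivrMr ?mulr_gt0// mul1r (le_trans hy)//.
by rewrite -ler_pdivrMr// mul1r.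
Qed.

Lemma sinc_le2 l x s : 0 <= x <= s -> `|sin (omega l * x) / (omega l * eps ^+ 2)| <= s / eps ^+ 2.
Proof.
move=> /andP[x0 xs]; have w0 := omega_gt0 a b heps l.
rewrite norm_quot//; have := norm_sin_le (omega l * x); move: (sin _) => y.
move: (omega l) w0 => w w0 hy.
rewrite ler_pdivrMr ?mulr_gt0// mulrCA mulfVK ?gt_eqF// (le_trans hy)//.
rewrite ger0_norm; last by rewrite mulr_ge0// ltW.
by rewrite ler_wpM2l// ltW.
Qed.

(** The two bounds of [sin (omega x) / (omega eps^2)] on [[0, tau]]: the first
    leads to the estimate that is uniform in [eps], the second to the one that
    is of second order in [tau]. *)
Definition sinc_bound (M : R) : Prop := M = 1 \/ M = tau / eps ^+ 2.

Lemma sinc_bound_ge0 M : sinc_bound M -> 0 <= M.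
Proof. by case=> ->; rewrite ?divr_ge0// ltW. Qed.

Lemma sinc_le M l x : sinc_bound M -> 0 <= x <= tau ->
  `|sin (omega l * x) / (omega l * eps ^+ 2)| <= M.
Proof. by case=> -> hx; [exact: sinc_le1|exact: sinc_le2]. Qed.

Lemma cont_sinc l : rcont 0 tau (fun th => sin (omega l * (tau - th)) / (eps ^+ 2 * omega l)).
Proof.
apply: rcontM; last exact: rcont_cst.
apply: rcontT => x; apply: continuous_comp; last exact: continuous_sin.
by apply: cvgM; [exact: cvg_cst|apply: cvgB; [exact: cvg_cst|exact: cvg_id]].
Qed.

Lemma coef_p_le M l : sinc_bound M -> `|coef_p a b eps tau l| <= M * tau.
Proof.
move=> hM; rewrite /coef_p RI_cc; last exact: cont_sinc.
rewrite -[X in _ <= _ * X](subr0 tau); apply: RI_bnd; rewrite ?ltW//.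
  exact/rcont_rint/cont_sinc.
move=> x /andP[x0 xt]; rewrite [eps ^+ 2 * _]mulrC; apply: sinc_le => //.
by rewrite subr_ge0 ltW//= gerBl ltW.
Qed.

Lemma coef_q_le M l : sinc_bound M -> `|coef_q a b eps tau l| <= M * tau ^+ 2.
Proof.
move=> hM; have cid : rcont 0 tau (fun th : R => th) by apply: rcontT => x; exact: cvg_id.
rewrite /coef_q (RI_cc (rcontM cid (@cont_sinc l))).
have -> : M * tau ^+ 2 = (tau * M) * (tau - 0) by ring.
apply: RI_bnd; rewrite ?ltW//; first exact/rcont_rint/(rcontM cid (@cont_sinc l)).
move=> x /andP[x0 xt]; rewrite normrM; apply: ler_pM => //.
  by rewrite (ger0_norm (ltW x0)) ltW.
rewrite [eps ^+ 2 * _]mulrC; apply: sinc_le => //.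
by rewrite subr_ge0 ltW//= gerBl ltW.
Qed.

Lemma coef_aN l s : coef_a (- l) s = coef_a l s.
Proof. by rewrite /Defs.coef_a /lambdap /lambdam muN sqrrN. Qed.

Lemma lambdapE l : lambdap a b eps l = - ((eps ^+ 2)^-1 + omega l).
Proof. by rewrite /lambdap /Defs.omega mulrDr mulr1. Qed.

Lemma lambdamE l : lambdam a b eps l = omega l - (eps ^+ 2)^-1.
Proof. by rewrite /lambdam /Defs.omega mulrBr mulr1 opprB. Qed.

Lemma omega_prod l : (omega l - (eps ^+ 2)^-1) * (omega l + (eps ^+ 2)^-1) = mu l ^+ 2 / eps ^+ 2.
Proof. by rewrite -subr_sqr (omega_sqr a b heps); move: ((eps ^+ 2)^-1) (mu l) => x m; ring. Qed.

(** Removing the fast phase turns [a_l] into the free propagator. *)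
Lemma coef_a_rot l s : expi (s / eps ^+ 2) * coef_a l s =
  (cos (omega l * s))%:C + 'i%C * (sin (omega l * s) / (omega l * eps ^+ 2))%:C.
Proof.
have := omega_gt0 a b heps l; rewrite /Defs.coef_a lambdapE lambdamE.
move: (omega l) => w w0; set z := (eps ^+ 2)^-1.
have w2 : (- (z + w) - (w - z))%:C = - (2 * w)%:C :> R[i] by rewrite -rmorphN; congr real_complex_def; ring.
rewrite w2 mulrA mulrBr !(mulrCA (expi _)) -!expiD.
have -> : s / eps ^+ 2 + s * (w - z) = w * s by rewrite /z; ring.
have -> : s / eps ^+ 2 + s * - (z + w) = - (w * s) by rewrite /z; ring.
have -> : expi (w * s) = (cos (w * s))%:C + 'i%C * (sin (w * s))%:C.
  by apply: complex_eq => /=; ring.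
have -> : expi (- (w * s)) = (cos (w * s))%:C - 'i%C * (sin (w * s))%:C.
  by apply: complex_eq; rewrite /expi cosN sinN /=; ring.
rewrite invfM -/z; move: (cos _) (sin _) => c d; clearbody z.
rewrite !(cRM, cRD, cRN, cRV, cR_nat).
have : w%:C != 0 by rewrite fmorph_eq0 gt_eqF.
by move: (w%:C) (z%:C) (c%:C) (d%:C) => W Z C D Wn; field.
Qed.

Lemma nc_coef_a_le1 l s : nc (coef_a l s) <= 1.
Proof.
have -> : nc (coef_a l s) = nc (expi (s / eps ^+ 2) * coef_a l s) by rewrite ncM nc_expi mul1r.
rewrite coef_a_rot -(ler_sqr (nc_ge0 _)) ?nnegrE// expr1n nc_sqr.
have w0 := omega_gt0 a b heps l; have w1 := omega_ge a b heps l.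
rewrite /= !(mul0r, mul1r, mulr0, subr0, addr0, add0r) -(cos2Dsin2 (omega l * s)) lerD2l.
move: (sin _) => y; move: (omega l) w0 w1 => w w0 w1.
have we : 0 < w * eps ^+ 2 by rewrite mulr_gt0.
have i0 : 0 <= (w * eps ^+ 2)^-1 by rewrite invr_ge0 ltW.
rewrite exprMn ler_piMr ?sqr_ge0// exprn_ile1// invf_le1//.
by rewrite -ler_pdivrMr// mul1r.
Qed.

Lemma coef_aB1 l s : coef_a l s - 1 =
  ((lambdap a b eps l)%:C * (expi (s * lambdam a b eps l) - 1) -
   (lambdam a b eps l)%:C * (expi (s * lambdap a b eps l) - 1)) /
   (lambdap a b eps l - lambdam a b eps l)%:C.
Proof.
have w0 := omega_gt0 a b heps l.
have n0 : (lambdap a b eps l - lambdam a b eps l)%:C != 0 :> R[i].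
  by rewrite fmorph_eq0 lambdapE lambdamE lt_eqF//; have := e2; rewrite -invr_gt0; lra.
rewrite /Defs.coef_a; move: n0; rewrite rmorphB/=.
move: (_%:C) (_%:C) (expi _) (expi _) => x y z t n0; field.
by [].
Qed.

(** In [coef_aB1] the first order terms in [s] of the two exponentials cancel,
    and [lambda^+ lambda^- = - mu^2 / eps^2] is a factor of what is left. First
    order bounds of the exponentials give the first estimate, second order
    bounds the second one. *)
Lemma nc_coef_aB1 l s : 0 <= s -> nc (coef_a l s - 1) <= 2 * s * mu l ^+ 2 /\
  nc (coef_a l s - 1) <= 2 * (s ^+ 2 / eps ^+ 2) * mu l ^+ 2.
Proof.
move=> s0; have w0 := omega_gt0 a b heps l; have w1 := omega_ge a b heps l.
rewrite coef_aB1; have := omega_prod l; rewrite lambdapE lambdamE.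
have z0 : 0 < (eps ^+ 2)^-1 by rewrite invr_gt0.
move: (omega l) w0 w1 => w w0 w1; move: ((eps ^+ 2)^-1) z0 w1 => z z0 w1 hp.
have en : - (z + w) - (w - z) = - (2 * w) by ring.
have dw0 : 0 < 2 * w by rewrite mulr_gt0.
have wz : 0 <= w - z by rewrite subr_ge0.
have zw : 0 <= z + w by rewrite addr_ge0// ltW.
have P0 : (w - z) * (w + z) <= z * mu l ^+ 2 by rewrite hp mulrC.
rewrite ncM ncV ncR en normrN (ger0_norm (ltW dw0)).
split; rewrite ler_pdivrMr//.
  rewrite (le_trans (ncB _ _))// !ncM !ncR normrN (ger0_norm zw) (ger0_norm wz).
  have h1 : nc (expi (s * (w - z)) - 1) <= 2 * (s * (w - z)).
    by apply: (le_trans (nc_expiB1 _)); rewrite ger0_norm ?mulr_ge0.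
  have h2 : nc (expi (s * - (z + w)) - 1) <= 2 * (s * (z + w)).
    by apply: (le_trans (nc_expiB1 _)); rewrite mulrN normrN ger0_norm// mulr_ge0.
  apply: (@le_trans _ _ ((z + w) * (2 * (s * (w - z))) + (w - z) * (2 * (s * (z + w))))).
    by apply: lerD; apply: ler_wpM2l.
  have h3 : s * ((w - z) * (w + z)) <= s * (z * mu l ^+ 2) by rewrite ler_wpM2l.
  have h4 : s * (z * mu l ^+ 2) <= s * (w * mu l ^+ 2).
    by rewrite ler_wpM2l// ler_wpM2r ?sqr_ge0.
  move: h3 h4; move: (mu l ^+ 2) => m; lra.
set A := (- (z + w))%:C * _ - _.
have -> : A = (- (z + w))%:C * (expi (s * (w - z)) - 1 - 'i%C * (s * (w - z))%:C) -
  (w - z)%:C * (expi (s * - (z + w)) - 1 - 'i%C * (s * - (z + w))%:C).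
  by rewrite /A !rmorphM/=; ring.
rewrite (le_trans (ncB _ _))// !ncM !ncR normrN (ger0_norm zw) (ger0_norm wz).
apply: (@le_trans _ _ ((z + w) * (2 * (s * (w - z)) ^+ 2) + (w - z) * (2 * (s * - (z + w)) ^+ 2))).
  by apply: lerD; apply: ler_wpM2l => //; exact: nc_expiB2.
have h3 : s ^+ 2 * w * ((w - z) * (w + z)) <= s ^+ 2 * w * (z * mu l ^+ 2).
  by rewrite ler_wpM2l// mulr_ge0 ?sqr_ge0// ltW.
move: h3; move: (mu l ^+ 2) => m; rewrite !exprMn sqrrN.
rewrite -[X in _ -> _ <= X](_ : 4 * (s ^+ 2 * w * (z * m)) = _); last by ring.
by move=> h3; apply: le_trans (ler_wpM2l (ler0n _ 4) h3); rewrite le_eqVlt; apply/orP; left; apply/eqP; ring.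
Qed.

(** The factor by which the scheme multiplies the modes of [v0] at an
    intermediate time. *)
Definition lin_a l s : R[i] := ((tau - s) / tau)%:C + (s / tau)%:C * coef_a l tau.

Lemma lin_aN l s : lin_a (- l) s = lin_a l s.
Proof. by rewrite /lin_a coef_aN. Qed.

Lemma nc_lin_a l s : 0 <= s <= tau -> nc (lin_a l s) <= 1.
Proof.
move=> /andP[s0 st]; have t0 := ltW htau; rewrite (le_trans (ncD _ _))// ncM !ncR.
rewrite !ger0_norm ?divr_ge0 ?subr_ge0//.
apply: (@le_trans _ _ ((tau - s) / tau + s / tau)).
  by rewrite lerD2l ler_piMr ?nc_coef_a_le1// divr_ge0.
by rewrite -mulrDl subrK divff// gt_eqF.
Qed.

Lemma lin_a_approx M l s : sinc_bound M -> 0 <= s <= tau ->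
  nc (coef_a l s - lin_a l s) <= 4 * (M * tau) * mu l ^+ 2.
Proof.
move=> hM /andP[s0 st].
have H x : 0 <= x <= tau -> nc (coef_a l x - 1) <= 2 * (M * tau) * mu l ^+ 2.
  move=> /andP[x0 xt]; have [h1 h2] := nc_coef_aB1 l x0.
  case: hM => ->.
    by apply: (le_trans h1); rewrite mul1r ler_wpM2r ?sqr_ge0// ler_wpM2l.
  apply: (le_trans h2); rewrite ler_wpM2r ?sqr_ge0// ler_wpM2l//.
  rewrite [leRHS](_ : _ = tau ^+ 2 / eps ^+ 2); last by ring.
  by rewrite ler_wpM2r ?invr_ge0 ?(ltW e2)// ler_sqr ?nnegrE// ltW.
have -> : coef_a l s - lin_a l s = (coef_a l s - 1) - (s / tau)%:C * (coef_a l tau - 1).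
  rewrite /lin_a mulrBl divff ?gt_eqF// cRD cRN.
  by rewrite (_ : 1%:C = 1)//; move: (s / tau)%:C => z; ring.
rewrite (le_trans (ncB _ _))// (_ : 4 * _ * _ = 2 * (M * tau) * mu l ^+ 2 + 2 * (M * tau) * mu l ^+ 2); last first.
  by move: (mu l) => m; ring.
apply: lerD; first by apply: H; rewrite s0.
have t0 := ltW htau; rewrite ncM ncR ger0_norm ?divr_ge0//; apply: (@le_trans _ _ (1 * nc (coef_a l tau - 1))).
  by rewrite ler_wpM2r ?nc_ge0// ler_pdivrMr// mul1r.
by rewrite mul1r; apply: H; rewrite lexx ltW.
Qed.

End coefficients.

(** * One step of the scheme *)

Lemma freqN0 N k : ~~ odd N -> k = 0%N -> - freq N k = freq N k + N%:Z.
Proof. by rewrite /freq => hN ->; lia. Qed.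

Lemma freqN N k : ~~ odd N -> (0 < k)%N -> (k < N)%N -> - freq N k = freq N (N - k)%N.
Proof. by rewrite /freq => hN k0 kN; lia. Qed.

Section one_step.
Context {R : realType}.
Variables (a b eps tau : R) (N M : nat).
Hypothesis hab : a < b.
Hypothesis heps : 0 < eps <= 1.
Hypothesis htau : 0 < tau <= 1.
Hypothesis N0 : (0 < N)%N.
Hypothesis Neven : ~~ odd N.
Hypothesis MN : (2 * M < N./2)%N.
Variable S : @state R N.
Variables (u du v dv : R -> R[i]) (e B : R).
Hypothesis hB : 1 <= B.
Hypothesis heB : 32 * e <= B.
Local Notation C1p := (C1p a b).
Local Notation mu := (mu a b).
Local Notation fc := (fc a b).
Local Notation H1sq := (H1sq a b).
Local Notation nrm := (nrm a b N).
Local Notation dft := (@dft R a b N).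
Local Notation near := (near_grid (N := N) a b M).
Local Notation v0 := (v0 eps S).
Local Notation dPsi := (dPsi a b tau S).
Implicit Types (l : int) (s L : R) (w : @grid R N) (c d : int -> R[i]).

Hypothesis nPsi : near u du (Psi S) e.
Hypothesis nv : near v dv v0 e.
Hypothesis hu : H1sq u du <= B ^+ 2.
Hypothesis hv : H1sq v dv <= B ^+ 2.
Local Notation uc := (fun x => conjc (u x)).
Local Notation vc := (fun x => conjc (v x)).
Hypothesis hu2 : nrm (fun l => (mu l ^+ 2)%:C * fc u l) <= B.
Hypothesis hu4 : nrm (fun l => (mu l ^+ 4)%:C * fc u l) <= B.
Hypothesis hv2 : nrm (fun l => (mu l ^+ 2)%:C * fc v l) <= B.
Hypothesis hvc2 : nrm (fun l => (mu l ^+ 2)%:C * fc vc l) <= B.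
Hypothesis hG : nrm (fc (fun x => v x * u x)) <= B.
Hypothesis hG2 : nrm (fun l => (mu l ^+ 2)%:C * fc (fun x => v x * u x) l) <= B.
Hypothesis hGc : nrm (fc (fun x => vc x * u x)) <= B.
Hypothesis hGc2 : nrm (fun l => (mu l ^+ 2)%:C * fc (fun x => vc x * u x) l) <= B.

Local Notation A := (Calg a b).
Local Notation X := (Cmul a b).
Local Notation P := (dft (Psi S)).
Local Notation V := (dft v0).
Local Notation Vc := (dft (fun j => conjc (v0 j))).

Let A0 : 0 <= A. Proof. exact: Calg_ge0. Qed.
Let X0 : 0 <= X.
Proof. by rewrite /Cmul addr_ge0 ?sqrtr_ge0// mulr_ge0 ?Calg_ge0. Qed.
Let B0 : 0 <= B. Proof. by apply: le_trans hB. Qed.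
Let e_ge0 : 0 <= e := near_ge0 nPsi.
Let t0 : 0 < tau. Proof. by case/andP: htau. Qed.
Let t1 : tau <= 1. Proof. by case/andP: htau. Qed.
Let eB : e <= B.
Proof. by apply: le_trans heB; rewrite ler_peMl// ler1n. Qed.

Lemma nrmZ (z : R[i]) c : nrm (fun l => z * c l) <= nc z * nrm c.
Proof. by apply: (nrm_le hab) => [|k]; rewrite ?nc_ge0// ncM. Qed.

Lemma nrm_mul_le c d L : 0 <= L -> (forall l, nc (c l) <= L) ->
  nrm (fun l => c l * d l) <= L * nrm d.
Proof. by move=> L0 h; apply: (nrm_le hab) => // k; rewrite ncM ler_wpM2r ?nc_ge0. Qed.

Lemma nc_mul_le (x y z : R[i]) L : nc x <= L * nc y -> nc (x * z) <= L * nc (y * z).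
Proof. by move=> h; rewrite !ncM mulrA ler_wpM2r ?nc_ge0. Qed.

Lemma near_mono (f df : R -> R[i]) z e1 e2 : near f df z e1 -> e1 <= e2 -> near f df z e2.
Proof.
move=> h le; have h0 := near_ge0 h; have [W [g [h1 h2 h3 h4 h5]]] := h.
exists W, g; split => //; last exact: le_trans le.
by apply: (le_trans h4); rewrite ler_sqr ?nnegrE// (le_trans h0).
Qed.

Lemma nrm_fc_B (f df : R -> R[i]) : C1p f df -> H1sq f df <= B ^+ 2 -> nrm (fc f) <= B.
Proof.
by move=> c h; have := nrm_sqrt (nrm_fc_le hab N c h); rewrite sqrtr_sqr ger0_norm.
Qed.

Lemma nPsic : near uc (fun x => conjc (du x)) (fun j => conjc (Psi S j)) (32 * e).
Proof. exact: near_conj. Qed.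
Lemma nvc : near vc (fun x => conjc (dv x)) (fun j => conjc (v0 j)) (32 * e).
Proof. exact: near_conj. Qed.

Lemma C1p_near (f df : R -> R[i]) z r : near f df z r -> C1p f df.
Proof. by move=> [? [? []]]. Qed.

Lemma nrm_near (f df : R -> R[i]) z r : near f df z r -> H1sq f df <= B ^+ 2 -> r <= B ->
  nrm (dft z) <= 3 * B.
Proof.
move=> h1 h2 h3; have := nrm_bound N hab (dft z) (fc f).
have := near_nrm hab h1; have := nrm_fc_B (C1p_near h1) h2.
by move: (nrm _) (nrm _) (nrm _) h3 => x y t; lra.
Qed.

Lemma nrm_P : nrm P <= 3 * B. Proof. exact: nrm_near nPsi hu eB. Qed.
Lemma nrm_V : nrm V <= 3 * B. Proof. exact: nrm_near nv hv eB. Qed.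
Lemma nrm_Pc : nrm (dft (fun j => conjc (Psi S j))) <= 3 * B.
Proof. by apply: nrm_near nPsic _ heB; rewrite H1sqJ. Qed.
Lemma nrm_Vc : nrm Vc <= 3 * B.
Proof. by apply: nrm_near nvc _ heB; rewrite H1sqJ. Qed.

Lemma nrm_prod w z : nrm (dft w) <= 3 * B -> nrm (dft (fun j => w j * z j)) <= 3 * (A * B) * nrm (dft z).
Proof.
move=> h; apply: (le_trans (nrm_dftM hab N0 Neven _ _)); rewrite ler_wpM2r ?nrm_ge0//.
have -> : 3 * (A * B) = A * (3 * B) by ring.
by rewrite ler_wpM2l.
Qed.

Lemma dist_P : nrm (fun l => fc u l - P l) <= 2 * e.
Proof. by rewrite nrm_distC; exact: (near_nrm hab nPsi). Qed.
Lemma dist_V : nrm (fun l => fc v l - V l) <= 2 * e.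
Proof. by rewrite nrm_distC; exact: (near_nrm hab nv). Qed.
Lemma dist_Vc : nrm (fun l => fc vc l - Vc l) <= 64 * e.
Proof.
rewrite nrm_distC; apply: (le_trans (near_nrm hab nvc)).
by rewrite mulrA -natrM.
Qed.

Lemma dist_VP : nrm (fun l => fc (fun x => v x * u x) l - dft (fun j => v0 j * Psi S j) l) <= 32 * (X * B * e).
Proof.
rewrite nrm_distC; apply: (le_trans (near_mul hab N0 Neven MN nv nPsi hv hu B0 eB)).
by rewrite ler_peMl ?mulr_ge0// ler1n.
Qed.
Lemma dist_VcP : nrm (fun l => fc (fun x => vc x * u x) l -
  dft (fun j => conjc (v0 j) * Psi S j) l) <= 32 * (X * B * e).
Proof.
have e32 : e <= 32 * e by rewrite ler_peMl// ler1n.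
have hvc : H1sq vc (fun x => conjc (dv x)) <= B ^+ 2 by rewrite H1sqJ.
rewrite nrm_distC; apply: (le_trans (near_mul hab N0 Neven MN nvc (near_mono nPsi e32) hvc hu B0 heB)).
by rewrite le_eqVlt; apply/orP; left; apply/eqP; ring.
Qed.

Hypothesis nPhiPsi : nrm (dft (fun j => Phi S j * Psi S j)) <= 9 * (A * B ^+ 2).
Definition Dp : R := B + 9 * (A * B ^+ 2).

Lemma Dp_ge0 : 0 <= Dp.
Proof. by rewrite /Dp addr_ge0// !mulr_ge0 ?sqr_ge0. Qed.

(** The filter [sin (mu^2 tau) / tau] is at most [mu^2] on the smooth part and at
    most [1 / tau] on the error; the factor [tau] in front is what the
    coefficients [d_l] and [q_l] provide. *)
Lemma nrm_dPsi : tau * nrm (dft dPsi) <= tau * Dp + 2 * e.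
Proof.
rewrite (@eq_nrm _ a b N _ (fun l => - 'i%C * (sin (mu l ^+ 2 * tau) / tau)%:C * P l
  + 'i%C * dft (fun j => Phi S j * Psi S j) l)); last by move=> k; rewrite dft_idft.
have h1 : nrm (fun l => - 'i%C * (sin (mu l ^+ 2 * tau) / tau)%:C * P l) <= B + 2 * e / tau.
  apply: (le_trans (nrm_bound N hab _ (fun l => - 'i%C * (sin (mu l ^+ 2 * tau) / tau)%:C * fc u l))).
  rewrite addrC; apply: lerD.
    apply: le_trans hu2; apply: (nrm_le1 hab) => k.
    rewrite -[leRHS]mul1r; apply: nc_mul_le.
    rewrite ncM ncN nci !mul1r !ncR; move: (mu _ ^+ 2) => m.
    rewrite normrM [X in _ * X]gtr0_norm ?invr_gt0// ler_pdivrMr//.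
    by rewrite (le_trans (norm_sin_le _))// normrM (gtr0_norm t0).
  rewrite (@eq_nrm _ a b N _ (fun l => (- 'i%C * (sin (mu l ^+ 2 * tau) / tau)%:C) * (P l - fc u l))); last first.
    by move=> k; rewrite mulrBr.
  apply: (@le_trans _ _ (tau^-1 * nrm (fun l => P l - fc u l))).
    apply: nrm_mul_le => [|l]; first by rewrite invr_ge0 ltW.
    rewrite !ncM ncN nci mul1r ncR normrM [X in _ * X]gtr0_norm ?invr_gt0//.
    by rewrite ler_piMl ?invr_ge0 ?(ltW t0)// sin_max.
  rewrite mulrC ler_wpM2r ?invr_ge0 ?(ltW t0)// nrm_distC; exact: dist_P.
have h2 : nrm (fun l => 'i%C * dft (fun j => Phi S j * Psi S j) l) <= 9 * (A * B ^+ 2).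
  by rewrite nrm_iZ.
apply: (@le_trans _ _ (tau * (B + 2 * e / tau + 9 * (A * B ^+ 2)))).
  rewrite ler_wpM2l ?(ltW t0)// (le_trans (nrmD N hab _ _))// lerD//.
rewrite /Dp; move: (9 * _) => z; rewrite le_eqVlt; apply/orP; left; apply/eqP.
by field; rewrite gt_eqF.
Qed.

Lemma nrm_d_term sg w : nrm (dft w) <= 3 * B ->
  nrm (fun l => coef_d a b eps tau sg l * dft (fun j => w j * dPsi j) l) <=
  6 * (A * B) * (tau ^+ 2 * Dp + 2 * (tau * e)).
Proof.
move=> hw; have t2 : 0 <= 2 * tau ^+ 2 by rewrite mulr_ge0 ?sqr_ge0.
apply: (le_trans (nrm_mul_le _ t2 (coef_d_le a b eps t0 sg))).
apply: (@le_trans _ _ (2 * tau ^+ 2 * (3 * (A * B) * nrm (dft dPsi)))).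
  by rewrite ler_wpM2l// nrm_prod.
have -> : 2 * tau ^+ 2 * (3 * (A * B) * nrm (dft dPsi)) = 6 * (A * B) * tau * (tau * nrm (dft dPsi)).
  by ring.
have -> : 6 * (A * B) * (tau ^+ 2 * Dp + 2 * (tau * e)) = 6 * (A * B) * tau * (tau * Dp + 2 * e).
  by ring.
by rewrite ler_wpM2l ?nrm_dPsi// !mulr_ge0// ltW.
Qed.

(** The increment over one step of the Fourier coefficients of [Psi]. *)
Definition dstep l : R[i] := (expi (- (mu l ^+ 2 * tau)) - 1) * P l
  + coef_c a b eps tau 1 l * dft (fun j => v0 j * Psi S j) l
  + coef_d a b eps tau 1 l * dft (fun j => v0 j * dPsi j) l
  + coef_c a b eps tau (-1) l * dft (fun j => conjc (v0 j) * Psi S j) l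
  + coef_d a b eps tau (-1) l * dft (fun j => conjc (v0 j) * dPsi j) l.

Lemma nrm_expi_err : nrm (fun l => (expi (- (mu l ^+ 2 * tau)) - 1) * (fc u l - P l)) <= 4 * e.
Proof.
apply: (@le_trans _ _ (2 * nrm (fun l => fc u l - P l))).
  by apply: nrm_mul_le => // l; exact: nc_expiB1_le2.
have := dist_P; move: (nrm _) => x; lra.
Qed.

Lemma nrm_expi_u : nrm (fun l => (expi (- (mu l ^+ 2 * tau)) - 1) * fc u l) <= 2 * tau * B.
Proof.
apply: (@le_trans _ _ (2 * tau * nrm (fun l => (mu l ^+ 2)%:C * fc u l))); last first.
  by apply: ler_wpM2l hu2; rewrite mulr_ge0// ltW.
apply: (nrm_le hab) => [|k]; first by rewrite mulr_ge0// ltW.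
apply: nc_mul_le; apply: (le_trans (nc_expiB1 _)).
rewrite normrN ncR; move: (mu _ ^+ 2) => m.
by rewrite normrM (gtr0_norm t0) -mulrA ler_wpM2l// mulrC.
Qed.

Lemma nrm_expi_u2 : nrm (fun l => (tau%:C * ('i%C * - (mu l ^+ 2)%:C) -
   (expi (- (mu l ^+ 2 * tau)) - 1)) * fc u l) <= 2 * tau ^+ 2 * B.
Proof.
apply: (@le_trans _ _ (2 * tau ^+ 2 * nrm (fun l => (mu l ^+ 4)%:C * fc u l))); last first.
  by apply: ler_wpM2l hu4; rewrite mulr_ge0// sqr_ge0.
apply: (nrm_le hab) => [|k]; first by rewrite mulr_ge0// sqr_ge0.
apply: nc_mul_le; move: (mu _) => m.
have := nc_expiB2 (- (m ^+ 2 * tau)); rewrite -ncN ncR.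
have -> : tau%:C * ('i%C * - (m ^+ 2)%:C) - (expi (- (m ^+ 2 * tau)) - 1) =
  - (expi (- (m ^+ 2 * tau)) - 1 - 'i%C * (- (m ^+ 2 * tau))%:C).
  by rewrite cRN (cRM (m ^+ 2)); ring.
move=> h; apply: (le_trans h); rewrite sqrrN.
rewrite ger0_norm; last by rewrite (exprM m 2 2) sqr_ge0.
by rewrite le_eqVlt; apply/orP; left; apply/eqP; ring.
Qed.

(** The coefficient [c_l] is [i tau] up to a term that costs one more
    [tau (mu^2 + eps^-2)]. *)
Lemma nrm_c_err sg c d r : `|sg| = 1 -> nrm c <= B -> nrm (fun l => (mu l ^+ 2)%:C * c l) <= B ->
  nrm (fun l => c l - d l) <= r ->
  nrm (fun l => 'i%C * tau%:C * c l - coef_c a b eps tau sg l * d l) <=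
  16 * B * (tau ^+ 2 / eps ^+ 2) + 2 * r.
Proof.
move=> hsg h1 h2 hr.
have e2 : 0 < eps ^+ 2 by case/andP: heps => ? _; rewrite exprn_gt0.
have i0 : 0 <= (eps ^+ 2)^-1 by rewrite invr_ge0 ltW.
have i1 : 1 <= (eps ^+ 2)^-1 by exact: inv_eps2_ge1.
apply: (le_trans (nrm_sub N hab _ (fun l => coef_c a b eps tau sg l * c l) _)).
apply: lerD; last first.
  rewrite (@eq_nrm _ a b N _ (fun l => coef_c a b eps tau sg l * (c l - d l))); last first.
    by move=> k; rewrite mulrBr.
  apply: (@le_trans _ _ (2 * nrm (fun l => c l - d l))); last by rewrite ler_wpM2l.
  apply: nrm_mul_le => // l; apply: (le_trans (coef_c_le _ _ _ t0 _ _)).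
  by rewrite ler_piMr.
rewrite (@eq_nrm _ a b N _ (fun l => ('i%C * tau%:C - coef_c a b eps tau sg l) * c l)); last first.
  by move=> k; rewrite mulrBl.
apply: (@le_trans _ _ (nrm (fun l => (8 * tau ^+ 2)%:C * (mu l ^+ 2)%:C * c l + (8 * tau ^+ 2 * (eps ^+ 2)^-1)%:C * c l))).
  apply: (nrm_le1 hab) => k; rewrite -mulrDl !ncM ler_wpM2r ?nc_ge0//.
  apply: (le_trans (coef_c_approx _ _ heps t0 _ hsg)).
  rewrite -cRM -cRD ncR -mulrDr ger0_norm// mulr_ge0 ?addr_ge0 ?sqr_ge0//.
  by rewrite mulr_ge0 ?sqr_ge0.
apply: (le_trans (nrmD N hab _ _)).
have k1 : nrm (fun l => (8 * tau ^+ 2)%:C * (mu l ^+ 2)%:C * c l) <= 8 * tau ^+ 2 * B.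
  rewrite (@eq_nrm _ a b N _ (fun l => (8 * tau ^+ 2)%:C * ((mu l ^+ 2)%:C * c l))); last first.
    by move=> k; rewrite mulrA.
  apply: (le_trans (nrmZ _ _)); rewrite ncR ger0_norm; last by rewrite mulr_ge0 ?sqr_ge0.
  by rewrite ler_wpM2l// mulr_ge0 ?sqr_ge0.
have k2 : nrm (fun l => (8 * tau ^+ 2 * (eps ^+ 2)^-1)%:C * c l) <= 8 * tau ^+ 2 * (eps ^+ 2)^-1 * B.
  apply: (le_trans (nrmZ _ _)); rewrite ncR ger0_norm; last by apply: mulr_ge0 => //; rewrite mulr_ge0 ?sqr_ge0.
  by rewrite ler_wpM2l//; apply: mulr_ge0 => //; rewrite mulr_ge0 ?sqr_ge0.
apply: (le_trans (lerD k1 k2)).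
have := ler_wpM2l (mulr_ge0 (ler0n _ 8) (mulr_ge0 (sqr_ge0 tau) B0)) i1.
by move: (_^-1) => z; lra.
Qed.

Lemma nrm5 (c1 c2 c3 c4 c5 : int -> R[i]) (r1 r2 r3 r4 r5 : R) :
  nrm c1 <= r1 -> nrm c2 <= r2 -> nrm c3 <= r3 -> nrm c4 <= r4 -> nrm c5 <= r5 ->
  nrm (fun l => c1 l + c2 l + c3 l + c4 l + c5 l) <= r1 + r2 + r3 + r4 + r5.
Proof.
move=> h1 h2 h3 h4 h5; do 4!(apply: (le_trans (nrmD N hab _ _)); apply: lerD => //).
Qed.

Definition Cpsi1 : R := 4 + 34 * B + 128 * (X * B) + 12 * (A * B) * (Dp + 2).

(** Every term of the step is replaced by its first order expansion in [tau],
    and the numerical data by the exact ones. *)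
Lemma dstep_taylor :
  nrm (fun l => tau%:C * ('i%C * (- ((mu l ^+ 2)%:C * fc u l) +
    (fc (fun x => v x * u x) l + fc (fun x => vc x * u x) l))) - dstep l) <=
  Cpsi1 * (e + tau ^+ 2 / eps ^+ 2).
Proof.
have tt : tau ^+ 2 <= tau ^+ 2 / eps ^+ 2.
  by rewrite ler_peMr ?sqr_ge0//; exact: inv_eps2_ge1.
have h1 := nrm_expi_err; have h2 := nrm_expi_u2.
have h3 := nrm_c_err (normr1 R) hG hG2 dist_VP.
have h4 := nrm_c_err (etrans (normrN1 R) (erefl 1)) hGc hGc2 dist_VcP.
have h5 := nrm_d_term 1 nrm_V; have h6 := nrm_d_term (-1) nrm_Vc.
rewrite (@eq_nrm _ a b N _ (fun l =>
  ((expi (- (mu l ^+ 2 * tau)) - 1) * (fc u l - P l) +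
   (tau%:C * ('i%C * - (mu l ^+ 2)%:C) - (expi (- (mu l ^+ 2 * tau)) - 1)) * fc u l)
  + ('i%C * tau%:C * fc (fun x => v x * u x) l
     - coef_c a b eps tau 1 l * dft (fun j => v0 j * Psi S j) l)
  + ('i%C * tau%:C * fc (fun x => vc x * u x) l
     - coef_c a b eps tau (-1) l * dft (fun j => conjc (v0 j) * Psi S j) l)
  + - (coef_d a b eps tau 1 l * dft (fun j => v0 j * dPsi j) l)
  + - (coef_d a b eps tau (-1) l * dft (fun j => conjc (v0 j) * dPsi j) l))); last first.
  move=> k; rewrite /dstep; move: (fc _ _) (fc _ _) (fc _ _) => x y z.
  move: (coef_c _ _ _ _ _ _) (coef_c _ _ _ _ _ _) (coef_d _ _ _ _ _ _) (coef_d _ _ _ _ _ _) => c1 c2 d1 d2.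
  move: (dft _ _) (dft _ _) (dft _ _) (dft _ _) (dft _ _) (expi _) => p1 p2 p3 p4 p5 E; ring.
have h12 := le_trans (nrmD N hab _ _) (lerD h1 h2).
rewrite -(nrmN a b N (fun l => coef_d _ _ _ _ _ _ * _)) in h5.
rewrite -(nrmN a b N (fun l => coef_d _ _ _ _ _ _ * _)) in h6.
apply: (le_trans (nrm5 h12 h3 h4 h5 h6)).
have te : tau * e <= e by rewrite ler_piMl.
have AB : 0 <= A * B by rewrite mulr_ge0.
have XB : 0 <= X * B by rewrite mulr_ge0.
have D0 := Dp_ge0.
have q1 := ler_wpM2l B0 tt.
have q2 := ler_wpM2l (mulr_ge0 AB D0) tt.
have q3 := ler_wpM2l AB te.
have T0 : 0 <= tau ^+ 2 / eps ^+ 2 by apply: le_trans tt; exact: sqr_ge0.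
have z1 := mulr_ge0 B0 e_ge0; have z2 := mulr_ge0 (mulr_ge0 AB D0) e_ge0.
have z3 := mulr_ge0 XB T0; have z4 := mulr_ge0 AB T0.
have z5 := mulr_ge0 AB e_ge0.
rewrite /Cpsi1; move: (A * B) (X * B) (tau ^+ 2 / _) (tau * e) q1 q2 q3 T0 z1 z2 z3 z4 z5 => ab xb q te' q1 q2 q3 T0 z1 z2 z3 z4 z5.
move: (tau ^+ 2) q1 q2 => t q1 q2.
nra.
Qed.

Definition Cpsi2 : R := 4 + 2 * B + 36 * (A * B ^+ 2) + 12 * (A * B) * (Dp + 2).

(** Each coefficient of the step is of order [tau] on the smooth part, with a
    constant that does not depend on [eps]; on the error, the exponential is
    merely bounded. *)
Lemma nrm_dstep : nrm dstep <= Cpsi2 * (e + tau).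
Proof.
have cbound sg w : nrm (dft w) <= 3 * B ->
  nrm (fun l => coef_c a b eps tau sg l * dft (fun j => w j * Psi S j) l) <= 18 * (A * B ^+ 2) * tau.
  move=> hw; have t2 : 0 <= 2 * tau by rewrite mulr_ge0// ltW.
  apply: (le_trans (nrm_mul_le _ t2 (coef_c_le a b eps t0 sg))).
  apply: (@le_trans _ _ (2 * tau * (3 * (A * B) * (3 * B)))).
    rewrite ler_wpM2l// (le_trans (nrm_prod _ hw))// ler_wpM2l ?nrm_P//.
    by rewrite !mulr_ge0.
  by rewrite le_eqVlt; apply/orP; left; apply/eqP; ring.
have h1 := nrm_expi_err; have h2 := nrm_expi_u.
have h3 := cbound 1 _ nrm_V; have h4 := cbound (-1) _ nrm_Vc.
have h5 := nrm_d_term 1 nrm_V; have h6 := nrm_d_term (-1) nrm_Vc.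
have h12 : nrm (fun l => (expi (- (mu l ^+ 2 * tau)) - 1) * P l) <= 2 * tau * B + 4 * e.
  rewrite (@eq_nrm _ a b N _ (fun l => (expi (- (mu l ^+ 2 * tau)) - 1) * fc u l
    - (expi (- (mu l ^+ 2 * tau)) - 1) * (fc u l - P l))); last first.
    by move=> k; rewrite -mulrBr subKr.
  exact: (le_trans (nrmB N hab _ _) (lerD h2 h1)).
apply: (le_trans (nrm5 h12 h3 h5 h4 h6)).
have te : tau * e <= e by rewrite ler_piMl.
have tt : tau ^+ 2 <= tau by rewrite expr2 ler_piMl// ltW.
have AB : 0 <= A * B by rewrite mulr_ge0.
have AB2 : 0 <= A * B ^+ 2 by rewrite mulr_ge0// sqr_ge0.
have D0 := Dp_ge0.
have q2 := ler_wpM2l (mulr_ge0 AB D0) tt.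
have q3 := ler_wpM2l AB te.
have tg := ltW t0.
have z1 := mulr_ge0 B0 e_ge0; have z2 := mulr_ge0 (mulr_ge0 AB D0) e_ge0.
have z3 := mulr_ge0 AB2 e_ge0; have z4 := mulr_ge0 AB tg.
have z5 := mulr_ge0 AB e_ge0.
rewrite /Cpsi2; move: (A * B) (A * B ^+ 2) (tau ^+ 2) (tau * e) q2 q3 z1 z2 z3 z4 z5 => ab xb q te' q2 q3 z1 z2 z3 z4 z5.
nra.
Qed.

Lemma nrm_Psi_sq : nrm (dft (Psi_sq S)) <= 9 * (A * B ^+ 2).
Proof.
rewrite (_ : Psi_sq S = fun j => Psi S j * conjc (Psi S j)); last first.
  by apply/funext => j; rewrite mulcJ.
apply: (le_trans (nrm_prod _ nrm_P)).
apply: (@le_trans _ _ (3 * (A * B) * (3 * B))); last by rewrite le_eqVlt; apply/orP; left; apply/eqP; ring.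
by rewrite ler_wpM2l ?nrm_Pc// !mulr_ge0.
Qed.

Lemma nrm_Re w : nrm (dft (fun j => (complex.Re (w j))%:C)) <= 17 * nrm (dft w).
Proof.
have -> : (fun j => (complex.Re (w j))%:C) = (fun j => 2^-1 * (w j + conjc (w j))).
  apply/funext => j; case: (w j) => x y /=.
  have -> : 2^-1 = (2^-1)%:C :> R[i] by rewrite cRV cR_nat.
  by apply: complex_eq; rewrite ?cReMr ?cImMr cReD || rewrite ?cImMr cImD; rewrite /=; field.
rewrite (@eq_nrm _ a b N _ (fun l => 2^-1 * (dft w l + dft (fun j => conjc (w j)) l))); last first.
  by move=> k; rewrite (dftZ a b _ (fun j => w j + conjc (w j))) (dftD a b w (fun j => conjc (w j))).
apply: (le_trans (nrmZ _ _)); rewrite nc2V.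
have := nrmD N hab (dft w) (dft (fun j => conjc (w j))); have := nrm_dft_conj hab N0 Neven w.
have := nrm_ge0 a b N (dft w).
by move: (nrm _) (nrm _) (nrm _) => x y t; lra.
Qed.

Lemma nrm_r1 L : sinc_bound eps tau L ->
  nrm (dft (r1 a b eps tau S)) <= (9 * (A * B ^+ 2) + 102 * (A * B) * (Dp + 2 * B)) * (L * tau).
Proof.
move=> hL; have L0 := sinc_bound_ge0 heps t0 hL.
rewrite (@eq_nrm _ a b N _ (fun l => (coef_p a b eps tau l)%:C * dft (Psi_sq S) l +
  2 * (coef_q a b eps tau l)%:C * dft (Re_Psi_dPsi a b tau S) l)); last by move=> k; rewrite dft_idft.
have h1 : nrm (fun l => (coef_p a b eps tau l)%:C * dft (Psi_sq S) l) <= L * tau * (9 * (A * B ^+ 2)).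
  apply: (@le_trans _ _ (L * tau * nrm (dft (Psi_sq S)))).
    apply: nrm_mul_le => [|l]; first by rewrite mulr_ge0// ltW.
    by rewrite ncR coef_p_le.
  by rewrite ler_wpM2l ?nrm_Psi_sq// mulr_ge0// ltW.
have h2 : nrm (fun l => 2 * (coef_q a b eps tau l)%:C * dft (Re_Psi_dPsi a b tau S) l) <=
   102 * (A * B) * (L * tau) * (tau * nrm (dft dPsi)).
  apply: (@le_trans _ _ (2 * (L * tau ^+ 2) * nrm (dft (Re_Psi_dPsi a b tau S)))).
    apply: nrm_mul_le => [|l]; first by rewrite mulr_ge0// mulr_ge0 ?sqr_ge0.
    by rewrite ncM ncR -cR_nat ncR ger0_norm// ler_wpM2l// coef_q_le.
  apply: (@le_trans _ _ (2 * (L * tau ^+ 2) * (17 * (3 * (A * B) * nrm (dft dPsi))))).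
    rewrite ler_wpM2l//; first by rewrite mulr_ge0// mulr_ge0 ?sqr_ge0.
    rewrite (le_trans (nrm_Re _))// ler_wpM2l//.
    exact: nrm_prod nrm_Pc.
  by rewrite le_eqVlt; apply/orP; left; apply/eqP; ring.
apply: (le_trans (nrmD N hab _ _)); apply: (le_trans (lerD h1 h2)).
have AB : 0 <= A * B by rewrite mulr_ge0.
have h3 : tau * nrm (dft dPsi) <= Dp + 2 * B.
  apply: (le_trans nrm_dPsi); apply: lerD; first by rewrite ler_piMl// Dp_ge0.
  by rewrite ler_wpM2l.
have Lt : 0 <= L * tau by rewrite mulr_ge0// ltW.
have := ler_wpM2l (mulr_ge0 (mulr_ge0 (ler0n _ 102) AB) Lt) h3.
by move: (A * B) (A * B ^+ 2) (L * tau) (_ * nrm _) => x y z t; lra.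
Qed.

Definition Cphi1 : R := 66 + 8 * B + 9 * (A * B ^+ 2) + 102 * (A * B) * (Dp + 2 * B).

(** Conjugation exchanges the frequencies [l] and [- l], and [- l] leaves the
    range of the grid for [l = - N/2] only; periodicity brings it back, and
    [lin_a] is even in [l]. *)
Lemma freq_opp_lin k s : (k < N)%N ->
  dft (fun j => ((tau - s) / tau)%:C * v0 j + (s / tau)%:C * v1 a b eps tau S j) (- freq N k) =
  lin_a a b eps tau (freq N k) s * V (- freq N k).
Proof.
have H (k' : 'I_N) : dft (fun j => ((tau - s) / tau)%:C * v0 j + (s / tau)%:C * v1 a b eps tau S j) (freq N k') =
  lin_a a b eps tau (freq N k') s * V (freq N k').
  rewrite (dftD a b (fun j => _ * v0 j) (fun j => _ * v1 a b eps tau S j)).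
  rewrite (dftZ a b _ v0) (dftZ a b _ (v1 a b eps tau S)) dft_idft// /lin_a; ring.
move=> kN; have [k0|k0] := posnP k.
  rewrite (freqN0 Neven k0).
  rewrite !(dft_period hab N0).
  exact: (H (Ordinal kN)).
have hk : (N - k < N)%N by rewrite ltn_subrL k0 N0.
by rewrite -lin_aN (freqN Neven k0 kN) (H (Ordinal hk)).
Qed.

(** The phase is interpolated exactly, so that the only error made on the exact
    data comes from interpolating [a_l] linearly between [0] and [tau]. *)
Lemma phi_interp s L : sinc_bound eps tau L -> 0 <= s <= tau ->
  nrm (fun l => expi (s / eps ^+ 2) * coef_a a b eps l s * fc v l
    + expi (- (s / eps ^+ 2)) * conjc (coef_a a b eps l s) * fc vc l
    - dft (fun j => expi (s / eps ^+ 2) *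
        (((tau - s) / tau)%:C * v0 j + (s / tau)%:C * v1 a b eps tau S j)
      + expi (- (s / eps ^+ 2)) * conjc
        (((tau - s) / tau)%:C * v0 j + (s / tau)%:C * v1 a b eps tau S j)
      + (s / tau)%:C * r1 a b eps tau S j) l) <=
  Cphi1 * (e + L * tau).
Proof.
move=> hL hs; have L0 := sinc_bound_ge0 heps t0 hL.
set w := fun j => ((tau - s) / tau)%:C * v0 j + (s / tau)%:C * v1 a b eps tau S j.
set m := fun l => lin_a a b eps tau l s; set al := fun l => coef_a a b eps l s.
have Lt : 0 <= L * tau by rewrite mulr_ge0// ltW.
have diff (c d : int -> R[i]) (f : int -> R[i]) (r : R) : (forall l, nc (f l) = nc (al l - m l)) ->
  nrm (fun l => (mu l ^+ 2)%:C * c l) <= B ->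
  nrm (fun l => f l * c l) <= 4 * (L * tau) * B.
  move=> hf hc; apply: (@le_trans _ _ (4 * (L * tau) * nrm (fun l => (mu l ^+ 2)%:C * c l))).
    apply: (nrm_le hab) => [|k]; first by rewrite mulr_ge0.
    by apply: nc_mul_le; rewrite hf ncR (ger0_norm (sqr_ge0 _)); exact: lin_a_approx.
  by rewrite ler_wpM2l// mulr_ge0.
have d1 := diff _ (fun=> 0) (fun l => expi (s / eps ^+ 2) * (al l - m l)) 0 _ hv2.
have d2 := diff _ (fun=> 0) (fun l => expi (- (s / eps ^+ 2)) * conjc (al l - m l)) 0 _ hvc2.
have {}d1 := d1 (fun l => etrans (ncM _ _) (etrans (congr1 (fun z => z * _) (nc_expi _)) (mul1r _))).
have {}d2 : nrm (fun l => expi (- (s / eps ^+ 2)) * conjc (al l - m l) * fc vc l) <= 4 * (L * tau) * B.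
  by apply: d2 => l; rewrite ncM nc_expi mul1r ncJ.
have d3 : nrm (fun l => expi (s / eps ^+ 2) * m l * (fc v l - V l)) <= 2 * e.
  apply: le_trans dist_V; rewrite -[leRHS]mul1r; apply: nrm_mul_le => // l.
  by rewrite ncM nc_expi mul1r nc_lin_a.
have d4 : nrm (fun l => expi (- (s / eps ^+ 2)) * conjc (m l) * (fc vc l - Vc l)) <= 64 * e.
  apply: le_trans dist_Vc; rewrite -[leRHS]mul1r; apply: nrm_mul_le => // l.
  by rewrite ncM nc_expi mul1r ncJ nc_lin_a.
have d5 : nrm (fun l => - ((s / tau)%:C * dft (r1 a b eps tau S) l)) <=
    (9 * (A * B ^+ 2) + 102 * (A * B) * (Dp + 2 * B)) * (L * tau).
  rewrite (nrmN a b N (fun l => _ * _)); apply: le_trans (nrm_r1 hL).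
  rewrite -[leRHS]mul1r; apply: nrm_mul_le => // l; case/andP: hs => s0 st.
  by rewrite ncR ger0_norm ?divr_ge0 ?(ltW t0)// ler_pdivrMr// mul1r.
rewrite (@eq_nrm _ a b N _ (fun l =>
   expi (s / eps ^+ 2) * (al l - m l) * fc v l +
   expi (- (s / eps ^+ 2)) * conjc (al l - m l) * fc vc l +
   expi (s / eps ^+ 2) * m l * (fc v l - V l) +
   expi (- (s / eps ^+ 2)) * conjc (m l) * (fc vc l - Vc l) +
   - ((s / tau)%:C * dft (r1 a b eps tau S) l))).
  apply: (le_trans (nrm5 d1 d2 d3 d4 d5)).
  have AB : 0 <= A * B by rewrite mulr_ge0.
  have AB2 : 0 <= A * B ^+ 2 by rewrite mulr_ge0// sqr_ge0.
  have D0 := Dp_ge0.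
  have D2 : 0 <= A * B * (Dp + 2 * B) by rewrite mulr_ge0// addr_ge0// mulr_ge0.
  have z1 := mulr_ge0 B0 e_ge0; have z2 := mulr_ge0 AB2 e_ge0; have z3 := mulr_ge0 D2 e_ge0.
  rewrite /Cphi1; have e0 := e_ge0; move: z2 z3; rewrite -[102 * _ * _]mulrA.
  by move: (A * B * _) (A * B ^+ 2) (L * tau) Lt => x y z Lt z2 z3; lra.
move=> k; have W1 : dft w (freq N k) = m (freq N k) * V (freq N k).
  have := freq_opp_lin s (ltn_ord (rev_ord k)).
  rewrite (dftD a b (fun j => _ * v0 j) (fun j => _ * v1 a b eps tau S j)).
  rewrite /w (dftD a b (fun j => _ * v0 j) (fun j => _ * v1 a b eps tau S j)).
  move=> _; rewrite (dftZ a b _ v0) (dftZ a b _ (v1 a b eps tau S)) dft_idft// /m /lin_a; ring.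
have W2 : dft (fun j => conjc (w j)) (freq N k) = conjc (m (freq N k)) * Vc (freq N k).
  by rewrite !dft_conj (freq_opp_lin s (ltn_ord k)) conjcM.
rewrite (dftD a b (fun j => expi (s / eps ^+ 2) * w j + expi (- (s / eps ^+ 2)) * conjc (w j)) (fun j => _ * r1 a b eps tau S j)).
rewrite (dftD a b (fun j => expi (s / eps ^+ 2) * w j) (fun j => expi (- (s / eps ^+ 2)) * conjc (w j))).
rewrite (dftZ a b _ w) (dftZ a b _ (fun j => conjc (w j))) (dftZ a b _ (r1 a b eps tau S)).
rewrite W1 W2 -/(al (freq N k)) conjcD conjcN.
move: (expi _) (expi _) (al _) (m _) (conjc (al _)) (conjc (m _)) => x1 x2 x3 x4 x5 x6.
move: (fc _ _) (fc _ _) (dft _ _) (dft _ _) (dft _ _) (_%:C) => y1 y2 y3 y4 y5 y6; ring.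
Qed.

End one_step.

(** * From Fourier coefficients to the error in H^1 *)

Lemma freq_surj N M (m : int) : (2 * M < N./2)%N -> `|m| <= M%:Z ->
  exists k : 'I_N, freq N k = m.
Proof.
move=> MN; rewrite ler_norml => /andP[h1 h2].
have hk : (absz (m + (N./2)%:Z)%R < N)%N by lia.
by exists (Ordinal hk); rewrite /freq /=; lia.
Qed.

Section interpolation_error.
Context {R : realType}.
Variables (a b : R) (N M : nat).
Hypothesis hab : a < b.
Hypothesis N0 : (0 < N)%N.
Hypothesis Neven : ~~ odd N.
Hypothesis MN : (2 * M < N./2)%N.
Local Notation C1p := (C1p a b).
Local Notation fc := (fc a b).
Local Notation H1sq := (H1sq a b).
Local Notation nrm := (nrm a b N).
Local Notation dft := (@dft R a b N).
Local Notation interp := (@interp R a b N).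
Implicit Types (u du V g : R -> R[i]) (w : @grid R N) (r d E : R) (z : R[i]).

Definition approximable d u du : Prop := exists V g,
  [/\ bl a b M V, C1p V g, C1p u du &
      H1sq (fun x => V x - u x) (fun x => g x - du x) <= d ^+ 2].

Lemma near_of_approximable d E u du w : 0 <= d -> approximable d u du ->
  nrm (fun l => fc u l - dft w l) <= E -> near_grid a b M u du w (E + d).
Proof.
move=> d0 [V [g [bV cV cu h]]] hE.
have E0 : 0 <= E by apply: le_trans hE; exact: nrm_ge0.
exists V, g; split => //.
  by apply: (le_trans h); rewrite ler_sqr ?nnegrE ?addr_ge0// lerDr.
apply: (le_trans (nrm_sub N hab _ (fc u) _)); apply: lerD.
  by rewrite nrm_distC.
by rewrite nrm_distC; exact: (nrm_fc_sub N hab cV cu d0 h).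
Qed.

Lemma approximable_scale d u du z : approximable d u du ->
  approximable (nc z * d) (fun x => z * u x) (fun x => z * du x).
Proof.
move=> [V [g [bV cV cu h]]]; exists (fun x => z * V x), (fun x => z * g x).
split; [exact: bl_scale|exact: C1pZ|exact: C1pZ|].
rewrite (_ : H1sq _ _ = nc z ^+ 2 * H1sq (fun x => V x - u x) (fun x => g x - du x)).
  by rewrite exprMn ler_wpM2l ?sqr_ge0.
rewrite -H1sqZ; last exact: C1pB.
by congr H1sq; apply/funext => x; rewrite mulrBr.
Qed.

Lemma H1sq_uniq u g (k : R -> R[i]) : C1p u g -> C1p u k -> H1sq u g = H1sq u k.
Proof.
move=> h1 h2; apply: eq_RI => x xab.
by rewrite -(cdif_cderive (C1p_d h1 xab)) (cdif_cderive (C1p_d h2 xab)).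
Qed.

Lemma bl_trig V : bl a b M V -> V =1 trig_poly a b N (fc V).
Proof.
elim=> [z m hm|V1 V2 b1 IH1 b2 IH2] x; last first.
  rewrite (IH1 x) (IH2 x) !trigE -big_split; apply: eq_bigr => k _ /=.
  by rewrite (fcD hab) ?mulrDl//; apply: ccont_Int; [exact: bl_ccont b1|exact: bl_ccont b2].
have [k0 fk] := freq_surj MN hm.
have Iem : Int a b (em a b m) by exact/ccont_Int/ccont_em.
rewrite trigE (bigD1 k0)//= big1 ?addr0.
  by rewrite fk (fcZ hab)// (fc_em hab) eqxx mulr1.
move=> k kk; rewrite (fcZ hab)// (fc_em hab) (_ : (m == freq N k) = false) ?mulr0 ?mul0r//.
by apply/negbTE; rewrite -subr_eq0 -fk freq_inj eq_sym.
Qed.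

Lemma C1p_interp_sub u du w : C1p u du ->
  C1p (fun x => u x - interp w x) (fun x => du x - trig_poly a b N (dcoef a b (dft w)) x).
Proof. by move=> h; apply: C1pB h _; exact: C1p_trig. Qed.

(** The interpolation error splits into the truncation error of [u] and a
    trigonometric polynomial, whose H^1 norm is read off from its coefficients. *)
Lemma Hnorm_interp_le d r u du w : 0 <= d -> approximable d u du ->
  nrm (fun l => fc u l - dft w l) <= r ->
  (Hnorm a b 1 (fun x => u x - interp w x)%R <= (2 * (d + r))%:E)%E.
Proof.
move=> d0 [V [g [bV cV cu h]]] hr.
have r0 : 0 <= r by apply: le_trans hr; exact: nrm_ge0.
apply: (Hnorm1_le hab (C1p_interp_sub w cu)); first by rewrite mulr_ge0 ?addr_ge0.
pose c l := fc V l - dft w l.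
have hc : nrm c <= d + r.
  apply: (le_trans (nrm_sub N hab _ (fc u) _)); apply: lerD => //.
  exact: (nrm_fc_sub N hab cV cu d0 h).
have uV := C1pB cu cV.
have Vg : C1p (trig_poly a b N c) (fun x => g x - trig_poly a b N (dcoef a b (dft w)) x).
  have := C1pB cV (C1p_trig hab N (dft w)); congr C1p.
  apply/funext => x; rewrite (bl_trig bV) !trigE -sumrB; apply: eq_bigr => k _.
  by rewrite /c mulrBl.
have E1 : H1sq (trig_poly a b N c) (fun x => g x - trig_poly a b N (dcoef a b (dft w)) x) <= (d + r) ^+ 2.
  have -> : H1sq (trig_poly a b N c) (fun x => g x - trig_poly a b N (dcoef a b (dft w)) x) =
     H1sq (trig_poly a b N c) (trig_poly a b N (dcoef a b c)).
    exact: (H1sq_uniq Vg (C1p_trig hab N c)).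
  rewrite (H1sq_trig hab) ler_sqr ?nnegrE ?addr_ge0//; exact: nrm_ge0.
have h' : H1sq (fun x => u x - V x) (fun x => du x - g x) <= d ^+ 2.
  rewrite -(H1sqN a b) (_ : H1sq _ _ = H1sq (fun x => V x - u x) (fun x => g x - du x))//.
  by congr H1sq; apply/funext => x; rewrite opprB.
have := H1sqD uV Vg.
rewrite (_ : H1sq (fun x => _ + _) _ = H1sq (fun x => u x - interp w x)
  (fun x => du x - trig_poly a b N (dcoef a b (dft w)) x)); last first.
  congr H1sq; apply/funext => x; last by rewrite addrA subrK.
  rewrite -[trig_poly _ _ _ c x](_ : V x - interp w x = _) ?addrA ?subrK//.
  by rewrite (bl_trig bV) /Defs.interp !trigE -sumrB; apply: eq_bigr => k _; rewrite /c mulrBl.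
move=> H; apply: (le_trans H).
have : d ^+ 2 <= (d + r) ^+ 2 by rewrite ler_sqr ?nnegrE ?addr_ge0// lerDl.
rewrite exprMn; move: E1 h'; move: (H1sq _ _) (H1sq _ _) ((d + r) ^+ 2) (d ^+ 2) => x y t s; lra.
Qed.

Lemma nrm_of_Hnorm r u du w : C1p u du ->
  (Hnorm a b 1 (fun x => u x - interp w x)%R <= r%:E)%E ->
  0 <= r /\ nrm (fun l => fc u l - dft w l) <= r.
Proof.
move=> cu h; have cc := C1p_interp_sub w cu.
have [r0 h1] := H1sq_le hab cc h; split => //.
have := nrm_sqrt (nrm_fc_le hab N cc h1); rewrite sqrtr_sqr ger0_norm//.
rewrite (@eq_nrm _ a b N _ (fun l => fc u l - dft w l))// => k.
rewrite (fcB hab) ?(fc_trig hab)//; first exact: ccont_Int (C1p_c0 cu).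
exact: ccont_Int (C1p_c0 (C1p_trig hab N _)).
Qed.

End interpolation_error.

Lemma mode_bound_sq_ge (R : realType) (a b K : R) : a < b -> 0 <= K ->
  [/\ K <= mode_bound_sq a b K, Ka a b * K * K <= mode_bound_sq a b K & 22 * (Ka a b * K * K) <= mode_bound_sq a b K].
Proof.
move=> hab K0; have k0 := Ka_ge0 hab.
have q1 : 0 <= Ka a b * K ^+ 2 by rewrite mulr_ge0 ?sqr_ge0.
have q2 : 0 <= Ka a b * K * (2 * K + 2 * (Ka a b * K ^+ 2)).
  by apply: mulr_ge0; [exact: mulr_ge0|lra].
rewrite -mulrA -expr2 /mode_bound_sq; split; lra.
Qed.

Lemma taylor_sum (R : realType) (x y B C e t : R) : x <= 3 * B * t -> y <= 2 * e ->
  0 <= B * e -> 0 <= e -> 0 <= t -> x + y + C * (e + t) <= (3 * B + 2 + C) * (e + t).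
Proof. by move=> *; lra. Qed.

Definition Cerr (R : realType) (a b B : R) : R :=
  2 * (4 + 5 * B + Cpsi1 a b B + Cpsi2 a b B + Cphi1 a b B).

Lemma consts_ge0 (R : realType) (a b B : R) : 1 <= B ->
  [/\ 0 <= Cpsi1 a b B, 0 <= Cpsi2 a b B & 0 <= Cphi1 a b B].
Proof.
move=> B1; have B0 : 0 <= B by apply: le_trans B1.
have A0 := Calg_ge0 a b; have D0 := Dp_ge0 a b B1.
have X0 : 0 <= Cmul a b by rewrite /Cmul addr_ge0 ?sqrtr_ge0// mulr_ge0.
have AB : 0 <= Calg a b * B by rewrite mulr_ge0.
have AB2 : 0 <= Calg a b * B ^+ 2 by rewrite mulr_ge0 ?sqr_ge0.
have XB : 0 <= Cmul a b * B by rewrite mulr_ge0.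
by split; rewrite /Cpsi1 /Cpsi2 /Cphi1; repeat (apply: addr_ge0 || apply: mulr_ge0 || exact: ler0n) => //.
Qed.

Lemma Cerr_gt0 (R : realType) (a b B : R) : 1 <= B -> 0 < Cerr a b B.
Proof.
move=> B1; have [c1 c2 c3] := consts_ge0 a b B1.
by rewrite mulr_gt0// !ltr_wpDr// mulr_ge0// (le_trans _ B1).
Qed.

Section error_at_time.
Context {R : realType}.
Variables (a b T eps K : R).
Hypothesis hab : a < b.
Hypothesis hT : 0 < T.
Hypothesis heps : 0 < eps <= 1.
Variables (psi : R -> R -> R[i]) (phi phit : R -> R -> R).
Variables (Dpsi Dphi Dphit : R -> nat -> R -> R[i]).
Hypothesis Rpsi : forall t, 0 <= t <= T -> Reg a b K (psi t) (Dpsi t).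
Hypothesis Rphi : forall t, 0 <= t <= T -> Reg a b K (fun x => (phi t x)%:C) (Dphi t).
Hypothesis Rphit : forall t, 0 <= t <= T ->
  Reg a b (K / eps ^+ 4) (fun x => (phit t x)%:C) (Dphit t).
Hypothesis cpsi : forall x, a <= x <= b -> ccontinuous_on `[0, T] (psi ^~ x).
Hypothesis cphi : forall x, a <= x <= b -> ccontinuous_on `[0, T] (fun t => (phi t x)%:C).
Hypothesis cphit : forall x, a <= x <= b -> ccontinuous_on `[0, T] (fun t => (phit t x)%:C).
Variables (psi0 : R -> R[i]) (phi0 phi1 : R -> R).
Hypothesis sol : solves a b T psi0 phi0 phi1 eps psi phi phit.

Variables (tau : R) (N M n : nat) (s B E d : R).
Hypothesis htau : 0 < tau <= 1.
Hypothesis N0 : (0 < N)%N.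
Hypothesis Neven : ~~ odd N.
Hypothesis MN : (2 * M < N./2)%N.
Hypothesis hs : 0 <= s <= tau.
Hypothesis hts : n%:R * tau + s <= T.
Hypothesis hB : mode_bound a b K + 1 <= B.
Hypothesis heB : 32 * (E + d) <= B.
Hypothesis d0 : 0 <= d.

Local Notation fc := (fc a b).
Local Notation H1sq := (H1sq a b).
Local Notation nrm := (nrm a b N).
Local Notation dft := (@dft R a b N).
Local Notation S := (mtifp a b eps tau N psi0 phi0 phi1 n).
Local Notation t0 := (n%:R * tau).
Local Notation approx := (approximable a b M).
Local Notation near := (near_grid (N := N) a b M).

Hypothesis Apsi : forall t, 0 <= t <= T -> approx d (psi t) (Dpsi t 1%N).
Hypothesis Aphi : forall t, 0 <= t <= T -> approx d (fun x => (phi t x)%:C) (Dphi t 1%N).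
Hypothesis Aphit : forall t, 0 <= t <= T ->
  approx d (fun x => (eps ^+ 2)%:C * (phit t x)%:C) (fun x => (eps ^+ 2)%:C * Dphit t 1%N x).
Hypothesis Epsi : nrm (fun l => fc (psi t0) l - dft (Psi S) l) <= E.
Hypothesis Ephi : nrm (fun l => fc (fun x => (phi t0 x)%:C) l - dft (Phi S) l) <= E.
Hypothesis Ephit : nrm (fun l => fc (fun x => (eps ^+ 2)%:C * (phit t0 x)%:C) l
  - dft (fun j => (eps ^+ 2)%:C * dPhi S j) l) <= E.

Let e0 : 0 < eps. Proof. by case/andP: heps. Qed.
Let tau0 : 0 < tau. Proof. by case/andP: htau. Qed.
Let s0 : 0 <= s. Proof. by case/andP: hs. Qed.
Let st : s <= tau. Proof. by case/andP: hs. Qed.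
Let t00 : 0 <= t0. Proof. by rewrite mulr_ge0// ltW. Qed.
Let t0T : 0 <= t0 <= T.
Proof. by rewrite t00 (le_trans _ hts)// lerDl. Qed.
Let t1T : 0 <= t0 + s <= T. Proof. by rewrite hts addr_ge0. Qed.
Let B1 : 1 <= B. Proof. by apply: le_trans hB; rewrite lerDr mode_bound_ge0. Qed.
Let mode_boundB : mode_bound a b K <= B. Proof. by apply: le_trans hB; rewrite lerDl. Qed.
Let Bge0 : 0 <= B. Proof. exact: le_trans B1. Qed.
Let K0 : 0 <= K. Proof. exact: Reg_K0 (Rpsi t0T). Qed.
Let E0 : 0 <= E. Proof. by apply: le_trans Epsi; exact: nrm_ge0. Qed.
Let e := E + d.
Let e_ge0 : 0 <= e. Proof. exact: addr_ge0. Qed.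

Local Notation u := (psi t0).
Local Notation v := (vx eps phi phit t0).
Let dv x : R[i] := 2^-1 * (Dphi t0 1%N x - 'i%C * ((eps ^+ 2)%:C * Dphit t0 1%N x)).

Lemma near_Psi : near u (Dpsi t0 1%N) (Psi S) e.
Proof. exact: near_of_approximable (Apsi t0T) Epsi. Qed.

Lemma near_Phi : near (fun x => (phi t0 x)%:C) (Dphi t0 1%N) (Phi S) e.
Proof. exact: near_of_approximable (Aphi t0T) Ephi. Qed.

Lemma near_v0 : near v dv (v0 eps S) e.
Proof.
have h := near_half hab near_Phi (near_of_approximable hab d0 (Aphit t0T) Ephit).
move: h; congr near_grid; apply/funext => x; first by rewrite /vx mulrA.
by rewrite /Defs.v0 mulrA.
Qed.

Lemma K_le_sqr : K <= B ^+ 2.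
Proof.
have [KB _ _] := mode_bound_sq_ge hab K0.
apply: (le_trans KB); have B20 : 0 <= mode_bound_sq a b K by apply: le_trans KB.
rewrite -(sqr_sqrtr B20) ler_sqr ?nnegrE ?sqrtr_ge0//; exact: mode_boundB.
Qed.

Lemma C1p_u : C1p a b u (Dpsi t0 1%N) /\ H1sq u (Dpsi t0 1%N) <= K.
Proof. exact: Reg_ex (Rpsi t0T). Qed.

Lemma H1_v : C1p a b v dv /\ H1sq v dv <= K.
Proof.
have [c1 b1] := Reg_ex (Rphi t0T); have [c2 b2] := Reg_ex (Rphit t0T).
have z2 := C1pZ (eps ^+ 2)%:C c2; have i2 := C1pZ 'i%C z2; have m := C1pB c1 i2.
have cv : C1p a b v dv.
  by have := C1pZ 2^-1 m; congr C1p; apply/funext => x; rewrite /vx mulrA.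
split => //.
have -> : H1sq v dv = nc (2^-1) ^+ 2 * H1sq (fun x => (phi t0 x)%:C - 'i%C * ((eps ^+ 2)%:C * (phit t0 x)%:C))
   (fun x => Dphi t0 1%N x - 'i%C * ((eps ^+ 2)%:C * Dphit t0 1%N x)).
  rewrite -(H1sqZ _ m); congr H1sq; apply/funext => x; by rewrite /vx mulrA.
have := H1sqB c1 i2; rewrite (H1sqZ _ z2) (H1sqZ _ c2) nci expr1n mul1r nc2V ncR.
have h : `|eps ^+ 2| ^+ 2 * H1sq (fun x => (phit t0 x)%:C) (Dphit t0 1%N) <= K.
  apply: (@le_trans _ _ (`|eps ^+ 2| ^+ 2 * (K / eps ^+ 4))); first by rewrite ler_wpM2l ?sqr_ge0.
  rewrite ger0_norm ?exprn_ge0 ?(ltW e0)// -exprM mulrCA divff ?mulr1// expf_neq0// gt_eqF//.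
move=> hd; have -> : K = 2^-1 ^+ 2 * (2 * K + 2 * K) by field.
rewrite ler_wpM2l ?sqr_ge0// (le_trans hd)// lerD// ler_wpM2l//.
Qed.

Lemma C3_bounds : [/\ nrm (fun l => (mu a b l ^+ 2)%:C * fc v l) <= B,
  nrm (fun l => (mu a b l ^+ 2)%:C * fc (fun x => conjc (v x)) l) <= B &
  [/\ nrm (fc (fun x => v x * u x)) <= B,
      nrm (fun l => (mu a b l ^+ 2)%:C * fc (fun x => v x * u x) l) <= B,
      nrm (fc (fun x => conjc (v x) * u x)) <= B &
      nrm (fun l => (mu a b l ^+ 2)%:C * fc (fun x => conjc (v x) * u x) l) <= B]].
Proof.
have [D cv] := vx_C3 heps Rphi Rphit t0T; have cu := Reg_C3 (Rpsi t0T).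
have [b1 b2 b3] := mode_bound_sq_ge hab K0.
have lB c : nrm c ^+ 2 <= mode_bound_sq a b K -> nrm c <= B by move=> h; apply: (le_trans (nrm_sqrt h)).
have [_ h1] := C3_nrm hab N cv; have [_ h2] := C3_nrm hab N (C3J cv).
have [h3 h4] := C3_prod hab N cv cu; have [h5 h6] := C3_prod hab N (C3J cv) cu.
split; [| |split]; apply: lB.
- exact: le_trans h1 b1.
- exact: le_trans h2 b1.
- exact: le_trans h3 b2.
- exact: le_trans h4 b3.
- exact: le_trans h5 b2.
- exact: le_trans h6 b3.
Qed.

Lemma nPhiPsi : nrm (dft (fun j => Phi S j * Psi S j)) <= 9 * (Calg a b * B ^+ 2).
Proof.
have eB : e <= B by apply: le_trans heB; rewrite ler_peMl// ler1n.
have h1 := nrm_near hab B1 near_Phi (le_trans (Reg_ex (Rphi t0T)).2 K_le_sqr) eB.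
have h2 := nrm_near hab B1 near_Psi (le_trans C1p_u.2 K_le_sqr) eB.
apply: (le_trans (nrm_dftM hab N0 Neven _ _)).
have -> : 9 * (Calg a b * B ^+ 2) = Calg a b * (3 * B) * (3 * B) by ring.
have A0 := Calg_ge0 a b.
apply: ler_pM h2; rewrite ?nrm_ge0// ?mulr_ge0 ?nrm_ge0//.
exact: ler_wpM2l.
Qed.

Lemma psi_hat_t_split l : 'i%C * (- ((mu a b l ^+ 2)%:C * fc u l) +
   (fc (fun x => v x * u x) l + fc (fun x => conjc (v x) * u x) l)) = psi_hat_t a b psi phi t0 l.
Proof.
have [cv _] := H1_v; have [cu _] := C1p_u.
rewrite -(fcD hab); try by apply/ccont_Int/C1p_c0; exact: (C1pM cv cu) || exact: (C1pM (C1pJ cv) cu).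
rewrite /psi_hat_t /psi_hat /coupling_hat; congr (_ * (_ + _)); apply: eq_fc => x _.
by rewrite -mulrDl vx_sum.
Qed.

Lemma dft_Psi_int (k : 'I_N) :
  dft (Psi_int a b eps tau psi0 phi0 phi1 n s) (freq N k) =
  dft (Psi S) (freq N k) + (s / tau)%:C * dstep a b eps tau S (freq N k).
Proof.
have -> : Psi_int a b eps tau psi0 phi0 phi1 n s = fun j =>
   ((tau - s) / tau)%:C * Psi S j + (s / tau)%:C * Psi_next a b eps tau S j by [].
rewrite (dftD a b (fun j => _ * Psi S j) (fun j => _ * Psi_next a b eps tau S j)).
rewrite (dftZ a b _ (Psi S)) (dftZ a b _ (Psi_next a b eps tau S)) dft_idft//.
have -> : ((tau - s) / tau)%:C = 1 - (s / tau)%:C :> R[i].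
  by rewrite mulrBl divff ?gt_eqF// cRD cRN.
rewrite /dstep; move: (coef_c _ _ _ _ _ _) (coef_c _ _ _ _ _ _) (coef_d _ _ _ _ _ _) (coef_d _ _ _ _ _ _) => c1 c2 d1 d2.
move: (dft _ _) (dft _ _) (dft _ _) (dft _ _) (dft _ _) (expi _) ((_ / _)%:C) => p1 p2 p3 p4 p5 x z; ring.
Qed.

Let sdt : nc ((s / tau)%:C : R[i]) <= 1.
Proof. by rewrite ncR ger0_norm ?divr_ge0 ?(ltW tau0)// ler_pdivrMr// mul1r. Qed.

(** The exact and the numerical increments are both [s] times the derivative of
    [psi_hat] at the grid time, up to second order. *)
Lemma psi_error1 : nrm (fun l => fc (psi (t0 + s)) l -
    dft (Psi_int a b eps tau psi0 phi0 phi1 n s) l) <=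
  (3 * B + 2 + Cpsi1 a b B) * (e + tau ^+ 2 / eps ^+ 2).
Proof.
have [k1 k2 [k3 k4 k5 k6]] := C3_bounds.
have [f1 f2 f4] := nrm_psi_hat hab hT Rpsi N t0T.
have hst := dstep_taylor hab heps htau N0 Neven MN B1 heB near_Psi near_v0
  (le_trans C1p_u.2 K_le_sqr) (le_trans H1_v.2 K_le_sqr) (le_trans f2 mode_boundB) (le_trans f4 mode_boundB) k3 k4 k5 k6 nPhiPsi.
have tay := psi_hat_taylor hab hT heps Rpsi Rphi Rphit cpsi cphi sol N t00 s0 hts.
have dP := dist_P hab near_Psi.
rewrite (@eq_nrm _ a b N _ (fun l =>
  (psi_hat a b psi (t0 + s) l - psi_hat a b psi t0 l - s%:C * psi_hat_t a b psi phi t0 l) +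
  (fc u l - dft (Psi S) l) +
  (s / tau)%:C * (tau%:C * ('i%C * (- ((mu a b l ^+ 2)%:C * fc u l) +
    (fc (fun x => v x * u x) l + fc (fun x => conjc (v x) * u x) l))) - dstep a b eps tau S l))); last first.
  move=> k; rewrite dft_Psi_int psi_hat_t_split /psi_hat.
  have -> : s%:C = (s / tau)%:C * tau%:C :> R[i] by rewrite -cRM divfK// gt_eqF.
  move: (dstep _ _ _ _ _ _) (psi_hat_t _ _ _ _ _ _) (fc _ _) (fc _ _) (dft _ _) (_%:C) (_%:C) => *; ring.
have h3 := le_trans (nrmZ N hab ((s / tau)%:C) _) (ler_pM (nc_ge0 _) (nrm_ge0 _ _ _ _) sdt hst).
rewrite mul1r in h3.
apply: (le_trans (nrmD N hab _ _)); apply: (le_trans (lerD (nrmD N hab _ _) h3)).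
have T0 : 0 <= tau ^+ 2 / eps ^+ 2 by rewrite divr_ge0 ?sqr_ge0.
have sl : s ^+ 2 / eps ^+ 2 <= tau ^+ 2 / eps ^+ 2.
  by rewrite ler_wpM2r ?invr_ge0 ?sqr_ge0// ler_sqr ?nnegrE// ltW.
have B0 := mode_bound_ge0 a b K.
have q : 3 * mode_bound a b K * (s ^+ 2 / eps ^+ 2) <= 3 * B * (tau ^+ 2 / eps ^+ 2).
  by apply: ler_pM sl; [exact: mulr_ge0|rewrite divr_ge0 ?sqr_ge0|rewrite ler_wpM2l].
have [c1 _ _] := consts_ge0 a b B1; have z1 := mulr_ge0 Bge0 e_ge0.
exact: taylor_sum (le_trans tay q) dP z1 e_ge0 T0.
Qed.

(** The exact and the numerical increments are both of order [tau], up to the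
    error at the grid time. *)
Lemma psi_error2 : nrm (fun l => fc (psi (t0 + s)) l -
    dft (Psi_int a b eps tau psi0 phi0 phi1 n s) l) <=
  (2 * B + 2 + Cpsi2 a b B) * (e + tau).
Proof.
have [f1 f2 f4] := nrm_psi_hat hab hT Rpsi N t0T.
have hst := nrm_dstep hab htau N0 Neven MN B1 heB near_Psi near_v0
  (le_trans C1p_u.2 K_le_sqr) (le_trans H1_v.2 K_le_sqr) (le_trans f2 mode_boundB) nPhiPsi.
have tay := psi_hat_lip hab hT Rpsi Rphi cpsi sol N t00 s0 hts.
have dP := dist_P hab near_Psi.
rewrite (@eq_nrm _ a b N _ (fun l =>
  (psi_hat a b psi (t0 + s) l - psi_hat a b psi t0 l) + (fc u l - dft (Psi S) l) -
  (s / tau)%:C * dstep a b eps tau S l)); last first.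
  move=> k; rewrite dft_Psi_int /psi_hat.
  move: (dstep _ _ _ _ _ _) (fc _ _) (fc _ _) (dft _ _) (_%:C) => *; ring.
have h3 := le_trans (nrmZ N hab ((s / tau)%:C) _) (ler_pM (nc_ge0 _) (nrm_ge0 _ _ _ _) sdt hst).
rewrite mul1r in h3.
apply: (le_trans (nrmB N hab _ _)); apply: (le_trans (lerD (nrmD N hab _ _) h3)).
have B0 := mode_bound_ge0 a b K.
have q : 2 * mode_bound a b K * s <= 2 * B * tau.
  by apply: ler_pM => //; rewrite ?mulr_ge0// ler_wpM2l.
have z1 := mulr_ge0 Bge0 e_ge0; have tg := ltW tau0.
move: (le_trans tay q) dP z1 e_ge0; rewrite -/e.
move: (nrm _) (nrm _) => x y h1 h2 z1 z2.
have -> : (2 * B + 2 + Cpsi2 a b B) * (e + tau) = 2 * B * tau + (2 * (B * e) + 2 * e + 2 * tau) + Cpsi2 a b B * (e + tau).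
  by ring.
lra.
Qed.

Lemma in_step x : 0 <= x <= s -> 0 <= x <= tau.
Proof. by move=> /andP[-> xs]; exact: le_trans xs st. Qed.

(** The free propagator, applied to the exact data, is compared with the
    interpolant by [phi_interp]; the source is left to [phi_hat_duhamel]. *)
Lemma phi_error L : sinc_bound eps tau L ->
  nrm (fun l => fc (fun x => (phi (t0 + s) x)%:C) l -
    dft (Phi_int a b eps tau psi0 phi0 phi1 n s) l) <= (2 * B + Cphi1 a b B) * (e + L * tau).
Proof.
move=> hL; have L0 := sinc_bound_ge0 heps tau0 hL.
have [k1 k2 [k3 k4 k5 k6]] := C3_bounds.
have [f1 f2 f4] := nrm_psi_hat hab hT Rpsi N t0T.
have hst := phi_interp hab heps htau N0 Neven MN B1 heB near_Psi near_v0
  (le_trans C1p_u.2 K_le_sqr) (le_trans f2 mode_boundB) k1 k2 nPhiPsi hL hs.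
have duh := phi_hat_duhamel hab hT heps Rpsi Rphi Rphit cphi cphit sol N t00 s0 hts L0.
have {}duh := duh (fun l x hx => sinc_le a b heps l hL (in_step hx)).
rewrite (@eq_nrm _ a b N _ (fun l => (phi_hat a b phi (t0 + s) l -
   ((cos (omega a b eps l * s))%:C * phi_hat a b phi t0 l +
    (sin (omega a b eps l * s) / omega a b eps l)%:C * phit_hat a b phit t0 l)) +
   (expi (s / eps ^+ 2) * coef_a a b eps l s * fc v l
    + expi (- (s / eps ^+ 2)) * conjc (coef_a a b eps l s) * fc (fun x => conjc (v x)) l
    - dft (Phi_int a b eps tau psi0 phi0 phi1 n s) l))); last first.
  move=> k; have [cv _] := H1_v; have [c1 _] := Reg_ex (Rphi t0T).
  have [c2 _] := Reg_ex (Rphit t0T).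
  have i1 := ccont_Int (C1p_c0 c1); have i2 := ccont_Int (C1p_c0 c2); have iv := ccont_Int (C1p_c0 cv).
  have Ev : fc v (freq N k) = 2^-1 * (phi_hat a b phi t0 (freq N k) - 'i%C * (eps ^+ 2)%:C * phit_hat a b phit t0 (freq N k)).
    rewrite /vx (fcZ hab); last by apply: IntD => //; apply/IntN/IntZ.
    by rewrite (fcB hab)//; [rewrite (fcZ hab)|exact: IntZ].
  have Ec : fc (fun x => conjc (v x)) (freq N k) = phi_hat a b phi t0 (freq N k) - fc v (freq N k).
    rewrite -(fcB hab)//; apply: eq_fc => x _; rewrite -(vx_sum eps phi phit); ring.
  have w0 := omega_gt0 a b heps (freq N k).
  have ra := coef_a_rot a b heps (freq N k) s.
  have rc : expi (- (s / eps ^+ 2)) * conjc (coef_a a b eps (freq N k) s) =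
    (cos (omega a b eps (freq N k) * s))%:C - 'i%C * (sin (omega a b eps (freq N k) * s) / (omega a b eps (freq N k) * eps ^+ 2))%:C.
    rewrite expiN -conjcM ra conjcD conjcM !conjcR.
    have -> : conjc ('i%C : R[i]) = - 'i%C by apply: complex_eq => //=; rewrite oppr0.
    by rewrite mulNr.
  rewrite ra rc Ec Ev -[fc (fun x => (phi (t0 + s) x)%:C) _]/(phi_hat a b phi (t0 + s) (freq N k)).
  have -> : (sin (omega a b eps (freq N k) * s) / omega a b eps (freq N k))%:C =
     (sin (omega a b eps (freq N k) * s) / (omega a b eps (freq N k) * eps ^+ 2))%:C * (eps ^+ 2)%:C :> R[i].
    rewrite -cRM; congr real_complex_def; move: (sin _) => x; move: (omega _ _ _ _) w0 => w w0.
    by have ep := e0; field; rewrite !gt_eqF.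
  move: (phi_hat _ _ _ _ _) (phi_hat _ _ _ _ _) (phit_hat _ _ _ _ _) (dft _ _) => F1 F2 G1 D1.
  move: ((cos _)%:C) ((sin _ / _)%:C) ((eps ^+ 2)%:C) => c q z.
  have i2' : 'i%C * 'i%C = -1 :> R[i] by rewrite -expr2 sqr_i.
  rewrite -[q * z * G1](_ : - ('i%C * 'i%C) * (q * z * G1) = _); last by rewrite i2' opprK mul1r.
  by field.
apply: (le_trans (nrmD N hab _ _)); apply: (le_trans (lerD duh hst)).
have B0 := mode_bound_ge0 a b K; have tg := ltW tau0.
have q : 2 * L * mode_bound a b K * s <= 2 * B * (L * tau).
  have -> : 2 * B * (L * tau) = 2 * L * B * tau by ring.
  by apply: ler_pM => //; rewrite ?mulr_ge0// ler_wpM2l// mulr_ge0.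
have z1 := mulr_ge0 Bge0 e_ge0.
have -> : (2 * B + Cphi1 a b B) * (e + L * tau) = 2 * B * (L * tau) + 2 * (B * e) + Cphi1 a b B * (e + L * tau).
  by ring.
by rewrite -/e lerD2r (le_trans q)// lerDl mulr_ge0.
Qed.

Lemma Hnorm_errors :
  let ep := (Hnorm a b 1 (fun x => psi (t0 + s) x
      - @interp R a b N (Psi_int a b eps tau psi0 phi0 phi1 n s) x)%R) in
  let ef := (Hnorm a b 1 (fun x => (phi (t0 + s) x)%:C
      - @interp R a b N (Phi_int a b eps tau psi0 phi0 phi1 n s) x)%R) in
  [/\ (ep <= (Cerr a b B * (e + tau ^+ 2 / eps ^+ 2))%:E)%E,
      (ep <= (Cerr a b B * (e + tau))%:E)%E,
      (ef <= (Cerr a b B * (e + tau ^+ 2 / eps ^+ 2))%:E)%E &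
      (ef <= (Cerr a b B * (e + tau))%:E)%E].
Proof.
have [c1 c2 c3] := consts_ge0 a b B1; have tg := ltW tau0; have b0 := Bge0.
have de : d <= e by rewrite lerDr.
have H k X : 0 <= X -> 0 <= k -> k <= 3 + 5 * B + Cpsi1 a b B + Cpsi2 a b B + Cphi1 a b B ->
  2 * (d + k * (e + X)) <= Cerr a b B * (e + X).
  move=> X0 k0 hk; rewrite /Cerr -mulrA ler_wpM2l//.
  have eX : 0 <= e + X by rewrite addr_ge0.
  have -> : 4 + 5 * B + Cpsi1 a b B + Cpsi2 a b B + Cphi1 a b B =
    1 + (3 + 5 * B + Cpsi1 a b B + Cpsi2 a b B + Cphi1 a b B) by ring.
  rewrite mulrDl mul1r lerD ?ler_wpM2r//.
  by rewrite (le_trans de)// lerDl.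
have q0 : 0 <= tau ^+ 2 / eps ^+ 2 by rewrite divr_ge0 ?sqr_ge0.
have L1 : sinc_bound eps tau 1 by left.
have L2 : sinc_bound eps tau (tau / eps ^+ 2) by right.
have P1 := phi_error L1; have P2 := phi_error L2.
rewrite mul1r in P1; rewrite (_ : tau / eps ^+ 2 * tau = tau ^+ 2 / eps ^+ 2) in P2; last by ring.
split.
- have h := Hnorm_interp_le hab MN d0 (Apsi t1T) psi_error1.
  apply: (le_trans h).
  by rewrite lee_fin H//; move: c1 c2 c3 b0; move: (Cpsi1 _ _ _) (Cpsi2 _ _ _) (Cphi1 _ _ _) => *; lra.
- have h := Hnorm_interp_le hab MN d0 (Apsi t1T) psi_error2.
  apply: (le_trans h).
  by rewrite lee_fin H//; move: c1 c2 c3 b0; move: (Cpsi1 _ _ _) (Cpsi2 _ _ _) (Cphi1 _ _ _) => *; lra.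
- have h := Hnorm_interp_le hab MN d0 (Aphi t1T) P2.
  apply: (le_trans h).
  by rewrite lee_fin H//; move: c1 c2 c3 b0; move: (Cpsi1 _ _ _) (Cpsi2 _ _ _) (Cphi1 _ _ _) => *; lra.
- have h := Hnorm_interp_le hab MN d0 (Aphi t1T) P1.
  apply: (le_trans h).
  by rewrite lee_fin H//; move: c1 c2 c3 b0; move: (Cpsi1 _ _ _) (Cpsi2 _ _ _) (Cphi1 _ _ _) => *; lra.
Qed.

End error_at_time.

(** * Uniform regularity and band-limited approximations *)

Section extraction.
Context {R : realType}.
Variables (a b T : R).
Hypothesis hab : a < b.
Hypothesis hT : 0 < T.
Local Notation C1p := (C1p a b).
Local Notation H1sq := (H1sq a b).
Implicit Types (u du : R -> R[i]) (K L d r t : R).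

Lemma Reg_mono K L u D : K <= L -> Reg a b K u D -> Reg a b L u D.
Proof.
move=> KL [h0 h1 h2 h3]; split => // [k k4|N]; first exact: le_trans (h2 k k4) KL.
exact: le_trans (h3 N) KL.
Qed.

Lemma LinfH_ge0 m (u : R -> R -> R[i]) : (0 <= LinfH a b T m u)%E.
Proof.
have lT : (0 < @leb R [set: R])%E.
  by have := @lebesgue_measure_itv R `]-oo, +oo[; rewrite set_itvNyy /= => ->; rewrite ltry.
apply: ess_sup_gee => //.
apply: nearW => t; rewrite /patch; case: ifP => _ //; exact: Hnorm_ge0.
Qed.

Lemma Reg_choice K (u : R -> R -> R[i]) : (forall t, 0 <= t <= T -> exists D, Reg a b K (u t) D) ->
  exists D, forall t, 0 <= t <= T -> Reg a b K (u t) (D t).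
Proof.
move=> h; have H t : exists D, 0 <= t <= T -> Reg a b K (u t) D.
  by have [/h[D hD]|n] := boolP (0 <= t <= T); [exists D|exists (fun _ _ => 0)].
by have [D hD] := choice H; exists D.
Qed.

Lemma sup_cont_Reg K m (u : R -> R -> R[i]) D x : (0 < m)%N -> C0_Hper a b T m u ->
  (forall t, 0 <= t <= T -> Reg a b K (u t) (D t)) -> a <= x <= b ->
  ccontinuous_on `[0, T] (fun t => u t x).
Proof.
move=> m0 hc hr; apply: (sup_continuous hab m0 hc) => t tT.
by exists (D t 1%N); exact: (Reg_ex (hr t tT)).1.
Qed.

Lemma split_eps r K : 0 < r <= 1 -> 0 <= K -> 4 * (K / r ^+ 2 + 1) ^+ 2 + 4 <= (4 * (K + 1) ^+ 2 + 4) / r ^+ 4.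
Proof.
move=> hr K0; have /andP[r0 r1] := hr; have i1 := inv_eps2_ge1 hr.
have -> : (4 * (K + 1) ^+ 2 + 4) / r ^+ 4 = 4 * (K * (r ^+ 2)^-1 + (r ^+ 2)^-1) ^+ 2 + 4 * (r ^+ 2)^-1 ^+ 2.
  by field; rewrite gt_eqF.
move: ((r ^+ 2)^-1) i1 => z z1.
have z0 : 0 <= z by apply: le_trans z1.
rewrite lerD// ?ler_wpM2l// ?ler_sqr ?nnegrE ?addr_ge0 ?mulr_ge0// ?lerD2l//.
by rewrite -[leLHS]mulr1 ler_wpM2l// exprn_ege1.
Qed.

(** Half the size of the coarser grid: the largest degree below [N / 4]. *)
Definition Mdeg (N : nat) : nat := ((N./2).-1)./2.
(** The constant of [approximable_exists]; its two terms belong to the two cases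
    of the proof. *)
Definition Kd h0 p K Kh : R := Kh * 4 ^+ p + Num.sqrt K / (Num.min h0 (b - a) / 4) ^+ p.

Lemma mesh_gt0 N : (0 < N)%N -> 0 < mesh a b N.
Proof. by move=> N0; rewrite /mesh divr_gt0 ?subr_gt0// ltr0n. Qed.

Lemma mesh_le N N' : (0 < N)%N -> (0 < N')%N -> (N <= 4 * N')%N -> mesh a b N' <= 4 * mesh a b N.
Proof.
move=> N0 N'0 NN; rewrite /mesh mulrCA ler_wpM2l ?subr_ge0 ?(ltW hab)//.
rewrite -[leRHS]invrK lef_pV2 ?posrE ?invr_gt0 ?mulr_gt0 ?invr_gt0 ?ltr0n// invfM invrK.
by rewrite ler_pdivrMl// -natrM ler_nat.
Qed.

(** A good interpolant on the coarser grid with [2 * Mdeg N] intervals is a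
    trigonometric polynomial of degree [Mdeg N], and the mesh size of that grid
    is at most four times that of the given one. When the coarser grid is empty
    or its mesh size exceeds [h0], the mesh size of the given grid is bounded
    below and the zero polynomial will do. *)
Lemma approximable_exists h0 p K Kh N u du : 0 < h0 -> 0 <= Kh -> C1p u du -> H1sq u du <= K ->
  (forall N' : nat, (0 < N')%N -> ~~ odd N' -> mesh a b N' <= h0 -> exists w : @grid R N',
     (Hnorm a b 1 (fun x => u x - interp a b w x)%R <= (Kh * mesh a b N' ^+ p)%:E)%E) ->
  (0 < N)%N -> ~~ odd N ->
  approximable a b (Mdeg N) (Kd h0 p K Kh * mesh a b N ^+ p) u du.
Proof.
move=> hh0 Kh0 cu hK H N0 Neven.
have m0 := mesh_gt0 N0; have mp : 0 <= mesh a b N ^+ p by rewrite exprn_ge0// ltW.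
set c := Num.min h0 (b - a) / 4.
have c0 : 0 < c by rewrite divr_gt0// lt_min hh0 subr_gt0.
have S0 : 0 <= Num.sqrt K / c ^+ p by rewrite divr_ge0 ?sqrtr_ge0// exprn_ge0// ltW.
have F0 : 0 <= Kh * 4 ^+ p by rewrite mulr_ge0// exprn_ge0.
have small : c <= mesh a b N -> approximable a b (Mdeg N) (Kd h0 p K Kh * mesh a b N ^+ p) u du.
  move=> cm; exists (fun=> 0), (fun=> 0); split => //; [exact: bl_zero|exact: C1p_cst|].
  rewrite (_ : H1sq _ _ = H1sq u du); last first.
    by rewrite -(H1sqN a b u); congr (H1sq _ _); apply/funext => x; rewrite sub0r.
  apply: (le_trans hK); have K0 : 0 <= K by apply: le_trans hK; exact: H1sq_ge0.
  rewrite -[leLHS](sqr_sqrtr K0) ler_sqr ?nnegrE ?sqrtr_ge0//; last by rewrite mulr_ge0// addr_ge0.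
  apply: (@le_trans _ _ (Num.sqrt K / c ^+ p * mesh a b N ^+ p)).
    rewrite -[leLHS]mulr1 -mulrA ler_wpM2l ?sqrtr_ge0// ler_pdivlMl ?exprn_gt0// mulr1.
    by rewrite lerXn2r ?nnegrE// ltW.
  by rewrite ler_wpM2r// lerDr.
have [N6|N6] := leqP 6 N; last first.
  apply: small; rewrite /c /mesh.
  have N4 : (N <= 4)%N by clear -N6 Neven; lia.
  apply: (@le_trans _ _ ((b - a) / 4)); first by rewrite ler_wpM2r// ge_min lexx orbT.
  by rewrite ler_wpM2l ?subr_ge0 ?(ltW hab)// lef_pV2 ?posrE ?ltr0n// ler_nat.
pose N' := (2 * Mdeg N)%N.
have N'0 : (0 < N')%N by rewrite /N' /Mdeg; clear -N6; lia.
have N'e : ~~ odd N' by rewrite /N' oddM.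
have NN : (N <= 4 * N')%N by rewrite /N' /Mdeg; clear -N6 Neven; lia.
have mm := mesh_le N0 N'0 NN.
have [hm|hm] := leP (mesh a b N') h0; last first.
  apply: small; rewrite /c ler_pdivrMr// mulrC (le_trans _ mm)//.
  by rewrite ge_min (ltW hm).
have [w hw] := H N' N'0 N'e hm.
have cw := C1p_trig hab N' (dft a b w).
have [_ h1] := H1sq_le hab (C1pB cu cw) hw.
exists (interp a b w), (trig_poly a b N' (dcoef a b (dft a b w))); split => //.
  apply: (@bl_sum _ a b _ N' (fun k => dft a b w (freq N' k)) (freq N')) => k kN.
  have := freq_le kN N'e.
  by rewrite /N' mul2n doubleK.
rewrite -(H1sqN a b) (_ : H1sq _ _ = H1sq (fun x => u x - trig_poly a b N' (dft a b w) x)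
  (fun x => du x - trig_poly a b N' (dcoef a b (dft a b w)) x)); last first.
  by congr (H1sq _ _); apply/funext => x; rewrite opprB.
apply: (le_trans h1); have m'0 := mesh_gt0 N'0.
rewrite ler_sqr ?nnegrE; last first.
- by rewrite mulr_ge0// addr_ge0.
- by rewrite mulr_ge0// exprn_ge0// ltW.
apply: (@le_trans _ _ (Kh * 4 ^+ p * mesh a b N ^+ p)).
  rewrite -mulrA ler_wpM2l// -exprMn lerXn2r ?nnegrE ?(ltW m'0)//.
  by rewrite mulr_ge0// ltW.
by rewrite ler_wpM2r// lerDl.
Qed.

Lemma small_step t r : 0 <= t -> 0 < r -> exists n tau, 0 < tau <= r /\ n%:R * tau = t.
Proof.
move=> t0 r0; have [->|tn] := eqVneq t 0.
  by exists 0%N, r; rewrite r0 lexx mul0r.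
have tp : 0 < t by rewrite lt_neqAle eq_sym tn.
have q0 : 0 <= t / r by rewrite divr_ge0// ltW.
have := archi_boundP q0; set n := Num.bound _ => hn.
have n0 : 0 < n%:R :> R by apply: le_lt_trans hn.
exists n, (t / n%:R); split; last by rewrite mulrC divfK// gt_eqF.
by rewrite divr_gt0//= ler_pdivrMr// mulrC -ler_pdivrMr// ltW.
Qed.

Lemma sum3_le (x y z : \bar R) r : (0 <= x)%E -> (0 <= y)%E -> (0 <= z)%E ->
  (x + y + z <= r%:E)%E -> [/\ (x <= r%:E)%E, (y <= r%:E)%E & (z <= r%:E)%E].
Proof.
move=> x0 y0 z0 h; split; apply: le_trans h.
- by rewrite -addeA leeDl// adde_ge0.
- by rewrite addeAC leeDr// adde_ge0.
- by rewrite leeDr// adde_ge0.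
Qed.

End extraction.

(** * The main theorem *)

Section auxiliary.
Context {R : realType}.
Implicit Types (x y r : R).

Lemma absorb1 (E A1 A2 k x q : R) : E <= A1 * (x + q) -> 0 <= A2 -> 0 <= k -> 0 <= x -> 0 <= q ->
  E + k * x + q <= (A1 + A2 + k + 1) * (x + q).
Proof.
move=> hE A0 k0 x0 q0; have := mulr_ge0 A0 x0; have := mulr_ge0 A0 q0; have := mulr_ge0 k0 q0.
lra.
Qed.

Lemma absorb2 (E A1 A2 k x q z : R) : E <= A2 * (x + z) -> 0 <= A1 -> 0 <= A2 -> 0 <= k ->
  0 <= x -> 0 <= q -> 0 <= z -> E + k * x + q <= (A1 + A2 + k + 1) * (x + q + z).
Proof.
move=> hE A10 A20 k0 x0 q0 z0; have h : 0 <= x + q + z by rewrite !addr_ge0.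
have := mulr_ge0 A10 h; have := mulr_ge0 A20 q0; have := mulr_ge0 k0 q0; have := mulr_ge0 k0 z0.
lra.
Qed.

Lemma double1 (C x q : R) : 0 <= C -> 0 <= x -> 0 <= q -> C * (x + q + q) <= (2 * C + 2) * (x + q).
Proof. by move=> C0 x0 q0; have := mulr_ge0 C0 x0; lra. Qed.

Lemma double2 (C x q : R) : 0 <= C -> 0 <= x -> 0 <= q -> x + q + q <= (2 * C + 2) * (x + q).
Proof. by move=> C0 x0 q0; have := mulr_ge0 C0 x0; have := mulr_ge0 C0 q0; lra. Qed.

Lemma Kd_scale (a b h0 : R) p (K Kh eps : R) : 0 < eps ->
  Kd a b h0 p (K / eps ^+ 4) (Kh / eps ^+ 2) = Kd a b h0 p K Kh / eps ^+ 2.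
Proof.
move=> e0; rewrite /Kd.
have -> : Num.sqrt (K / eps ^+ 4) = Num.sqrt K / eps ^+ 2.
  have e2 : 0 <= (eps ^+ 2)^-1 by rewrite invr_ge0 exprn_ge0// ltW.
  rewrite (_ : K / eps ^+ 4 = K * ((eps ^+ 2)^-1) ^+ 2).
    rewrite mulrC sqrtrM ?sqr_ge0// sqrtr_sqr ger0_norm// mulrC//.
  by rewrite exprVn -exprM.
by move: ((_ / 4) ^+ p) (Num.sqrt K) => z s; ring.
Qed.

Lemma nrm_scale (a b : R) N (z : R[i]) (u : R -> R[i]) (w : @grid R N) r : a < b -> Int a b u ->
  nrm a b N (fun l => fc a b u l - dft a b w l) <= r ->
  nrm a b N (fun l => fc a b (fun x => z * u x) l - dft a b (fun j => z * w j) l) <= nc z * r.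
Proof.
move=> hab iu h; rewrite (@eq_nrm _ a b N _ (fun l => z * (fc a b u l - dft a b w l))).
  by rewrite (le_trans (nrmZ N hab _ _))// ler_wpM2l// nc_ge0.
by move=> k; rewrite (fcZ hab)// (dftZ a b z w) mulrBr.
Qed.

Lemma min_quot_le x y : 0 < x -> 0 < y -> Num.min (x ^+ 2 / y) y <= x.
Proof.
move=> x0 y0; rewrite ge_min; have [yx|xy] := leP y x; first by rewrite orbT.
by rewrite ler_pdivrMr// expr2 ler_wpM2l ?(ltW xy)// ltW.
Qed.

(** The maximum over [eps] is reached when the two bounds are equal. *)
Lemma is_max_min x : 0 < x < 1 ->
  is_max [set Num.min (x ^+ 2 / e ^+ 2) (e ^+ 2) | e in [set e : R | 0 < e <= 1]] x.
Proof.
move=> /andP[x0 x1]; split; last first.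
  by move=> _ [e /andP[e0 _] <-]; apply: min_quot_le; rewrite ?exprn_gt0.
exists (Num.sqrt x); first by rewrite /= sqrtr_gt0 x0 -[leRHS]sqrtr1 ler_wsqrtr// ltW.
by rewrite sqr_sqrtr ?(ltW x0)// expr2 mulfK ?gt_eqF// minxx.
Qed.

End auxiliary.
Unset Implicit Arguments.
Set Strict Implicit.
Local Close Scope complex_scope.

Theorem theorem5p1 (R : realType) (a b T : R) (m0 : nat)
    (psi0 : R -> R[i]) (phi0 phi1 : R -> R)
    (psi : R -> R -> R -> R[i]) (phi phit : R -> R -> R -> R)
    (h0 tau0 : R) (hab : a < b) (hT : 0 < T)
    (hsol : forall eps : R, 0 < eps <= 1 ->
      solves a b T psi0 phi0 phi1 eps (psi eps) (phi eps) (phit eps))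
    (hA : assumption_A a b T m0 psi phi phit)
    (hh0 : 0 < h0 < 1) (htau0 : 0 < tau0 < 1)
    (herr1 : exists2 K : R, 0 < K &
      forall (eps tau : R) (N n : nat),
        admissible a b h0 tau0 eps tau N -> n%:R <= T / tau ->
        (Hnorm a b 1 (e_psi a b psi0 phi0 phi1 psi eps tau N n)
         + Hnorm a b 1 (e_phi a b psi0 phi0 phi1 phi eps tau N n)
         + (eps ^+ 2)%:E
           * Hnorm a b 1 (de_phi a b psi0 phi0 phi1 phit eps tau N n)
         <= (K * (mesh a b N ^+ (m0 - 1) + tau ^+ 2 / eps ^+ 2))%:E)%E)
    (herr2 : exists2 K : R, 0 < K &
      forall (eps tau : R) (N n : nat),
        admissible a b h0 tau0 eps tau N -> n%:R <= T / tau ->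
        (Hnorm a b 1 (e_psi a b psi0 phi0 phi1 psi eps tau N n)
         + Hnorm a b 1 (e_phi a b psi0 phi0 phi1 phi eps tau N n)
         + (eps ^+ 2)%:E
           * Hnorm a b 1 (de_phi a b psi0 phi0 phi1 phit eps tau N n)
         <= (K * (mesh a b N ^+ (m0 - 1) + eps ^+ 2))%:E)%E)
    (hbound : forall (eps tau : R) (N n : nat),
        admissible a b h0 tau0 eps tau N -> n%:R <= T / tau ->
        let S := mtifp a b eps tau N psi0 phi0 phi1 n in
        [/\ (Hnorm a b 1 (interp a b (Psi S)) <= Cpsi a b T m0 psi + 1)%E,
            (Hnorm a b 1 (interp a b (Phi S)) <= Cphi a b T m0 phi phit + 1)%E &
            (Hnorm a b 1 (interp a b (dPhi S))
             <= ((eps ^+ 2)^-1)%:E * (Cphi a b T m0 phi phit + 1))%E]) :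
  (exists2 C : R, 0 < C &
    forall (eps tau : R) (N n : nat) (s t : R),
      admissible a b h0 tau0 eps tau N ->
      0 <= t <= T -> 0 <= s <= tau -> t = n%:R * tau + s ->
      let h := mesh a b N in
      let err_psi := Hnorm a b 1
        (eint_psi a b psi0 phi0 phi1 psi eps tau N n s) in
      let err_phi := Hnorm a b 1
        (eint_phi a b psi0 phi0 phi1 phi eps tau N n s) in
      [/\ (err_psi <= (C * (h ^+ (m0 - 1) + tau ^+ 2 / eps ^+ 2))%:E)%E,
          (err_psi <= (C * (h ^+ (m0 - 1) + tau + eps ^+ 2))%:E)%E,
          (err_phi <= (C * (h ^+ (m0 - 1) + tau ^+ 2 / eps ^+ 2))%:E)%E &
          (err_phi <= (C * (h ^+ (m0 - 1) + tau + eps ^+ 2))%:E)%E])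
  /\
  (exists2 C : R, 0 < C &
    forall (eps tau : R) (N n : nat) (s t : R),
      admissible a b h0 tau0 eps tau N ->
      0 <= t <= T -> 0 <= s <= tau -> t = n%:R * tau + s ->
      let h := mesh a b N in
      let err_psi := Hnorm a b 1
        (eint_psi a b psi0 phi0 phi1 psi eps tau N n s) in
      let err_phi := Hnorm a b 1
        (eint_phi a b psi0 phi0 phi1 phi eps tau N n s) in
      exists M : R,
        is_max [set Num.min (tau ^+ 2 / e ^+ 2) (e ^+ 2) |
                e in [set e : R | 0 < e <= 1]] M
        /\ [/\ (err_psi <= (C * (h ^+ (m0 - 1) + tau + M))%:E)%E,
               (err_phi <= (C * (h ^+ (m0 - 1) + tau + M))%:E)%E,
               h ^+ (m0 - 1) + tau + M <= C * (h ^+ (m0 - 1) + tau),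
               (err_psi <= (C * (h ^+ (m0 - 1) + tau))%:E)%E &
               (err_phi <= (C * (h ^+ (m0 - 1) + tau))%:E)%E]).
Proof.
have [m5 hCpsi hCphi [K1 K10 hK1] [K2 K20 hK2]] := hA.
have [A1 A10 he1] := herr1; have [A2 A20 he2] := herr2.
have /andP[h00 h01] := hh0; have /andP[tau00 tau01] := htau0.
set p := (m0 - 1)%N.
pose K := 4 * (K1 + K2 + 1) ^+ 2 + 4.
pose kd := Kd a b h0 p K (2 * A1).
pose B := mode_bound a b K + 1 + 32 * (2 * A2 + kd).
have K0 : 0 <= K by rewrite addr_ge0// mulr_ge0 ?sqr_ge0.
have kd0 : 0 <= kd.
  rewrite addr_ge0 ?mulr_ge0 ?exprn_ge0 ?(ltW A10)//.
  by rewrite invr_ge0 exprn_ge0// divr_ge0// le_min (ltW h00) subr_ge0 ltW.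
have B_ge : mode_bound a b K + 1 <= B.
  by rewrite lerDl mulr_ge0// addr_ge0// mulr_ge0// ltW.
have mono (x : R) : 0 <= x -> x <= K1 + K2 -> 4 * (x + 1) ^+ 2 + 4 <= K.
  move=> x0 xK; rewrite lerD2r ler_wpM2l// ler_sqr ?nnegrE ?lerD2r// addr_ge0//.
  exact: le_trans xK.
have main (eps tau : R) (N n : nat) (s t : R) :
    admissible a b h0 tau0 eps tau N ->
    0 <= t <= T -> 0 <= s <= tau -> t = n%:R * tau + s ->
    let h := mesh a b N in
    exists E, [/\ E <= A1 * (h ^+ p + tau ^+ 2 / eps ^+ 2), E <= A2 * (h ^+ p + eps ^+ 2) &
     [/\ (Hnorm a b 1 (eint_psi a b psi0 phi0 phi1 psi eps tau N n s)
           <= (Cerr a b B * (E + kd * h ^+ p + tau ^+ 2 / eps ^+ 2))%:E)%E,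
         (Hnorm a b 1 (eint_psi a b psi0 phi0 phi1 psi eps tau N n s)
           <= (Cerr a b B * (E + kd * h ^+ p + tau))%:E)%E,
         (Hnorm a b 1 (eint_phi a b psi0 phi0 phi1 phi eps tau N n s)
           <= (Cerr a b B * (E + kd * h ^+ p + tau ^+ 2 / eps ^+ 2))%:E)%E &
         (Hnorm a b 1 (eint_phi a b psi0 phi0 phi1 phi eps tau N n s)
           <= (Cerr a b B * (E + kd * h ^+ p + tau))%:E)%E]].
  move=> adm tT hs tE h; have [heps N0 Neven /andP[hm0 hm] /andP[ht0 ht1]] := adm.
  have /andP[e0 e1] := heps.
  have e2 : 0 < eps ^+ 2 by rewrite exprn_gt0.
  have hp0 : 0 <= h ^+ p by rewrite exprn_ge0// ltW.
  have eE0 : (0 <= (eps ^+ 2)%:E)%E by rewrite lee_fin ltW.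
  have divide (x : \bar R) r : ((eps ^+ 2)%:E * x <= r%:E)%E -> (x <= (r / eps ^+ 2)%:E)%E.
    by move=> hx; rewrite [r / _]mulrC EFinM lee_pdivlMl.
  have hp1 : h ^+ p <= 1 by rewrite exprn_ile1// ltW// (le_lt_trans hm).
  (* both norms are nonnegative, so that the bound on their sum splits *)
  have cP := hCpsi eps heps; have [cF cFt _] := hCphi eps heps.
  have [hF hFt] : (LinfH a b T m0 (fun t x => (phi eps t x)%:C%C) <= K2%:E)%E /\
      (LinfH a b T m0 (fun t x => (phit eps t x)%:C%C) <= (K2 / eps ^+ 2)%:E)%E.
    have := hK2 eps heps; have := LinfH_ge0 a b T m0 (fun t x => (phi eps t x)%:C%C).
    have := LinfH_ge0 a b T m0 (fun t x => (phit eps t x)%:C%C).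
    move: (LinfH _ _ _ _ _) (LinfH _ _ _ _ _) => x y y0 x0 hxy.
    have ey0 : (0 <= (eps ^+ 2)%:E * y)%E by rewrite mule_ge0// lee_fin ltW.
    split; first by apply: le_trans hxy; rewrite leeDl.
    by apply: divide; apply: le_trans hxy; rewrite leeDr.
  have [Dp hDp] := Reg_choice (fun t0 t0T => Reg_of_C0 hab hT m5 cP (hK1 eps heps) t0T).
  have [Df hDf] := Reg_choice (fun t0 t0T => Reg_of_C0 hab hT m5 cF hF t0T).
  have [Dt hDt] := Reg_choice (fun t0 t0T => Reg_of_C0 hab hT m5 cFt hFt t0T).
  have Rpsi t' (tT' : 0 <= t' <= T) : Reg a b K (psi eps t') (Dp t').
    by apply: Reg_mono (hDp _ tT'); apply: mono; rewrite ?lerDl ltW.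
  have Rphi t' (tT' : 0 <= t' <= T) : Reg a b K (fun x => (phi eps t' x)%:C%C) (Df t').
    by apply: Reg_mono (hDf _ tT'); apply: mono; rewrite ?lerDr ltW.
  have Rphit t' (tT' : 0 <= t' <= T) :
      Reg a b (K / eps ^+ 4) (fun x => (phit eps t' x)%:C%C) (Dt t').
    apply: Reg_mono (hDt _ tT'); apply: (le_trans (split_eps heps (ltW K20))).
    by rewrite ler_wpM2r ?invr_ge0 ?exprn_ge0 ?(ltW e0)//; apply: mono; rewrite ?lerDr ltW.
  have mpos : (0 < m0)%N by apply: leq_trans m5.
  have sP x (xab : a <= x <= b) := sup_cont_Reg hab mpos cP Rpsi xab.
  have sF x (xab : a <= x <= b) := sup_cont_Reg hab mpos cF Rphi xab.
  have sFt x (xab : a <= x <= b) := sup_cont_Reg hab mpos cFt Rphit xab.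
  (* a time step with [tau'^2 / eps^2 <= h'^p] leaves only the error in space *)
  have coarse t' (N' : nat) : 0 <= t' <= T -> (0 < N')%N -> ~~ odd N' -> mesh a b N' <= h0 ->
      exists w1 w2 w3 : @grid R N',
      [/\ (Hnorm a b 1 (fun x => psi eps t' x - interp a b w1 x)%R
            <= (2 * A1 * mesh a b N' ^+ p)%:E)%E,
          (Hnorm a b 1 (fun x => (phi eps t' x)%:C%C - interp a b w2 x)%R
            <= (2 * A1 * mesh a b N' ^+ p)%:E)%E &
          (Hnorm a b 1 (fun x => (phit eps t' x)%:C%C - interp a b w3 x)%R
            <= (2 * A1 / eps ^+ 2 * mesh a b N' ^+ p)%:E)%E].
    move=> /andP[t0' tT'] N'0 N'e hm'; have m'0 := mesh_gt0 hab N'0.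
    have mp0 : 0 < mesh a b N' ^+ p by rewrite exprn_gt0.
    have mp1 : mesh a b N' ^+ p <= 1 by rewrite exprn_ile1// ltW// (le_lt_trans hm').
    have r0 : 0 < Num.min tau0 (eps * mesh a b N' ^+ p) by rewrite lt_min tau00 mulr_gt0.
    have [n' [tau' [/andP[tp tr] nt]]] := small_step t0' r0.
    have adm' : admissible a b h0 tau0 eps tau' N'.
      by split => //; [rewrite m'0|rewrite tp (le_trans tr)// ge_min lexx].
    have n'T : n'%:R <= T / tau' by rewrite ler_pdivlMr// nt.
    have q : tau' ^+ 2 / eps ^+ 2 <= mesh a b N' ^+ p.
      rewrite ler_pdivrMr//; apply: (@le_trans _ _ ((eps * mesh a b N' ^+ p) ^+ 2)).
        rewrite ler_sqr ?nnegrE ?(ltW tp)//; last by rewrite mulr_ge0// ltW.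
        by rewrite (le_trans tr)// ge_min lexx orbT.
      rewrite exprMn mulrC; apply: ler_wpM2r; first exact: ltW.
      rewrite [X in X <= _]expr2.
      by apply: ler_piMl => //; exact: ltW.
    have := he1 eps tau' N' n' adm' n'T; rewrite -/p => H.
    have {}H : (Hnorm a b 1 (e_psi a b psi0 phi0 phi1 psi eps tau' N' n')
         + Hnorm a b 1 (e_phi a b psi0 phi0 phi1 phi eps tau' N' n')
         + (eps ^+ 2)%:E * Hnorm a b 1 (de_phi a b psi0 phi0 phi1 phit eps tau' N' n')
         <= (2 * A1 * mesh a b N' ^+ p)%:E)%E.
      apply: (le_trans H); rewrite lee_fin.
      have -> : 2 * A1 * mesh a b N' ^+ p = A1 * (2 * mesh a b N' ^+ p) by ring.
      rewrite ler_wpM2l ?(ltW A10)//.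
      by rewrite (_ : 2 * _ = mesh a b N' ^+ p + mesh a b N' ^+ p) ?lerD2l//; ring.
    have [H1 H2 H3] := sum3_le (Hnorm_ge0 _ _ _ _) (Hnorm_ge0 _ _ _ _)
      (mule_ge0 eE0 (Hnorm_ge0 _ _ _ _)) H.
    move: H1 H2 H3; rewrite /e_psi /e_phi /de_phi nt => H1 H2 H3.
    set S' := mtifp _ _ _ _ _ _ _ _ _ in H1 H2 H3.
    exists (Psi S'), (Phi S'), (dPhi S'); split => //.
    by rewrite mulrAC; exact: divide.
  have Apsi t' (tT' : 0 <= t' <= T) :
      approximable a b (Mdeg N) (kd * h ^+ p) (psi eps t') (Dp t' 1%N).
    have [c1 b1] := Reg_ex (Rpsi t' tT').
    apply: (approximable_exists hab h00 _ c1 b1) => //; first by rewrite mulr_ge0// ltW.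
    by move=> N' q1 q2 q3; have [w [_ [_ [hw _ _]]]] := coarse t' N' tT' q1 q2 q3; exists w.
  have Aphi t' (tT' : 0 <= t' <= T) :
      approximable a b (Mdeg N) (kd * h ^+ p) (fun x => (phi eps t' x)%:C%C) (Df t' 1%N).
    have [c1 b1] := Reg_ex (Rphi t' tT').
    apply: (approximable_exists hab h00 _ c1 b1) => //; first by rewrite mulr_ge0// ltW.
    by move=> N' q1 q2 q3; have [_ [w [_ [_ hw _]]]] := coarse t' N' tT' q1 q2 q3; exists w.
  have Aphit t' (tT' : 0 <= t' <= T) :
      approximable a b (Mdeg N) (kd * h ^+ p) (fun x => (eps ^+ 2)%:C%C * (phit eps t' x)%:C%C)
        (fun x => (eps ^+ 2)%:C%C * Dt t' 1%N x).
    have [c1 b1] := Reg_ex (Rphit t' tT').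
    have -> : kd * h ^+ p = nc (eps ^+ 2)%:C%C *
        (Kd a b h0 p (K / eps ^+ 4) (2 * A1 / eps ^+ 2) * h ^+ p).
      rewrite ncR ger0_norm ?(ltW e2)// Kd_scale// -/kd.
      by field; rewrite gt_eqF.
    apply: approximable_scale.
    apply: (approximable_exists hab h00 _ c1 b1) => //.
      by rewrite divr_ge0 ?(ltW e2)// mulr_ge0// ltW.
    by move=> N' q1 q2 q3; have [_ [_ [w [_ _ hw]]]] := coarse t' N' tT' q1 q2 q3; exists w.
  (* at the grid time preceding [t], the error is at most the smaller of the two
     bounds, which serves all four estimates *)
  have /andP[s0 st] := hs.
  have nT : n%:R <= T / tau.
    rewrite ler_pdivlMr//; case/andP: tT => _; apply: le_trans; by rewrite tE lerDl.
  have t0T : 0 <= n%:R * tau <= T.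
    by rewrite mulr_ge0 ?(ltW ht0)//= -ler_pdivlMr.
  pose E := Num.min (A1 * (h ^+ p + tau ^+ 2 / eps ^+ 2)) (A2 * (h ^+ p + eps ^+ 2)).
  have hE x : (x <= (A1 * (h ^+ p + tau ^+ 2 / eps ^+ 2))%:E)%E ->
      (x <= (A2 * (h ^+ p + eps ^+ 2))%:E)%E -> (x <= E%:E)%E.
    by rewrite /E /Num.min => x1 x2; case: ifP.
  have [H1 H2 H3] := sum3_le (Hnorm_ge0 _ _ _ _) (Hnorm_ge0 _ _ _ _)
      (mule_ge0 eE0 (Hnorm_ge0 _ _ _ _)) (hE _ (he1 eps tau N n adm nT) (he2 eps tau N n adm nT)).
  have {}H3 := divide _ _ H3.
  have [cu _] := Reg_ex (Rpsi _ t0T); have [cf _] := Reg_ex (Rphi _ t0T).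
  have [cg _] := Reg_ex (Rphit _ t0T).
  have [E0 N1] := nrm_of_Hnorm hab cu H1; have [_ N2] := nrm_of_Hnorm hab cf H2.
  have [_ N3] := nrm_of_Hnorm hab cg H3.
  have {}N3 := nrm_scale (eps ^+ 2)%:C%C hab (ccont_Int (C1p_c0 cg)) N3.
  rewrite ncR (ger0_norm (ltW e2)) (_ : eps ^+ 2 * (E / eps ^+ 2) = E) in N3; last first.
    by field; rewrite gt_eqF.
  exists E; split; [by rewrite ge_min lexx|by rewrite ge_min lexx orbT|].
  have MN : (2 * Mdeg N < N./2)%N by rewrite /Mdeg; clear -N0 Neven; lia.
  have tau1 : 0 < tau <= 1 by rewrite ht0 ltW// (le_lt_trans ht1).
  have hts : n%:R * tau + s <= T by rewrite -tE; case/andP: tT.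
  have heB : 32 * (E + kd * h ^+ p) <= B.
    have EA : E <= 2 * A2.
      apply: (@le_trans _ _ (A2 * (h ^+ p + eps ^+ 2))); first by rewrite ge_min lexx orbT.
      by rewrite mulrC ler_wpM2r ?(ltW A20)// (_ : 2 = 1 + 1)// lerD// exprn_ile1// ltW.
    rewrite (@le_trans _ _ (32 * (2 * A2 + kd)))//.
      by rewrite ler_wpM2l// lerD// ler_piMr.
    by rewrite lerDr addr_ge0// mode_bound_ge0.
  exact: (Hnorm_errors hab hT heps Rpsi Rphi Rphit sP sF sFt (hsol eps heps) tau1 N0 Neven MN
    hs hts B_ge heB (mulr_ge0 kd0 hp0) Apsi Aphi Aphit N1 N2 N3).
have Ce0 : 0 < Cerr a b B by apply: Cerr_gt0; apply: le_trans B_ge; rewrite lerDr mode_bound_ge0.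
pose C := Cerr a b B * (A1 + A2 + kd + 1).
have C0 : 0 < C by rewrite mulr_gt0// ltr_wpDl// addr_ge0// addr_ge0// ltW.
have part1 (eps tau : R) (N n : nat) (s t : R) :
    admissible a b h0 tau0 eps tau N ->
    0 <= t <= T -> 0 <= s <= tau -> t = n%:R * tau + s ->
    let h := mesh a b N in
    let ep := Hnorm a b 1 (eint_psi a b psi0 phi0 phi1 psi eps tau N n s) in
    let ef := Hnorm a b 1 (eint_phi a b psi0 phi0 phi1 phi eps tau N n s) in
    [/\ (ep <= (C * (h ^+ p + tau ^+ 2 / eps ^+ 2))%:E)%E,
        (ep <= (C * (h ^+ p + tau + eps ^+ 2))%:E)%E,
        (ef <= (C * (h ^+ p + tau ^+ 2 / eps ^+ 2))%:E)%E &
        (ef <= (C * (h ^+ p + tau + eps ^+ 2))%:E)%E].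
  move=> adm tT hs tE h ep ef.
  have [E [E1 E2 [b1 b2 b3 b4]]] := main eps tau N n s t adm tT hs tE.
  have [_ _ _ /andP[hm0 _] /andP[ht0 _]] := adm.
  have hp0 : 0 <= h ^+ p by rewrite exprn_ge0// ltW.
  have q0 : 0 <= tau ^+ 2 / eps ^+ 2 by rewrite divr_ge0 ?sqr_ge0.
  have e20 : 0 <= eps ^+ 2 by rewrite sqr_ge0.
  have X1 : E + kd * h ^+ p + tau ^+ 2 / eps ^+ 2 <= (A1 + A2 + kd + 1) * (h ^+ p + tau ^+ 2 / eps ^+ 2).
    exact: absorb1 E1 (ltW A20) kd0 hp0 q0.
  have X2 : E + kd * h ^+ p + tau <= (A1 + A2 + kd + 1) * (h ^+ p + tau + eps ^+ 2).
    exact: absorb2 E2 (ltW A10) (ltW A20) kd0 hp0 (ltW ht0) e20.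
  by split; [apply: le_trans b1 _|apply: le_trans b2 _|apply: le_trans b3 _|apply: le_trans b4 _];
    rewrite lee_fin /C -mulrA ler_wpM2l// ltW.
split; first by exists C.
exists (2 * C + 2); first by rewrite addr_gt0// mulr_gt0.
move=> eps tau N n s t adm tT hs tE h ep ef.
have [p1 p2 p3 p4] := part1 eps tau N n s t adm tT hs tE.
have [/andP[e0 _] _ _ /andP[hm0 _] /andP[ht0 ht1]] := adm.
have hp0 : 0 <= h ^+ p by rewrite exprn_ge0// ltW.
have tau1 : 0 < tau < 1 by rewrite ht0 (le_lt_trans ht1).
have Z0 : 0 <= h ^+ p + tau by rewrite addr_ge0// ltW.
have unif x : (x <= (C * (h ^+ p + tau ^+ 2 / eps ^+ 2))%:E)%E ->
    (x <= (C * (h ^+ p + tau + eps ^+ 2))%:E)%E -> (x <= ((2 * C + 2) * (h ^+ p + tau))%:E)%E.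
  move=> x1 x2.
  have W : C * (h ^+ p + tau + tau) <= (2 * C + 2) * (h ^+ p + tau).
    exact: double1 (ltW C0) hp0 (ltW ht0).
  have := min_quot_le ht0 (exprn_gt0 2 e0); rewrite ge_min => /orP[q|q].
    apply: (le_trans x1); rewrite lee_fin (le_trans _ W)// ler_wpM2l ?(ltW C0)//.
    by rewrite -addrA lerD2l (le_trans q)// lerDl ltW.
  apply: (le_trans x2); rewrite lee_fin (le_trans _ W)// ler_wpM2l ?(ltW C0)//.
  by rewrite lerD2l.
exists tau; split; first exact: is_max_min.
have up x : (x <= ((2 * C + 2) * (h ^+ p + tau))%:E)%E -> (x <= ((2 * C + 2) * (h ^+ p + tau + tau))%:E)%E.
  move=> hx; apply: (le_trans hx); rewrite lee_fin ler_wpM2l ?lerDl ?(ltW ht0)//.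
  by rewrite addr_ge0// mulr_ge0// ltW.
have hD : h ^+ p + tau + tau <= (2 * C + 2) * (h ^+ p + tau) := double2 (ltW C0) hp0 (ltW ht0).
have q1 := unif _ p1 p2; have q2 := unif _ p3 p4.
exact: And5 (up _ q1) (up _ q2) hD q1 q2.
Qed.
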